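(* Let $\Omega\subset\mathbb C$ be a bounded domain with $C^3$-boundary, let $G$ be a hydrodynamic Green's function on $\Omega$, let $N\in\mathbb N$, and let $\Gamma=(\Gamma_1,\dots,\Gamma_N)\in\mathbb R^N$ satisfy, for all $J\subset\{1,\dots,N\}$ with $|J|\ge 2$, $$\sum_{\substack{i,j\in J\\ i\neq j}}\Gamma_i\Gamma_j\neq 0\qquad\text{and}\qquad \sum_{j\in J}\Gamma_j^2>\sum_{\substack{i,j\in J\\ i\neq j}}|\Gamma_i\Gamma_j|,$$ as well as $\Gamma_j=(-1)^j|\Gamma_j|$ for $j\in\{1,\dots,N\}$ and $|\Gamma_j|\le|\Gamma_{j+1}|$ for $j\in\{1,\dots,N-1\}$. Then the Kirchhoff--Routh path function $H_\Omega$ has a critical point in $\mathcal F_N\Omega$.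
   Context: Identify $\mathbb C$ with $\mathbb R^2$; differentiability is meant in the real sense. For $M\in\mathbb N$, $\mathcal F_M\Omega:=\{(z_1,\dots,z_M)\in\Omega^M: z_i\neq z_j\text{ for }i\neq j\}$, an open subset of $\mathbb C^M$ (and $\mathcal F_2\overline\Omega$ is defined analogously). Sums over $i,j\in J$, $i\ne j$, run over ordered pairs. Hydrodynamic Green's function: let $k_0=\operatorname{rank}\pi_1(\Omega)$, let $\Omega_1,\dots,\Omega_{k_0}$ be the bounded components of $\mathbb C\setminus\overline\Omega$, and put $\partial\Omega_0:=\partial\Omega\setminus\bigcup_{j=1}^{k_0}\partial\Omega_j$. Given $\gamma_0,\dots,\gamma_{k_0}\in\mathbb R$ with $\sum_{j=0}^{k_0}\gamma_j=-1$, the hydrodynamic Green's function with periods $\gamma_0,\dots,\gamma_{k_0}$ is the unique $G\in C^2(\mathcal F_2\overline\Omega)$ such that: $-\Delta G(\cdot,y)=\delta_y$ for every $y\in\Omega$; $\langle\nabla_xG(x,y),\tau_x\rangle=0$ for all $y\in\Omega$, $x\in\partial\Omega$; $\int_{\partial\Omega_j}\langle\nabla_xG(x,y),\nu_x\rangle\,ds(x)=\gamma_j$ for all $j\in\{0,\dots,k_0\}$, $y\in\Omega$; $\int_{\partial\Omega}G(x,y)\langle\nabla_xG(x,z),\nu_x\rangle\,ds(x)=0$ for all $y,z\in\Omega$. Here $\tau_x$ is the unit tangent and $\nu_x$ the unit normal of $\partial\Omega$ pointing out of $\Omega$. The map $(x,y)\mapsto G(x,y)+\frac1{2\pi}\ln|x-y|$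 extends to a function $g$ on $\Omega\times\Omega$; put $h(x):=g(x,x)$. The Kirchhoff--Routh path function is $$H_\Omega:\mathcal F_N\Omega\to\mathbb R,\qquad H_\Omega(z_1,\dots,z_N)=\sum_{j=1}^N\Gamma_j^2h(z_j)+\sum_{\substack{i,j=1\\ i\neq j}}^N\Gamma_i\Gamma_jG(z_i,z_j).$$ *)

(* Defs.v *)
From HB Require Import structures.
From mathcomp Require Import all_boot all_order all_algebra.
From mathcomp Require Import all_classical all_reals all_analysis.

Set Implicit Arguments.
Unset Strict Implicit.
Unset Printing Implicit Defensive.

Import Order.TTheory GRing.Theory Num.Theory.
Import numFieldNormedType.Exports.

Local Open Scope classical_set_scope.
Local Open Scope ring_scope.

Notation plane R := (R * R)%type (only parsing).

(* The library norm on R * R is the max norm; it gives the right topology and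
   the right notion of differentiability, but lengths and distances below are
   measured with the Euclidean norm. *)
Definition dot (R : realType) (u v : plane R) : R := u.1 * v.1 + u.2 * v.2.

Definition enorm (R : realType) (u : plane R) : R := Num.sqrt (dot u u).

Definition bd (T : topologicalType) (A : set T) : set T := closure A `\` A°.

(* On a finite-dimensional V this is the usual C^k, since all the directional
   derivatives are required to exist and to be of class C^(k-1). *)
Fixpoint Ck (R : realType) (V : normedModType R) (k : nat)
    (U : set V) (f : V -> R) : Prop :=
  (forall p, U p -> {for p, continuous f}) /\
  match k with
  | 0 => True
  | k'.+1 => forall v : V,
      (forall p, U p -> derivable f p v) /\ Ck k' U (fun p => 'D_v f p)
  end.

(* All derivatives of f of order at most k, taken in the open set U, extend
   continuously to X, where U `<=` X `<=` closure U: limits along U exist at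
   every point of X. *)
Fixpoint derivatives_extend (R : realType) (V : normedModType R) (k : nat)
    (U X : set V) (f : V -> R) : Prop :=
  (forall p, X p -> cvg (f @ within U (nbhs p))) /\
  match k with
  | 0 => True
  | k'.+1 => forall v : V, derivatives_extend k' U X (fun p => 'D_v f p)
  end.

Definition Ck_up_to (R : realType) (V : normedModType R) (k : nat)
    (U X : set V) (f : V -> R) : Prop :=
  [/\ Ck k U f, derivatives_extend k U X f & {within X, continuous f}].

Definition domain (R : realType) (Om : set (plane R)) : Prop :=
  [/\ Om !=set0, open Om & connected Om].

(* In the orthonormal frame obtained by rotating the axes (first axis e), Om
   is locally the region above the graph of a C^3 function. *)
Definition C3_boundary (R : realType) (Om : set (plane R)) : Prop :=
  forall p, bd Om p ->
    exists (e : plane R) (r : R) (phi : R -> R),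
      [/\ enorm e = 1, 0 < r, Ck 3 [set: R] phi &
          forall x, enorm (x - p) < r ->
            (Om x <-> phi (dot (x - p) e) < dot (x - p) (- e.2, e.1))].

Definition F2 (R : realType) (A : set (plane R)) : set (plane R * plane R) :=
  [set p | [/\ A p.1, A p.2 & p.1 <> p.2]].

Definition grad (R : realType) (f : plane R -> R) (x : plane R) : plane R :=
  ('D_((1, 0) : plane R) f x, 'D_((0, 1) : plane R) f x).

Definition laplacian (R : realType) (f : plane R -> R) (x : plane R) : R :=
  'D_((1, 0) : plane R) (fun u => 'D_((1, 0) : plane R) f u) x +
  'D_((0, 1) : plane R) (fun u => 'D_((0, 1) : plane R) f u) x.

(* The gradient of G in its first variable at x in the closure of Om; on the
   boundary it is the continuous extension of the gradient in Om. *)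
Definition gradx (R : realType) (Om : set (plane R))
    (G : plane R * plane R -> R) (x y : plane R) : plane R :=
  (lim ((grad (fun w => G (w, y)) u).1 @[u --> within Om (nbhs x)]),
   lim ((grad (fun w => G (w, y)) u).2 @[u --> within Om (nbhs x)])).

Definition unit_tangent (R : realType) (Om : set (plane R))
    (x tau : plane R) : Prop :=
  enorm tau = 1 /\
  exists c : R -> plane R,
    [/\ c 0 = x, \forall t \near (0 : R), bd Om (c t) & is_derive (0 : R) (1 : R) c tau].

Definition is_outer_normal (R : realType) (Om : set (plane R))
    (x nu : plane R) : Prop :=
  [/\ enorm nu = 1,
      forall tau, unit_tangent Om x tau -> dot tau nu = 0 &
      \forall t \near (0 : R)^'+, ~ closure Om (x + t *: nu)].

Definition outer_normal (R : realType) (Om : set (plane R))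
    (x : plane R) : plane R :=
  xget 0 [set nu | is_outer_normal Om x nu].

(* c is an L-periodic parametrization by arc length of a simple closed C^1
   curve of length L. *)
Definition arclength_loop (R : realType) (L : R) (c : R -> plane R) : Prop :=
  [/\ 0 < L,
      forall t, c (t + L) = c t,
      forall s t, 0 <= s < L -> 0 <= t < L -> c s = c t -> s = t,
      forall t, derivable c t 1 /\ enorm ('D_1 c t) = 1 &
      continuous (fun t => 'D_1 c t)].

(* v is the integral of f over C with respect to arc length, where C is a
   finite disjoint union of simple closed C^1 curves. *)
Definition is_arclength_integral (R : realType) (C : set (plane R))
    (f : plane R -> R) (v : R) : Prop :=
  exists (n : nat) (L : 'I_n -> R) (c : 'I_n -> R -> plane R),
    [/\ forall i, arclength_loop (L i) (c i),
        forall i j s t, c i s = c j t -> i = j,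
        C = \bigcup_i range (c i),
        forall i, (@lebesgue_measure R).-integrable `[0, L i]
                    (fun t => (f (c i t))%:E) &
        v = \sum_(i < n) \int[@lebesgue_measure R]_(t in `[0, L i]) f (c i t)].

Definition lebesgue2 (R : realType) :
    {measure set (measurableTypeR R * measurableTypeR R) -> \bar R} :=
  ((@lebesgue_measure R) \x (@lebesgue_measure R))%E.

Definition test_function (R : realType) (Om : set (plane R))
    (phi : plane R -> R) : Prop :=
  (forall k, Ck k [set: plane R] phi) /\
  exists2 K : set (plane R), compact K /\ K `<=` Om &
    forall x, ~ K x -> phi x = 0.

(* The distributional equation - Delta u = delta_y in Om. *)
Definition fundamental_solution (R : realType) (Om : set (plane R))
    (u : plane R -> R) (y : plane R) : Prop :=
  (forall K : set (plane R), compact K -> K `<=` Om ->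
     (@lebesgue2 R).-integrable K (fun x => (u x)%:E)) /\
  (forall phi, test_function Om phi ->
     - (\int[@lebesgue2 R]_(x in Om) (u x * laplacian phi x)) = phi y).

(* Omj enumerates the bounded components of the complement of closure Om. *)
Definition is_hole_enumeration (R : realType) (Om : set (plane R)) (k0 : nat)
    (Omj : 'I_k0 -> set (plane R)) : Prop :=
  injective Omj /\
  range Omj = [set C | bounded_set C /\
    exists2 x, (~` closure Om) x & C = connected_component (~` closure Om) x].

(* Index ord0 is the remaining part of the boundary, index lift ord0 i is the
   boundary of the i-th hole. *)
Definition boundary_part (R : realType) (Om : set (plane R)) (k0 : nat)
    (Omj : 'I_k0 -> set (plane R)) (j : 'I_k0.+1) : set (plane R) :=
  if unlift ord0 j is Some i then bd (Omj i)
  else bd Om `\` \bigcup_i bd (Omj i).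

(* G matters only on F2 (closure Om); its values elsewhere are irrelevant. *)
Definition hydrodynamic_Green_with_periods (R : realType)
    (Om : set (plane R)) (k0 : nat) (Omj : 'I_k0 -> set (plane R))
    (gamma : 'I_k0.+1 -> R) (G : plane R * plane R -> R) : Prop :=
  Ck_up_to 2 (F2 Om) (F2 (closure Om)) G /\
  [/\ forall y, Om y -> fundamental_solution Om (fun x => G (x, y)) y,
      forall x y tau, bd Om x -> Om y -> unit_tangent Om x tau ->
        dot (gradx Om G x y) tau = 0,
      forall j y, Om y ->
        is_arclength_integral (boundary_part Om Omj j)
          (fun x => dot (gradx Om G x y) (outer_normal Om x)) (gamma j) &
      forall y z, Om y -> Om z ->
        is_arclength_integral (bd Om)
          (fun x => G (x, y) * dot (gradx Om G x z) (outer_normal Om x)) 0].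

Definition hydrodynamic_Green (R : realType) (Om : set (plane R))
    (G : plane R * plane R -> R) : Prop :=
  exists (k0 : nat) (Omj : 'I_k0 -> set (plane R)) (gamma : 'I_k0.+1 -> R),
    [/\ is_hole_enumeration Om Omj, \sum_j gamma j = -1 &
        hydrodynamic_Green_with_periods Om Omj gamma G].

(* The continuous extension to Om `*` Om of G(x,y) + ln |x - y| / (2 pi). *)
Definition regular_part (R : realType) (Om : set (plane R))
    (G : plane R * plane R -> R) (p : plane R * plane R) : R :=
  lim (G q + ln (enorm (q.1 - q.2)) / (2 * pi) @[q --> within (F2 Om) (nbhs p)]).

Definition robin (R : realType) (Om : set (plane R))
    (G : plane R * plane R -> R) (x : plane R) : R :=
  regular_part Om G (x, x).

(* A configuration of N points is an N x 2 matrix whose rows are the points,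
   so that the configuration space is a normed module. *)
Definition point (R : realType) (N : nat) (z : 'M[R]_(N, 2)) (i : 'I_N) :
  plane R := (z i ord0, z i ord_max).

Definition config_space (R : realType) (N : nat) (Om : set (plane R)) :
  set 'M[R]_(N, 2) :=
  [set z | (forall i, Om (point z i)) /\
           (forall i j, i != j -> point z i <> point z j)].

Definition Kirchhoff_Routh (R : realType) (N : nat) (Om : set (plane R))
    (G : plane R * plane R -> R) (Gam : 'I_N -> R) (z : 'M[R]_(N, 2)) : R :=
  \sum_j Gam j ^+ 2 * robin Om G (point z j) +
  \sum_i \sum_(j | j != i) Gam i * Gam j * G (point z i, point z j).

Definition critical_point (R : realType) (V : normedModType R)
    (f : V -> R) (z : V) : Prop :=
  differentiable f z /\ forall v, 'd f z v = 0.

(* Main.v *)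
From HB Require Import structures.
Require Import Defs.
From mathcomp Require Import all_boot all_order all_algebra.
From mathcomp Require Import all_classical all_reals all_analysis.
From mathcomp Require Import measurable_realfun.
From mathcomp Require Import ring lra.

(** If H has no critical point, there is a vector field W on the configuration
    space along which H grows at a definite rate, and which is small near the
    boundary of the configuration space.  Following W from a suitable torus of
    configurations must reach a configuration whose points lie in increasing
    order on a horizontal line; but on those H is bounded above, because the
    signs of the vortices alternate and their strengths increase.  This is
    absurd once H has grown enough.

    The field W is patched from local ones.  Near a configuration of distinct
    points of Om it is constant.  Near a collision inside Om it is a dilation
    about the point q of collision, along which H changes at the rate
    -(sum of the Gamma_i Gamma_j) / (2 pi) plus a small error.  Near a boundary
    point p with inner normal n it moves each point x by kap x *: n, with kap x
    comparable to the distance to the boundary; there h contributes Gamma_j^2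
    while G contributes at most |Gamma_i Gamma_j|, up to a common factor.

    The boundary estimate only uses that G is C^1 up to the boundary and
    locally constant in the first variable along it.  Let y* be the reflection
    y - 2 kap y n of y.  Then psi = 4 pi g - ln |x - y*|^2 is harmonic in x and
    varies slowly in y when x is on the boundary, hence for all x by the maximum
    principle; the gradient bound for harmonic functions controls its derivative
    in x.  Harmonicity is used in the form of a second difference quotient
    tending to 0, so that a fundamental solution need only be tested against
    mollified logarithms.

    The torus consists of the configurations whose successive gaps have lengths
    r 5^j and arbitrary angles th_j.  Euler steps along W change the angles by a
    bounded continuous function b of th, and th + b th = 0 has a solution by
    the Poincare-Miranda theorem. *)

Set Implicit Arguments.
Unset Strict Implicit.
Unset Printing Implicit Defensive.

Import Order.TTheory GRing.Theory Num.Theory.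
Import numFieldNormedType.Exports.

Local Open Scope classical_set_scope.
Local Open Scope ring_scope.

(** * Uniformity over compact sets *)

(** The configuration space is not compact, and where several vortices collide or approach the
    boundary, terms of H can tend to plus and to minus infinity at once; so neither extremal points
    nor properness are available. Everything rests on two linear bounds for W: |W_j| is at most C
    times the distance from z_j to any point outside Om, and |W_i - W_j| is at most C |z_i - z_j|. A
    step of length tau then shrinks these distances by at most the factor 1 - C tau, so all steps up
    to a fixed time stay in one compact set, where the gain per step is uniform. Thus a merely
    continuous W suffices. The two conditions on subsets J make the leading growth term nonzero at a
    collision in Om and positive at the boundary.

    The delicate regime has x on the boundary and y in Om both close to the same boundary point p.
    There the boundary values of G are read off at another boundary point, far from the pole, which
    is legitimate because they are locally constant.

    Derivatives are taken in the strict sense because increments are needed between two points that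
    both vary, as in an Euler step that starts near a given configuration. *)

Lemma compact_small (R : realType) (V : normedModType R) (K : set V) (P : R -> V -> Prop) :
  compact K ->
  (forall x, K x -> exists2 r : R, 0 < r & forall y, `|y - x| < r ->
     forall d, 0 < d -> d < r -> P d y) ->
  exists2 r : R, 0 < r & forall y, K y -> forall d, 0 < d -> d < r -> P d y.
Proof.
move=> /compact_near_coveringP cK H.
have /cK : forall x, K x -> \forall x' \near x & d \near (0 : R)^'+, P d x'.
  move=> x /H[r r0 Hr]; exists (ball x r, [set d | 0 < d < r]); rewrite /=.
    split; first exact: nbhsx_ballx.
    near=> d => /=; apply/andP; split; near: d; [exact: nbhs_right_gt | exact: nbhs_right_lt].
  move=> [y d] /= [+ /andP[d0 dr]]; rewrite -ball_normE /= distrC => yr.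
  exact: Hr yr _ d0 dr.
move=> /nbhs_ballP[r /= r0 Hr].
exists r => // y Ky d d0 dr; apply: Hr => //.
by rewrite -ball_normE /= sub0r normrN gtr0_norm.
Unshelve. all: by end_near. Qed.

Lemma mx_norm_ge (R : realType) m n (x : 'M[R]_(m, n)) i j : `|x i j| <= `|x|.
Proof.
by have := @mx_normrE R m n x; rewrite -[mx_norm x]/(`|x|) => ->;
  exact: (le_bigmax _ _ (i, j)).
Qed.

Lemma mx_norm_le (R : realType) m n (x : 'M[R]_(m, n)) c : 0 <= c ->
  (forall i j, `|x i j| <= c) -> `|x| <= c.
Proof.
move=> c0 H; have := @mx_normrE R m n x; rewrite -[mx_norm x]/(`|x|) => ->.
by apply: bigmax_le => // -[i j] _; exact: H.
Qed.

(** Only [x] is confined to [K]: the nearby point [y] may lie outside, which uniform continuity of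
    the restriction to [K] would not allow. *)
Lemma compact_uniform (R : realType) (V W : normedModType R) (f : V -> W) (K : set V) (e : R) :
  compact K -> (forall x, K x -> {for x, continuous f}) -> 0 < e ->
  exists2 d : R, 0 < d & forall x y, K x -> `|y - x| < d -> `|f y - f x| < e.
Proof.
move=> cK cf e0.
have [|d d0 Hd] := @compact_small R V K
  (fun d x => forall y, `|y - x| < d -> `|f y - f x| < e) cK.
  move=> x Kx; have := cf _ Kx => /cvgrPdist_lt/(_ (e / 2)).
  rewrite divr_gt0// => /(_ isT)/nbhs_ballP[r /= r0 Hr].
  exists (r / 2); first by rewrite divr_gt0.
  move=> y yx d d0 dr z zy.
  have Bz : `|f x - f z| < e / 2.
    apply: Hr; rewrite -ball_normE /= -(subrKA y).
    rewrite (le_lt_trans (ler_normD _ _))// (splitr r) ltrD// distrC//.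
    exact: lt_trans zy dr.
  have By : `|f x - f y| < e / 2.
    apply: Hr; rewrite -ball_normE /= distrC (lt_trans yx)//.
    by rewrite ltr_pdivrMr// ltr_pMr// ltr1n.
  rewrite -(subrKA (f x)) (le_lt_trans (ler_normD _ _))// (splitr e) ltrD//.
  by rewrite distrC.
exists (d / 2); first by rewrite divr_gt0.
move=> x y Kx yx; apply: (Hd x Kx (d / 2)) => //; first by rewrite divr_gt0.
by rewrite ltr_pdivrMr// ltr_pMr// ltr1n.
Qed.

Lemma continuous_coords (R : realType) (T : topologicalType) m n (f : T -> 'M[R]_(m, n)) x :
  (forall i j, {for x, continuous (fun t => f t i j)}) -> {for x, continuous f}.
Proof.
move=> H; apply/cvgrPdist_le => e e0.
have : \forall t \near x, forall ij : 'I_m * 'I_n, `|f x ij.1 ij.2 - f t ij.1 ij.2| <= e.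
  by apply: filter_forall => -[i j]; have /cvgrPdist_le/(_ e e0) := H i j.
apply: filterS => t Ht; apply: mx_norm_le; first exact: ltW.
by move=> i j; rewrite !mxE; exact: (Ht (i, j)).
Qed.

(** * A class of smooth functions *)

(** Turns a directional derivative into a derivative in one real variable, where the chain rule and
    the mean value theorem apply. *)
Lemma is_derive_line (R : realType) (V W : normedModType R) (f : V -> W) (x v : V) (d : W) :
  is_derive x v f d <-> is_derive (0 : R) (1 : R) (fun t : R => f (t *: v + x)) d.
Proof.
have E : (fun h : R => h^-1 *: ((f \o shift x) (h *: v) - f x)) =
  (fun h => h^-1 *: (((fun t : R => f (t *: v + x)) \o shift 0) (h *: 1) -
     (fun t : R => f (t *: v + x)) 0)).
  by apply/funext => h /=; rewrite addr0 scale0r add0r [h *: 1]mulr1.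
by split=> -[H1 H2]; split; move: H1 H2; rewrite /derivable /derive ?E -?E.
Qed.

Lemma is_derive_line_at (R : realType) (V W : normedModType R) (f : V -> W) (x v : V) (t : R) (d : W) :
  is_derive (t *: v + x) v f d -> is_derive t (1 : R) (fun s : R => f (s *: v + x)) d.
Proof.
move=> H; apply/is_derive_line; move/is_derive_line: H; congr is_derive.
by apply/funext => s; rewrite scalerDl addrA [s *: 1]mulr1.
Qed.

Lemma is_derive_cvg (R : realType) (V W : normedModType R) (f : V -> W) (x v : V) (d : W) :
  h^-1 *: (f (h *: v + x) - f x) @[h --> (0 : R)^'] --> d -> is_derive x v f d.
Proof. by move=> H; split; [exact: cvgP H | exact: cvg_lim H]. Qed.

Lemma is_derive_comp1 (R : realType) (V : normedModType R) (f : V -> R) (g : R -> R) (x v : V) (d e : R) :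
  is_derive x v f d -> is_derive (f x) 1 g e -> is_derive x v (fun y => g (f y)) (e * d).
Proof.
move=> /is_derive_line H1 H2; apply/is_derive_line.
apply: (@is_derive1_comp _ g (fun t => f (t *: v + x))) => //.
by rewrite scale0r add0r.
Qed.

(** The powers of 1/t in front of exp (-1/t) make the family closed under differentiation up to
    linear combinations, so it can be a constructor of an inductive class of smooth functions. *)
Definition flat (R : realType) (n : nat) (t : R) : R :=
  if 0 < t then t^-1 ^+ n * expR (- t^-1) else 0.

Lemma flat_gt0 (R : realType) n (t : R) : 0 < t -> 0 < flat n t.
Proof. by move=> t0; rewrite /flat t0 mulr_gt0 ?exprn_gt0 ?invr_gt0 ?expR_gt0. Qed.

Lemma flat_ge0 (R : realType) n (t : R) : 0 <= flat n t.
Proof. by have [/(flat_gt0 n)/ltW//|h] := ltP 0 t; rewrite /flat ltNge h. Qed.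

Lemma flat_le0 (R : realType) n (t : R) : t <= 0 -> flat n t = 0.
Proof. by move=> h; rewrite /flat ltNge h. Qed.

(** From exp s >= 1 + s^(n+1) / (n+1)! at s = 1/t. Since [flat n h / h = flat n.+1 h], this linear
    decay is what makes the derivative at 0 vanish. *)
Lemma flat_le (R : realType) n (t : R) : 0 <= t -> flat n t <= (n.+1)`!%:R * t.
Proof.
rewrite le_eqVlt => /predU1P[<-|t0]; first by rewrite flat_le0 ?mulr0.
rewrite /flat t0 expRN ler_pdivrMr ?expR_gt0//.
have := @expR_ge1Dxn R t^-1 n; rewrite invr_ge0 => /(_ (ltW t0)) H.
have f0 : 0 < (n.+1)`!%:R :> R by rewrite ltr0n fact_gt0.
apply: (@le_trans _ _ ((n.+1)`!%:R * t * (t^-1 ^+ n.+1 / (n.+1)`!%:R))).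
  rewrite [leRHS](_ : _ = t^-1 ^+ n)// exprS; field.
  by rewrite !gt_eqF.
rewrite ler_pM2l ?mulr_gt0//; apply: le_trans H; by rewrite lerDr.
Qed.

Lemma is_derive_flat (R : realType) n (t : R) :
  is_derive t 1 (flat n) (flat n.+2 t - n%:R * flat n.+1 t).
Proof.
have [t0|t0|<-] := ltgtP 0 t; last first.
- rewrite !flat_le0// mulr0 subr0; apply: is_derive_cvg; apply/cvgrPdist_le => e e0; near=> h.
  rewrite addr0 [h *: 1]mulr1 (@flat_le0 _ _ 0)// subr0 sub0r normrN [_ *: _]mulrC.
  have he : `|h| <= e / (n.+2)`!%:R.
    by near: h; apply: dnbhs0_le; rewrite divr_gt0// ltr0n fact_gt0.
  rewrite ler_pdivlMr ?ltr0n ?fact_gt0// in he.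
  have [h1|h1] := ltP 0 h; last by rewrite flat_le0// mul0r normr0 ltW.
  rewrite (_ : _ / h = flat n.+1 h); last by rewrite /flat h1 exprS mulrC mulrA.
  rewrite ger0_norm ?flat_ge0// (le_trans (flat_le _ (ltW h1)))// mulrC.
  by rewrite gtr0_norm in he.
- rewrite !flat_le0 ?ltW// mulr0 subr0.
  have nE : \near t, (cst 0 : R -> R) t = flat n t.
    by near=> s; rewrite /cst flat_le0// ltW//; near: s; exact: lt_nbhsl.
  exact: near_eq_is_derive nE (is_derive_cst _ _ _).
- have nE : \near t, (((fun y : R => y^-1) ^+ n) * (fun y => expR (- y^-1))) t = flat n t.
    by near=> s; rewrite /flat fctE exprfctE; case: ifPn => // /negP[]; near: s; exact: lt_nbhsr.
  have dV : is_derive t 1 (fun y : R => y^-1) (- t ^- 2 *: 1).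
    have tn : t != 0 by rewrite gt_eqF.
    by apply: (@is_deriveV _ id _ _ _ tn); exact: is_derive_id.
  have dX := is_deriveX n dV.
  have dE : is_derive t 1 (fun y => expR (- y^-1)) (expR (- t^-1) * - (- t ^- 2 *: 1)).
    exact: (is_derive_comp1 (is_deriveN dV) (is_derive_expR _)).
  apply: near_eq_is_derive nE _; apply: is_derive_eq (is_deriveM dX dE) _.
  rewrite /flat t0 exprfctE /GRing.scale /=.
  by case: n {dX} => [|n]; rewrite /= !exprS; field; rewrite gt_eqF.
Unshelve. all: by end_near. Qed.

Lemma continuous_flat (R : realType) n : continuous (@flat R n).
Proof.
move=> t; apply: differentiable_continuous; apply/derivable1_diffP.
by have [] := is_derive_flat n t.
Qed.

Lemma measurable_flat (R : realType) n : measurable_fun [set: R] (@flat R n).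
Proof. by apply: continuous_measurable_fun; exact: continuous_flat. Qed.

Lemma measurable_inv (R : realType) : measurable_fun [set: R] (fun y : R => y^-1).
Proof.
rewrite -(setUv [set 0 : R]); apply/measurable_funU => //; first exact: measurableC.
split; first exact: measurable_fun_set1.
apply: open_continuous_measurable_fun; first by apply: closed_openC; exact: closed_eq.
by move=> x /set_mem /eqP x0; apply: inv_continuous.
Qed.

(** A syntactic class: continuity, measurability and closure under directional derivatives follow by
    structural induction, and then [Ck k] for every k by induction on k. It is rich enough to
    contain the mollified logarithms used as test functions. *)
Inductive smooth (R : realType) : (plane R -> R) -> Prop :=
| smooth_cst c : smooth (fun=> c)
| smooth_fst : smooth fst
| smooth_snd : smooth snd
| smooth_add f g : smooth f -> smooth g -> smooth (fun x => f x + g x)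
| smooth_mul f g : smooth f -> smooth g -> smooth (fun x => f x * g x)
| smooth_inv f : smooth f -> (forall x, f x != 0) -> smooth (fun x => (f x)^-1)
| smooth_ln f : smooth f -> (forall x, 0 < f x) -> smooth (fun x => ln (f x))
| smooth_flat n f : smooth f -> smooth (fun x => flat n (f x)).

Lemma smooth_continuous (R : realType) (f : plane R -> R) : smooth f -> continuous f.
Proof.
elim=> {f} [c|||f g _ cf _ cg|f g _ cf _ cg|f _ cf f0|f _ cf f0|n f _ cf] x.
- exact: cst_continuous.
- exact: cvg_fst.
- exact: cvg_snd.
- exact: (@continuousD _ _ _ f g x (cf x) (cg x)).
- exact: (@continuousM _ _ f g x (cf x) (cg x)).
- exact: (@continuousV _ _ f x (f0 x) (cf x)).
- by apply: (@continuous_comp _ _ _ f (@ln R)); [exact: cf | exact: continuous_ln].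
- by apply: (@continuous_comp _ _ _ f (@flat R n)); [exact: cf | exact: continuous_flat].
Qed.

Lemma smooth_measurable (R : realType) (f : plane R -> R) : smooth f ->
  measurable_fun [set: measurableTypeR R * measurableTypeR R] f.
Proof.
elim=> {f} [c|||f g _ cf _ cg|f g _ cf _ cg|f _ cf f0|f _ cf f0|n f _ cf].
- exact: measurable_cst.
- exact: measurable_fst.
- exact: measurable_snd.
- exact: measurable_funD.
- exact: measurable_funM.
- exact: (measurableT_comp (@measurable_inv R)).
- exact: (measurableT_comp (@measurable_ln R)).
- exact: (measurableT_comp (@measurable_flat R n)).
Qed.

Lemma smooth_derive (R : realType) (f : plane R -> R) (v : plane R) : smooth f ->
  exists2 g, smooth g & forall x, is_derive x v f (g x).
Proof.
elim=> {f} [c|||f g sf [f' sf' df] sg [g' sg' dg]|f g sf [f' sf' df] sg [g' sg' dg]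
  |f sf [f' sf' df] f0|f sf [f' sf' df] f0|n f sf [f' sf' df]].
- by exists (fun=> 0); [exact: smooth_cst | move=> x; exact: is_derive_cst].
- exists (fun=> v.1); first exact: smooth_cst.
  move=> x; apply: is_derive_cvg; apply/cvgrPdist_le => e e0; near=> h.
  have h0 : h != 0 by near: h; exact: nbhs_dnbhs_neq.
  rewrite /= addrK [_ *: _]mulrA mulVf// mul1r subrr normr0 ltW//.
- exists (fun=> v.2); first exact: smooth_cst.
  move=> x; apply: is_derive_cvg; apply/cvgrPdist_le => e e0; near=> h.
  have h0 : h != 0 by near: h; exact: nbhs_dnbhs_neq.
  rewrite /= addrK [_ *: _]mulrA mulVf// mul1r subrr normr0 ltW//.
- by exists (fun x => f' x + g' x); [exact: smooth_add | move=> x; exact: is_deriveD].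
- exists (fun x => f x * g' x + g x * f' x).
    by apply: smooth_add; exact: smooth_mul.
  by move=> x; exact: is_deriveM.
- exists (fun x => (-1) * ((f x)^-1 * (f x)^-1) * f' x).
    by do ?[apply: smooth_mul|apply: smooth_inv] => //; exact: smooth_cst.
  move=> x; have d1 : is_derive (f x) 1 (fun y : R => y^-1) (- (f x) ^- 2 *: 1).
    by apply: (@is_deriveV _ id _ _ _ (f0 x)); exact: is_derive_id.
  apply: is_derive_eq (is_derive_comp1 (df x) d1) _.
  by rewrite [_ *: _]mulr1 expr2 invfM mulN1r.
- exists (fun x => (f x)^-1 * f' x).
    by apply: smooth_mul => //; apply: smooth_inv => // x; rewrite gt_eqF.
  by move=> x; apply: is_derive_comp1 => //; exact: is_derive1_ln.
- exists (fun x => (flat n.+2 (f x) + (- n%:R) * flat n.+1 (f x)) * f' x).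
    apply: smooth_mul => //; apply: smooth_add; first exact: smooth_flat.
    by apply: smooth_mul; [exact: smooth_cst | exact: smooth_flat].
  move=> x; apply: is_derive_comp1 => //; rewrite mulNr; exact: is_derive_flat.
Unshelve. all: by end_near. Qed.

Lemma smooth_is_derive (R : realType) (f : plane R -> R) (v x : plane R) : smooth f ->
  is_derive x v f ('D_v f x).
Proof. by move=> /(smooth_derive v)[g sg dg]; apply: is_derive_eq (dg x) _; rewrite derive_val. Qed.

Lemma smooth_D (R : realType) (f : plane R -> R) (v : plane R) : smooth f ->
  smooth (fun x => 'D_v f x).
Proof.
move=> /(smooth_derive v)[g sg dg].
by rewrite (_ : (fun x => _) = g)//; apply/funext => x; rewrite derive_val.
Qed.

Lemma smooth_Ck (R : realType) (f : plane R -> R) k : smooth f -> Ck k [set: plane R] f.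
Proof.
elim: k f => [|k IH] f sf /=; (split; first by move=> p _; exact: smooth_continuous) => //.
move=> v; split; last by apply: IH; exact: smooth_D.
by move=> p _; have [] := smooth_is_derive v p sf.
Qed.

Lemma smooth_affine (R : realType) (f : plane R -> R) (c : R) (a : plane R) : smooth f ->
  smooth (fun x => f (c *: (x + a))).
Proof.
elim=> {f} [d|||f g _ cf _ cg|f g _ cf _ cg|f _ cf f0|f _ cf f0|n f _ cf].
- exact: smooth_cst.
- apply: (smooth_mul (smooth_cst c)); apply: (smooth_add (smooth_fst R)); exact: smooth_cst.
- apply: (smooth_mul (smooth_cst c)); apply: (smooth_add (smooth_snd R)); exact: smooth_cst.
- exact: smooth_add.
- exact: smooth_mul.
- exact: smooth_inv.
- exact: smooth_ln.
- exact: smooth_flat.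
Qed.

Lemma smooth_sub (R : realType) (f g : plane R -> R) : smooth f -> smooth g ->
  smooth (fun x => f x - g x).
Proof.
move=> sf sg; rewrite (_ : (fun x => _) = fun x => f x + (-1) * g x); last first.
  by apply/funext => x; rewrite mulN1r.
by apply: smooth_add => //; apply: smooth_mul => //; exact: smooth_cst.
Qed.

Lemma smooth_laplacian (R : realType) (f : plane R -> R) : smooth f -> smooth (laplacian f).
Proof. by move=> sf; apply: smooth_add; do 2 apply: smooth_D. Qed.

(** * Logarithms smoothed near the pole *)

Notation e1 := ((1, 0) : plane _).
Notation e2 := ((0, 1) : plane _).

Lemma dot_ge0 (R : realType) (w : plane R) : 0 <= dot w w.
Proof. by rewrite addr_ge0 // -expr2 sqr_ge0. Qed.

Lemma dot_gt0 (R : realType) (w : plane R) : w != 0 -> 0 < dot w w.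
Proof.
case: w => a b; rewrite lt0r dot_ge0 andbT /dot /= => w0.
apply: contra w0; rewrite paddr_eq0 -?expr2 ?sqr_ge0// !expf_eq0 /=.
by move=> /andP[/eqP -> /eqP ->].
Qed.

Lemma smooth_dot (R : realType) : smooth (fun w : plane R => dot w w).
Proof. by apply: smooth_add; apply: smooth_mul; exact: smooth_fst || exact: smooth_snd. Qed.

Lemma is_derive_fst (R : realType) (x v : plane R) : is_derive x v (fst : plane R -> R) v.1.
Proof.
apply: is_derive_cvg; apply/cvgrPdist_le => e e0; near=> h.
have h0 : h != 0 by near: h; exact: nbhs_dnbhs_neq.
by rewrite /= addrK [_ *: _]mulrA mulVf// mul1r subrr normr0 ltW.
Unshelve. all: by end_near. Qed.

Lemma is_derive_snd (R : realType) (x v : plane R) : is_derive x v (snd : plane R -> R) v.2.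
Proof.
apply: is_derive_cvg; apply/cvgrPdist_le => e e0; near=> h.
have h0 : h != 0 by near: h; exact: nbhs_dnbhs_neq.
by rewrite /= addrK [_ *: _]mulrA mulVf// mul1r subrr normr0 ltW.
Unshelve. all: by end_near. Qed.

Lemma is_derive_dot (R : realType) (x v : plane R) :
  is_derive x v (fun w : plane R => dot w w) (2 * dot x v).
Proof.
apply: is_derive_eq (is_deriveD (is_deriveM (is_derive_fst x v) (is_derive_fst x v))
  (is_deriveM (is_derive_snd x v) (is_derive_snd x v))) _.
by rewrite /dot /GRing.scale /=; ring.
Qed.

Lemma is_derive_dotl (R : realType) (x v a : plane R) :
  is_derive x v (fun u : plane R => dot u a) (dot v a).
Proof.
apply: is_derive_cvg; apply/cvgrPdist_le => e e0; near=> h.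
have h0 : h != 0 by near: h; exact: nbhs_dnbhs_neq.
have -> : dot (h *: v + x) a - dot x a = h * dot v a.
  change ((h * v.1 + x.1) * a.1 + (h * v.2 + x.2) * a.2 - dot x a = h * dot v a).
  by rewrite /dot; ring.
by rewrite [_ *: _]mulrA mulVf// mul1r subrr normr0 ltW.
Unshelve. all: by end_near. Qed.

(** A smooth step, 0 for s <= 1/4 and 1 for s >= 1. Differences are written with [+ -] and [-1 *] so
    that the constructors of [smooth] match. *)
Definition cutoff (R : realType) (s : R) : R :=
  flat 0 (s + - 4^-1) * (flat 0 (s + - 4^-1) + flat 0 (1 + -1 * s))^-1.

Lemma cutoff_den (R : realType) (s : R) : 0 < flat 0 (s + - 4^-1) + flat 0 (1 + -1 * s).
Proof.
have [h|h] := ltP 4^-1 s.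
  by rewrite ltr_wpDr ?flat_ge0// flat_gt0// subr_gt0.
by rewrite ltr_wpDl ?flat_ge0// flat_gt0//; lra.
Qed.

Lemma cutoff_small (R : realType) (s : R) : s <= 4^-1 -> cutoff s = 0.
Proof. by move=> h; rewrite /cutoff flat_le0 ?mul0r// subr_le0. Qed.

Lemma cutoff_big (R : realType) (s : R) : 1 <= s -> cutoff s = 1.
Proof.
move=> h; rewrite /cutoff (@flat_le0 _ _ (1 + _)); last by lra.
by rewrite addr0 divff// gt_eqF// flat_gt0//; lra.
Qed.

Lemma cutoff_itv (R : realType) (s : R) : 0 <= cutoff s <= 1.
Proof.
have d0 := cutoff_den s.
rewrite divr_ge0 ?flat_ge0 ?(ltW d0)//= ler_pdivrMr// mul1r lerDl flat_ge0//.
Qed.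

(** In the Euclidean norm this is |w|^2 for |w| >= 1 and 1 for |w| <= 1/2. It stays positive in
    between, so its logarithm is smooth on the whole plane. *)
Definition radial (R : realType) (w : plane R) : R := 1 + cutoff (dot w w) * (dot w w + -1).

Lemma radial_gt0 (R : realType) (w : plane R) : 0 < radial w.
Proof.
rewrite /radial; set s := dot w w; have /andP[c0 c1] := cutoff_itv s.
have [h|h] := leP s 4^-1; first by rewrite cutoff_small // mul0r addr0.
have [h1|h1] := leP 1 s; first by rewrite ltr_wpDr// mulr_ge0//; lra.
nra.
Qed.

Lemma smooth_radial (R : realType) : smooth (@radial R).
Proof.
have sd := smooth_dot R.
have s1 : smooth (fun w : plane R => flat 0 (dot w w + - 4^-1)).
  by apply: smooth_flat; apply: smooth_add => //; exact: smooth_cst.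
have s2 : smooth (fun w : plane R => flat 0 (1 + -1 * dot w w)).
  apply: smooth_flat; apply: smooth_add; first exact: smooth_cst.
  by apply: smooth_mul => //; exact: smooth_cst.
apply: (smooth_add (smooth_cst 1)); apply: smooth_mul.
  apply: smooth_mul => //; apply: smooth_inv; first exact: smooth_add.
  by move=> x; rewrite gt_eqF// cutoff_den.
by apply: smooth_add => //; exact: smooth_cst.
Qed.

(* A smooth function equal to ln |w|^2 off the disc of radius d and constant on the disc of
   radius d/2; its Laplacian is 4 pi times a mollifier carried by the annulus. *)
Definition smlog (R : realType) (d : R) (w : plane R) : R :=
  ln (radial (d^-1 *: (w + 0))) + ln (d ^+ 2).

Lemma smooth_smlog (R : realType) (d : R) : smooth (smlog d).
Proof.
apply: smooth_add; last exact: smooth_cst.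
apply: (@smooth_affine _ (fun w => ln (radial w)) d^-1 0).
by apply: smooth_ln; [exact: smooth_radial | exact: radial_gt0].
Qed.

Lemma dotZ (R : realType) (c : R) (w : plane R) : dot (c *: w) (c *: w) = c ^+ 2 * dot w w.
Proof.
change (c * w.1 * (c * w.1) + c * w.2 * (c * w.2) = c ^+ 2 * dot w w).
by rewrite /dot; ring.
Qed.

Lemma smlog_far (R : realType) (d : R) (w : plane R) : 0 < d -> d ^+ 2 <= dot w w ->
  smlog d w = ln (dot w w).
Proof.
move=> d0 dw; have d20 : 0 < d ^+ 2 by rewrite exprn_gt0.
rewrite /smlog /radial addr0 dotZ exprVn.
have h : 1 <= (d ^+ 2)^-1 * dot w w by rewrite mulrC ler_pdivlMr// mul1r.
rewrite cutoff_big// mul1r addrCA subrr addr0 -lnM ?posrE// ?(lt_le_trans _ h)//.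
by rewrite mulrAC mulVf ?mul1r// gt_eqF.
Qed.

Lemma smlog_near (R : realType) (d : R) (w : plane R) : 0 < d -> dot w w <= d ^+ 2 / 4 ->
  smlog d w = ln (d ^+ 2).
Proof.
move=> d0 dw; have d20 : 0 < d ^+ 2 by rewrite exprn_gt0.
rewrite /smlog /radial addr0 dotZ exprVn.
by rewrite cutoff_small ?mul0r ?addr0 ?ln1 ?add0r// mulrC ler_pdivrMr// mulrC.
Qed.

Lemma dot_oppr (R : realType) (w : plane R) : dot (- w) (- w) = dot w w.
Proof. by rewrite /dot /= !mulrNN. Qed.

Lemma derive_affine (R : realType) (f : plane R -> R) (c : R) (a x v : plane R) : smooth f ->
  'D_v (fun x => f (c *: (x + a))) x = c * 'D_v f (c *: (x + a)).
Proof.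
move=> sf; suff H : is_derive x v (fun x => f (c *: (x + a))) (c * 'D_v f (c *: (x + a))).
  by rewrite derive_val.
apply/is_derive_line.
have /is_derive_line H := smooth_is_derive v (c *: (x + a)) sf.
have -> : (fun t : R => f (c *: (t *: v + x + a))) =
  (fun s => f (s *: v + c *: (x + a))) \o (fun t : R => c * t).
  by apply/funext => t /=; rewrite -addrA scalerDr scalerA.
rewrite mulrC; apply: is_derive1_comp; first by rewrite mulr0.
by have := is_deriveZ c (is_derive_id (0 : R) (1 : R)); rewrite [c *: 1]mulr1.
Qed.

Lemma laplacian_affine (R : realType) (f : plane R -> R) (c : R) (a x : plane R) : smooth f ->
  laplacian (fun x => f (c *: (x + a))) x = c ^+ 2 * laplacian f (c *: (x + a)).
Proof.
move=> sf; rewrite /laplacian mulrDr.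
have E v : 'D_v (fun u => 'D_v (fun x => f (c *: (x + a))) u) x =
    c ^+ 2 * 'D_v (fun u => 'D_v f u) (c *: (x + a)).
  rewrite (_ : (fun u => 'D_v (fun x => f (c *: (x + a))) u) =
     c \*: (fun u => 'D_v f (c *: (u + a)))); last first.
    by apply/funext => u; rewrite derive_affine.
  rewrite deriveZ; last by have [] := smooth_is_derive v x (smooth_affine c a (smooth_D v sf)).
  by rewrite (derive_affine _ _ _ _ (smooth_D v sf)) expr2 -mulrA.
by rewrite (E e1) (E e2).
Qed.

Lemma laplacian_addc (R : realType) (f : plane R -> R) (k : R) (x : plane R) : smooth f ->
  laplacian (fun x => f x + k) x = laplacian f x.
Proof.
move=> sf; have E v u : 'D_v (fun x => f x + k) u = 'D_v f u.
  have := is_deriveD (smooth_is_derive v u sf) (is_derive_cst k u v).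
  by move=> [_]; rewrite addr0.
have E2 v : 'D_v (fun u => 'D_v (fun x => f x + k) u) x = 'D_v (fun u => 'D_v f u) x.
  by rewrite (_ : (fun u => 'D_v (fun x => f x + k) u) = (fun u => 'D_v f u))//; apply/funext.
exact: (congr2 +%R (E2 e1) (E2 e2)).
Qed.

Lemma laplacian_smlog (R : realType) (d : R) (a x : plane R) : 
  laplacian (fun x => smlog d (x + a)) x =
  (d ^+ 2)^-1 * laplacian (fun w => ln (radial w)) (d^-1 *: (x + a)).
Proof.
have sr : smooth (fun w : plane R => ln (radial w)).
  by apply: smooth_ln; [exact: smooth_radial | exact: radial_gt0].
rewrite (_ : (fun x => _) = fun x => ln (radial (d^-1 *: (x + a))) + ln (d ^+ 2)); last first.
  by apply/funext => u; rewrite /smlog addr0.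
rewrite laplacian_addc; last exact: (smooth_affine _ _ sr).
by rewrite (laplacian_affine _ _ _ sr) exprVn.
Qed.

Lemma near_eq_laplacian (R : realType) (f g : plane R -> R) (x : plane R) :
  (\near x, f x = g x) -> laplacian f x = laplacian g x.
Proof.
move=> fg; have {}fg := nbhs_interior fg.
have E v : 'D_v (fun u => 'D_v f u) x = 'D_v (fun u => 'D_v g u) x.
  by apply: near_eq_derive; apply: filterS fg => u; exact: near_eq_derive.
exact: (congr2 +%R (E e1) (E e2)).
Qed.

Lemma is_derive_lndot (R : realType) (x v : plane R) : x != 0 ->
  is_derive x v (fun w : plane R => ln (dot w w)) ((dot x x)^-1 * (2 * dot x v)).
Proof.
move=> x0; apply: (is_derive_comp1 (is_derive_dot x v)).
by apply: is_derive1_ln; exact: dot_gt0.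
Qed.

Lemma dot_continuous (R : realType) : continuous (fun w : plane R => dot w w).
Proof. by apply: smooth_continuous; exact: smooth_dot. Qed.

Lemma laplacian_lndot (R : realType) (x : plane R) : x != 0 ->
  laplacian (fun w : plane R => ln (dot w w)) x = 0.
Proof.
move=> x0; have d0 := dot_gt0 x0.
have nx : \forall u \near x, u != 0.
  have : \forall u \near x, 0 < dot u u by exact: (cvgr_gt _ (@dot_continuous R x)).
  by apply: filterS => u; apply: contraTneq => ->; rewrite /dot /= mulr0 addr0 ltxx.
have E v : 'D_v (fun u => 'D_v (fun w : plane R => ln (dot w w)) u) x =
   (dot x x)^-1 * (2 * dot v v) - (dot x x) ^- 2 * (2 * dot x v) ^+ 2.
  have nD : \forall u \near x, 'D_v (fun w : plane R => ln (dot w w)) u = (dot u u)^-1 * (2 * dot u v).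
    by apply: filterS nx => u u0; have [_ ->] := is_derive_lndot v u0.
  rewrite (near_eq_derive v nD).
    have dl : is_derive x v (fun u : plane R => 2 * dot u v) (2 * dot v v).
      exact: is_deriveZ (is_derive_dotl x v v).
    have dV : is_derive x v (fun u : plane R => (dot u u)^-1) ((- dot x x ^- 2 *: 1) * (2 * dot x v)).
      apply: (is_derive_comp1 (is_derive_dot x v)).
      have dn : dot x x != 0 by rewrite gt_eqF.
      by apply: (@is_deriveV _ id _ _ _ dn); exact: is_derive_id.
    have [_ ->] := is_deriveM dV dl.
    by rewrite /GRing.scale /=; ring.
rewrite (congr2 +%R (E e1) (E e2) : laplacian _ x = _).
move: d0; rewrite /dot /= => d0; field.
by rewrite gt_eqF.
Qed.

Lemma laplacian_smlog_far (R : realType) (d : R) (x : plane R) : 0 < d -> d ^+ 2 < dot x x ->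
  laplacian (smlog d) x = 0.
Proof.
move=> d0 dx; rewrite (@near_eq_laplacian _ _ (fun w : plane R => ln (dot w w))).
  apply: laplacian_lndot; apply: contraTneq dx => ->.
  by rewrite /dot /= mulr0 addr0 -leNgt sqr_ge0.
have : \forall u \near x, d ^+ 2 < dot u u by exact: (cvgr_gt _ (@dot_continuous R x)).
by apply: filterS => u du; rewrite smlog_far// ltW.
Qed.

Lemma laplacian_cst (R : realType) (k : R) (x : plane R) : laplacian (fun=> k) x = 0.
Proof.
have E v : (fun u => 'D_v (fun _ : plane R => k) u) = fun=> 0.
  by apply/funext => u; have [_ ->] := is_derive_cst k u v.
have E2 v : 'D_v (fun u => 'D_v (fun _ : plane R => k) u) x = 0.
  by rewrite E; have [_ ->] := is_derive_cst (0 : R) x v.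
by rewrite (congr2 +%R (E2 e1) (E2 e2) : laplacian _ x = _) addr0.
Qed.

Lemma laplacian_smlog_near (R : realType) (d : R) (x : plane R) : 0 < d -> dot x x < d ^+ 2 / 4 ->
  laplacian (smlog d) x = 0.
Proof.
move=> d0 dx; rewrite (@near_eq_laplacian _ _ (fun=> ln (d ^+ 2))); first exact: laplacian_cst.
have : \forall u \near x, dot u u < d ^+ 2 / 4 by exact: (cvgr_lt _ (@dot_continuous R x)).
by apply: filterS => u du; rewrite smlog_near// ltW.
Qed.

(** * Integration over squares *)

Lemma continuous_pair (T U V : topologicalType) (f : T -> U) (g : T -> V) (x : T) :
  {for x, continuous f} -> {for x, continuous g} -> {for x, continuous (fun t => (f t, g t))}.
Proof. by move=> cf cg; exact: (cvg_pair cf cg). Qed.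

Lemma is_derive_slice1 (R : realType) (g : plane R -> R) (s t d : R) :
  is_derive ((s, t) : plane R) (e1 : plane R) g d -> is_derive s (1 : R) (fun r : R => g (r, t)) d.
Proof.
have E (r : R) : r *: (e1 : plane R) + (0, t) = (r, t).
  by change ((r * 1 + 0, r * 0 + t) = (r, t)); rewrite mulr1 addr0 mulr0 add0r.
by rewrite -E => /is_derive_line_at; congr is_derive; apply/funext => r; rewrite E.
Qed.

Lemma is_derive_slice2 (R : realType) (g : plane R -> R) (s t d : R) :
  is_derive ((s, t) : plane R) (e2 : plane R) g d -> is_derive t (1 : R) (fun r : R => g (s, r)) d.
Proof.
have E (r : R) : r *: (e2 : plane R) + (s, 0) = (s, r).
  by change ((r * 0 + s, r * 1 + 0) = (s, r)); rewrite mulr1 addr0 mulr0 add0r.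
by rewrite -E => /is_derive_line_at; congr is_derive; apply/funext => r; rewrite E.
Qed.

Definition square (R : realType) (x : plane R) (a : R) : set (plane R) :=
  `[x.1 - a, x.1 + a]%classic `*` `[x.2 - a, x.2 + a]%classic.

Lemma squareP (R : realType) (x : plane R) (a : R) (y : plane R) :
  square x a y <-> `|y - x| <= a.
Proof.
rewrite /square /= !in_itv /=.
have -> : `|y - x| = Num.max `|y.1 - x.1| `|y.2 - x.2| by [].
rewrite ge_max !ler_distl; split.
  by move=> [/andP[? ?] /andP[? ?]]; apply/andP; split; apply/andP.
by move=> /andP[/andP[? ?] /andP[? ?]]; split; apply/andP.
Qed.

Lemma compact_square (R : realType) (x : plane R) (a : R) : compact (square x a).
Proof. by apply: compact_setX; exact: segment_compact. Qed.

Lemma measurable_square (R : realType) (x : plane R) (a : R) :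
  measurable (square x a : set (measurableTypeR R * measurableTypeR R)).
Proof. by apply: measurableX; exact: measurable_itv. Qed.

Lemma lebesgue2_square (R : realType) (x : plane R) (a : R) : 0 <= a ->
  @lebesgue2 R (square x a) = ((2 * a) ^+ 2)%:E.
Proof.
move=> a0; rewrite /square.
set A := `[_, _]%classic; set B := `[_, _]%classic.
have -> : @lebesgue2 R (A `*` B) = (@lebesgue_measure R A * @lebesgue_measure R B)%E.
  by apply: product_measure1E; exact: measurable_itv.
rewrite !lebesgue_measure_itv /= !lte_fin.
move: a0; rewrite le_eqVlt => /predU1P[<-|a0].
  by rewrite !subr0 !addr0 !ltxx mule0 mulr0 expr0n.
have h (t : R) : t - a < t + a by lra.
by rewrite !h -!EFinB -EFinM; congr (_%:E); ring.
Qed.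

Lemma lebesgue2_square_fin (R : realType) (x : plane R) (a : R) :
  (@lebesgue2 R (square x a) < +oo)%E.
Proof.
have [a0|a0] := leP 0 a; first by rewrite lebesgue2_square// ltry.
rewrite (_ : square x a = set0) ?measure0//.
apply/seteqP; split => // y /squareP; rewrite leNgt.
by rewrite (lt_le_trans a0).
Qed.

Lemma integrable_square_bounded (R : realType) (x : plane R) (a : R) (f : plane R -> R) :
  measurable_fun (square x a : set (measurableTypeR R * measurableTypeR R)) f ->
  [bounded f t | t in square x a] ->
  (@lebesgue2 R).-integrable (square x a) (EFin \o f).
Proof.
move=> mf bf; apply: measurable_bounded_integrable => //.
- exact: measurable_square.
- exact: lebesgue2_square_fin.
Qed.

Lemma continuous_bounded_square (R : realType) (x : plane R) (a : R) (f : plane R -> R) :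
  continuous f -> [bounded f t | t in square x a].
Proof.
move=> cf; have /compact_bounded[M [Mr HM]] : compact (f @` square x a).
  by apply: continuous_compact; [exact: continuous_subspaceT | exact: compact_square].
by exists M; split => // N MN y Ay; apply: HM => //; exists y.
Qed.

Lemma integrable_square_smooth (R : realType) (x : plane R) (a : R) (f : plane R -> R) :
  smooth f -> (@lebesgue2 R).-integrable (square x a) (EFin \o f).
Proof.
move=> sf; apply: integrable_square_bounded.
  by apply: measurable_funTS; exact: smooth_measurable.
by apply: continuous_bounded_square; exact: smooth_continuous.
Qed.

Lemma fubini_rect1 (R : realType) (A B : set (measurableTypeR R)) (f : plane R -> R) :
  measurable A -> measurable B ->
  (@lebesgue2 R).-integrable (A `*` B) (EFin \o f) ->
  (\int[@lebesgue2 R]_(z in A `*` B) (f z)%:E =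
   \int[@lebesgue_measure R]_(t in B) \int[@lebesgue_measure R]_(s in A) (f (s, t))%:E)%E.
Proof.
move=> mA mB intf; rewrite integral_mkcond.
have mAB : measurable (A `*` B) by exact: measurableX.
rewrite -integral21_prod_meas1; last by apply/(integrable_mkcond _ mAB).
rewrite [RHS]integral_mkcond; apply: eq_integral => t _.
rewrite /fubini_G patchE; case: ifPn => tB.
  rewrite [RHS]integral_mkcond; apply: eq_integral => s _.
  by rewrite !patchE in_setX tB andbT.
by rewrite integral0_eq// => s _; rewrite patchE in_setX (negbTE tB) andbF.
Qed.

Lemma fubini_rect2 (R : realType) (A B : set (measurableTypeR R)) (f : plane R -> R) :
  measurable A -> measurable B ->
  (@lebesgue2 R).-integrable (A `*` B) (EFin \o f) ->
  (\int[@lebesgue2 R]_(z in A `*` B) (f z)%:E =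
   \int[@lebesgue_measure R]_(s in A) \int[@lebesgue_measure R]_(t in B) (f (s, t))%:E)%E.
Proof.
move=> mA mB intf; rewrite integral_mkcond.
have mAB : measurable (A `*` B) by exact: measurableX.
rewrite -integral12_prod_meas1; last by apply/(integrable_mkcond _ mAB).
rewrite [RHS]integral_mkcond; apply: eq_integral => t _.
rewrite /fubini_F patchE; case: ifPn => tB.
  rewrite [RHS]integral_mkcond; apply: eq_integral => s _.
  by rewrite !patchE in_setX tB.
by rewrite integral0_eq// => s _; rewrite patchE in_setX (negbTE tB).
Qed.

Lemma FTC2_everywhere (R : realType) (F f : R -> R) (a b : R) : a < b ->
  continuous f -> (forall t : R, is_derive t (1 : R) F (f t)) ->
  (\int[@lebesgue_measure R]_(t in `[a, b]) (f t)%:E = (F b - F a)%:E)%E.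
Proof.
move=> ab cf dF.
have cF : continuous F.
  by move=> t; apply: differentiable_continuous; apply/derivable1_diffP; have [] := dF t.
rewrite (@continuous_FTC2 _ f F)//.
- exact: continuous_subspaceT.
- split; first by move=> t _; have [] := dF t.
  + by apply: cvg_at_right_filter; exact: cF.
  + by apply: cvg_at_left_filter; exact: cF.
- by move=> t _; rewrite derive1E derive_val.
Qed.

(** The flux of grad ln |w|^2 through one pair of opposite sides of a square of half side a; the
    antiderivative is 4 atan ((t - c) / a). Two such pairs give the total 4 pi. *)
Lemma flux_integral (R : realType) (c a : R) : 0 < a ->
  (\int[@lebesgue_measure R]_(t in `[(c - a)%R, (c + a)%R])
     (4 * a / (a ^+ 2 + (t - c) ^+ 2))%:E = (2 * pi)%:E)%E.
Proof.
move=> a0; have a20 : 0 < a ^+ 2 by rewrite exprn_gt0.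
pose F (t : R) := 4 * atan (a^-1 * (t - c)).
have den t : a ^+ 2 + (t - c) ^+ 2 != 0 by rewrite gt_eqF// ltr_wpDr// sqr_ge0.
have dlin (t : R) : is_derive t (1 : R) (fun t : R => a^-1 * (t - c)) (a^-1).
  have := is_deriveZ a^-1 (is_deriveB (is_derive_id t (1 : R)) (is_derive_cst c t (1:R))).
  by rewrite subr0 [a^-1 *: 1]mulr1.
have cf : continuous (fun t : R => 4 * a / (a ^+ 2 + (t - c) ^+ 2)).
  have cl (t : R) : (fun t : R => t - c) @ t --> t - c.
    by apply: cvgB; [exact: cvg_id | exact: cvg_cst].
  move=> t; apply: cvgM; first exact: cvg_cst.
  apply: cvgV => //; apply: cvgD; first exact: cvg_cst.
  exact: (@cvgM _ _ _ _ (fun t : R => t - c) (fun t : R => t - c) _ _ (cl t) (cl t)).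
have dF (t : R) : is_derive t (1 : R) F (4 * a / (a ^+ 2 + (t - c) ^+ 2)).
  have dA := is_derive_comp1 (dlin t) (is_derive1_atan (a^-1 * (t - c))).
  apply: is_derive_eq (is_deriveZ 4 dA) _.
  have -> : a ^+ 2 + (t - c) ^+ 2 = a ^+ 2 * (1 + (a^-1 * (t - c)) ^+ 2).
    by field; rewrite gt_eqF.
  have den2 : 1 + (a^-1 * (t - c)) ^+ 2 != 0 by rewrite gt_eqF// ltr_wpDr// sqr_ge0.
  rewrite /GRing.scale /=; move: (1 + (a^-1 * (t - c)) ^+ 2) den2 => q q0.
  by field; rewrite q0 gt_eqF.
have ab : c - a < c + a by lra.
rewrite (FTC2_everywhere ab cf dF) /F; congr (_%:E); rewrite !(addrC c) !addrK.
rewrite mulrN mulVf ?gt_eqF// atanN atan1.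
by field.
Qed.

(* Flux through the four sides of a square; on the boundary of the square f is ln |.-x|^2. *)
Lemma integral_laplacian_smlog (R : realType) (d a : R) (x : plane R) : 0 < d -> d < a ->
  (\int[@lebesgue2 R]_(z in square x a) (laplacian (fun z : plane R => smlog d (z - x)) z)%:E = (4 * pi)%:E)%E.
Proof.
move=> d0 da; have a0 : 0 < a by exact: lt_trans da.
pose f := fun z : plane R => smlog d (z - x).
have sf : smooth f.
  have := smooth_affine 1 (- x) (smooth_smlog d).
  by rewrite (_ : (fun _ => _) = f)//; apply/funext => z; rewrite scale1r.
have Df (v : plane R) (z : plane R) : a ^+ 2 <= dot (z - x) (z - x) -> 'D_v f z =
   (dot (z - x) (z - x))^-1 * (2 * dot (z - x) v).
  move=> az; have ad : d ^+ 2 < dot (z - x) (z - x).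
    by apply: lt_le_trans az; rewrite ltr_pXn2r// nnegrE ltW.
  have nE : \forall u \near z, ln (dot (u - x) (u - x)) = f u.
    have cu : {for z, continuous (fun u : plane R => dot (u - x) (u - x))}.
      apply: (@continuous_comp _ _ _ (fun u : plane R => u - x) (fun w => dot w w)).
        by apply: continuousB; [exact: cvg_id | exact: cst_continuous].
      exact: dot_continuous.
    have : \forall u \near z, d ^+ 2 < dot (u - x) (u - x) by exact: (cvgr_gt _ cu).
    by apply: filterS => u du; rewrite /f smlog_far// ltW.
  rewrite -(near_eq_derive v nE).
  have zx : z - x != 0.
    by apply: contraTneq ad => ->; rewrite /dot /= mulr0 addr0 -leNgt sqr_ge0.
  have /is_derive_line H := is_derive_lndot v zx.
  suff H2 : is_derive z v (fun u : plane R => ln (dot (u - x) (u - x))) ((dot (z - x) (z - x))^-1 * (2 * dot (z - x) v)).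
    by rewrite derive_val.
  apply/is_derive_line; rewrite (_ : (fun t : R => _) = fun t : R => ln (dot (t *: v + (z - x)) (t *: v + (z - x))))//.
  by apply/funext => t; rewrite addrA.
pose D1 := fun z : plane R => 'D_(e1 : plane R) f z; pose D2 := fun z : plane R => 'D_(e2 : plane R) f z.
have sD1 : smooth D1 by exact: smooth_D.
have sD2 : smooth D2 by exact: smooth_D.
pose D11 := fun z : plane R => 'D_(e1 : plane R) D1 z; pose D22 := fun z : plane R => 'D_(e2 : plane R) D2 z.
have sD11 : smooth D11 by exact: smooth_D.
have sD22 : smooth D22 by exact: smooth_D.
have mi (c : R) : measurable (`[c - a, c + a]%classic : set (measurableTypeR R)).
  exact: measurable_itv.
have lt_ca (c : R) : c - a < c + a by lra.
have cont1 t (g : plane R -> R) : smooth g -> continuous (fun s : R => g (s, t)).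
  move=> sg s; apply: (@continuous_comp _ _ _ (fun s : R => (s, t)) g).
    exact: continuous_pair (@cvg_id _ _) (@cvg_cst _ _ _ _ _).
  exact: smooth_continuous.
have cont2 s (g : plane R -> R) : smooth g -> continuous (fun t : R => g (s, t)).
  move=> sg t; apply: (@continuous_comp _ _ _ (fun t : R => (s, t)) g).
    exact: continuous_pair (@cvg_cst _ _ _ _ _) (@cvg_id _ _).
  exact: smooth_continuous.
have der1 (s t : R) : is_derive s (1 : R) (fun s : R => D1 (s, t)) (D11 (s, t)).
  by apply: is_derive_slice1; exact: smooth_is_derive.
have der2 (s t : R) : is_derive t (1 : R) (fun t : R => D2 (s, t)) (D22 (s, t)).
  by apply: is_derive_slice2; exact: smooth_is_derive.
have I1 : (\int[@lebesgue2 R]_(z in square x a) (D11 z)%:E = (2 * pi)%:E)%E.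
  rewrite /square fubini_rect1 ?mi//; last exact: integrable_square_smooth.
  rewrite -(flux_integral x.2 a0); apply: eq_integral => t _.
  rewrite (FTC2_everywhere (lt_ca _) (cont1 t _ sD11) (fun s => der1 s t)).
  congr (_%:E); rewrite /D1.
  rewrite !Df; first last.
  - by rewrite /dot /= addrAC subrr add0r -!expr2 lerDl sqr_ge0.
  - by rewrite /dot /= addrAC subrr add0r mulrNN -!expr2 lerDl sqr_ge0.
  rewrite /dot /= (_ : x.1 + a - x.1 = a); last by ring.
  rewrite (_ : x.1 - a - x.1 = - a); last by ring.
  have den : a ^+ 2 + (t - x.2) ^+ 2 != 0 by rewrite gt_eqF// ltr_wpDr ?sqr_ge0// exprn_gt0.
  by field; rewrite den.
have I2 : (\int[@lebesgue2 R]_(z in square x a) (D22 z)%:E = (2 * pi)%:E)%E.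
  rewrite /square fubini_rect2 ?mi//; last exact: integrable_square_smooth.
  rewrite -(flux_integral x.1 a0); apply: eq_integral => t _.
  rewrite (FTC2_everywhere (lt_ca _) (cont2 t _ sD22) (fun s => der2 t s)).
  congr (_%:E); rewrite /D2.
  rewrite !Df; first last.
  - by rewrite /dot /= addrAC subrr add0r -!expr2 lerDr sqr_ge0.
  - by rewrite /dot /= addrAC subrr add0r mulrNN -!expr2 lerDr sqr_ge0.
  rewrite /dot /= (_ : x.2 + a - x.2 = a); last by ring.
  rewrite (_ : x.2 - a - x.2 = - a); last by ring.
  have den : a ^+ 2 + (t - x.1) ^+ 2 != 0 by rewrite gt_eqF// ltr_wpDr ?sqr_ge0// exprn_gt0.
  have den2 : (t - x.1) ^+ 2 + a ^+ 2 != 0 by rewrite addrC.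
  by field; rewrite den.
rewrite (_ : (fun z => _) = (fun z => (D11 z)%:E + (D22 z)%:E)%E); last by apply/funext => z.
rewrite integralD.
- rewrite (congr2 (fun u v => u + v)%E I1 I2) -EFinD; congr EFin; ring.
- exact: measurable_square.
- exact: integrable_square_smooth.
- exact: integrable_square_smooth.
Qed.

(** * Strict derivatives *)

Lemma is_deriveZv (R : realType) (V : normedModType R) (f : V -> R) (x v : V) (c d : R) :
  is_derive x v f d -> is_derive x (c *: v) f (c * d).
Proof.
move=> /is_derive_line H; apply/is_derive_line.
have -> : (fun t : R => f (t *: (c *: v) + x)) = (fun s => f (s *: v + x)) \o (fun t : R => c * t).
  by apply/funext => t /=; rewrite scalerA mulrC.
rewrite mulrC; apply: is_derive1_comp; first by rewrite mulr0.
by have := is_deriveZ c (is_derive_id (0 : R) (1 : R)); rewrite [c *: 1]mulr1.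
Qed.

Lemma derive1_continuous (R : realType) (f : R -> R) (t d : R) :
  is_derive t (1 : R) f d -> {for t, continuous f}.
Proof. by move=> [H _]; apply: differentiable_continuous; apply/derivable1_diffP. Qed.

Lemma MVT_line (R : realType) (V : normedModType R) (f : V -> R) (x v : V) (D : V -> R) :
  (forall t : R, 0 <= t <= 1 -> is_derive (t *: v + x) v f (D (t *: v + x))) ->
  exists2 t : R, 0 <= t <= 1 & f (v + x) - f x = D (t *: v + x).
Proof.
move=> H; have [||t] := @MVT_segment R (fun s => f (s *: v + x)) (fun s => D (s *: v + x)) 0 1 ler01.
- move=> t; rewrite in_itv /= => /andP[t0 t1]; apply: is_derive_line_at; apply: H.
  by rewrite !ltW.
- apply: continuous_in_subspaceT => t; rewrite inE /= in_itv /= => t01.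
  exact: derive1_continuous (is_derive_line_at (H t t01)).
- by rewrite in_itv /= => t01; rewrite scale1r scale0r add0r subr0 mulr1 => E; exists t.
Qed.

(** The mean value theorem is applied to the error, to its derivative, and to the second derivative
    on either side of 0; each use contributes one factor at most t. *)
Lemma second_difference_le (R : realType) (p p1 p2 p3 : R -> R) (t C : R) : 0 < t ->
  (forall s : R, `|s| <= t -> is_derive s (1 : R) p (p1 s)) ->
  (forall s : R, `|s| <= t -> is_derive s (1 : R) p1 (p2 s)) ->
  (forall s : R, `|s| <= t -> is_derive s (1 : R) p2 (p3 s)) ->
  (forall s : R, `|s| <= t -> `|p3 s| <= C) ->
  `|p t + p (- t) - 2 * p 0 - t ^+ 2 * p2 0| <= 2 * C * t ^+ 3.
Proof.
move=> t0 H1 H2 H3 H4.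
have C0 : 0 <= C by apply: le_trans (normr_ge0 _) (H4 0 _); rewrite normr0 ltW.
have neg (q dq : R -> R) : (forall s : R, `|s| <= t -> is_derive s (1 : R) q (dq s)) ->
  forall s : R, `|s| <= t -> is_derive s (1 : R) (fun s => q (- s)) (- dq (- s)).
  move=> Hq s st; have Hs : is_derive (- s) (1 : R) q (dq (- s)) by apply: Hq; rewrite normrN.
  have := is_derive_comp1 (is_deriveN (is_derive_id s (1 : R))) Hs.
  by rewrite mulrN1.
have mvt (q dq : R -> R) (r : R) : 0 <= r -> r <= t -> q 0 = 0 ->
  (forall s : R, `|s| <= t -> is_derive s (1 : R) q (dq s)) ->
  exists2 s, 0 <= s <= r & q r = dq s * r.
  move=> r0 rt q0 Hq.
  have [||s] := @MVT_segment R q dq 0 r r0.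
  - move=> s; rewrite in_itv /= => /andP[s0 s1]; apply: Hq.
    by rewrite gtr0_norm// (le_trans (ltW s1)).
  - apply: continuous_in_subspaceT => s; rewrite inE /= in_itv /= => /andP[s0 s1].
    by apply: derive1_continuous (Hq s _); rewrite ger0_norm// (le_trans s1).
  - by rewrite in_itv /= q0 !subr0 => ? ?; exists s.
pose q s := p s + p (- s) - 2 * p 0 - s ^+ 2 * p2 0.
pose q1 s := p1 s + - p1 (- s) - 2 * s * p2 0.
have dq s : `|s| <= t -> is_derive s (1 : R) q (q1 s).
  move=> st; have dsq : is_derive s (1 : R) (fun s : R => s ^+ 2 * p2 0) (2 * s * p2 0).
    have := is_deriveM (is_deriveX 2 (is_derive_id s (1 : R))) (is_derive_cst (p2 0) s (1 : R)).
    rewrite scaler0 add0r [X in is_derive _ _ _ X](_ : _ = 2 * s * p2 0); last first.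
      by rewrite /GRing.scale /=; ring.
    by [].
  have := is_deriveB (is_deriveB (is_deriveD (H1 s st) (neg _ _ H1 s st)) (is_derive_cst (2 * p 0) s (1 : R))) dsq.
  by rewrite subr0.
have q0 : q 0 = 0 by rewrite /q oppr0 expr0n mul0r subr0 mulr2n mulrDl mul1r subrr.
have q10 : q1 0 = 0 by rewrite /q1 oppr0 mulr0 mul0r subr0 subrr.
have [s /andP[s0 st] Eq] := mvt q q1 t (ltW t0) (lexx _) q0 dq.
have dq1 r : `|r| <= t -> is_derive r (1 : R) q1 (p2 r + p2 (- r) - 2 * p2 0).
    move=> rt; have dl : is_derive r (1 : R) (fun s : R => 2 * s * p2 0) (2 * p2 0).
      have := is_deriveZ (2 * p2 0) (is_derive_id r (1 : R)).
      rewrite [_ *: 1]mulr1; congr is_derive; apply/funext => z.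
      by rewrite /= [_ *: _]mulrAC.
    have := is_deriveB (is_deriveD (H2 r rt) (is_deriveN (neg _ _ H2 r rt))) dl.
    by rewrite opprK.
have [r /andP[r0 rs] Eq1] := mvt q1 _ s s0 st q10 dq1.
have rt := le_trans rs st.
    have dm r' : `|r'| <= t -> is_derive r' (1 : R) (fun z => p2 z - p2 0) (p3 r').
      by move=> rt'; have := is_deriveB (H3 r' rt') (is_derive_cst (p2 0) r' (1 : R)); rewrite subr0.
    have [a /andP[a0 ar] Ea] := mvt _ _ r r0 rt (subrr _) dm.
    have dm' r' : `|r'| <= t -> is_derive r' (1 : R) (fun z => p2 (- z) - p2 0) (- p3 (- r')).
      move=> rt'; have := is_deriveB (neg _ _ H3 r' rt') (is_derive_cst (p2 0) r' (1 : R)).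
      by rewrite subr0.
    have [|b /andP[b0 br] Eb] := mvt _ _ r r0 rt _ dm'; first by rewrite oppr0 subrr.
    rewrite -/(q t) Eq Eq1 (_ : p2 r + _ - _ = (p2 r - p2 0) + (p2 (- r) - p2 0)); last by ring.
    rewrite Ea Eb -mulrDl !normrM (ger0_norm r0) (ger0_norm s0) (ger0_norm (ltW t0)).
    have h : `|p3 a + - p3 (- b)| <= 2 * C.
      rewrite (le_trans (ler_normD _ _))// normrN mulr2n mulrDl mul1r lerD// H4// ?normrN.
        by rewrite ger0_norm// (le_trans ar).
      by rewrite ger0_norm// (le_trans br).
    rewrite !exprS expr0 mulr1 !mulrA.
    rewrite !ler_pM ?mulr_ge0 ?normr_ge0//.
exact: ltW.
Qed.

(* L is the strict derivative of f at x: both x1 and x2 vary in the difference quotient. *)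
Definition sdiff (R : realType) (V : normedModType R) (f : V -> R) (x : V) (L : V -> R) : Prop :=
  [/\ forall (a : R) u v, L (a *: u + v) = a * L u + L v,
      exists C : R, forall v, `|L v| <= C * `|v| &
      forall e : R, 0 < e -> exists2 r : R, 0 < r & forall x1 x2 : V,
        `|x1 - x| < r -> `|x2 - x| < r -> `|f x1 - f x2 - L (x1 - x2)| <= e * `|x1 - x2|].

Lemma sdiffL0 (R : realType) (V : normedModType R) (f : V -> R) (x : V) (L : V -> R) :
  sdiff f x L -> L 0 = 0.
Proof. by case=> H _ _; have := H (-1) 0 0; rewrite scaler0 addr0 mulN1r addNr. Qed.

Lemma sdiffLD (R : realType) (V : normedModType R) (f : V -> R) (x : V) (L : V -> R) u v :
  sdiff f x L -> L (u + v) = L u + L v.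
Proof. by case=> H _ _; have := H 1 u v; rewrite scale1r mul1r. Qed.

Lemma sdiffLZ (R : realType) (V : normedModType R) (f : V -> R) (x : V) (L : V -> R) c u :
  sdiff f x L -> L (c *: u) = c * L u.
Proof.
by move=> H; have /= := H; case=> E _ _; have := E c u 0; rewrite !addr0 (sdiffL0 H) addr0.
Qed.

(** Strictness at the single point [x] controls increments between any two nearby points; in
    particular the function is continuous on a whole neighbourhood of [x]. *)
Lemma sdiff_lipschitz (R : realType) (V : normedModType R) (f : V -> R) (x : V) (L : V -> R) :
  sdiff f x L -> exists2 C : R, 0 < C & exists2 r : R, 0 < r & forall x1 x2 : V,
        `|x1 - x| < r -> `|x2 - x| < r -> `|f x1 - f x2| <= C * `|x1 - x2|.
Proof.
move=> [_ [C HC] /(_ 1 ltr01)[r r0 Hr]].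
exists (`|C| + 1); first by rewrite ltr_wpDl.
exists r => // x1 x2 h1 h2; rewrite -(subrK (L (x1 - x2)) (f x1 - f x2)).
rewrite (le_trans (ler_normD _ _))// addrC mulrDl lerD//; last exact: Hr.
by rewrite (le_trans (HC _))// ler_wpM2r// ler_norm.
Qed.

Lemma sdiff_continuous (R : realType) (V : normedModType R) (f : V -> R) (x : V) (L : V -> R) :
  sdiff f x L -> {for x, continuous f}.
Proof.
move=> /sdiff_lipschitz[C C0 [r r0 H]]; apply/cvgrPdist_le => e e0.
apply/nbhs_ballP; exists (Num.min r (e / C)); first by rewrite /= lt_min r0 divr_gt0.
move=> y; rewrite -ball_normE /= lt_min => /andP[yr ye].
rewrite (le_trans (H _ _ _ _)) ?subrr ?normr0//; first by rewrite distrC.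
by rewrite mulrC -ler_pdivlMr// ltW.
Qed.

Lemma sdiff_add (R : realType) (V : normedModType R) (f g : V -> R) (x : V) (L M : V -> R) :
  sdiff f x L -> sdiff g x M -> sdiff (fun z => f z + g z) x (fun v => L v + M v).
Proof.
move=> [l1 [C1 b1] H1] [l2 [C2 b2] H2]; split.
- by move=> a u v; rewrite l1 l2; ring.
- exists (C1 + C2) => v; rewrite (le_trans (ler_normD _ _))// mulrDl lerD//.
- move=> e e0; have [r1 r10 h1] := H1 (e / 2) (divr_gt0 e0 (ltr0n _ 2)).
  have [r2 r20 h2] := H2 (e / 2) (divr_gt0 e0 (ltr0n _ 2)).
  exists (Num.min r1 r2); first by rewrite lt_min r10.
  move=> x1 x2; rewrite !lt_min => /andP[a1 a2] /andP[c1 c2].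
  rewrite (_ : _ - _ = (f x1 - f x2 - L (x1 - x2)) + (g x1 - g x2 - M (x1 - x2))); last by ring.
  rewrite (le_trans (ler_normD _ _))// (splitr e) mulrDl lerD//; [exact: h1 | exact: h2].
Qed.

Lemma sdiff_scale (R : realType) (V : normedModType R) (f : V -> R) (x : V) (L : V -> R) (c : R) :
  sdiff f x L -> sdiff (fun z => c * f z) x (fun v => c * L v).
Proof.
move=> [l1 [C1 b1] H1]; split.
- by move=> a u v; rewrite l1; ring.
- by exists (`|c| * C1) => v; rewrite normrM -mulrA ler_wpM2l.
- move=> e e0; have c0 : 0 < `|c| + 1 by rewrite ltr_wpDl.
  have [r r0 h] := H1 (e / (`|c| + 1)) (divr_gt0 e0 c0).
  exists r => // x1 x2 a1 a2; rewrite -!mulrBr normrM.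
  apply: (@le_trans _ _ ((`|c| + 1) * (e / (`|c| + 1) * `|x1 - x2|))).
    by rewrite ler_pM ?normr_ge0//; [rewrite lerDl | exact: h].
  by rewrite mulrA mulrCA mulfV ?mulr1// gt_eqF.
Qed.

Lemma sdiff_cst (R : realType) (V : normedModType R) (c : R) (x : V) :
  sdiff (fun=> c) x (fun=> 0).
Proof.
split; first by move=> a u v; rewrite mulr0 addr0.
- by exists 0 => v; rewrite normr0 mul0r.
- by move=> e e0; exists 1 => // x1 x2 _ _; rewrite !subrr normr0 mulr_ge0 // ltW.
Qed.

Lemma sdiff_sum (R : realType) (V : normedModType R) (I : Type) (s : seq I) (P : pred I)
    (f : I -> V -> R) (x : V) (L : I -> V -> R) :
  (forall i, P i -> sdiff (f i) x (L i)) ->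
  sdiff (fun z => \sum_(i <- s | P i) f i z) x (fun v => \sum_(i <- s | P i) L i v).
Proof.
move=> H; elim: s => [|i s IH].
  have := sdiff_cst 0 x; congr sdiff; apply/funext => z; by rewrite big_nil.
have E (h : I -> V -> R) : (fun z => \sum_(j <- i :: s | P j) h j z) =
  if P i then (fun z => h i z + \sum_(j <- s | P j) h j z) else (fun z => \sum_(j <- s | P j) h j z).
  by apply/funext => z; rewrite big_cons; case: (P i).
by rewrite !E; case: ifPn => // Pi; apply: sdiff_add => //; exact: H.
Qed.

Lemma sdiff_comp_linear (R : realType) (V W : normedModType R) (f : W -> R) (A : V -> W) (x : V)
    (L : W -> R) (C : R) :
  (forall (a : R) u v, A (a *: u + v) = a *: A u + A v) -> (forall v, `|A v| <= C * `|v|) ->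
  sdiff f (A x) L -> sdiff (fun z => f (A z)) x (fun v => L (A v)).
Proof.
move=> lA bA [l1 [C1 b1] H1].
have AB u v : A (u - v) = A u - A v.
  by have := lA (-1) v u; rewrite !scaleN1r addrC => ->; rewrite addrC.
have C0 : 0 < `|C| + 1 by rewrite ltr_wpDl.
have bA' v : `|A v| <= (`|C| + 1) * `|v|.
  by rewrite (le_trans (bA v))// ler_wpM2r// (le_trans (ler_norm _))// lerDl.
split.
- by move=> a u v; rewrite lA l1.
- exists (`|C1| * (`|C| + 1)) => v; rewrite (le_trans (b1 _))// -mulrA.
  by rewrite (@le_trans _ _ (`|C1| * `|A v|)) ?ler_wpM2r ?ler_norm ?ler_wpM2l.
- move=> e e0; have [r r0 h] := H1 (e / (`|C| + 1)) (divr_gt0 e0 C0).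
  exists (r / (`|C| + 1)); first by rewrite divr_gt0.
  move=> x1 x2; rewrite !ltr_pdivlMr// => a1 a2.
  rewrite AB (le_trans (h _ _ _ _))//.
  + by rewrite -AB (le_lt_trans (bA' _))// mulrC.
  + by rewrite -AB (le_lt_trans (bA' _))// mulrC.
  + rewrite -AB mulrAC ler_pdivrMr// -mulrA ler_wpM2l ?(ltW e0)//.
    by rewrite mulrC.
Qed.

Lemma sum4_le (R : realType) (a b c d : R) : 0 <= a -> 0 <= b -> 0 < c -> 0 < d ->
  [/\ a <= a + b + c + d + 1, b <= a + b + c + d + 1, c <= a + b + c + d + 1 & d <= a + b + c + d + 1].
Proof. by move=> a0 b0 c0 d0; split; lra. Qed.

Lemma sdiff_mul (R : realType) (V : normedModType R) (f g : V -> R) (x : V) (L M : V -> R) :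
  sdiff f x L -> sdiff g x M -> sdiff (fun z => f z * g z) x (fun v => f x * M v + g x * L v).
Proof.
move=> sf sg; have := sf => -[l1 [C1 b1] H1]; have := sg => -[l2 [C2 b2] H2].
have [K1 K10 [r1 r10 lip1]] := sdiff_lipschitz sf.
have [K2 K20 [r2 r20 lip2]] := sdiff_lipschitz sg.
split.
- by move=> a u v; rewrite l1 l2; ring.
- exists (`|f x| * C2 + `|g x| * C1) => v.
  rewrite (le_trans (ler_normD _ _))// mulrDl lerD// normrM -mulrA ler_wpM2l//.
move=> e e0.
have A0 : 0 < `|f x| + `|g x| + K1 + K2 + 1 by rewrite ltr_wpDl// !addr_ge0// ltW.
set A := `|f x| + `|g x| + K1 + K2 + 1 in A0.
have e40 : 0 < e / (4 * A) by rewrite divr_gt0// mulr_gt0.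
have [r3 r30 h1] := H1 _ e40; have [r4 r40 h2] := H2 _ e40.
(* Both Lipschitz constants are at most A, so each quadratic error term below carries the factor r5
   A^2 <= e/4. *)
pose r5 := Num.min 1 (e / (4 * A ^+ 2)).
have r50 : 0 < r5 by rewrite lt_min ltr01 divr_gt0// mulr_gt0// exprn_gt0.
have r5e : r5 * A ^+ 2 <= e / 4.
  rewrite -ler_pdivlMr ?exprn_gt0// ge_min; apply/orP; right.
  by rewrite le_eqVlt; apply/orP; left; apply/eqP; field; rewrite gt_eqF.
clearbody r5; exists (Num.min (Num.min r1 r2) (Num.min (Num.min r3 r4) r5)).
  by rewrite !lt_min r10 r20 r30 r40 r50.
move=> x1 x2; rewrite !lt_min => /andP[/andP[a1 a2] /andP[/andP[a3 a4] a5]].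
move=> /andP[/andP[c1 c2] /andP[/andP[c3 c4] c5]].
(* The first two terms are the errors of the factors; the last two are of second order, one factor
   being small near [x] and the other Lipschitz. *)
rewrite (_ : _ - _ = f x * (g x1 - g x2 - M (x1 - x2)) + g x * (f x1 - f x2 - L (x1 - x2)) +
   (f x1 - f x) * (g x1 - g x2) + (g x2 - g x) * (f x1 - f x2)); last by ring.
have n0 := normr_ge0 (x1 - x2).
have [fA gA KA1 KA2] : [/\ `|f x| <= A, `|g x| <= A, K1 <= A & K2 <= A].
  by rewrite /A; apply: sum4_le => //.
have q1 : `|f x * (g x1 - g x2 - M (x1 - x2))| <= e / 4 * `|x1 - x2|.
  rewrite normrM (le_trans (ler_pM (normr_ge0 _) (normr_ge0 _) fA (h2 _ _ a4 c4)))//.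
  by rewrite le_eqVlt; apply/orP; left; apply/eqP; field; rewrite gt_eqF.
have q2 : `|g x * (f x1 - f x2 - L (x1 - x2))| <= e / 4 * `|x1 - x2|.
  rewrite normrM (le_trans (ler_pM (normr_ge0 _) (normr_ge0 _) gA (h1 _ _ a3 c3)))//.
  by rewrite le_eqVlt; apply/orP; left; apply/eqP; field; rewrite gt_eqF.
have small (h : V -> R) (K : R) (z : V) : 0 < K -> K <= A -> `|h z - h x| <= K * `|z - x| ->
    `|z - x| < r5 -> `|h z - h x| <= A * r5.
  move=> K0 KA /le_trans + zr; apply; apply: ler_pM => //; [exact: ltW | exact: ltW].
have q3 : `|(f x1 - f x) * (g x1 - g x2)| <= e / 4 * `|x1 - x2|.
  have s1 := small f K1 x1 K10 KA1 (lip1 x1 x a1 _) a5.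
  rewrite subrr normr0 in s1; have {}s1 := s1 r10.
  have s2 : `|g x1 - g x2| <= A * `|x1 - x2|.
    by rewrite (le_trans (lip2 _ _ a2 c2))// ler_wpM2r.
  rewrite normrM (le_trans (ler_pM (normr_ge0 _) (normr_ge0 _) s1 s2))//.
  rewrite (_ : A * r5 * (A * `|x1 - x2|) = r5 * A ^+ 2 * `|x1 - x2|); last by ring.
  by rewrite ler_wpM2r.
have q4 : `|(g x2 - g x) * (f x1 - f x2)| <= e / 4 * `|x1 - x2|.
  have s1 := small g K2 x2 K20 KA2 (lip2 x2 x c2 _) c5.
  rewrite subrr normr0 in s1; have {}s1 := s1 r20.
  have s2 : `|f x1 - f x2| <= A * `|x1 - x2|.
    by rewrite (le_trans (lip1 _ _ a1 c1))// ler_wpM2r.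
  rewrite normrM (le_trans (ler_pM (normr_ge0 _) (normr_ge0 _) s1 s2))//.
  rewrite (_ : A * r5 * (A * `|x1 - x2|) = r5 * A ^+ 2 * `|x1 - x2|); last by ring.
  by rewrite ler_wpM2r.
rewrite (le_trans (ler_normD _ _))// (le_trans (lerD (le_trans (ler_normD _ _) (lerD (le_trans (ler_normD _ _) (lerD q1 q2)) q3)) q4))//.
lra.
Qed.

Lemma sdiff_is_derive (R : realType) (V : normedModType R) (f : V -> R) (x v : V) (L : V -> R) :
  sdiff f x L -> is_derive x v f (L v).
Proof.
move=> sf; have := sf => -[lL [C bL] H]; apply: is_derive_cvg; apply/cvgrPdist_le => e e0.
have v0 : 0 < `|v| + 1 by rewrite ltr_wpDl.
have [r r0 Hr] := H (e / (`|v| + 1)) (divr_gt0 e0 v0); near=> h.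
have h0 : h != 0 by near: h; exact: nbhs_dnbhs_neq.
have hr : `|h| <= r / (`|v| + 1) / 2 by near: h; apply: dnbhs0_le; rewrite !divr_gt0.
have hv : `|(h *: v + x) - x| < r.
  rewrite addrK normrZ (@le_lt_trans _ _ (r / (`|v| + 1) / 2 * (`|v| + 1)))//.
    by rewrite ler_pM// lerDl.
  by rewrite mulrAC divfK ?gt_eqF// ltr_pdivrMr// ltr_pMr// ltr1n.
have := Hr _ x hv; rewrite subrr normr0 => /(_ r0).
rewrite addrK (sdiffLZ _ _ sf) normrZ => Hb.
rewrite (_ : L v - _ = - (h^-1 * (f (h *: v + x) - f x - h * L v))); last first.
  by rewrite /GRing.scale /=; field.
rewrite normrN normrM normfV mulrC ler_pdivrMr ?normr_gt0//.
rewrite (le_trans Hb)// mulrC -mulrA [leRHS]mulrC ler_wpM2l//.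
by rewrite mulrA ler_pdivrMr// mulrC ler_wpM2l ?(ltW e0)// lerDl.
Unshelve. all: by end_near. Qed.

Lemma sdiff_diff (R : realType) (V : normedModType R) (f : V -> R) (x : V) (L : V -> R) :
  sdiff f x L -> differentiable f x /\ forall v, 'd f x v = L v.
Proof.
move=> sf; have [lL [C bL] H] := sf.
pose mL := GRing.isLinear.Build R V R *:%R L lL.
pose Lm : {linear V -> R} := HB.pack L mL.
have cL : continuous Lm.
  apply/linear_bounded_continuous; apply/linear_boundedP; exists C; split; first exact: num_real.
  by move=> M CM v; rewrite (le_trans (bL v))// ler_wpM2r// ltW.
have E : f \o shift x = cst (f x) + (Lm : V -> R) +o_ (0 : V) id.
  apply/eqaddoP => _/posnumP[e]; have [r r0 Hr] := H e%:num (gt0 e).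
  near=> h; have hr : `|h + x - x| < r.
    by rewrite addrK; near: h; exact: nbhs0_lt.
  have := Hr _ x hr; rewrite subrr normr0 => /(_ r0); rewrite addrK.
  by rewrite (_ : (f \o shift x - (cst (f x) + (Lm : V -> R))) h = f (h + x) - f x - L h)// opprD addrA.
have dE := diff_unique cL E.
by split=> [|v]; [apply/diff_locallyP; rewrite dE | rewrite dE].
Unshelve. all: by end_near. Qed.

(** Continuous partial derivatives give a strict derivative: go from [x2] to [x1] changing one
    coordinate at a time, with the mean value theorem on each leg. The abstract basis covers the
    line, the plane and pairs of plane points alike. *)
Lemma sdiff_partials (R : realType) (V : normedModType R) n (b : 'I_n -> V) (c : 'I_n -> V -> R)
    (f : V -> R) (D : 'I_n -> V -> R) (x : V) :
  (forall i (a : R) u v, c i (a *: u + v) = a * c i u + c i v) ->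
  (forall i v, `|c i v| <= `|v|) -> (forall i, `|b i| <= 1) ->
  (forall v, v = \sum_i c i v *: b i) ->
  (forall i, {for x, continuous (D i)}) ->
  (forall i, \forall y \near x, is_derive y (b i) f (D i y)) ->
  sdiff f x (fun v => \sum_i c i v * D i x).
Proof.
move=> lc bc bb vE cD dD; split.
- move=> a u v; rewrite mulr_sumr -big_split /=; apply: eq_bigr => i _.
  by rewrite lc; ring.
- exists (\sum_i `|D i x|) => v; rewrite mulr_suml (le_trans (ler_norm_sum _ _ _))//.
  by apply: ler_sum => i _; rewrite normrM mulrC ler_wpM2l.
move=> e e0; have n0 : 0 < n.+1%:R :> R by rewrite ltr0n.
have en0 : 0 < e / n.+1%:R by rewrite divr_gt0.
have : \forall y \near x, forall i, is_derive y (b i) f (D i y) /\ `|D i x - D i y| <= e / n.+1%:R.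
  apply: filter_forall => i; have /cvgrPdist_le/(_ _ en0) := cD i.
  by move=> h; exact: filterI (dD i) h.
(* A point of the path differs from [x2] by at most (1 + n) |v| with |v| <= 2 s, and [x2] is within
   s of [x]: in total (2 n + 3) s = r. *)
move=> /nbhs_ballP[r /= r0 Hr]; pose s := r / (2 * n%:R + 3).
have k0 : 0 < 2 * n%:R + 3 :> R by rewrite ltr_wpDl// mulr_ge0.
exists s; first by rewrite divr_gt0.
move=> x1 x2 h1 h2; set v := x1 - x2.
have vs : `|v| <= 2 * s.
  rewrite /v -(subrKA x) (le_trans (ler_normD _ _))// mulr2n mulrDl mul1r lerD// ltW//.
  by rewrite distrC.
pose P k := \sum_(i < n | (i < k)%N) c i v *: b i.
have Pb k : `|P k| <= n%:R * `|v|.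
  rewrite (le_trans (ler_norm_sum _ _ _))//.
  apply: (@le_trans _ _ (\sum_(i < n) `|v|)); last by rewrite sumr_const card_ord mulr_natl.
  rewrite big_mkcond /=; apply: ler_sum => i _; case: ifP => _; last exact: normr_ge0.
  by rewrite normrZ -[leRHS]mulr1 ler_pM.
have PS (k : 'I_n) : P k.+1 = c k v *: b k + P k.
  rewrite /P (bigD1 k) //=; congr (_ + _); apply: eq_bigl => i.
  by rewrite ltnS ltn_neqAle andbC (inj_eq val_inj).
have PSn : x1 = P n + x2.
  rewrite -[LHS](subrK x2) -/v; congr (_ + _); rewrite {1}(vE v).
  by apply: eq_bigl => i; rewrite ltn_ord.
have P0 : P 0%N = 0 by rewrite /P big1.
have step (k : 'I_n) : `|f (P k.+1 + x2) - f (P k + x2) - c k v * D k x| <= e / n.+1%:R * `|v|.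
  have inball t : 0 <= t <= 1 -> ball x r (t *: (c k v *: b k) + (P k + x2)).
    move=> /andP[t0 t1]; rewrite -ball_normE /= distrC.
    rewrite (_ : _ - x = t *: (c k v *: b k) + P k + (x2 - x)); last by rewrite !addrA.
    have a1 : `|t *: (c k v *: b k)| <= `|v|.
      rewrite normrZ ger0_norm// normrZ -[leRHS]mul1r ler_pM ?mulr_ge0//.
      by rewrite -[leRHS]mulr1 ler_pM.
    rewrite (le_lt_trans (ler_normD _ _))// (@le_lt_trans _ _ (`|v| + n%:R * `|v| + `|x2 - x|))//.
      by rewrite lerD2r (le_trans (ler_normD _ _))// lerD.
    have -> : r = (1 + n%:R) * (2 * s) + s by rewrite /s; field; rewrite gt_eqF.
    by rewrite ler_ltD// -[X in X + _ <= _]mul1r -mulrDl ler_wpM2l// addr_ge0.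
  have [t t01] := @MVT_line R V f (P k + x2) (c k v *: b k) (fun y => c k v * D k y)
     (fun t h => is_deriveZv (c k v) (Hr _ (inball t h) k).1).
  rewrite addrA -PS => ->; rewrite -mulrBr normrM mulrC ler_pM//.
  by rewrite distrC; exact: (Hr _ (inball t t01) k).2.
have -> : f x1 - f x2 = \sum_(k < n) (f (P k.+1 + x2) - f (P k + x2)).
  rewrite PSn -[in f x2](add0r x2) -P0.
  elim: (n) => [|m IHm]; first by rewrite big_ord0 subrr.
  by rewrite big_ord_recr /= -IHm addrC subrKA.
rewrite -sumrB (le_trans (ler_norm_sum _ _ _))// (le_trans (ler_sum _ (fun k _ => step k)))//.
rewrite sumr_const card_ord -mulrnAl ler_wpM2r// -mulr_natl.
by rewrite mulrCA ger_pMr// ler_pdivrMr// mul1r ler_nat.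
Unshelve. all: by end_near. Qed.

(** * Representation of a fundamental solution *)

Lemma Rintegral_restrict (R : realType) (A B : set (plane R)) (f : plane R -> R) :
  A `<=` B -> (forall z, B z -> ~ A z -> f z = 0) ->
  \int[@lebesgue2 R]_(z in B) f z = \int[@lebesgue2 R]_(z in A) f z.
Proof.
move=> AB H; rewrite Rintegral_mkcond [RHS]Rintegral_mkcond; apply: eq_Rintegral => z _.
rewrite !patchE; case: ifPn => [/set_mem Bz|nB]; case: ifPn => // nA.
  by apply: H => // Az; move: nA; rewrite (mem_set Az).
by move: nB; rewrite (mem_set (AB _ (set_mem nA))).
Qed.

Lemma Rintegral_square_le (R : realType) (x : plane R) (a c : R) (f : plane R -> R) : 0 <= a ->
  (@lebesgue2 R).-integrable (square x a) (EFin \o f) ->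
  (forall z, square x a z -> `|f z| <= c) ->
  `|\int[@lebesgue2 R]_(z in square x a) f z| <= c * (2 * a) ^+ 2.
Proof.
move=> a0 intf H; have mS := measurable_square x a.
rewrite (le_trans (le_normr_Rintegral mS intf))//.
have -> : c * (2 * a) ^+ 2 = \int[@lebesgue2 R]_(z in square x a) c.
  by rewrite Rintegral_cst//; have := lebesgue2_square x a0 => /= ->.
apply: le_Rintegral => //.
  by have := integrable_norm intf.
apply: integrable_square_bounded; first exact: measurable_cst.
by apply: continuous_bounded_square; exact: cst_continuous.
Qed.

Lemma integrable_square_mul (R : realType) (x : plane R) (a : R) (u f : plane R -> R) :
  (@lebesgue2 R).-integrable (square x a) (fun z => (u z)%:E) -> smooth f ->
  (@lebesgue2 R).-integrable (square x a) (EFin \o (fun z => u z * f z)).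
Proof.
move=> intu sf; have mS := measurable_square x a.
have mf : measurable_fun (square x a : set (measurableTypeR R * measurableTypeR R)) f.
  by apply: measurable_funTS; exact: smooth_measurable.
exact: (integrableMl mS intu mf (continuous_bounded_square x a (smooth_continuous sf))).
Qed.

Lemma smooth_shift (R : realType) (f : plane R -> R) (x : plane R) : smooth f ->
  smooth (fun z => f (z - x)).
Proof.
move=> /(smooth_affine 1 (- x)); rewrite (_ : (fun _ => _) = fun z => f (z - x))//.
by apply/funext => z; rewrite scale1r.
Qed.

Lemma laplacian_shift (R : realType) (f : plane R -> R) (x z : plane R) : smooth f ->
  laplacian (fun z : plane R => f (z - x)) z = laplacian f (z - x).
Proof.
have E : (fun w : plane R => f (1 *: (w + - x))) = (fun w => f (w - x)).
  by apply/funext => w; rewrite scale1r.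
by move=> sf; have := laplacian_affine 1 (- x) z sf; rewrite E expr1n mul1r scale1r.
Qed.

Lemma laplacian_sub (R : realType) (f g : plane R -> R) (x : plane R) : smooth f -> smooth g ->
  laplacian (fun z => f z - g z) x = laplacian f x - laplacian g x.
Proof.
move=> sf sg; have E v : 'D_v (fun u => 'D_v (fun z => f z - g z) u) x =
   'D_v (fun u => 'D_v f u) x - 'D_v (fun u => 'D_v g u) x.
  rewrite (_ : (fun u => 'D_v (fun z => f z - g z) u) = (fun u => 'D_v f u) - (fun u => 'D_v g u)).
    have [_ ->//] := is_deriveB (smooth_is_derive v x (smooth_D v sf)) (smooth_is_derive v x (smooth_D v sg)).
  apply/funext => u; have [_ ->//] := is_deriveB (smooth_is_derive v u sf) (smooth_is_derive v u sg).
rewrite (congr2 +%R (E e1) (E e2) : laplacian _ x = _) opprD addrACA; reflexivity.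
Qed.

Definition lapk (R : realType) (d : R) : plane R -> R := laplacian (smlog d).

Lemma lapk_shift (R : realType) (d : R) (x z : plane R) :
  laplacian (fun z : plane R => smlog d (z - x)) z = lapk d (z - x).
Proof. exact: (laplacian_shift x z (smooth_smlog d)). Qed.

Lemma smooth_lapk (R : realType) (d : R) : smooth (lapk d).
Proof. by apply: smooth_laplacian; exact: smooth_smlog. Qed.

Lemma dot_square (R : realType) (a : R) (w : plane R) : 0 <= a -> ~ square 0 a w -> a ^+ 2 < dot w w.
Proof.
move=> a0 /squareP; rewrite subr0 => /negP; rewrite -ltNge.
rewrite (_ : `|w| = Num.max `|w.1| `|w.2|)// lt_max => /orP[h|h].
  rewrite /dot -!expr2 -(real_normK (num_real w.1)).
  by rewrite ltr_wpDr ?sqr_ge0// ltr_pXn2r// ?nnegrE.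
rewrite /dot -!expr2 -(real_normK (num_real w.2)).
by rewrite ltr_wpDl ?sqr_ge0// ltr_pXn2r// ?nnegrE.
Qed.

Lemma square_shift (R : realType) (x z : plane R) (a : R) : square x a z <-> square 0 a (z - x).
Proof. by split=> /squareP h; apply/squareP; move: h; rewrite ?subr0. Qed.

Lemma lapk_out (R : realType) (d a : R) (x z : plane R) : 0 < d -> d <= a -> ~ square x a z ->
  lapk d (z - x) = 0.
Proof.
move=> d0 da nz; apply: laplacian_smlog_far => //.
rewrite (@le_lt_trans _ _ (a ^+ 2))//.
  by rewrite ler_pXn2r// nnegrE ltW// (lt_le_trans d0).
apply: dot_square; first by rewrite ltW// (lt_le_trans d0).
by move=> h; apply: nz; apply/square_shift.
Qed.

(** By scaling, [lapk d w] is d^-2 times a fixed continuous function at w/d, and that function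
    vanishes outside the square of half side 1. *)
Lemma lapk_bound (R : realType) : exists2 C : R, 0 <= C &
  forall d (w : plane R), 0 < d -> `|lapk d w| <= C / d ^+ 2.
Proof.
have sr : smooth (fun w : plane R => ln (radial w)).
  by apply: smooth_ln; [exact: smooth_radial | exact: radial_gt0].
have E d (w : plane R) : lapk d w = (d ^+ 2)^-1 * laplacian (fun w => ln (radial w)) (d^-1 *: w).
  rewrite /lapk -(subr0 w) -laplacian_shift; last exact: smooth_smlog.
  by have := laplacian_smlog d (- 0) w; rewrite !subr0.
have [M [Mr HM]] := continuous_bounded_square (0 : plane R) 1 (smooth_continuous (smooth_laplacian sr)).
exists (`|M| + 1); first by rewrite addr_ge0.
have bd w : `|laplacian (fun w : plane R => ln (radial w)) w| <= `|M| + 1.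
  have [Sw|nS] := pselect (square 0 1 w).
    by apply: (HM (`|M| + 1)) => //; rewrite (le_lt_trans (ler_norm M))// ltrDl.
  have := @lapk_out _ 1 1 0 w ltr01 (lexx _) nS.
  rewrite subr0 E expr1n invr1 mul1r scale1r => ->; rewrite normr0 addr_ge0//.
move=> d w d0; rewrite E normrM normfV mulrC (gtr0_norm (exprn_gt0 2 d0)).
by rewrite ler_wpM2r// invr_ge0 exprn_ge0// ltW.
Qed.

Lemma test_integral (R : realType) (Om S : set (plane R)) (u phi : plane R -> R) (x y : plane R) (b : R) :
  fundamental_solution Om u y -> square x b `<=` S -> S `<=` Om -> smooth phi ->
  (forall z, ~ square x b z -> phi z = 0) ->
  \int[@lebesgue2 R]_(z in S) (u z * laplacian phi z) = - phi y.
Proof.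
move=> [_ fs] bS SO sphi phi0.
have lap0 z : ~ square x b z -> laplacian phi z = 0.
  move=> nz; rewrite (@near_eq_laplacian _ _ (fun=> 0)); first exact: laplacian_cst.
  have cn : {for z, continuous (fun w : plane R => `|w - x|)}.
    apply: (@continuous_comp _ _ _ (fun w : plane R => w - x) (fun w => `|w|)).
      by apply: continuousB; [exact: cvg_id | exact: cst_continuous].
    exact: norm_continuous.
  have bz : b < `|z - x| by rewrite ltNge; apply/negP => /squareP.
  have : \forall w \near z, b < `|w - x| by exact: (cvgr_gt _ cn).
  by apply: filterS => w bw; apply: phi0 => /squareP; rewrite leNgt bw.
have := fs phi; rewrite (@Rintegral_restrict _ S Om)//; last first.
  by move=> z _ nS; rewrite lap0 ?mulr0// => /bS.
move=> <-; first by rewrite opprK.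
split; first by move=> k; exact: smooth_Ck.
exists (square x b); last exact: phi0.
by split; [exact: compact_square | exact: subset_trans SO].
Qed.

(** A single [smlog d] has no compact support, but both functions equal the true logarithm far from
    [x], so their difference is an admissible test function. *)
Lemma mollified_difference (R : realType) (Om : set (plane R)) (u : plane R -> R) (x y : plane R) (a d d' : R) :
  fundamental_solution Om u y -> square x a `<=` Om -> 0 < d <= a -> 0 < d' <= a ->
  \int[@lebesgue2 R]_(z in square x a) (u z * lapk d (z - x)) -
  \int[@lebesgue2 R]_(z in square x a) (u z * lapk d' (z - x)) = smlog d' (y - x) - smlog d (y - x).
Proof.
move=> fs aO /andP[d0 da] /andP[d'0 d'a].
have sd := smooth_shift x (smooth_smlog d); have sd' := smooth_shift x (smooth_smlog d').
have intu := fs.1 _ (@compact_square _ x a) aO.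
rewrite -RintegralB; first last.
- by apply: integrable_square_mul => //; apply: smooth_shift; exact: smooth_lapk.
- by apply: integrable_square_mul => //; apply: smooth_shift; exact: smooth_lapk.
- exact: measurable_square.
have := @test_integral _ Om (square x a) u _ x y a fs (fun _ h => h) aO (smooth_sub sd sd').
rewrite opprB => <-.
  apply: eq_Rintegral => z _; rewrite -mulrBr; congr (_ * _).
  by rewrite (laplacian_sub z sd sd') (lapk_shift d x z) (lapk_shift d' x z).
move=> z nz; have az : a ^+ 2 <= dot (z - x) (z - x).
  apply: ltW; apply: dot_square; first exact: le_trans (ltW d0) da.
  by move=> h; apply: nz; apply/square_shift.
have sq r : 0 < r -> r <= a -> r ^+ 2 <= dot (z - x) (z - x).
  by move=> r0 ra; apply: le_trans az; rewrite ler_pXn2r// nnegrE ltW// (lt_le_trans r0).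
by rewrite !smlog_far// ?subrr// sq.
Qed.

Lemma mollifier_limit (R : realType) (Om : set (plane R)) (u : plane R -> R) (x y : plane R) (a e : R) :
  fundamental_solution Om u y -> square x a `<=` Om -> 0 < a -> {for x, continuous u} -> 0 < e ->
  exists2 r : R, 0 < r & forall d, 0 < d -> d < r ->
  `|\int[@lebesgue2 R]_(z in square x a) (u z * lapk d (z - x)) - 4 * pi * u x| <= e.
Proof.
move=> fs aO a0 cu e0; have [C C0 HC] := lapk_bound R.
(* The kernel is at most C / d^2 and is integrated over a square of area (4 d)^2, so an oscillation
   of u of size e / (16 C + 1) contributes at most e. *)
have e'0 : 0 < e / (16 * C + 1) by rewrite divr_gt0// ltr_wpDl// mulr_ge0.
have /cvgrPdist_le/(_ _ e'0)/nbhs_ballP[s /= s0 Hs] := cu.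
have intu b : b <= a -> (@lebesgue2 R).-integrable (square x b) (fun z => (u z)%:E).
  move=> ba; apply: fs.1; first exact: compact_square.
  by apply: subset_trans aO => z /squareP h; apply/squareP; exact: le_trans ba.
exists (Num.min (s / 2) (a / 2)); first by rewrite lt_min !divr_gt0.
move=> d d0; rewrite lt_min => /andP[ds da].
have d2a : 2 * d <= a by lra.
have sk : smooth (fun z : plane R => lapk d (z - x)) by apply: smooth_shift; exact: smooth_lapk.
rewrite (@Rintegral_restrict _ (square x (2 * d)) (square x a)); first last.
- by move=> z _ nz; rewrite (@lapk_out _ d (2 * d))// ?mulr0// mulr2n mulrDl mul1r lerDl ltW.
- by move=> z /squareP h; apply/squareP; exact: le_trans d2a.
have mS := measurable_square x (2 * d).
have mass : \int[@lebesgue2 R]_(z in square x (2 * d)) (lapk d (z - x)) = 4 * pi.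
  have d2 : d < 2 * d by rewrite mulr2n mulrDl mul1r ltrDl.
  have H := integral_laplacian_smlog x d0 d2.
  rewrite /Rintegral; transitivity (fine (4 * pi)%:E : R) => //.
  congr fine; apply: etrans H; apply: eq_integral => z _.
  by rewrite (lapk_shift d x z).
rewrite -mass [X in _ - X]mulrC -RintegralZl; first last.
- exact: integrable_square_smooth.
- exact: mS.
rewrite -RintegralB; first last.
- have := integrableZl mS (u x) (integrable_square_smooth x (2 * d) sk).
  by congr integrable; apply/funext => z /=; rewrite EFinM.
- exact: integrable_square_mul (intu _ d2a) sk.
- exact: mS.
have intf : (@lebesgue2 R).-integrable (square x (2 * d))
  (EFin \o (fun z => u z * lapk d (z - x) - u x * lapk d (z - x))).
  have := integrableB mS (integrable_square_mul (intu _ d2a) sk)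
    (integrableZl mS (u x) (integrable_square_smooth x (2 * d) sk)).
  by congr integrable; apply/funext => z /=; rewrite EFinB EFinM.
have d20 : 0 <= 2 * d by rewrite mulr_ge0// ltW.
apply: (le_trans (Rintegral_square_le (c := e / (16 * C + 1) * (C / d ^+ 2)) d20 intf _)).
  move=> z /squareP zx; rewrite -mulrBl normrM ler_pM// ?HC//.
  rewrite distrC; apply: Hs; rewrite -ball_normE /= distrC (le_lt_trans zx)//; lra.
rewrite (_ : _ * _ = e * (16 * C / (16 * C + 1))).
  by rewrite ler_piMr ?(ltW e0)// ler_pdivrMr ?ltr_wpDl ?mulr_ge0// mul1r lerDl.
by field; rewrite (gt_eqF d0)/= gt_eqF// ltr_wpDl// mulr_ge0.
Qed.

(* Test with smlog s - smlog d, centred at x, and let s tend to 0. *)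
Lemma representation (R : realType) (Om : set (plane R)) (u : plane R -> R) (x y : plane R) (a d : R) :
  fundamental_solution Om u y -> square x a `<=` Om -> 0 < d <= a -> {for x, continuous u} -> x != y ->
  4 * pi * u x + ln (dot (x - y) (x - y)) =
  \int[@lebesgue2 R]_(z in square x a) (u z * lapk d (z - x)) + smlog d (y - x).
Proof.
move=> fs aO /andP[d0 da] cu xy; have a0 := lt_le_trans d0 da.
have yx0 : 0 < dot (y - x) (y - x) by apply: dot_gt0; rewrite subr_eq0 eq_sym.
apply/eqP; rewrite -subr_eq0 -normr_le0; apply/ler_addgt0Pl => e e0; rewrite addr0.
have [r r0 Hr] := mollifier_limit fs aO a0 cu e0.
(* Taking s at most the Euclidean distance from x to y makes [smlog s (y - x)] the true
   logarithm. *)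
pose s := Num.min (r / 2) (Num.min a (Num.sqrt (dot (y - x) (y - x)))).
have s0 : 0 < s by rewrite !lt_min divr_gt0// a0 sqrtr_gt0.
have sr : s < r by rewrite gt_min; apply/orP; left; rewrite ltr_pdivrMr// ltr_pMr// ltr1n.
have sa : s <= a by rewrite !ge_min lexx orbT.
have sy : s ^+ 2 <= dot (y - x) (y - x).
  rewrite -(sqr_sqrtr (ltW yx0)) ler_pXn2r ?nnegrE ?sqrtr_ge0 ?(ltW s0)//.
  by rewrite !ge_min lexx !orbT.
pose I d := \int[@lebesgue2 R]_(z in square x a) (u z * lapk d (z - x)).
have : `|I s - 4 * pi * u x| <= e := Hr s s0 sr.
have : I s - I d = smlog d (y - x) - smlog s (y - x).
  by apply: mollified_difference fs aO _ _; rewrite ?s0 ?d0.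
rewrite -/(I d) (smlog_far s0 sy) -(dot_oppr (y - x)) opprB.
move: (I s) (I d) (ln _) (smlog _ _) => Is Id l q E.
by rewrite distrC (_ : 4 * pi * u x - Is = 4 * pi * u x + l - (Id + q)) //; lra.
Qed.

(** * Strict derivatives of integrals *)

Lemma fst_le (R : realType) (U V : normedModType R) (v : U * V) : `|v.1| <= `|v|.
Proof. by rewrite (_ : `|v| = Num.max `|v.1| `|v.2|)// le_max lexx. Qed.

Lemma snd_le (R : realType) (U V : normedModType R) (v : U * V) : `|v.2| <= `|v|.
Proof. by rewrite (_ : `|v| = Num.max `|v.1| `|v.2|)// le_max lexx orbT. Qed.

Lemma pair_norm_le (R : realType) (U V : normedModType R) (v : U * V) (c : R) :
  `|v.1| <= c -> `|v.2| <= c -> `|v| <= c.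
Proof. by move=> h1 h2; rewrite (_ : `|v| = Num.max `|v.1| `|v.2|)// ge_max h1. Qed.

Lemma pair_norm_lt (R : realType) (U V : normedModType R) (v : U * V) (c : R) :
  `|v.1| < c -> `|v.2| < c -> `|v| < c.
Proof. by move=> h1 h2; rewrite (_ : `|v| = Num.max `|v.1| `|v.2|)// gt_max h1. Qed.

Lemma pair_ext (T U : Type) (u v : T * U) : u.1 = v.1 -> u.2 = v.2 -> u = v.
Proof. by case: u v => [a b] [c d] /= -> ->. Qed.

Definition basis2 (R : realType) (i : 'I_2) : plane R := nth 0 [:: e1; e2] i.
Definition coord2 (R : realType) (i : 'I_2) (v : plane R) : R := nth 0 [:: v.1; v.2] i.

Lemma sdiff_smooth (R : realType) (f : plane R -> R) (x : plane R) : smooth f ->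
  exists L, sdiff f x L.
Proof.
move=> sf; eexists; apply: (@sdiff_partials _ _ 2 (@basis2 R) (@coord2 R) f
  (fun i y => 'D_(basis2 R i) f y) x).
- by move=> [[|[|i]] Hi] //.
- move=> [[|[|i]] Hi] // v; [exact: fst_le | exact: snd_le].
- by move=> [[|[|i]] Hi] //; apply: pair_norm_le; rewrite /= ?normr1 ?normr0.
- move=> v; rewrite !big_ord_recl big_ord0; apply: pair_ext.
    by change (v.1 = v.1 * 1 + (v.2 * 0 + 0)); rewrite mulr1 mulr0 !addr0.
  by change (v.2 = v.1 * 0 + (v.2 * 1 + 0)); rewrite mulr1 mulr0 add0r addr0.
- by move=> i; apply: smooth_continuous; exact: smooth_D.
- by move=> i; near=> y; exact: smooth_is_derive.
Unshelve. all: by end_near. Qed.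

Definition basis4 (R : realType) (i : 'I_4) : plane R * plane R :=
  nth 0 [:: (e1, 0); (e2, 0); (0, e1); (0, e2)] i.
Definition coord4 (R : realType) (i : 'I_4) (v : plane R * plane R) : R :=
  nth 0 [:: v.1.1; v.1.2; v.2.1; v.2.2] i.

Lemma coord4_linear (R : realType) (i : 'I_4) (a : R) (u v : plane R * plane R) :
  coord4 i (a *: u + v) = a * coord4 i u + coord4 i v.
Proof. by move: i => [[|[|[|[|i]]]] Hi] //. Qed.

Lemma coord4_le (R : realType) (i : 'I_4) (v : plane R * plane R) : `|coord4 i v| <= `|v|.
Proof.
move: i => [[|[|[|[|i]]]] Hi] //; rewrite /coord4 /=.
- exact: le_trans (fst_le _) (fst_le _).
- exact: le_trans (snd_le _) (fst_le _).
- exact: le_trans (fst_le _) (snd_le _).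
- exact: le_trans (snd_le _) (snd_le _).
Qed.

Lemma basis4_le (R : realType) (i : 'I_4) : `|basis4 R i| <= 1.
Proof.
move: i => [[|[|[|[|i]]]] Hi] //; rewrite /basis4 /=;
 by do ?[apply: pair_norm_le] => /=; rewrite ?normr1 ?normr0.
Qed.

Lemma basis4E (R : realType) (v : plane R * plane R) : v = \sum_i coord4 i v *: basis4 R i.
Proof.
rewrite !big_ord_recl big_ord0; apply: pair_ext; apply: pair_ext.
- change (v.1.1 = v.1.1 * 1 + (v.1.2 * 0 + (v.2.1 * 0 + (v.2.2 * 0 + 0)))).
  by rewrite mulr1 !mulr0 !addr0.
- change (v.1.2 = v.1.1 * 0 + (v.1.2 * 1 + (v.2.1 * 0 + (v.2.2 * 0 + 0)))).
  by rewrite mulr1 !mulr0 !addr0 add0r.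
- change (v.2.1 = v.1.1 * 0 + (v.1.2 * 0 + (v.2.1 * 1 + (v.2.2 * 0 + 0)))).
  by rewrite mulr1 !mulr0 !addr0 !add0r.
- change (v.2.2 = v.1.1 * 0 + (v.1.2 * 0 + (v.2.1 * 0 + (v.2.2 * 1 + 0)))).
  by rewrite mulr1 !mulr0 !addr0 !add0r.
Qed.

Lemma Ck1_sdiff (R : realType) (U : set (plane R * plane R)) (f : plane R * plane R -> R)
    (p : plane R * plane R) :
  open U -> Ck 1 U f -> U p ->
  sdiff f p (fun v => \sum_i coord4 i v * 'D_(basis4 R i) f p).
Proof.
move=> oU [cf df] Up; apply: (@sdiff_partials _ _ 4 (@basis4 R) (@coord4 R) f
  (fun i y => 'D_(basis4 R i) f y) p).
- exact: coord4_linear.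
- exact: coord4_le.
- exact: basis4_le.
- exact: basis4E.
- by move=> i; exact: (df (basis4 R i)).2.1.
- move=> i; have : \forall y \near p, U y by exact: open_nbhs_nbhs.
  by apply: filterS => y Uy; apply/derivableP; exact: (df (basis4 R i)).1.
Qed.

Lemma Ck_S (R : realType) (V : normedModType R) k (U : set V) (f : V -> R) :
  Ck k.+1 U f -> Ck k U f.
Proof.
elim: k f => [|k IH] f [cf df]; first by split.
by split => // v; have [h1 h2] := df v; split => //; exact: IH.
Qed.

Lemma open_F2 (R : realType) (Om : set (plane R)) : open Om -> open (F2 Om).
Proof.
move=> oO; rewrite (_ : F2 Om = (fst @^-1` Om) `&` (snd @^-1` Om) `&`
  ((fun p : plane R * plane R => `|p.1 - p.2|) @^-1` [set t | 0 < t])); last first.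
  apply/seteqP; split => [p [h1 h2 h3]|p [[h1 h2] h3]]; split => //.
    by rewrite /= normr_gt0 subr_eq0; apply/eqP.
  by move: h3; rewrite /= normr_gt0 subr_eq0 => /eqP.
apply: openI; first by apply: openI; apply: open_comp => // p _; [exact: cvg_fst | exact: cvg_snd].
apply: open_comp; last exact: open_gt.
move=> p _; apply: (@continuous_comp _ _ _ (fun p : plane R * plane R => p.1 - p.2) (fun w => `|w|)).
  by apply: continuousB; [exact: cvg_fst | exact: cvg_snd].
exact: norm_continuous.
Qed.

(** Differentiation under the integral sign, the strict remainder being uniform in the integration
    variable. ['D_v (K z) p] names the derivative for each z without a choice of linear maps
    depending on z. *)
Lemma sdiff_integral (R : realType) (V : normedModType R) (x0 : plane R) (a : R)
    (K : plane R -> V -> R) (p : V) :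
  0 <= a ->
  (\forall q \near p, (@lebesgue2 R).-integrable (square x0 a) (EFin \o (fun z => K z q))) ->
  (forall z, square x0 a z -> exists L, sdiff (K z) p L) ->
  (exists C : R, forall z, square x0 a z -> forall v, `|'D_v (K z) p| <= C * `|v|) ->
  (forall e : R, 0 < e -> exists2 r : R, 0 < r & forall z, square x0 a z -> forall p1 p2,
     `|p1 - p| < r -> `|p2 - p| < r ->
     `|K z p1 - K z p2 - 'D_(p1 - p2) (K z) p| <= e * `|p1 - p2|) ->
  sdiff (fun q => \int[@lebesgue2 R]_(z in square x0 a) K z q) p
    (fun v => \int[@lebesgue2 R]_(z in square x0 a) 'D_v (K z) p).
Proof.
move=> a0 /nbhs_ballP[r0 /= r00 intK] dK [C HC] unif; set S := square x0 a in intK dK HC unif *.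
have mS : measurable (S : set (measurableTypeR R * measurableTypeR R)) := measurable_square x0 a.
have intK' q : `|q - p| < r0 -> (@lebesgue2 R).-integrable S (EFin \o (fun z => K z q)).
  by move=> h; apply: intK; rewrite -ball_normE /= distrC.
have linK z (c : R) u v : S z -> 'D_(c *: u + v) (K z) p = c * 'D_u (K z) p + 'D_v (K z) p.
  move=> /dK[L sL].
  have E w : 'D_w (K z) p = L w by have [_ ->] := sdiff_is_derive w sL.
  by rewrite !E; have [-> _ _] := sL.
have D0 z : S z -> 'D_0 (K z) p = 0.
  by move=> Sz; have := linK z 1 0 0 Sz; rewrite scaler0 addr0 mul1r; lra.
have DZ z (c : R) u : S z -> 'D_(c *: u) (K z) p = c * 'D_u (K z) p.
  by move=> Sz; have := linK z c u 0 Sz; rewrite addr0 D0// addr0.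
(* The derivative is measurable in z as a pointwise limit of difference quotients with increments v
   / (n + 1). *)
have mDs v : `|v| < r0 ->
    measurable_fun (S : set (measurableTypeR R * measurableTypeR R)) (fun z => 'D_v (K z) p).
  move=> vr0.
  apply: (@measurable_fun_cvg _ _ _ _ (fun n z => n.+1%:R * (K z (n.+1%:R^-1 *: v + p) - K z p))).
    move=> n; apply: measurable_funM; first exact: measurable_cst.
    have small : `|n.+1%:R^-1 *: v| <= `|v|.
      by rewrite normrZ ger0_norm ?invr_ge0// ler_piMl// invf_le1// ler1n.
    have m1 := measurable_int _ (intK' (n.+1%:R^-1 *: v + p) _).
    have m2 := measurable_int _ (intK' p _).
    apply: measurable_funB.
      by apply/measurable_EFinP; apply: m1; rewrite addrK (le_lt_trans small).
    by apply/measurable_EFinP; apply: m2; rewrite subrr normr0.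
  move=> z Sz; have [L sL] := dK z Sz; have [_ _ HL] := sL.
  have [_ ->] := sdiff_is_derive v sL.
  apply/cvgrPdist_le => e e0; have v0 : 0 < `|v| + 1 by rewrite ltr_wpDl.
  have [r r1 Hr] := HL (e / (`|v| + 1)) (divr_gt0 e0 v0).
  near=> n; have n0 : 0 < n.+1%:R :> R by rewrite ltr0n.
  have hv : `|n.+1%:R^-1 *: v + p - p| < r.
    rewrite addrK normrZ ger0_norm ?invr_ge0// (@le_lt_trans _ _ (n.+1%:R^-1 * (`|v| + 1)))//.
      by rewrite ler_wpM2l ?invr_ge0// lerDl.
    rewrite -ltr_pdivlMr//; near: n.
    exact: (near_infty_natSinv_lt (PosNum (divr_gt0 r1 v0))).
  have := Hr _ p hv; rewrite subrr normr0 => /(_ r1).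
  rewrite addrK (sdiffLZ _ _ sL) normrZ ger0_norm ?invr_ge0// => Hb.
  rewrite (_ : L v - _ = - (n.+1%:R * (K z (n.+1%:R^-1 *: v + p) - K z p - n.+1%:R^-1 * L v))); last first.
    by rewrite [in RHS]mulrBr [in RHS]mulrA mulfV ?gt_eqF// mul1r opprB.
  rewrite normrN normrM ger0_norm// -ler_pdivlMl// (le_trans Hb)//.
  rewrite mulrCA ler_wpM2l ?invr_ge0//.
  by rewrite mulrAC ler_pdivrMr// ler_wpM2l ?(ltW e0)// lerDl.
(* Integrability of K is known only within r0 of p, so a large v is first scaled down. *)
have mD v : measurable_fun (S : set (measurableTypeR R * measurableTypeR R)) (fun z => 'D_v (K z) p).
  pose c := r0 / 2 / (`|v| + 1); have v0 : 0 < `|v| + 1 by rewrite ltr_wpDl.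
  have c0 : 0 < c by rewrite !divr_gt0.
  have := mDs (c *: v).
  rewrite normrZ gtr0_norm// => h; have {}h := h _.
  apply: (eq_measurable_fun (fun z => c^-1 * 'D_(c *: v) (K z) p)).
    by move=> z /set_mem Sz; rewrite DZ// mulrA mulVf ?mul1r// gt_eqF.
  apply: measurable_funM; first exact: measurable_cst.
  apply: h; rewrite (@le_lt_trans _ _ (c * (`|v| + 1)))//.
    by rewrite ler_wpM2l ?(ltW c0)// lerDl.
  by rewrite /c divfK ?gt_eqF// ltr_pdivrMr// ltr_pMr// ltr1n.
have iD v : (@lebesgue2 R).-integrable S (EFin \o (fun z => 'D_v (K z) p)).
  apply: integrable_square_bounded => //.
  exists (C * `|v|); split; first exact: num_real.
  by move=> M CM z Sz; apply: (le_trans (HC z Sz v)); exact: ltW.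
split.
- move=> c u v; rewrite -RintegralZl// -RintegralD//; last first.
    by have := integrableZl mS c (iD u); congr integrable; apply/funext => z /=; rewrite EFinM.
  by apply: eq_Rintegral => z /set_mem Sz; exact: linK.
- exists (C * (2 * a) ^+ 2) => v; rewrite mulrAC; apply: Rintegral_square_le => //.
  by move=> z Sz; exact: HC.
- move=> e e0; have a20 : 0 < (2 * a) ^+ 2 + 1 by rewrite ltr_wpDl// sqr_ge0.
  have [r r1 Hr] := unif _ (divr_gt0 e0 a20).
  exists (Num.min r0 r); first by rewrite lt_min r00.
  move=> p1 p2; rewrite !lt_min => /andP[a1 a2] /andP[b1 b2].
  have i12 := integrableB mS (intK' _ a1) (intK' _ b1).
  rewrite -RintegralB//; [|exact: intK'|exact: intK'].
  rewrite -RintegralB//.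
  apply: (le_trans (Rintegral_square_le (c := e / ((2 * a) ^+ 2 + 1) * `|p1 - p2|) a0 _ _)).
  + by have := integrableB mS i12 (iD (p1 - p2)); congr integrable.
  + by move=> z Sz; exact: Hr.
  + rewrite mulrAC ler_wpM2r// mulrAC ler_pdivrMr// ler_wpM2l ?(ltW e0)//.
    by rewrite lerDl.
Unshelve. all: by end_near. Qed.

(** * The regular part *)

Lemma sdiff_near_eq (R : realType) (V : normedModType R) (f g : V -> R) (x : V) (L : V -> R) :
  (\forall y \near x, f y = g y) -> sdiff f x L -> sdiff g x L.
Proof.
move=> /nbhs_ballP[r0 /= r00 H0] [lL bL H]; split => // e e0.
have [r r1 Hr] := H e e0; exists (Num.min r0 r); first by rewrite lt_min r00.
move=> x1 x2; rewrite !lt_min => /andP[a1 a2] /andP[b1 b2].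
have E y : `|y - x| < r0 -> f y = g y by move=> h; apply: H0; rewrite -ball_normE /= distrC.
by rewrite -(E _ a1) -(E _ b1); exact: Hr.
Qed.

Lemma sdiff_slice (R : realType) (V W : normedModType R) (f : V * W -> R) (z : V) (p : W) (L : V * W -> R) :
  sdiff f (z, p) L -> sdiff (fun q => f (z, q)) p (fun v => L (0, v)).
Proof.
have nE (v : W) : `|(0 : V, v)| = `|v|.
  by rewrite (_ : `|(0 : V, v)| = Num.max `|0 : V| `|v|)// normr0; apply/max_idPr.
move=> [lL [C bL] H]; split.
- move=> a u v; rewrite -lL; congr L; apply: pair_ext => //=.
  by change (0 = a *: 0 + 0 :> V); rewrite scaler0 addr0.
- by exists C => v; rewrite (le_trans (bL _))// nE.
- move=> e e0; have [r r0 Hr] := H e e0; exists r => // x1 x2 h1 h2.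
  have E (u v : W) : (z, u) - (z, v) = (0 : V, u - v) :> V * W.
    by apply: pair_ext => //=; exact: subrr.
  have := Hr (z, x1) (z, x2); rewrite !E !nE; exact.
Qed.

Lemma sdiff_dist (R : realType) (V : normedModType R) (f : V -> R) (x : V) (L M : V -> R) (e r : R) :
  sdiff f x L -> (forall c v, M (c *: v) = c * M v) -> 0 < r ->
  (forall x1 x2, `|x1 - x| < r -> `|x2 - x| < r -> `|f x1 - f x2 - M (x1 - x2)| <= e * `|x1 - x2|) ->
  forall v, `|L v - M v| <= e * `|v|.
Proof.
move=> sf MZ r0 HM v; have [_ _ H] := sf.
apply/ler_addgt0Pl => eta eta0; have v0 : 0 < `|v| + 1 by rewrite ltr_wpDl.
have [r1 r10 Hr] := H (eta / (`|v| + 1)) (divr_gt0 eta0 v0).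
pose c := Num.min r r1 / 2 / (`|v| + 1).
have m0 : 0 < Num.min r r1 by rewrite lt_min r0.
have c0 : 0 < c by rewrite !divr_gt0.
have cv : `|c *: v + x - x| < Num.min r r1.
  rewrite addrK normrZ gtr0_norm// (@le_lt_trans _ _ (c * (`|v| + 1)))//.
    by rewrite ler_wpM2l ?(ltW c0)// lerDl.
  by rewrite /c divfK ?gt_eqF// ltr_pdivrMr// ltr_pMr// ltr1n.
move: cv; rewrite lt_min => /andP[cv1 cv2].
have := HM _ x cv1; rewrite subrr normr0 => /(_ r0).
have := Hr _ x cv2; rewrite subrr normr0 => /(_ r10).
rewrite addrK (sdiffLZ _ _ sf) MZ normrZ gtr0_norm// => h1 h2.
rewrite -(ler_pM2l c0) -{1}(gtr0_norm c0) -normrM.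
rewrite (_ : c * (L v - M v) = (f (c *: v + x) - f x - c * M v) - (f (c *: v + x) - f x - c * L v)); last by ring.
rewrite (le_trans (ler_normB _ _))// addrC mulrDr lerD//; last by rewrite mulrCA.
rewrite (le_trans h1)// mulrCA ler_wpM2l ?(ltW c0)//.
by rewrite mulrAC ler_pdivrMr// ler_wpM2l ?(ltW eta0)// lerDl.
Qed.

Lemma near_square (R : realType) (Om : set (plane R)) (x : plane R) : open Om -> Om x ->
  exists2 a : R, 0 < a & square x a `<=` Om.
Proof.
move=> oO Ox; have /nbhs_ballP[r /= r0 Hr] : nbhs x Om by exact: open_nbhs_nbhs.
exists (r / 2); first by rewrite divr_gt0.
move=> z /squareP zx; apply: Hr; rewrite -ball_normE /= distrC (le_lt_trans zx)//.
by rewrite ltr_pdivrMr// ltr_pMr// ltr1n.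
Qed.

(** The pole of G (z, y) at z = y is harmless: [lapk d (z - x)] vanishes for |z - x| < d/2, so the
    integrand is zero when z, x and y are all close to q. For z different from q, G is C^1 at (z,
    q). Joint strict derivatives in (z, x, y) and compactness of the square then give the uniformity
    needed. *)
Lemma kernel_sdiff (R : realType) (Om : set (plane R)) (G : plane R * plane R -> R) (q : plane R) (a d : R) :
  open Om -> Ck 1 (F2 Om) G -> (forall y, Om y -> fundamental_solution Om (fun x => G (x, y)) y) ->
  square q a `<=` Om -> 0 < d < a ->
  exists L, sdiff (fun p => \int[@lebesgue2 R]_(z in square q a) (G (z, p.2) * lapk d (z - p.1)))
    (q, q) L.
Proof.
move=> oO cG fs aO /andP[d0 da]; have a0 := lt_trans d0 da.
have Oq : Om q by apply: aO; apply/squareP; rewrite subrr normr0 ltW.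
pose K (z : plane R) (p : plane R * plane R) := G (z, p.2) * lapk d (z - p.1).
pose KK (w : plane R * (plane R * plane R)) := K w.1 w.2.
have joint z : square q a z -> exists L, sdiff KK (z, (q, q)) L.
  move=> Sz; have [->|zq] := eqVneq z q.
    exists (fun=> 0); apply: sdiff_near_eq (sdiff_cst 0 _).
    pose dd (w : plane R * (plane R * plane R)) := dot (w.1 - w.2.1) (w.1 - w.2.1).
    have cd : continuous dd.
      move=> w; apply: (@continuous_comp _ _ _ (fun w : plane R * (plane R * plane R) => w.1 - w.2.1) (fun w => dot w w)).
        apply: continuousB; first exact: cvg_fst.
        apply: (@continuous_comp _ _ _ (fun w : plane R * (plane R * plane R) => w.2) fst).
          exact: cvg_snd.
        exact: cvg_fst.
      exact: dot_continuous.
    have d20 : dd (q, (q, q)) < d ^+ 2 / 4.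
      by rewrite /dd /= subrr /dot /= mulr0 addr0 divr_gt0// exprn_gt0.
    have : \forall w \near (q, (q, q)), dd w < d ^+ 2 / 4 by exact: (cvgr_lt _ (cd _)).
    by apply: filterS => w dw; rewrite /KK /K /lapk laplacian_smlog_near// mulr0.
  have [L2 sL2] := sdiff_smooth (z - q) (smooth_lapk d).
  have Fzq : F2 Om (z, q) by split => //=; [exact: aO | exact/eqP].
  have sG := Ck1_sdiff (open_F2 oO) cG Fzq.
  eexists; apply: (@sdiff_mul _ _ (fun w : plane R * (plane R * plane R) => G (w.1, w.2.2))
    (fun w : plane R * (plane R * plane R) => lapk d (w.1 - w.2.1))).
    apply: (@sdiff_comp_linear _ _ _ G (fun w : plane R * (plane R * plane R) => (w.1, w.2.2)) _ _ 1) => //.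
      move=> v; rewrite mul1r; apply: pair_norm_le => /=; first exact: fst_le.
      exact: le_trans (snd_le _) (snd_le _).
    exact: sG.
  apply: (@sdiff_comp_linear _ _ _ (lapk d) (fun w : plane R * (plane R * plane R) => w.1 - w.2.1)
    (z, (q, q)) _ 2 _ _ sL2).
    move=> c u v; change (c *: u.1 + v.1 - (c *: u.2.1 + v.2.1) = c *: (u.1 - u.2.1) + (v.1 - v.2.1)).
    by rewrite scalerBr opprD addrACA.
  move=> v; rewrite (le_trans (ler_normB _ _))// mulr2n mulrDl mul1r lerD ?fst_le//.
  exact: le_trans (fst_le _) (snd_le _).
have slice z : square q a z -> exists L, sdiff (K z) (q, q) L.
  by move=> /joint[L sL]; exists (fun v => L (0, v)); exact: (sdiff_slice sL).
have local z e : square q a z -> 0 < e -> exists L r, [/\ 0 < r, sdiff KK (z, (q, q)) L,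
    forall z' p1 p2, `|z' - z| < r -> `|p1 - (q, q)| < r -> `|p2 - (q, q)| < r ->
    `|K z' p1 - K z' p2 - L (0, p1 - p2)| <= e * `|p1 - p2| &
    forall z' v, square q a z' -> `|z' - z| < r -> `|'D_v (K z') (q, q) - L (0, v)| <= e * `|v|].
  move=> Sz e0; have [L sL] := joint z Sz; have [_ _ /(_ e e0)[r r0 Hr]] := sL.
  have est z' p1 p2 : `|z' - z| < r -> `|p1 - (q, q)| < r -> `|p2 - (q, q)| < r ->
    `|K z' p1 - K z' p2 - L (0, p1 - p2)| <= e * `|p1 - p2|.
    move=> hz h1 h2; have := Hr (z', p1) (z', p2).
    have -> : (z', p1) - (z', p2) = (0 : plane R, p1 - p2) by apply: pair_ext => //=; exact: subrr.
    have -> : `|(0 : plane R, p1 - p2)| = `|p1 - p2|.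
      by rewrite (_ : `|(0 : plane R, p1 - p2)| = Num.max `|0 : plane R| `|p1 - p2|)// normr0; apply/max_idPr.
    by apply; apply: pair_norm_lt.
  exists L, r; split => // z' v Sz' hz; have [L' sL'] := slice z' Sz'.
  have [_ ->] := sdiff_is_derive v sL'.
  apply: (sdiff_dist sL' (M := fun v => L (0, v)) _ r0) => [c w|x1 x2 h1 h2]; last exact: est.
  rewrite -(sdiffLZ _ _ sL); congr L; apply: pair_ext => //=.
  by change (0 = c *: 0 :> plane R); rewrite scaler0.
exists (fun v => \int[@lebesgue2 R]_(z in square q a) 'D_v (K z) (q, q)).
apply: (@sdiff_integral _ _ q a K (q, q)) => //.
- exact: ltW.
- have /nbhs_ballP[r /= r0 Hr] : nbhs q Om by exact: open_nbhs_nbhs.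
  apply/nbhs_ballP; exists r => // p [_ /= p2].
  apply: integrable_square_mul; last by apply: smooth_shift; exact: smooth_lapk.
  by apply: (fs p.2 _).1 => //; [exact: Hr | exact: compact_square].
(* The unknown constant is encoded as the inverse of the scale, so that [compact_small] produces a
   single bound for all z. *)
- have [|r r0 Hr] := @compact_small R _ (square q a) (fun d z => square q a z -> forall v,
     `|'D_v (K z) (q, q)| <= d^-1 * `|v|) (@compact_square _ q a).
    move=> z Sz; have [L [r [r0 sL _ H]]] := local z 1 Sz ltr01.
    have [_ [C bL] _] := sL.
    have C0 : 0 < `|C| + 1 by rewrite ltr_wpDl.
    exists (Num.min r (`|C| + 1)^-1); first by rewrite lt_min r0 invr_gt0.
    move=> z'; rewrite lt_min => /andP[h1 _] d' d'0; rewrite lt_min => /andP[_ h2] Sz' v.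
    rewrite -(subrK (L (0, v)) ('D_v _ _)) (le_trans (ler_normD _ _))//.
    rewrite (@le_trans _ _ ((`|C| + 1) * `|v|))//.
      rewrite addrC mulrDl lerD//; last exact: H.
      rewrite (le_trans (bL _))// (_ : `|(0 : plane R, v)| = `|v|); last first.
        by rewrite (_ : `|(0 : plane R, v)| = Num.max `|0 : plane R| `|v|)// normr0; apply/max_idPr.
      by rewrite ler_wpM2r// ler_norm.
    by rewrite ler_wpM2r// -[leLHS]invrK lef_pV2 ?posrE ?invr_gt0// ltW.
  exists ((r / 2)^-1) => z Sz v; apply: Hr => //; first by rewrite divr_gt0.
  by rewrite ltr_pdivrMr// ltr_pMr// ltr1n.
- move=> e e0; have [|r r0 Hr] := @compact_small R _ (square q a) (fun d z => square q a z ->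
     forall p1 p2, `|p1 - (q, q)| < d -> `|p2 - (q, q)| < d ->
     `|K z p1 - K z p2 - 'D_(p1 - p2) (K z) (q, q)| <= e * `|p1 - p2|) (@compact_square _ q a).
    move=> z Sz; have [L [r [r0 sL H1 H2]]] := local z (e / 2) Sz (divr_gt0 e0 (ltr0n _ 2)).
    exists r => // z' hz d' d'0 d'r Sz' p1 p2 h1 h2.
    apply: (le_trans (ler_distD (L (0, p1 - p2)) _ _)).
    rewrite (splitr e) mulrDl lerD//; last by rewrite distrC; exact: H2.
    by apply: H1 => //; exact: lt_trans d'r.
  exists (r / 2); first by rewrite divr_gt0.
  move=> z Sz; apply: Hr => //; first by rewrite divr_gt0.
  by rewrite ltr_pdivrMr// ltr_pMr// ltr1n.
Qed.

Lemma dot0 (R : realType) : dot (0 : plane R) 0 = 0.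
Proof. by rewrite /dot /= mulr0 addr0. Qed.

Lemma ln_enorm (R : realType) (w : plane R) : w != 0 ->
  ln (enorm w) / (2 * pi) = ln (dot w w) / (4 * pi).
Proof.
move=> /dot_gt0 w0; rewrite -[in RHS](sqr_sqrtr (ltW w0)) lnXn ?sqrtr_gt0//.
have pi0 : pi != 0 :> R by rewrite gt_eqF// pi_gt0.
rewrite /enorm; move: (ln _) (pi : R) pi0 => l P P0.
by rewrite mulr2n; field.
Qed.

Lemma regular_part_lim (R : realType) (Om : set (plane R)) (G F : plane R * plane R -> R) (p : plane R * plane R) :
  open Om -> Om p.1 -> Om p.2 -> {for p, continuous F} ->
  (\forall q \near p, F2 Om q -> F q = G q + ln (dot (q.1 - q.2) (q.1 - q.2)) / (4 * pi)) ->
  regular_part Om G p = F p.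
Proof.
move=> oO O1 O2 cF H.
have PF : ProperFilter (within (F2 Om) (nbhs p)).
  apply: Build_ProperFilter_ex => B; rewrite /within /= => /nbhs_ballP[r /= r0 HB].
  have [a a0 aO] := near_square oO O1.
  pose s := Num.min (r / 2) a; have s0 : 0 < s by rewrite lt_min divr_gt0.
  have sr : s < r by rewrite gt_min; apply/orP; left; rewrite ltr_pdivrMr// ltr_pMr// ltr1n.
  (* The filter has to be proper for the limit to be determined. Points of [F2 Om] near p come from
     a shift of the first coordinate: t = 0 off the diagonal, t = s on it. *)
  have ex (t : R) : 0 <= t -> t <= s -> p.1 + t *: e1 != p.2 -> exists x, B x.
    move=> t0 ts tp; exists (p.1 + t *: e1, p.2).
    have nt : `|t *: (e1 : plane R)| <= t.
      rewrite normrZ ger0_norm// ler_piMr// pair_norm_le//= ?normr1 ?normr0//.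
    apply: HB; last first.
      split => //=; last exact/eqP.
      apply: aO; apply/squareP; rewrite addrAC subrr add0r (le_trans nt)// (le_trans ts)//.
      by rewrite ge_min lexx orbT.
    rewrite -ball_normE /=; apply: pair_norm_lt => /=; last by rewrite subrr normr0.
    rewrite opprD addrA subrr add0r normrN (le_lt_trans nt)// (le_lt_trans ts)//.
  have [p12|p12] := eqVneq p.1 p.2; last first.
    by apply: (ex 0) => //; rewrite ?scale0r ?addr0// ltW.
  apply: (ex s) => //; first exact: ltW.
  rewrite p12 -subr_eq0 addrAC subrr add0r scaler_eq0 negb_or gt_eqF//=.
  by apply/eqP => -[/eqP]; rewrite oner_eq0.
rewrite /regular_part; apply: cvg_lim => //.
have cw : F @ within (F2 Om) (nbhs p) --> F p by apply: cvg_within_filter.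
apply: cvg_trans cw; apply: near_eq_cvg; rewrite /prop_near1 /within /=.
apply: filterS H => q Hq Fq; rewrite Hq// -ln_enorm//.
by case: Fq => _ _ /eqP; rewrite subr_eq0.
Qed.

Lemma regular_part_off (R : realType) (Om : set (plane R)) (G : plane R * plane R -> R) (p : plane R * plane R) :
  open Om -> Ck 1 (F2 Om) G -> F2 Om p ->
  regular_part Om G p = G p + ln (dot (p.1 - p.2) (p.1 - p.2)) / (4 * pi).
Proof.
move=> oO cG Fp; move: (Fp) => [m1 m2 /eqP p12].
apply: (@regular_part_lim _ _ _ (fun p => G p + ln (dot (p.1 - p.2) (p.1 - p.2)) / (4 * pi))) => //.
  have c1 : {for p, continuous G} by apply: cG.1.
  have c2 : {for p, continuous (fun q : plane R * plane R => dot (q.1 - q.2) (q.1 - q.2))}.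
    apply: (@continuous_comp _ _ _ (fun p : plane R * plane R => p.1 - p.2) (fun w => dot w w)).
      by apply: continuousB; [exact: cvg_fst | exact: cvg_snd].
    exact: dot_continuous.
  apply: cvgD; first exact: c1.
  apply: cvgM; last exact: cvg_cst.
  apply: (continuous_comp c2); apply: continuous_ln; apply: dot_gt0; rewrite subr_eq0//.
by near=> q.
Unshelve. all: by end_near. Qed.

(** * Harmonicity of the regular part *)

Definition green_kernel (R : realType) (Om : set (plane R)) (G : plane R * plane R -> R) : Prop :=
  [/\ open Om, Ck 1 (F2 Om) G & forall y, Om y -> fundamental_solution Om (fun x => G (x, y)) y].

Lemma smlog_pair_sdiff (R : realType) (d : R) (p : plane R * plane R) :
  exists L, sdiff (fun p => smlog d (p.2 - p.1)) p L.
Proof.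
have [L sL] := sdiff_smooth (p.2 - p.1) (smooth_smlog d).
exists (fun v => L (v.2 - v.1)).
apply: (@sdiff_comp_linear _ _ _ (smlog d) (fun p : plane R * plane R => p.2 - p.1) p _ 2 _ _ sL).
  move=> c u v; change (c *: u.2 + v.2 - (c *: u.1 + v.1) = c *: (u.2 - u.1) + (v.2 - v.1)).
  by rewrite scalerBr opprD addrACA.
by move=> v; rewrite (le_trans (ler_normB _ _))// mulr2n mulrDl mul1r lerD ?fst_le ?snd_le.
Qed.

Lemma square_sub (R : realType) (q x : plane R) (a d : R) : `|x - q| <= a - d -> square x d `<=` square q a.
Proof.
move=> xq z /squareP zx; apply/squareP; rewrite -(subrKA x) (le_trans (ler_normD _ _))//.
by rewrite -(subrK d a) addrC lerD.
Qed.

Lemma potential_restrict (R : realType) (u : plane R -> R) (q x : plane R) (a d : R) : 0 < d ->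
  `|x - q| <= a - d ->
  \int[@lebesgue2 R]_(z in square q a) (u z * lapk d (z - x)) =
  \int[@lebesgue2 R]_(z in square x d) (u z * lapk d (z - x)).
Proof.
move=> d0 xq; apply: Rintegral_restrict; first exact: square_sub.
by move=> z _ nz; rewrite (lapk_out d0 (lexx d) nz) mulr0.
Qed.

Lemma continuous_fst_arg (R : realType) (Om : set (plane R)) (G : plane R * plane R -> R) (x y : plane R) :
  Ck 1 (F2 Om) G -> F2 Om (x, y) -> {for x, continuous (fun x => G (x, y))}.
Proof.
move=> cG Fxy; apply: (@continuous_comp _ _ _ (fun x : plane R => (x, y)) G).
  exact: continuous_pair (@cvg_id _ _) (@cvg_cst _ _ _ _ _).
exact: cG.1.
Qed.

Lemma potential_off (R : realType) (Om : set (plane R)) (G : plane R * plane R -> R) (q x y : plane R) (a d : R) :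
  green_kernel Om G -> square q a `<=` Om -> 0 < d -> `|x - q| <= a - d -> Om y -> x != y ->
  4 * pi * G (x, y) + ln (dot (x - y) (x - y)) =
  \int[@lebesgue2 R]_(z in square q a) (G (z, y) * lapk d (z - x)) + smlog d (y - x).
Proof.
move=> [oO cG fs] aO d0 xq Oy xy; rewrite potential_restrict//.
have dO := subset_trans (square_sub xq) aO.
apply: (@representation R Om (fun z => G (z, y)) x y d d) => //; [exact: fs | by rewrite d0 lexx |].
apply: continuous_fst_arg cG _; split => //=; last exact/eqP.
by apply: dO; apply/squareP; rewrite subrr normr0 ltW.
Qed.

Lemma pi4_gt0 (R : realType) : 0 < 4 * pi :> R.
Proof. by rewrite mulr_gt0// pi_gt0. Qed.

(** The representation off the diagonal has a right-hand side that makes sense on it. Its strict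
    derivative at (q, q) makes it continuous around that point, hence it equals the limit defining
    [regular_part] at all nearby points, those on the diagonal included. *)
Lemma regular_diag (R : realType) (Om : set (plane R)) (G : plane R * plane R -> R) (q : plane R) (a d : R) :
  green_kernel Om G -> square q a `<=` Om -> 0 < d < a ->
  exists L, sdiff (regular_part Om G) (q, q) L /\
  4 * pi * regular_part Om G (q, q) =
  \int[@lebesgue2 R]_(z in square q a) (G (z, q) * lapk d (z - q)) + smlog d (q - q).
Proof.
move=> gk aO /andP[d0 da]; have [oO cG fs] := gk.
have a0 := lt_trans d0 da.
have [|L1 s1] := @kernel_sdiff _ Om G q a d oO cG fs aO; first by rewrite d0.
have [L2 s2] := smlog_pair_sdiff d (q, q).
have sF := sdiff_scale (4 * pi)^-1 (sdiff_add s1 s2).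
set F := (fun z => (4 * pi)^-1 * _) in sF.
have [C C0 [r1 r10 lip]] := sdiff_lipschitz sF.
pose r := Num.min r1 (a - d); have r0 : 0 < r by rewrite lt_min r10 subr_gt0.
have E p : `|p - (q, q)| < r -> regular_part Om G p = F p.
  rewrite lt_min => /andP[pr pa].
  have pin (x : plane R) : `|x - q| <= `|p - (q, q)| -> Om x.
    move=> xp; apply: aO; apply/squareP; rewrite (le_trans xp)// (le_trans (ltW pa))//.
    by rewrite gerBl ltW.
  apply: regular_part_lim => //.
  - by apply: pin; exact: (fst_le (p - (q, q))).
  - by apply: pin; exact: (snd_le (p - (q, q))).
  - apply/cvgrPdist_le => e e0; near=> p'.
    have h1 : `|p' - p| <= e / C by rewrite distrC; near: p'; apply: cvgr_dist_le; rewrite ?divr_gt0.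
    have h2 : `|p' - (q, q)| < r1.
      have : `|p - p'| < r1 - `|p - (q, q)|.
        by near: p'; apply: cvgr_dist_lt; rewrite ?subr_gt0.
      rewrite ltrBrDr distrC; apply: le_lt_trans.
      by rewrite -(subrKA p) (le_trans (ler_normD _ _)).
    by rewrite distrC (le_trans (lip _ _ h2 pr))// mulrC -ler_pdivlMr.
  - near=> p' => -[m1 m2 p12].
    have h2 : `|p' - (q, q)| < a - d.
      have : `|p - p'| < a - d - `|p - (q, q)|.
        by near: p'; apply: cvgr_dist_lt; rewrite ?subr_gt0.
      rewrite ltrBrDr distrC; apply: le_lt_trans.
      by rewrite -(subrKA p) (le_trans (ler_normD _ _)).
    have h3 : `|p'.1 - q| <= a - d.
      by rewrite (le_trans (fst_le (p' - (q, q))))// ltW.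
    have /eqP p12' := p12.
    rewrite /F -(potential_off gk aO d0 h3 m2 p12') -surjective_pairing.
    move: (4 * pi : R) (pi4_gt0 R) => P P0; field.
    by rewrite gt_eqF.
eexists; split; first apply: sdiff_near_eq sF.
  apply/nbhs_ballP; exists r => // p; rewrite -ball_normE /= distrC => /E ->//.
have h : `|(q, q) - (q, q)| < r by rewrite subrr normr0.
rewrite (E _ h) /F /= mulrA mulfV ?mul1r//.
by rewrite gt_eqF// pi4_gt0.
Unshelve. all: by end_near. Qed.

Lemma sdiff_lndot (R : realType) (x : plane R) : x != 0 ->
  exists L, sdiff (fun w : plane R => ln (dot w w)) x L.
Proof.
move=> x0; pose d := Num.sqrt (dot x x) / 2; have dx := dot_gt0 x0.
have d0 : 0 < d by rewrite divr_gt0// sqrtr_gt0.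
have [L sL] := sdiff_smooth x (smooth_smlog d).
exists L; apply: sdiff_near_eq sL.
have : \forall u \near x, d ^+ 2 < dot u u.
  apply: (cvgr_gt _ (@dot_continuous R x)).
  rewrite /d exprMn sqr_sqrtr ?ltW// -[ltRHS]mulr1 ltr_pM2l//.
  by rewrite exprVn invf_lt1 ?exprn_gt0// exprn_egt1// ltr1n.
by apply: filterS => u du; rewrite smlog_far// ltW.
Qed.

Lemma regular_sdiff (R : realType) (Om : set (plane R)) (G : plane R * plane R -> R) (p : plane R * plane R) :
  green_kernel Om G -> Om p.1 -> Om p.2 -> exists L, sdiff (regular_part Om G) p L.
Proof.
move=> gk m1 m2; have [oO cG fs] := gk.
have [p12|p12] := eqVneq p.1 p.2.
  have [a a0 aO] := near_square oO m1.
  have [|L [sL _]] := @regular_diag _ Om G p.1 a (a / 2) gk aO.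
    by rewrite divr_gt0//= ltr_pdivrMr// ltr_pMr// ltr1n.
  exists L; suff -> : p = (p.1, p.1) by [].
  by rewrite {2}p12 -surjective_pairing.
have Fp : F2 Om p by split => //; exact/eqP.
have pd : p.1 - p.2 != 0 by rewrite subr_eq0.
have [L sL] := sdiff_lndot pd.
have s2 : sdiff (fun p : plane R * plane R => ln (dot (p.1 - p.2) (p.1 - p.2))) p (fun v => L (v.1 - v.2)).
  apply: (@sdiff_comp_linear _ _ _ (fun w : plane R => ln (dot w w)) (fun p : plane R * plane R => p.1 - p.2) p _ 2 _ _ sL).
    move=> c u v; change (c *: u.1 + v.1 - (c *: u.2 + v.2) = c *: (u.1 - u.2) + (v.1 - v.2)).
    by rewrite scalerBr opprD addrACA.
  by move=> v; rewrite (le_trans (ler_normB _ _))// mulr2n mulrDl mul1r lerD ?fst_le ?snd_le.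
have s1 := Ck1_sdiff (open_F2 oO) cG Fp.
eexists; apply: sdiff_near_eq (sdiff_add s1 (sdiff_scale (4 * pi)^-1 s2)).
have : \forall q \near p, F2 Om q by apply: open_nbhs_nbhs; split => //; exact: open_F2.
by apply: filterS => q Fq; rewrite regular_part_off// [in RHS]mulrC.
Qed.

Lemma regular_formula (R : realType) (Om : set (plane R)) (G : plane R * plane R -> R) (q x y : plane R) (a d : R) :
  green_kernel Om G -> square q a `<=` Om -> 0 < d -> `|x - q| < a - d -> Om y ->
  4 * pi * regular_part Om G (x, y) =
  \int[@lebesgue2 R]_(z in square q a) (G (z, y) * lapk d (z - x)) + smlog d (y - x).
Proof.
move=> gk aO d0 xq Oy; have [oO cG fs] := gk.
have Ox : Om x.
  by apply: aO; apply/squareP; rewrite (le_trans (ltW xq))// gerBl ltW.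
have [<-|xy] := eqVneq x y; last first.
  rewrite -(potential_off gk aO d0 (ltW xq) Oy xy) regular_part_off//=.
    by rewrite mulrDr mulrCA mulfV ?mulr1// gt_eqF// pi4_gt0.
  by split => //; exact/eqP.
(* On the diagonal the formula is known only at the centre of a square. Recentre at x, with half
   side a - |x - q| > d; both integrals live on the square of half side d around x. *)
have [||L [_ ->]] := @regular_diag _ Om G x (a - `|x - q|) d gk.
- by apply: subset_trans aO; apply: square_sub; rewrite subKr.
- by rewrite d0 ltrBrDr addrC -ltrBrDr.
congr (_ + _).
rewrite [RHS](@potential_restrict _ (fun z => G (z, x)) q x a d d0 (ltW xq)).
apply: (@potential_restrict _ (fun z => G (z, x)) x x _ d d0).
by rewrite subrr normr0 subr_ge0 ltW// ltrBrDr addrC -ltrBrDr.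
Qed.

(** t^2 times the five-point discrete Laplacian. *)
Definition SD (R : realType) (w : plane R -> R) (x : plane R) (t : R) : R :=
  (w (t *: e1 + x) + w ((- t) *: e1 + x) - 2 * w x) +
  (w (t *: e2 + x) + w ((- t) *: e2 + x) - 2 * w x).

(* A pointwise, integral-free form of harmonicity. *)
Definition sdharmonic (R : realType) (w : plane R -> R) (x : plane R) : Prop :=
  forall e : R, 0 < e -> exists2 r : R, 0 < r & forall t, 0 < t -> t < r -> `|SD w x t| <= e * t ^+ 2.

Lemma smooth_SD (R : realType) (f : plane R -> R) (a : R) : smooth f ->
  exists2 C : R, 0 <= C & forall w t, square 0 a w -> 0 < t -> t <= 1 ->
    `|SD f w t - t ^+ 2 * laplacian f w| <= C * t ^+ 3.
Proof.
move=> sf.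
have bnd (v : plane R) : exists2 M : R, 0 <= M & forall w, square 0 (a + 1) w ->
    `|'D_v (fun x => 'D_v (fun x => 'D_v f x) x) w| <= M.
  have s3 := smooth_D v (smooth_D v (smooth_D v sf)).
  have [M [Mr HM]] := continuous_bounded_square (0 : plane R) (a + 1) (smooth_continuous s3).
  exists (`|M| + 1); first by rewrite addr_ge0.
  move=> w Sw; apply: (HM (`|M| + 1)) => //.
  by rewrite (le_lt_trans (ler_norm M))// ltrDl.
have [M1 M10 H1] := bnd e1; have [M2 M20 H2] := bnd e2.
exists (2 * M1 + 2 * M2); first by rewrite addr_ge0 ?mulr_ge0.
move=> w t Sw t0 t1.
have one (v : plane R) M : `|v| <= 1 -> (forall w, square 0 (a + 1) w ->
    `|'D_v (fun x => 'D_v (fun x => 'D_v f x) x) w| <= M) ->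
    `|f (t *: v + w) + f ((- t) *: v + w) - 2 * f w - t ^+ 2 * 'D_v (fun x => 'D_v f x) w| <= 2 * M * t ^+ 3.
  move=> v1 HM.
  have D1 := smooth_D v sf; have D2 := smooth_D v D1.
  have := @second_difference_le R (fun s => f (s *: v + w)) (fun s => 'D_v f (s *: v + w))
    (fun s => 'D_v (fun x => 'D_v f x) (s *: v + w))
    (fun s => 'D_v (fun x => 'D_v (fun x => 'D_v f x) x) (s *: v + w)) t M t0.
  rewrite !scale0r !add0r; apply.
  - by move=> s _; exact: (is_derive_line_at (smooth_is_derive v _ sf)).
  - by move=> s _; exact: (is_derive_line_at (smooth_is_derive v _ D1)).
  - by move=> s _; exact: (is_derive_line_at (smooth_is_derive v _ D2)).
  - move=> s st; apply: HM; apply/squareP; move/squareP: Sw; rewrite !subr0 => wa.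
    rewrite (le_trans (ler_normD _ _))// addrC lerD// normrZ.
    by rewrite (le_trans _ t1)// (le_trans _ st)// ler_piMr.
have n1 : `|e1 : plane R| <= 1 by apply: pair_norm_le; rewrite /= ?normr1 ?normr0.
have n2 : `|e2 : plane R| <= 1 by apply: pair_norm_le; rewrite /= ?normr1 ?normr0.
have := one e1 M1 n1 H1; have := one e2 M2 n2 H2.
rewrite /SD /laplacian.
set A := f _ + f _ - _; set B := f _ + f _ - _; set D := 'D__ _ _; set D' := 'D__ _ _.
move=> h2 h1.
rewrite (_ : B + A - _ = (B - t ^+ 2 * D') + (A - t ^+ 2 * D)); last by ring.
by rewrite (le_trans (ler_normD _ _))// mulrDl lerD.
Qed.

Lemma SD_refl (R : realType) (f : plane R -> R) (x y : plane R) (t : R) :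
  SD (fun x => f (y - x)) x t = SD f (y - x) t.
Proof.
have E (c : R) (v : plane R) : y - (c *: v + x) = (- c) *: v + (y - x).
  by rewrite opprD scaleNr addrCA.
by rewrite /SD !E !opprK; ring.
Qed.

Lemma SD_scale (R : realType) (f : plane R -> R) (x : plane R) (t c : R) :
  SD (fun x => c * f x) x t = c * SD f x t.
Proof. by rewrite /SD; ring. Qed.

Lemma SD_add (R : realType) (f g : plane R -> R) (x : plane R) (t : R) :
  SD (fun x => f x + g x) x t = SD f x t + SD g x t.
Proof. by rewrite /SD; ring. Qed.

Lemma sdharmonic_scale (R : realType) (f : plane R -> R) (x : plane R) (c : R) :
  sdharmonic f x -> sdharmonic (fun x => c * f x) x.
Proof.
move=> H e e0; have c0 : 0 < `|c| + 1 by rewrite ltr_wpDl.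
have [r r0 Hr] := H (e / (`|c| + 1)) (divr_gt0 e0 c0).
exists r => // t t0 tr; rewrite SD_scale normrM.
rewrite (le_trans (ler_wpM2l (normr_ge0 c) (Hr t t0 tr)))// mulrA ler_wpM2r ?sqr_ge0//.
by rewrite mulrA ler_pdivrMr// mulrC ler_wpM2l ?(ltW e0)// lerDl.
Qed.

Lemma sdharmonic_add (R : realType) (f g : plane R -> R) (x : plane R) :
  sdharmonic f x -> sdharmonic g x -> sdharmonic (fun x => f x + g x) x.
Proof.
move=> H1 H2 e e0.
have [r1 r10 h1] := H1 _ (divr_gt0 e0 (ltr0n R 2)).
have [r2 r20 h2] := H2 _ (divr_gt0 e0 (ltr0n R 2)).
exists (Num.min r1 r2); first by rewrite lt_min r10.
move=> t t0; rewrite lt_min => /andP[t1 t2].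
rewrite SD_add (le_trans (ler_normD _ _))// (splitr e) mulrDl lerD//; [exact: h1 | exact: h2].
Qed.

Lemma sdharmonic_near_eq (R : realType) (f g : plane R -> R) (x : plane R) :
  (\forall y \near x, f y = g y) -> sdharmonic f x -> sdharmonic g x.
Proof.
move=> /nbhs_ballP[r0 /= r00 H0] H e e0; have [r r1 Hr] := H e e0.
exists (Num.min r0 r); first by rewrite lt_min r00.
move=> t t0; rewrite lt_min => /andP[t1 t2].
have E (c : R) (v : plane R) : `|v| <= 1 -> `|c| <= t -> g (c *: v + x) = f (c *: v + x).
  move=> v1 ct; apply/esym; apply: H0; rewrite -ball_normE /= distrC addrK normrZ.
  by rewrite (le_lt_trans _ t1)// (le_trans _ ct)// ler_piMr.
have n1 : `|e1 : plane R| <= 1 by apply: pair_norm_le; rewrite /= ?normr1 ?normr0.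
have n2 : `|e2 : plane R| <= 1 by apply: pair_norm_le; rewrite /= ?normr1 ?normr0.
have := Hr t t0 t2; rewrite /SD !E ?normrN ?(gtr0_norm t0)//.
suff -> : g x = f x by [].
by have := E 0 e1 n1; rewrite scale0r add0r normr0; apply; exact: ltW.
Qed.

Lemma SD_le (R : realType) (f : plane R -> R) (x : plane R) : smooth f -> laplacian f x = 0 -> sdharmonic f x.
Proof.
move=> sf lf e e0; have [C C0 HC] := smooth_SD `|x| sf.
have C1 : 0 < C + 1 by rewrite ltr_wpDl.
exists (Num.min 1 (e / (C + 1))); first by rewrite lt_min ltr01 divr_gt0.
move=> t t0; rewrite lt_min => /andP[t1 t2].
have := HC x t; rewrite lf mulr0 subr0 => H.
have {}H : `|SD f x t| <= C * t ^+ 3 by apply: H => //; [apply/squareP; rewrite subr0 | exact: ltW].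
rewrite (le_trans H)// exprSr mulrA mulrAC ler_wpM2r ?sqr_ge0//.
rewrite ltr_pdivlMr// in t2; rewrite (le_trans _ (ltW t2))// mulrC ler_wpM2l ?(ltW t0)//.
by rewrite lerDl.
Qed.

Lemma sdharmonic_lndot (R : realType) (a x : plane R) : x != a ->
  sdharmonic (fun z : plane R => ln (dot (z - a) (z - a))) x.
Proof.
move=> xa; have x0 : x - a != 0 by rewrite subr_eq0.
pose d := Num.sqrt (dot (x - a) (x - a)) / 2; have dx := dot_gt0 x0.
have d0 : 0 < d by rewrite divr_gt0// sqrtr_gt0.
have d2 : d ^+ 2 < dot (x - a) (x - a).
  rewrite /d exprMn sqr_sqrtr ?ltW// -[ltRHS]mulr1 ltr_pM2l//.
  by rewrite exprVn invf_lt1 ?exprn_gt0// exprn_egt1// ltr1n.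
have ss := smooth_shift a (smooth_smlog d).
apply: sdharmonic_near_eq (SD_le ss _); last first.
  by rewrite (lapk_shift d a x); exact: laplacian_smlog_far.
have cz : {for x, continuous (fun z : plane R => dot (z - a) (z - a))}.
  apply: (@continuous_comp _ _ _ (fun z : plane R => z - a) (fun w => dot w w)).
    by apply: continuousB; [exact: cvg_id | exact: cst_continuous].
  exact: dot_continuous.
have : \forall u \near x, d ^+ 2 < dot (u - a) (u - a) by exact: (cvgr_gt _ cz).
by apply: filterS => u du; rewrite smlog_far// ltW.
Qed.

Lemma mul_Rintegral_ext (R : realType) (S : set (plane R)) (u f g : plane R -> R) :
  (forall z, f z = g z) ->
  \int[@lebesgue2 R]_(z in S) (u z * f z) = \int[@lebesgue2 R]_(z in S) (u z * g z).
Proof. by move=> /funext ->. Qed.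

Lemma test_integral_shift (R : realType) (Om : set (plane R)) (u f : plane R -> R) (x y : plane R) (a : R) :
  fundamental_solution Om u y -> square x a `<=` Om -> smooth f ->
  (forall z, ~ square x a z -> f (z - x) = 0) ->
  \int[@lebesgue2 R]_(z in square x a) (u z * laplacian f (z - x)) = - f (y - x).
Proof.
move=> fs aO sf f0.
rewrite (mul_Rintegral_ext (square x a) u (fun z => esym (laplacian_shift x z sf))).
exact: (@test_integral _ Om (square x a) u (fun z => f (z - x)) x y a fs (fun _ h => h) aO (smooth_shift x sf) f0).
Qed.

Lemma Rintegral_diff_le (R : realType) (x : plane R) (a c B : R) (u f g : plane R -> R) :
  (@lebesgue2 R).-integrable (square x a) (EFin \o u) -> smooth f -> smooth g ->
  (forall z, square x a z -> `|f z - c * g z| <= B) ->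
  `|\int[@lebesgue2 R]_(z in square x a) (u z * f z) -
    c * \int[@lebesgue2 R]_(z in square x a) (u z * g z)| <=
  B * \int[@lebesgue2 R]_(z in square x a) `|u z|.
Proof.
move=> intu sf sg fg; have mS := measurable_square x a.
have iu k : smooth k -> (@lebesgue2 R).-integrable (square x a) (EFin \o (fun z => u z * k z)).
  by move=> sk; exact: integrable_square_mul.
have sd : smooth (fun z => f z - c * g z) := smooth_sub sf (smooth_mul (smooth_cst c) sg).
rewrite -RintegralZl//; last exact: iu sg.
rewrite -RintegralB//; [|exact: iu sf|by have := integrableZl mS c (iu _ sg); congr integrable].
have -> : \int[@lebesgue2 R]_(z in square x a) (u z * f z - c * (u z * g z)) =
    \int[@lebesgue2 R]_(z in square x a) (u z * (f z - c * g z)).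
  by apply: eq_Rintegral => z _; ring.
rewrite (le_trans (le_normr_Rintegral mS (iu _ sd)))//.
rewrite -RintegralZl//; last by have := integrable_norm intu.
apply: le_Rintegral => //.
- by have := integrable_norm (iu _ sd).
- by have := integrableZl mS B (integrable_norm intu); congr integrable.
- by move=> z Sz; rewrite normrM mulrC ler_wpM2r// fg.
Qed.

(** The potential and the mollified logarithm are not harmonic separately, but their defects cancel.
    [lapk d (z - x)] is itself a test function in z, so the potential contributes - t^2 lapk d (y -
    x) up to O(t^3), and [smlog d (y - x)] contributes the opposite term. *)
Lemma regular_sdharmonic (R : realType) (Om : set (plane R)) (G : plane R * plane R -> R) (x y : plane R) :
  green_kernel Om G -> Om x -> Om y -> sdharmonic (fun x => regular_part Om G (x, y)) x.
Proof.
move=> gk Ox Oy; have [oO cG fs] := gk.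
have [a a0 aO] := near_square oO Ox.
pose d := a / 2; have d0 : 0 < d by rewrite divr_gt0.
have da : d < a by rewrite ltr_pdivrMr// ltr_pMr// ltr1n.
pose u (z : plane R) := G (z, y).
pose I (x' : plane R) := \int[@lebesgue2 R]_(z in square x a) (u z * lapk d (z - x')).
pose S (x' : plane R) := smlog d (y - x').
have P0 := pi4_gt0 R.
suff H : sdharmonic (fun x' => I x' + S x') x.
  have E : \forall x' \near x, (4 * pi)^-1 * (I x' + S x') = regular_part Om G (x', y).
    apply/nbhs_ballP; exists (a - d); first by rewrite /= subr_gt0.
    move=> x'; rewrite -ball_normE /= distrC => xx'.
    rewrite -(regular_formula gk aO d0 xx' Oy).
    by move: (4 * pi : R) P0 => P P0; rewrite mulrA mulVf ?mul1r// gt_eqF.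
  exact: sdharmonic_near_eq E (sdharmonic_scale _ H).
have intu : (@lebesgue2 R).-integrable (square x a) (fun z => (u z)%:E).
  by apply: (fs y Oy).1 => //; exact: compact_square.
have mS := measurable_square x a.
have slap := smooth_lapk d.
have [C1 C10 HC1] := smooth_SD (a + a) slap.
have [C2 C20 HC2] := smooth_SD `|y - x| (smooth_smlog d).
pose M := \int[@lebesgue2 R]_(z in square x a) `|u z|.
have M0 : 0 <= M by apply: Rintegral_ge0.
have K0 : 0 < C1 * M + C2 + 1 by rewrite ltr_wpDl// addr_ge0// mulr_ge0.
move=> e e0; exists (Num.min 1 (e / (C1 * M + C2 + 1))); first by rewrite lt_min ltr01 divr_gt0.
move=> t t0; rewrite lt_min => /andP[t1 t2].
have iu f : smooth f -> (@lebesgue2 R).-integrable (square x a) (EFin \o (fun z => u z * f z)).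
  by move=> sf; exact: integrable_square_mul.
have sl (c : plane R) : smooth (fun z => lapk d (z - c)) by apply: smooth_shift.
have sc (v : plane R) : smooth (fun z : plane R => lapk d (v + (z - x))).
  rewrite (_ : (fun z => _) = fun z => lapk d (z - (x - v))); first exact: sl.
  by apply/funext => z; congr lapk; rewrite opprB addrCA.
have s2 : smooth (fun z => 2 * lapk d (z - x)) := smooth_mul (smooth_cst 2) (sl x).
have sSD : smooth (fun z => SD (lapk d) (z - x) t) :=
  smooth_add (smooth_sub (smooth_add (sc _) (sc _)) s2) (smooth_sub (smooth_add (sc _) (sc _)) s2).
have sLap : smooth (fun z => laplacian (lapk d) (z - x)).
  by apply: smooth_shift; exact: smooth_laplacian.
pose J f := \int[@lebesgue2 R]_(z in square x a) (u z * f z).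
have Jadd f g : smooth f -> smooth g -> J (fun z => f z + g z) = J f + J g.
  move=> sf sg; rewrite /J -RintegralD//; [|exact: iu|exact: iu].
  by apply: eq_Rintegral => z _; rewrite mulrDr.
have Jsub f g : smooth f -> smooth g -> J (fun z => f z - g z) = J f - J g.
  move=> sf sg; rewrite /J -RintegralB//; [|exact: iu|exact: iu].
  by apply: eq_Rintegral => z _; rewrite mulrBr.
have Jsc (c : R) f : smooth f -> J (fun z => c * f z) = c * J f.
  move=> sf; rewrite /J -RintegralZl//; last exact: iu.
  by apply: eq_Rintegral => z _; rewrite mulrCA.
have Jlin k1 k2 k3 k4 k0 : smooth k1 -> smooth k2 -> smooth k3 -> smooth k4 -> smooth k0 ->
    J (fun z => (k1 z + k2 z - 2 * k0 z) + (k3 z + k4 z - 2 * k0 z)) =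
    (J k2 + J k1 - 2 * J k0) + (J k4 + J k3 - 2 * J k0).
  move=> h1 h2 h3 h4 h0; have h20 := smooth_mul (smooth_cst 2) h0.
  rewrite (Jadd _ _ (smooth_sub (smooth_add h1 h2) h20) (smooth_sub (smooth_add h3 h4) h20)).
  rewrite (Jsub _ _ (smooth_add h1 h2) h20) (Jsub _ _ (smooth_add h3 h4) h20).
  by rewrite (Jadd _ _ h1 h2) (Jadd _ _ h3 h4) (Jsc 2 _ h0); congr (_ - _ + (_ - _)); exact: addrC.
have SDI : SD I x t = J (fun z => SD (lapk d) (z - x) t).
  have lin (v : plane R) (c : R) : I (c *: v + x) = J (fun z => lapk d ((- c) *: v + (z - x))).
    by apply: eq_Rintegral => z _; congr (_ * lapk d _); rewrite opprD scaleNr addrCA.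
  have -> : SD I x t = (J (fun z => lapk d (- t *: e1 + (z - x))) + J (fun z => lapk d (t *: e1 + (z - x))) - 2 * I x) +
     (J (fun z => lapk d (- t *: e2 + (z - x))) + J (fun z => lapk d (t *: e2 + (z - x))) - 2 * I x).
    by rewrite /SD !lin opprK.
  by apply: esym; exact: (Jlin _ _ _ _ _ (sc (t *: e1)) (sc (- t *: e1)) (sc (t *: e2)) (sc (- t *: e2)) (sl x)).
have lapI : \int[@lebesgue2 R]_(z in square x a) (u z * laplacian (lapk d) (z - x)) = - lapk d (y - x).
  apply: (test_integral_shift (fs y Oy) aO slap) => z nz.
  exact: (lapk_out d0 (ltW da) nz).
have SDS : `|SD S x t - t ^+ 2 * lapk d (y - x)| <= C2 * t ^+ 3.
  rewrite SD_refl; apply: HC2 => //; last exact: ltW.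
  by apply/squareP; rewrite subr0.
have HI : `|SD I x t + t ^+ 2 * lapk d (y - x)| <= C1 * M * t ^+ 3.
  rewrite SDI -[lapk d (y - x)]opprK -lapI mulrN [leRHS]mulrAC.
  apply: (@Rintegral_diff_le R x a (t ^+ 2) (C1 * t ^+ 3) u (fun z => SD (lapk d) (z - x) t)
    (fun z => laplacian (lapk d) (z - x)) intu sSD sLap) => z /squareP zx.
  apply: HC1 => //; last exact: ltW.
  by apply/squareP; rewrite subr0 (le_trans zx)// lerDl ltW.
rewrite SD_add (_ : _ + _ = (SD I x t + t ^+ 2 * lapk d (y - x)) + (SD S x t - t ^+ 2 * lapk d (y - x))); last by ring.
rewrite (le_trans (ler_normD _ _))// (le_trans (lerD HI SDS))// -mulrDl exprSr mulrA mulrAC.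
rewrite ler_wpM2r ?sqr_ge0//.
rewrite ltr_pdivlMr// in t2; rewrite (le_trans _ (ltW t2))// mulrC ler_wpM2l ?(ltW t0)//.
by rewrite lerDl.
Qed.

(** * Maximum principle and gradient bound *)

Lemma SD_sqnorm (R : realType) (c : R) (a x : plane R) (t : R) :
  SD (fun x => c * dot (x - a) (x - a)) x t = 4 * c * t ^+ 2.
Proof. by rewrite /SD /dot /= /GRing.scale /=; ring. Qed.

Lemma line_small (R : realType) (v : plane R) (t r : R) (x : plane R) : `|v| <= 1 -> `|t| < r ->
  `|x - (t *: v + x)| < r.
Proof.
move=> v1 tr; rewrite opprD addrCA subrr addr0 normrN normrZ (le_lt_trans _ tr)//.
by rewrite -[leRHS]mulr1 ler_wpM2l.
Qed.

Lemma e1_norm (R : realType) : `|e1 : plane R| <= 1.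
Proof. by apply: pair_norm_le => /=; rewrite ?normr1 ?normr0. Qed.

Lemma e2_norm (R : realType) : `|e2 : plane R| <= 1.
Proof. by apply: pair_norm_le => /=; rewrite ?normr1 ?normr0. Qed.

(** Maximise w + eta |x|^2. At an interior maximum its second difference is nonpositive, whereas it
    is at least (4 - 1) eta t^2. The choice of eta keeps the perturbation below half of the supposed
    excess over M. *)
Lemma max_principle (R : realType) (K : set (plane R)) (w : plane R -> R) (M : R) :
  compact K -> (forall x, K x -> w @ within K (nbhs x) --> w x) ->
  (forall x, K x -> w x <= M \/ nbhs x K /\ sdharmonic w x) ->
  forall x, K x -> w x <= M.
Proof.
move=> cK cw H x1 Kx1; rewrite leNgt; apply/negP => wM.
pose q (x : plane R) := dot (x - 0) (x - 0).
have cq : continuous q by move=> z; apply: (smooth_continuous (smooth_shift 0 (smooth_dot R))).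
have [b Kb qb] : exists2 c, c \in K & forall t, t \in K -> q t <= q c.
  by apply: compact_EVT_max => //; [exists x1 | exact: continuous_subspaceT].
have q0 z : 0 <= q z by exact: dot_ge0.
have B0 : 0 < q b + 1 by rewrite ltr_wpDl.
pose eta := (w x1 - M) / 2 / (q b + 1).
have eta0 : 0 < eta by rewrite !divr_gt0// subr_gt0.
pose u x := w x + eta * q x.
have [c Kc uc] : exists2 c, c \in K & forall t, t \in K -> u t <= u c.
  apply: compact_EVT_max => //; first by exists x1.
  apply/subspace_continuousP => z Kz; apply: cvgD; first exact: cw.
  by apply: cvgMr; apply: cvg_within_filter; exact: cq.
have {Kc}Kc' : K c by rewrite inE in Kc.
have [wc|[nK hw]] := H c Kc'.
  have : u x1 <= u c by apply: uc; rewrite inE.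
  have hx : 0 <= eta * q x1 by rewrite mulr_ge0// ltW.
  have hc : eta * q c <= (w x1 - M) / 2.
    rewrite -[leRHS](divfK (lt0r_neq0 B0)) ler_wpM2l ?(ltW eta0)//.
    by rewrite (le_trans (qb c _)) ?inE// lerDl.
  by rewrite /u; lra.
have /nbhs_ballP[r0 r00 Hr0] := nK.
have [r r1 Hr] := hw eta eta0.
pose t := Num.min r r0 / 2.
have m0 : 0 < Num.min r r0 by rewrite lt_min r1.
have t0 : 0 < t by rewrite divr_gt0.
have tm : t < Num.min r r0 by rewrite ltr_pdivrMr// ltr_pMr// ltr1n.
have [tr tr0] : t < r /\ t < r0 by apply/andP; rewrite -lt_min.
have le s (v : plane R) : `|v| <= 1 -> `|s| < r0 -> u (s *: v + c) <= u c.
  by move=> v1 s0; apply: uc; rewrite inE; apply: Hr0; rewrite -ball_normE /=; exact: line_small.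
have tt : `|t| < r0 by rewrite gtr0_norm.
have tt' : `|- t| < r0 by rewrite normrN.
have := le _ _ (e1_norm R) tt; have := le _ _ (e1_norm R) tt'.
have := le _ _ (e2_norm R) tt; have := le _ _ (e2_norm R) tt'.
have := Hr _ t0 tr; have := SD_sqnorm eta 0 c t; rewrite -/q.
rewrite ler_norml => E /andP[h1 _] l1 l2 l3 l4.
have : SD u c t <= 0 by rewrite /SD; lra.
rewrite SD_add (_ : SD (fun x => eta * q x) c t = 4 * eta * t ^+ 2)//.
have : 0 < eta * t ^+ 2 by rewrite mulr_gt0// exprn_gt0.
by lra.
Qed.

Lemma nbhs_itv (R : realType) (x a b : R) : a < x < b -> nbhs x [set` `[a, b]].
Proof.
move=> xab; have /near_in_itvoo : x \in `]a, b[ by rewrite in_itv.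
by apply: filterS => y /=; exact: subset_itv_oo_cc.
Qed.

Lemma SD_reflect (R : realType) (u : plane R -> R) (a : R) (x : plane R) (t : R) :
  SD (fun z => u (a - z.1, z.2)) x t = SD u (a - x.1, x.2) t.
Proof.
have E1 (c : R) : (a - (c *: e1 + x).1, (c *: e1 + x).2) = (- c) *: e1 + (a - x.1, x.2).
  by apply: pair_ext; rewrite /= /GRing.scale /=; ring.
have E2 (c : R) : (a - (c *: e2 + x).1, (c *: e2 + x).2) = c *: e2 + (a - x.1, x.2).
  by apply: pair_ext; rewrite /= /GRing.scale /=; ring.
by rewrite /SD !E1 !E2 opprK; congr (_ - _ + _); exact: addrC.
Qed.

Lemma SD_barrier (R : realType) (k d a b : R) (x : plane R) (t : R) :
  SD (fun z => k * ((z.2 - b) ^+ 2 + (z.1 - a) * (d - (z.1 - a)))) x t = 0.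
Proof. by rewrite /SD /= /GRing.scale /=; ring. Qed.

(* Compare the odd part of u in the first variable with a harmonic quadratic barrier on a
   half square. *)
Lemma gradient_upper (R : realType) (u : plane R -> R) (x : plane R) (d M c t : R) : 0 < t -> t <= d ->
  (forall z, `|z - x| <= d -> [/\ {for z, continuous u}, sdharmonic u z & `|u z - c| <= M]) ->
  u (t *: e1 + x) - u ((- t) *: e1 + x) <= 4 * M * t / d.
Proof.
move=> t0 td H; have d0 : 0 < d := lt_le_trans t0 td.
have M0 : 0 <= M.
  by have [//|_ _ h] := H x; [rewrite subrr normr0 ltW | exact: le_trans h].
pose rho (z : plane R) : plane R := (2 * x.1 - z.1, z.2).
pose k := 2 * M / d ^+ 2.
have k0 : 0 <= k by apply: divr_ge0; [exact: mulr_ge0 | exact: sqr_ge0].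
have kd : k * d ^+ 2 = 2 * M by rewrite divfK// gt_eqF// exprn_gt0.
clearbody k.
(* The barrier has vanishing second differences. It is nonnegative on the side z.1 = x.1, where the
   odd part of u is zero, and at least k d^2 = 2 M, a bound for the odd part, on the other three
   sides. *)
pose b (z : plane R) := k * ((z.2 - x.2) ^+ 2 + (z.1 - x.1) * (2 * d - (z.1 - x.1))).
pose w (z : plane R) := u z + (-1) * u (rho z) + (-1) * b z.
pose K := [set` `[x.1, x.1 + d]] `*` [set` `[x.2 - d, x.2 + d]].
have cK : compact K by apply: compact_setX; exact: segment_compact.
have KP z : K z <-> (x.1 <= z.1 <= x.1 + d) /\ (x.2 - d <= z.2 <= x.2 + d).
  by rewrite /K /= !in_itv.
have Kx z : K z -> `|z - x| <= d /\ `|rho z - x| <= d.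
  move/KP => [/andP[h1 h2] /andP[h3 h4]].
  by split; apply: pair_norm_le; rewrite /= ler_norml; lra.
have wK : forall z, K z -> w z <= 0.
  apply: (max_principle cK) => z Kz; have [zx rx] := Kx z Kz.
    have [cz _ _] := H z zx; have [cr _ _] := H _ rx.
    apply: cvg_within_filter; apply: cvgD; first apply: cvgD => //.
      apply: cvgMr; apply: (@continuous_comp _ _ _ rho u) => //.
      apply: continuous_pair; last by exact: cvg_snd.
      by apply: cvgB; [exact: cvg_cst | exact: cvg_fst].
    apply: cvgMr; apply: cvgMr.
    have c1 : (fun z : plane R => z.1 - x.1) @ z --> z.1 - x.1.
      by apply: cvgB; [exact: cvg_fst | exact: cvg_cst].
    have c2 : (fun z : plane R => z.2 - x.2) @ z --> z.2 - x.2.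
      by apply: cvgB; [exact: cvg_snd | exact: cvg_cst].
    apply: cvgD; first by apply: cvgM.
    by apply: cvgM => //; apply: cvgB => //; exact: cvg_cst.
  have [_ hz mz] := H z zx; have [_ hr mr] := H _ rx.
  have /KP[/andP[h1 h2] /andP[h3 h4]] := Kz.
  have uu : u z - u (rho z) <= 2 * M.
    move: mz mr; rewrite !ler_norml => /andP[? ?] /andP[? ?]; lra.
  have [E|n1] := eqVneq z.1 x.1.
    left; rewrite /w /b (_ : rho z = z); last by apply: pair_ext => //=; rewrite E; ring.
    rewrite E; suff : 0 <= k * ((z.2 - x.2) ^+ 2) by lra.
    by rewrite mulr_ge0// sqr_ge0.
  have sq : 0 <= k * (z.2 - x.2) ^+ 2 by rewrite mulr_ge0// sqr_ge0.
  have sp : 0 <= k * ((z.1 - x.1) * (2 * d - (z.1 - x.1))).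
    by rewrite mulr_ge0// mulr_ge0//; lra.
  have [E|n2] := eqVneq (z.1 - x.1) d.
    left; rewrite /w /b mulrDr E; move: sq kd uu; rewrite expr2; lra.
  have bb : (z.2 - x.2) ^+ 2 = d ^+ 2 -> w z <= 0.
    by move=> E; rewrite /w /b mulrDr E kd; lra.
  have [E|n3] := eqVneq (z.2 - x.2) d; first by left; apply: bb; rewrite E.
  have [E|n4] := eqVneq (z.2 - x.2) (- d); first by left; apply: bb; rewrite E sqrrN.
  right; split.
    exists ([set` `[x.1, x.1 + d]], [set` `[x.2 - d, x.2 + d]]) => //=; split; apply: nbhs_itv.
      rewrite !lt_neqAle h1 h2 eq_sym n1 !andbT; apply: contra n2 => /eqP ->; apply/eqP; ring.
    rewrite !lt_neqAle h3 h4 !andbT; apply/andP; split.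
      by apply: contra n4 => /eqP <-; apply/eqP; ring.
    by apply: contra n3 => /eqP ->; apply/eqP; ring.
  apply: sdharmonic_add; first apply: sdharmonic_add => //.
    by apply: sdharmonic_scale => e /hr[r r0 Hr]; exists r => // s s0 sr; rewrite SD_reflect; exact: Hr.
  apply: sdharmonic_scale => e e0; exists 1 => // s s0 _.
  by rewrite SD_barrier normr0 mulr_ge0// ?ltW// exprn_gt0.
have : w (t *: e1 + x) <= 0.
  by apply: wK; apply/KP => /=; rewrite /GRing.scale /=; split; lra.
rewrite /w /b (_ : rho _ = (- t) *: e1 + x); last first.
  by apply: pair_ext; rewrite /= /GRing.scale /=; ring.
rewrite /= /GRing.scale /= => h.
suff : k * (t * (2 * d)) <= 4 * M * t / d.
  have : 0 <= k * t ^+ 2 by rewrite mulr_ge0// sqr_ge0.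
  move: h; rewrite expr2; lra.
rewrite ler_pdivlMr// (_ : _ * _ * d = k * d ^+ 2 * 2 * t); last by ring.
by rewrite kd; lra.
Qed.

Lemma gradient_estimate (R : realType) (u : plane R -> R) (x : plane R) (d M c t : R) : 0 < t -> t <= d ->
  (forall z, `|z - x| <= d -> [/\ {for z, continuous u}, sdharmonic u z & `|u z - c| <= M]) ->
  `|u (t *: e1 + x) - u ((- t) *: e1 + x)| <= 4 * M * t / d.
Proof.
move=> t0 td H; rewrite ler_norml; apply/andP; split; last exact: (gradient_upper (c := c)).
pose v z := (-1) * u z.
have : v (t *: e1 + x) - v ((- t) *: e1 + x) <= 4 * M * t / d.
  apply: (gradient_upper (c := - c)) => // z /H[cz hz mz]; split.
  - by apply: cvgMr.
  - exact: sdharmonic_scale.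
  - by rewrite /v mulN1r -opprD normrN.
by rewrite /v; lra.
Qed.

Lemma gradient_estimate2 (R : realType) (u : plane R -> R) (x : plane R) (d M c t : R) : 0 < t -> t <= d ->
  (forall z, `|z - x| <= d -> [/\ {for z, continuous u}, sdharmonic u z & `|u z - c| <= M]) ->
  `|u (t *: e2 + x) - u ((- t) *: e2 + x)| <= 4 * M * t / d.
Proof.
move=> t0 td H; pose v (z : plane R) := u (z.2, z.1).
have E (s : R) (z : plane R) : ((s *: e1 + z).2, (s *: e1 + z).1) = s *: e2 + (z.2, z.1).
  by apply: pair_ext; rewrite /= /GRing.scale /=; ring.
have E' (s : R) (z : plane R) : ((s *: e2 + z).2, (s *: e2 + z).1) = s *: e1 + (z.2, z.1).
  by apply: pair_ext; rewrite /= /GRing.scale /=; ring.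
have := @gradient_estimate _ v (x.2, x.1) d M c t t0 td; rewrite /v !E -!surjective_pairing.
apply=> z zx; have [|cz hz mz] := H (z.2, z.1).
  by apply: pair_norm_le; rewrite /=; [have := snd_le (z - (x.2, x.1)) | have := fst_le (z - (x.2, x.1))];
    move=> /= h; exact: le_trans h zx.
split => //.
    apply: (@continuous_comp _ _ _ (fun z : plane R => (z.2, z.1)) u) => //.
    by apply: continuous_pair; [exact: cvg_snd | exact: cvg_fst].
  move=> e /hz[r r0 Hr]; exists r => // s s0 sr.
  by have := Hr s s0 sr; rewrite /SD !E !E' addrC.
Qed.

(** * Boundary charts *)

Lemma within_cvgP (R : realType) (V : normedModType R) (A : set V) (f : V -> R) (x : V) (l : R) :
  f @ within A (nbhs x) --> l <->
  forall e, 0 < e -> exists2 r : R, 0 < r & forall y, A y -> `|y - x| < r -> `|f y - l| < e.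
Proof.
split=> [H e e0|H].
  have /cvgrPdist_lt/(_ e e0) := H; rewrite near_withinE => /nbhs_ballP[r /= r0 Hr].
  by exists r => // y Ay yx; rewrite distrC; apply: Hr => //; rewrite -ball_normE /= distrC.
apply/cvgrPdist_lt => e /H[r r0 Hr]; rewrite near_withinE; apply/nbhs_ballP; exists r => //= y.
by rewrite -ball_normE /= distrC => yx Ay; rewrite distrC; exact: Hr.
Qed.

Lemma continuousP_eps (R : realType) (V : normedModType R) (f : V -> R) (x : V) :
  {for x, continuous f} <->
  forall e, 0 < e -> exists2 r : R, 0 < r & forall y, `|y - x| < r -> `|f y - f x| < e.
Proof.
split=> [H e e0|H].
  have /cvgrPdist_lt/(_ e e0)/nbhs_ballP[r /= r0 Hr] := H.
  by exists r => // y yx; rewrite distrC; apply: Hr => //; rewrite -ball_normE /= distrC.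
apply/cvgrPdist_lt => e /H[r r0 Hr]; apply/nbhs_ballP; exists r => //= y.
by rewrite -ball_normE /= distrC => yx; rewrite distrC; exact: Hr.
Qed.

Lemma sdiff_translate (R : realType) (V : normedModType R) (f : V -> R) (p x : V) (L : V -> R) :
  sdiff f (x - p) L -> sdiff (fun z => f (z - p)) x L.
Proof.
move=> [lL bL H]; split => // e /H[r r0 Hr]; exists r => // x1 x2 h1 h2.
have E (a b : V) : (a - p) - (b - p) = a - b by rewrite opprB addrA subrK.
by have := Hr (x1 - p) (x2 - p); rewrite !E; exact.
Qed.

Lemma sdiff_derive (R : realType) (V : normedModType R) (f : V -> R) (x : V) :
  (exists L, sdiff f x L) -> sdiff f x (fun v => 'D_v f x).
Proof.
move=> [L sL]; rewrite (_ : (fun v => _) = L)//; apply/funext => v.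
by have [_ ->] := sdiff_is_derive v sL.
Qed.

Lemma sdiff_C1 (R : realType) (f : R -> R) (t : R) : Ck 1 [set: R] f ->
  sdiff f t (fun v => v * 'D_1 f t).
Proof.
move=> [_ H]; have [dv [cd _]] := H 1.
have := @sdiff_partials R R 1 (fun=> 1) (fun=> id) f (fun _ y => 'D_1 f y) t.
rewrite (_ : (fun v : R => \sum_(i < 1) _) = fun v => v * 'D_1 f t); last first.
  by apply/funext => v; rewrite big_ord1.
apply => //; first by move=> _; rewrite normr1.
- by move=> v; rewrite big_ord1 [RHS]mulr1.
- by move=> _; exact: cd.
- by move=> _; near=> y; apply/derivableP; exact: dv.
Unshelve. all: by end_near. Qed.

Lemma is_derive_curve (R : realType) (V : normedModType R) (f : V -> R) (c : R -> V) (s : R) (v : V) (L : V -> R) :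
  sdiff f (c s) L -> is_derive s (1 : R) c v -> is_derive s (1 : R) (fun t => f (c t)) (L v).
Proof.
move=> sf [dc Ec]; have [df Ef] := sdiff_diff sf.
have dcs : differentiable c s by apply/derivable1_diffP.
have dfc : differentiable (f \o c) s by exact: differentiable_comp.
have H : derivable (f \o c) s 1 by exact: diff_derivable.
split; first exact: H.
rewrite -[LHS]/('D_1 (f \o c) s) deriveE// diff_comp//= -Ef; congr ('d f (c s) _).
by rewrite -deriveE.
Qed.

Definition perp (R : realType) (e : plane R) : plane R := (- e.2, e.1).

Definition graph_point (R : realType) (e p : plane R) (s h : R) : plane R :=
  p + (s *: e + h *: perp e).

Lemma dot_add (R : realType) (u v w : plane R) : dot (u + v) w = dot u w + dot v w.
Proof. by rewrite /dot /=; ring. Qed.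

Lemma dot_scale (R : realType) (c : R) (v w : plane R) : dot (c *: v) w = c * dot v w.
Proof. by rewrite /dot /= /GRing.scale /=; ring. Qed.

Lemma dot_scaler (R : realType) (c : R) (v w : plane R) : dot w (c *: v) = c * dot w v.
Proof. by rewrite /dot /= /GRing.scale /=; ring. Qed.

Lemma dot_opp (R : realType) (v w : plane R) : dot (- v) w = - dot v w.
Proof. by rewrite /dot /=; ring. Qed.

Lemma dot_perp (R : realType) (e : plane R) : dot (perp e) (perp e) = dot e e.
Proof. by rewrite /dot /=; ring. Qed.

Lemma dot_e_perp (R : realType) (e : plane R) : dot e (perp e) = 0.
Proof. by rewrite /dot /=; ring. Qed.

Lemma dot_perp_e (R : realType) (e : plane R) : dot (perp e) e = 0.
Proof. by rewrite /dot /=; ring. Qed.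

Lemma graph_point_coord (R : realType) (e p : plane R) (s h : R) : dot e e = 1 ->
  dot (graph_point e p s h - p) e = s /\ dot (graph_point e p s h - p) (perp e) = h.
Proof.
move=> ee; rewrite /graph_point addrC addKr !dot_add !dot_scale dot_perp_e dot_e_perp dot_perp ee.
by rewrite !mulr1 !mulr0 addr0 add0r.
Qed.

Lemma graph_pointE (R : realType) (e p x : plane R) : dot e e = 1 ->
  x = graph_point e p (dot (x - p) e) (dot (x - p) (perp e)).
Proof.
rewrite /graph_point /dot => E.
apply: pair_ext; rewrite /= /GRing.scale /=.
  rewrite (_ : _ + _ = p.1 + (x.1 - p.1) * (e.1 * e.1 + e.2 * e.2)); last by ring.
  by rewrite E; ring.
rewrite (_ : _ + _ = p.2 + (x.2 - p.2) * (e.1 * e.1 + e.2 * e.2)); last by ring.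
by rewrite E; ring.
Qed.

Lemma norm_sq_le (R : realType) (v : plane R) : `|v| ^+ 2 <= dot v v.
Proof.
rewrite (_ : `|v| = Num.max `|v.1| `|v.2|)// /dot -!expr2.
have a := sqr_ge0 v.1; have b := sqr_ge0 v.2.
by case: (leP `|v.1| `|v.2|) => _; rewrite real_normK ?num_real//; lra.
Qed.

Lemma dot_le (R : realType) (u v : plane R) : `|dot u v| <= 2 * (`|u| * `|v|).
Proof.
rewrite mulrDl mul1r (le_trans (ler_normD _ _))// !normrM.
by apply: lerD; apply: ler_pM => //; rewrite ?fst_le ?snd_le.
Qed.

Lemma dot_sq_le (R : realType) (v : plane R) : dot v v <= 2 * `|v| ^+ 2.
Proof. by have := dot_le v v; rewrite (ger0_norm (dot_ge0 v)) -expr2. Qed.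

Lemma enormE (R : realType) (v : plane R) : enorm v = 1 <-> dot v v = 1.
Proof.
split=> [h|h]; last by rewrite /enorm h sqrtr1.
by rewrite -(sqr_sqrtr (dot_ge0 v)) -/(enorm v) h expr1n.
Qed.

Lemma enorm_le (R : realType) (v : plane R) : enorm v <= 2 * `|v|.
Proof.
rewrite -(@ler_pXn2r _ 2)// ?nnegrE ?sqrtr_ge0 ?mulr_ge0// sqr_sqrtr ?dot_ge0//.
rewrite (le_trans (dot_sq_le v))// exprMn; have := sqr_ge0 `|v|; lra.
Qed.

Lemma unit_norm_le (R : realType) (v : plane R) : dot v v = 1 -> `|v| <= 1.
Proof.
by move=> vv; rewrite -(@ler_pXn2r _ 2)// ?nnegrE// expr1n -vv norm_sq_le.
Qed.

Lemma perp_norm (R : realType) (v : plane R) : `|perp v| = `|v|.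
Proof.
by rewrite (_ : `|perp v| = Num.max `|- v.2| `|v.1|)// normrN maxC.
Qed.

Lemma bdE (R : realType) (Om : set (plane R)) (x : plane R) : open Om -> bd Om x -> closure Om x /\ ~ Om x.
Proof. by move=> oO [cx nx]; split => // Ox; apply: nx; rewrite (interior_id _).1. Qed.

Lemma bd_intro (R : realType) (Om : set (plane R)) (x : plane R) : closure Om x -> ~ Om x -> bd Om x.
Proof. by move=> cx nx; split => // /interior_subset. Qed.

Lemma closure_eps (R : realType) (Om : set (plane R)) (x : plane R) (r : R) : closure Om x -> 0 < r ->
  exists2 y, Om y & `|y - x| < r.
Proof.
move=> cx r0; have [y [Oy]] := cx _ (nbhsx_ballx x r r0).
by rewrite -ball_normE /= distrC => h; exists y.
Qed.

Lemma eps_closure (R : realType) (Om : set (plane R)) (x : plane R) :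
  (forall r : R, 0 < r -> exists2 y, Om y & `|y - x| < r) -> closure Om x.
Proof.
move=> H B /nbhs_ballP[r /= r0 Hr]; have [y Oy yx] := H r r0; exists y; split => //.
by apply: Hr; rewrite -ball_normE /= distrC.
Qed.

Definition graph_chart (R : realType) (Om : set (plane R)) (p e : plane R) (f : R -> R) (r : R) : Prop :=
  [/\ dot e e = 1, 0 < r, Ck 1 [set: R] f, f 0 = 0 &
      forall x, `|x - p| < r -> (Om x <-> f (dot (x - p) e) < dot (x - p) (perp e))].

Lemma C1_continuous (R : realType) (f : R -> R) : Ck 1 [set: R] f -> continuous f.
Proof. by move=> [cf _] t; exact: cf. Qed.

Lemma dotl_continuous (R : realType) (p v : plane R) : continuous (fun z : plane R => dot (z - p) v).
Proof.
move=> x; apply/continuousP_eps => e e0; exists (e / (2 * `|v| + 1)).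
  by rewrite divr_gt0// ltr_wpDl// mulr_ge0.
have v0 : 0 < 2 * `|v| + 1 by rewrite ltr_wpDl// mulr_ge0.
move=> y; rewrite ltr_pdivlMr// => yx.
have -> : dot (y - p) v - dot (x - p) v = dot (y - x) v by rewrite /dot /=; ring.
rewrite (le_lt_trans (dot_le _ _))// (le_lt_trans _ yx)//.
by have := normr_ge0 (y - x); nra.
Qed.

Lemma C3_graph_chart (R : realType) (Om : set (plane R)) (p : plane R) : open Om -> C3_boundary Om -> bd Om p ->
  exists e f r, graph_chart Om p e f r.
Proof.
move=> oO C3 bp; have [e [r [f [ee r0 cf H]]]] := C3 p bp.
have {}ee : dot e e = 1 by apply/enormE.
(* The radius is halved because the Euclidean norm is at most twice the max norm. *)
exists e, f, (r / 2); split => //; first by rewrite divr_gt0.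
- by apply: Ck_S; exact: Ck_S.
- have [cp np] := bdE oO bp.
  have f0 : continuous f by have [c _] := cf; move=> t; exact: c.
  apply/eqP; rewrite eq_le; apply/andP; split; last first.
    rewrite leNgt; apply/negP => f00; apply: np; apply/H; first by rewrite subrr /enorm dot0 sqrtr0.
    by rewrite subrr {1}/dot /= !mul0r addr0 /dot /= !mul0r addr0.
  rewrite leNgt; apply/negP => f00.
  have : continuous (fun z : plane R => f (dot (z - p) e) - dot (z - p) (perp e)).
    move=> z; apply: cvgB; last exact: dotl_continuous.
    by apply: (@continuous_comp _ _ _ (fun z : plane R => dot (z - p) e) f); [exact: dotl_continuous | exact: f0].
  move=> /(_ p)/continuousP_eps/(_ _ f00)[d d0 Hd].
  have m0 : 0 < Num.min d (r / 2) by rewrite lt_min d0 divr_gt0.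
  have [y Oy] := closure_eps cp m0; rewrite lt_min => /andP[yd yr].
  have := Hd y yd; rewrite subrr /dot /= !mul0r !addr0 subr0 -/(dot _ _).
  have /H : enorm (y - p) < r.
    by rewrite (le_lt_trans (enorm_le _))// -ltr_pdivlMl// mulrC.
  move=> [/(_ Oy) h _]; rewrite ltr_norml => /andP[h1 _].
  move: h h1; rewrite /dot /=; lra.
- move=> x xp; apply: H; rewrite (le_lt_trans (enorm_le _))// -ltr_pdivlMl// mulrC//.
Qed.

Lemma graph_boundary (R : realType) (Om : set (plane R)) (p e : plane R) (f : R -> R) (r : R) :
  open Om -> graph_chart Om p e f r -> exists2 d : R, 0 < d &
  (forall s h, `|s| < d -> 0 < h -> h < d -> Om (graph_point e p s (f s + h))) /\
  (forall s, `|s| < d -> bd Om (graph_point e p s (f s))).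
Proof.
move=> oO [ee r0 cf f0 H].
have fc : continuous f by exact: C1_continuous.
have /continuousP_eps/(_ (r / 3)) := fc 0.
rewrite divr_gt0// => /(_ isT)[d d0 Hd].
have gp s h : `|s| < d -> `|s| < r / 3 -> `|h| < r / 3 -> `|graph_point e p s (f s + h) - p| < r.
  move=> sd sr hr; have := Hd s; rewrite !subr0 f0 subr0 => /(_ sd) fr.
  rewrite /graph_point addrC addKr (le_lt_trans (ler_normD _ _))// !normrZ perp_norm.
  have e1' := unit_norm_le ee; have n0 := normr_ge0 e.
  have hh := ler_normD (f s) h; have := normr_ge0 s; have := normr_ge0 (f s + h); nra.
have O s h : `|s| < d -> `|s| < r / 3 -> `|h| < r / 3 -> Om (graph_point e p s (f s + h)) <-> 0 < h.
  move=> sd sr hr; have /H := gp s h sd sr hr.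
  by have [-> ->] := graph_point_coord p s (f s + h) ee; rewrite ltrDl.
exists (Num.min d (r / 3)); first by rewrite lt_min d0 divr_gt0.
have A s h : `|s| < Num.min d (r / 3) -> 0 < h -> h < Num.min d (r / 3) -> Om (graph_point e p s (f s + h)).
  by rewrite !lt_min => /andP[s1 s2] h0 /andP[h1 h2]; apply/O => //; rewrite gtr0_norm.
split=> // s sm; apply: bd_intro.
  apply: eps_closure => c c0; pose h := Num.min c (Num.min d (r / 3)) / 2.
  have m0 : 0 < Num.min c (Num.min d (r / 3)) by rewrite !lt_min c0 d0 divr_gt0.
  have h0 : 0 < h by rewrite divr_gt0.
  have hm : h < Num.min c (Num.min d (r / 3)) by rewrite ltr_pdivrMr// ltr_pMr// ltr1n.
  clearbody h; move: hm; rewrite lt_min => /andP[hc hm].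
  exists (graph_point e p s (f s + h)); first exact: A.
  rewrite (_ : _ - _ = h *: perp e); last by apply: pair_ext; rewrite /= /GRing.scale /=; ring.
  rewrite normrZ perp_norm gtr0_norm// (le_lt_trans _ hc)//.
  by have := unit_norm_le ee; have := normr_ge0 e; nra.
move: sm; rewrite lt_min => /andP[s1 s2].
rewrite -[f s]addr0 => /O; rewrite ltxx normr0 divr_gt0//.
by move=> /(_ s1 s2 isT).
Qed.

Lemma graph_boundary_conv (R : realType) (Om : set (plane R)) (p e : plane R) (f : R -> R) (r : R) (x : plane R) :
  open Om -> graph_chart Om p e f r -> bd Om x -> `|x - p| < r ->
  f (dot (x - p) e) = dot (x - p) (perp e).
Proof.
move=> oO [ee r0 cf f0 H] bx xp; have [cx nx] := bdE oO bx.
apply/eqP; rewrite eq_le; apply/andP; split; last first.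
  by rewrite leNgt; apply/negP => h; apply: nx; apply/H.
rewrite leNgt -subr_gt0; apply/negP => h0.
have : continuous (fun z : plane R => f (dot (z - p) e) - dot (z - p) (perp e)).
  move=> z; apply: cvgB; last exact: dotl_continuous.
  apply: (@continuous_comp _ _ _ (fun z : plane R => dot (z - p) e) f); first exact: dotl_continuous.
  exact: C1_continuous.
move=> /(_ x)/continuousP_eps/(_ _ h0)[d d0 Hd].
have m0 : 0 < Num.min d (r - `|x - p|) by rewrite lt_min d0 subr_gt0.
have [y Oy] := closure_eps cx m0; rewrite lt_min => /andP[yd yr].
have yp : `|y - p| < r.
  by rewrite -(subrKA x) (le_lt_trans (ler_normD _ _))// -ltrBrDr.
have /H[/(_ Oy) h1 _] := yp.
by have := Hd y yd; rewrite ltr_norml => /andP[h2 _]; lra.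
Qed.

(** * Limits of the Green's function and its derivatives at the boundary *)

Lemma kernel_closure_cont (R : realType) (Om : set (plane R)) (G : plane R * plane R -> R) k (q : plane R * plane R) :
  Ck_up_to k (F2 Om) (F2 (closure Om)) G -> F2 (closure Om) q -> forall e, 0 < e ->
  exists2 r : R, 0 < r & forall q', F2 (closure Om) q' -> `|q' - q| < r -> `|G q' - G q| < e.
Proof. by move=> [_ _ /subspace_continuousP H] Fq; apply/within_cvgP; exact: H. Qed.

Lemma kernel_closure_derive (R : realType) (Om : set (plane R)) (G : plane R * plane R -> R)
    (q v : plane R * plane R) :
  Ck_up_to 2 (F2 Om) (F2 (closure Om)) G -> F2 (closure Om) q -> exists l : R, forall e, 0 < e ->
  exists2 r : R, 0 < r & forall q', F2 Om q' -> `|q' - q| < r -> `|'D_v G q' - l| < e.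
Proof.
move=> [_ [_ /(_ v)[H _]] _] Fq; have /cvg_ex[l] := H q Fq.
by move=> /within_cvgP Hl; exists l.
Qed.

Lemma kernel_sdiff_F2 (R : realType) (Om : set (plane R)) (G : plane R * plane R -> R) (q : plane R * plane R) :
  open Om -> Ck_up_to 2 (F2 Om) (F2 (closure Om)) G -> F2 Om q -> sdiff G q (fun v => 'D_v G q).
Proof.
move=> oO [/Ck_S cG _ _] Fq; apply: sdiff_derive; eexists.
exact: Ck1_sdiff (open_F2 oO) cG Fq.
Qed.

Lemma kernel_derive_coord (R : realType) (Om : set (plane R)) (G : plane R * plane R -> R) (q v : plane R * plane R) :
  open Om -> Ck_up_to 2 (F2 Om) (F2 (closure Om)) G -> F2 Om q ->
  'D_v G q = \sum_i coord4 i v * 'D_(basis4 R i) G q.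
Proof.
move=> oO [/Ck_S cG _ _] Fq.
by have [_ ->] := sdiff_is_derive v (Ck1_sdiff (open_F2 oO) cG Fq).
Qed.

Lemma kernel_derive_bounded (R : realType) (Om : set (plane R)) (G : plane R * plane R -> R) (q : plane R * plane R) :
  open Om -> Ck_up_to 2 (F2 Om) (F2 (closure Om)) G -> F2 (closure Om) q ->
  exists2 C : R, 0 < C & exists2 r : R, 0 < r &
    forall q' v, F2 Om q' -> `|q' - q| < r -> `|'D_v G q'| <= C * `|v|.
Proof.
move=> oO cG Fq.
have /(_ _)/cid-/all_sig[l Hl] := fun i => kernel_closure_derive (basis4 R i) cG Fq.
have /(_ _)/cid2-/all_sig2[r r0 Hr] := fun i => Hl i 1 ltr01.
exists (1 + \sum_i (`|l i| + 1)).
  by rewrite ltr_wpDr// sumr_ge0// => i _; rewrite addr_ge0.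
exists (\big[Order.min/1]_i r i); first by apply: lt_bigmin => // i _; exact: r0.
move=> q' v Fq' qr; rewrite (kernel_derive_coord v oO cG Fq') mulrDl mulr_suml ler_wpDl ?mul1r//.
rewrite (le_trans (ler_norm_sum _ _ _))//; apply: ler_sum => i _.
rewrite normrM mulrC ler_pM ?coord4_le//.
have qi : `|q' - q| < r i by apply: lt_le_trans qr _; exact: bigmin_le_cond.
have h := Hr i q' Fq' qi.
have -> : 'D_(basis4 R i) G q' = ('D_(basis4 R i) G q' - l i) + l i by rewrite subrK.
by rewrite (le_trans (ler_normD _ _))// addrC lerD// ltW.
Qed.

Lemma derive_slice (R : realType) (f : plane R * plane R -> R) (x y v : plane R) :
  'D_v (fun w => f (w, y)) x = 'D_((v, 0) : plane R * plane R) f (x, y).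
Proof.
rewrite /derive.
have -> // : (fun h : R => h^-1 *: (((fun w => f (w, y)) \o shift x) (h *: v) - f (x, y))) =
  (fun h => h^-1 *: ((f \o shift (x, y)) (h *: ((v, 0) : plane R * plane R)) - f (x, y))).
apply/funext => h /=; congr (_ *: (f _ - _)).
by apply: pair_ext => //=; rewrite scaler0 add0r.
Qed.

Lemma within_proper (R : realType) (Om : set (plane R)) (x : plane R) : closure Om x ->
  ProperFilter (within Om (nbhs x)).
Proof.
move=> cx; apply: Build_ProperFilter_ex => B; rewrite /within /= => /nbhs_ballP[r /= r0 HB].
by have [y Oy yx] := closure_eps cx r0; exists y; apply: HB => //; rewrite -ball_normE /= distrC.
Qed.

(** [gradx] is a limit in the first variable with y fixed. The extension of the derivatives of G
    supplies a limit in both variables, and the two agree since the filter within Om is proper at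
    points of the closure. *)
Lemma gradx_lim (R : realType) (Om : set (plane R)) (G : plane R * plane R -> R) (x y : plane R) :
  Ck_up_to 2 (F2 Om) (F2 (closure Om)) G -> closure Om x -> Om y -> x <> y ->
  (forall e, 0 < e -> exists2 r : R, 0 < r & forall q, F2 Om q -> `|q - (x, y)| < r ->
      `|'D_((e1, 0) : plane R * plane R) G q - (gradx Om G x y).1| < e) /\
  (forall e, 0 < e -> exists2 r : R, 0 < r & forall q, F2 Om q -> `|q - (x, y)| < r ->
      `|'D_((e2, 0) : plane R * plane R) G q - (gradx Om G x y).2| < e).
Proof.
move=> cG cx Oy xy; have cy : closure Om y by exact: subset_closure.
have Fq : F2 (closure Om) (x, y) by [].
have PF := within_proper cx.
have xy0 : 0 < `|x - y| by rewrite normr_gt0 subr_eq0; exact/eqP.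
suff S (v : plane R) : forall e, 0 < e -> exists2 r : R, 0 < r & forall q, F2 Om q -> `|q - (x, y)| < r ->
    `|'D_((v, 0) : plane R * plane R) G q - lim ('D_v (fun w => G (w, y)) u @[u --> within Om (nbhs x)])| < e.
  by split; exact: S.
have [l Hl] := kernel_closure_derive (v, 0) cG Fq.
rewrite (_ : lim _ = l)//; apply: cvg_lim => //; apply/within_cvgP => e /Hl[r r0 Hr].
exists (Num.min r `|x - y|); first by rewrite lt_min r0.
move=> u Ou; rewrite lt_min => /andP[ur uy]; rewrite derive_slice; apply: Hr.
  split => //= E; move: uy; rewrite E distrC ltxx//.
by apply: pair_norm_lt => //=; rewrite subrr normr0.
Qed.

Lemma graph_point_derive (R : realType) (e p : plane R) (f : R -> R) (h s : R) :
  derivable f s 1 ->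
  is_derive s (1 : R) (fun s => graph_point e p s (f s + h)) (e + 'D_1 f s *: perp e).
Proof.
move=> df; apply: is_derive_cvg.
have -> : (fun t : R => t^-1 *: (graph_point e p (t *: 1 + s) (f (t *: 1 + s) + h) - graph_point e p s (f s + h))) =
    (fun t : R => (t^-1 * t) *: e + (t^-1 *: (f (t *: 1 + s) - f s)) *: perp e).
  apply/funext => t; apply: pair_ext; rewrite /= /GRing.scale /=; ring.
apply: cvgD.
  rewrite -[X in _ --> X]scale1r; apply: cvgZr_tmp; apply: cvg_near_cst.
  by near do rewrite mulVf//; exact: nbhs_dnbhs_neq.
by apply: cvgZr_tmp; exact: df.
Unshelve. all: by end_near. Qed.

Lemma is_derive_scale_dir (R : realType) (V : normedModType R) (g : R -> V) (s c : R) (v : V) :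
  is_derive s (1 : R) g v -> is_derive s c g (c *: v).
Proof.
move=> [dg Eg]; have dgs : differentiable g s by apply/derivable1_diffP.
split; first exact: diff_derivable.
by rewrite deriveE// -Eg (deriveE _ dgs) -linearZ /= [c *: 1]mulr1.
Qed.

Definition tangential_Green (R : realType) (Om : set (plane R)) (G : plane R * plane R -> R) : Prop :=
  forall x y tau, bd Om x -> Om y -> unit_tangent Om x tau -> dot (gradx Om G x y) tau = 0.

Lemma graph_tangent (R : realType) (Om : set (plane R)) (G : plane R * plane R -> R) (p e : plane R)
    (f : R -> R) (d s : R) (y : plane R) :
  tangential_Green Om G -> dot e e = 1 -> Ck 1 [set: R] f -> `|s| < d ->
  (forall s, `|s| < d -> bd Om (graph_point e p s (f s))) -> Om y ->
  dot (gradx Om G (graph_point e p s (f s)) y) (e + 'D_1 f s *: perp e) = 0.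
Proof.
move=> tG ee [_ /(_ 1)[df _]] sd H Oy.
pose v := e + 'D_1 f s *: perp e; rewrite -/v.
have v0 : 0 < dot v v.
  rewrite (_ : dot v v = dot e e * (1 + 'D_1 f s ^+ 2)); last first.
    by rewrite /v /dot /= /GRing.scale /=; ring.
  by rewrite ee mul1r ltr_wpDr ?sqr_ge0.
pose c := (Num.sqrt (dot v v))^-1.
have c0 : 0 < c by rewrite invr_gt0 sqrtr_gt0.
have : dot (gradx Om G (graph_point e p s (f s)) y) (c *: v) = 0.
  apply: tG => //; first exact: H.
  split.
    apply/enormE; rewrite (_ : dot _ _ = c ^+ 2 * dot v v); last by rewrite /dot /= /GRing.scale /=; ring.
    by rewrite /c exprVn sqr_sqrtr ?mulVf ?gt_eqF// ltW.
  exists (fun t => graph_point e p (t *: c + s) (f (t *: c + s))); split.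
  - by rewrite scale0r add0r.
  - have s0 : 0 < (d - `|s|) / c by rewrite divr_gt0// subr_gt0.
    have : \forall t \near (0 : R), `|t| < (d - `|s|) / c by exact: nbhs0_lt.
    apply: filterS => t tc; apply: H.
    by rewrite (le_lt_trans (ler_normD _ _))// -ltrBrDr normrM (gtr0_norm c0) -ltr_pdivlMr.
  - have := graph_point_derive e p 0 (df s I) => /(is_derive_scale_dir c)/is_derive_line.
   
    rewrite -/v; congr is_derive.
    by apply/funext => t; rewrite addr0.
by rewrite dot_scaler => /eqP; rewrite mulf_eq0 gt_eqF//= => /eqP.
Qed.

Lemma sdiff_slice1 (R : realType) (V W : normedModType R) (f : V * W -> R) (z : V) (p : W) (L : V * W -> R) :
  sdiff f (z, p) L -> sdiff (fun q => f (q, p)) z (fun v => L (v, 0)).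
Proof.
have nE (v : V) : `|(v, 0 : W)| = `|v|.
  by rewrite (_ : `|_| = Num.max `|v| `|0 : W|)// normr0; apply/max_idPl.
have sE (a b : V) : (a, p) - (b, p) = (a - b, 0 : W) by apply: pair_ext => //=; rewrite subrr.
move=> [lL [C bL] H]; split.
- move=> a u v; rewrite -lL; congr L; apply: pair_ext => //=.
  by rewrite scaler0 addr0.
- by exists C => v; rewrite (le_trans (bL _))// nE.
- move=> e /H[r r0 Hr]; exists r => // x1 x2 h1 h2.
  by have := Hr (x1, p) (x2, p); rewrite !sE !nE; exact.
Qed.

Lemma dot_perturb (R : realType) (a1 a2 b1 b2 x1 x2 l1 l2 ep : R) :
  `|a1 - b1| <= ep -> `|a2 - b2| <= ep -> `|x1 - l1| <= ep -> `|x2 - l2| <= ep -> ep <= 1 ->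
  l1 * b1 + l2 * b2 = 0 -> `|a1 * x1 + a2 * x2| <= ep * (`|l1| + `|l2| + `|b1| + `|b2| + 3).
Proof.
move=> h1 h2 h3 h4 ep1 E.
have -> : a1 * x1 + a2 * x2 = (a1 - b1) * (x1 - l1) + (a1 - b1) * l1 + b1 * (x1 - l1) +
    ((a2 - b2) * (x2 - l2) + (a2 - b2) * l2 + b2 * (x2 - l2)) + (l1 * b1 + l2 * b2) by ring.
have M (a b c d : R) : `|a| <= c -> `|b| <= d -> `|a * b| <= c * d by move=> ? ?; rewrite normrM ler_pM.
have T (a b c : R) : `|a + b + c| <= `|a| + `|b| + `|c|.
  by rewrite (le_trans (ler_normD _ _))// lerD2r ler_normD.
rewrite E addr0 (le_trans (ler_normD _ _))// (le_trans (lerD (T _ _ _) (T _ _ _)))//.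
have m1 := M _ _ _ _ h1 h3; have m2 := M _ _ _ _ h1 (lexx `|l1|).
have m3 := M _ _ _ _ (lexx `|b1|) h3.
have m4 := M _ _ _ _ h2 h4; have m5 := M _ _ _ _ h2 (lexx `|l2|).
have m6 := M _ _ _ _ (lexx `|b2|) h4.
have ep0 : 0 <= ep := le_trans (normr_ge0 _) h1.
have ep2 : ep * ep <= ep by rewrite -[leRHS]mulr1 ler_wpM2l.
lra.
Qed.

(** On the boundary itself the derivatives of G exist only as limits, so the graph is shifted by h >
    0 into Om. The derivative of G along the shifted curve tends to 0 with h, uniformly for s in a
    compact interval; the mean value theorem there and continuity of G up to the boundary finish the
    argument. *)
Lemma graph_boundary_const (R : realType) (Om : set (plane R)) (G : plane R * plane R -> R) (p e : plane R)
    (f : R -> R) (r : R) :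
  open Om -> Ck_up_to 2 (F2 Om) (F2 (closure Om)) G -> tangential_Green Om G -> graph_chart Om p e f r ->
  exists2 d : R, 0 < d & forall y, Om y -> forall s0 s1, `|s0| < d -> `|s1| < d ->
    G (graph_point e p s0 (f s0), y) = G (graph_point e p s1 (f s1), y).
Proof.
move=> oO cG tG gc; have [d d0 [HO Hb]] := graph_boundary oO gc.
have [ee r0 cf f0 _] := gc.
have [_ /(_ 1)[df [cdf _]]] := cf.
exists d => // y Oy s0 s1 s0d s1d.
pose gam h s := graph_point e p s (f s + h).
have gam0 s : gam 0 s = graph_point e p s (f s) by rewrite /gam addr0.
pose v s : plane R := e + 'D_1 f s *: perp e.
have e1' := unit_norm_le ee; have e0' := normr_ge0 e.
have Fq s : `|s| < d -> F2 (closure Om) (gam 0 s, y).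
  rewrite gam0 => sd; have [c1 c2] := bdE oO (Hb s sd).
  by split => //=; [exact: subset_closure | move=> E; apply: c2; rewrite E].
have close s eps : 0 < eps -> exists2 r', 0 < r' & forall s' h, `|s' - s| < r' -> `|h| < r' ->
    `|gam h s' - gam 0 s| < eps.
  move=> p0; have fc : continuous f by exact: C1_continuous.
  have /continuousP_eps/(_ (eps / 3)) := fc s.
  rewrite divr_gt0// => /(_ isT)[r1 r10 Hr1].
  exists (Num.min r1 (eps / 3)); first by rewrite lt_min r10 divr_gt0.
  move=> s' h; rewrite !lt_min => /andP[h1 h2] /andP[h3 h4]; have h5 := Hr1 s' h1.
  rewrite (_ : gam h s' - gam 0 s = (s' - s) *: e + ((f s' - f s) + h) *: perp e); last first.
    by apply: pair_ext; rewrite /= /GRing.scale /=; ring.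
  rewrite (le_lt_trans (ler_normD _ _))// !normrZ perp_norm.
  have := ler_normD (f s' - f s) h; have := normr_ge0 (s' - s); have := normr_ge0 (f s' - f s + h).
  nra.
pose dd := Num.max `|s0| `|s1|.
have ddd : dd < d by rewrite gt_max s0d.
have small eta : 0 < eta -> exists2 h0, 0 < h0 & forall s, `|s| <= dd -> forall h, 0 < h -> h < h0 ->
    F2 Om (gam h s, y) /\ `|'D_((v s, 0) : plane R * plane R) G (gam h s, y)| <= eta.
  move=> eta0.
  have cK : compact [set` `[- dd, dd]] by exact: segment_compact.
  have [|h0 h00 Hh] := @compact_small R R _ (fun h s =>
    F2 Om (gam h s, y) /\ `|'D_((v s, 0) : plane R * plane R) G (gam h s, y)| <= eta) cK; last first.
    by exists h0 => // s sd h; apply: Hh; rewrite /= in_itv /= -ler_norml.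
  move=> s; rewrite /= in_itv /= -ler_norml => sdd.
  have sd : `|s| < d by exact: le_lt_trans ddd.
  have [cg ng] := bdE oO (Hb s sd).
  have gy : gam 0 s <> y by move=> E; apply: ng; rewrite -gam0 E.
  rewrite -gam0 in cg.
  have [H1 H2] := gradx_lim cG cg Oy gy.
  have := graph_tangent tG ee cf sd Hb Oy; rewrite -gam0 -/(v s).
  move: (gradx Om G (gam 0 s) y) H1 H2 => l H1 H2 lv.
  pose A := `|l.1| + `|l.2| + `|(v s).1| + `|(v s).2| + 3.
  have A0 : 0 < A by rewrite ltr_wpDl// !addr_ge0.
  pose ep := Num.min 1 (eta / A).
  have ep0 : 0 < ep by rewrite lt_min ltr01 divr_gt0.
  have [ep1 epA] : ep <= 1 /\ ep * A <= eta.
    by split; rewrite /ep ?ge_min ?lexx// -ler_pdivlMr// ge_min lexx orbT.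
  clearbody ep.
  have [r1 r10 Hr1] := H1 ep ep0; have [r2 r20 Hr2] := H2 ep ep0.
  have gy0 : 0 < `|gam 0 s - y| by rewrite normr_gt0 subr_eq0; exact/eqP.
  have m0 : 0 < Num.min (Num.min r1 r2) `|gam 0 s - y| by rewrite !lt_min r10 r20.
  have [r3 r30 Hr3] := close s _ m0.
  have cv : continuous (fun s => 'D_1 f s) by move=> t; exact: cdf.
  have /continuousP_eps/(_ _ ep0)[r4 r40 Hr4] := cv s.
  exists (Num.min (Num.min r3 r4) (d - `|s|)); first by rewrite !lt_min r30 r40 subr_gt0.
  move=> s' ; rewrite !lt_min -andbA => /and3P[a1 a2 a3] h hp.
  rewrite !lt_min => /andP[/andP[b1 b2] b3].
  have s'd : `|s'| < d.
    by rewrite -(subrK s s') (le_lt_trans (ler_normD _ _))// -ltrBrDr.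
  have hd : h < d by rewrite (lt_le_trans b3)// gerBl.
  have := Hr3 s' h a1; rewrite gtr0_norm// => /(_ b1); rewrite !lt_min => /andP[/andP[c1 c2] c3].
  have Fg : F2 Om (gam h s', y).
    split => //=; first exact: HO.
    by move=> E; move: c3; rewrite E distrC ltxx.
  have nq c : `|gam h s' - gam 0 s| < c -> `|(gam h s', y) - (gam 0 s, y)| < c.
    by move=> hc; apply: pair_norm_lt => //=; rewrite subrr normr0 (le_lt_trans _ hc).
  have D1 := Hr1 _ Fg (nq _ c1); have D2 := Hr2 _ Fg (nq _ c2).
  split => //; have sG := kernel_sdiff_F2 oO cG Fg.
  have -> : 'D_((v s', 0) : plane R * plane R) G (gam h s', y) =
      (v s').1 * 'D_((e1, 0) : plane R * plane R) G (gam h s', y) +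
      (v s').2 * 'D_((e2, 0) : plane R * plane R) G (gam h s', y).
    rewrite -(sdiffLZ _ _ sG) -(sdiffLZ (v s').2 _ sG) -(sdiffLD _ _ sG).
    congr ('D_ _ G _); apply: pair_ext; apply: pair_ext; rewrite /= /GRing.scale /=; ring.
  have [dv1 dv2] : `|(v s').1 - (v s).1| <= ep /\ `|(v s').2 - (v s).2| <= ep.
    have vv : `|v s' - v s| <= ep.
      rewrite (_ : v s' - v s = ('D_1 f s' - 'D_1 f s) *: perp e); last first.
        by apply: pair_ext; rewrite /= /GRing.scale /=; ring.
      by rewrite normrZ perp_norm -[leRHS]mulr1 ler_pM// ltW// Hr4.
    by split; [apply: le_trans (fst_le _) vv | apply: le_trans (snd_le _) vv].
  move: lv; rewrite /dot; move: ('D_(_ : plane R * plane R) G _) D1 => x1 D1.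
  move: ('D_(_ : plane R * plane R) G _) D2 => x2 D2 lv.
  rewrite (le_trans _ epA)//.
  exact: (dot_perturb dv1 dv2 (ltW D1) (ltW D2) ep1 lv).
apply/eqP; rewrite -subr_eq0 -normr_le0; apply/ler_addgt0Pl => eps eps0; rewrite addr0.
pose eta := eps / 3 / (1 + `|s0 - s1|).
have n0 : 0 < 1 + `|s0 - s1| by rewrite ltr_wpDr.
have eta0 : 0 < eta by rewrite !divr_gt0.
have [h0 h00 Hh] := small eta eta0.
have e30 : 0 < eps / 3 by rewrite divr_gt0.
have [c0 c00 Hc0] := kernel_closure_cont cG (Fq _ s0d) e30.
have [c1 c10 Hc1] := kernel_closure_cont cG (Fq _ s1d) e30.
have [r1 r10 Hr1] := close s0 _ c00; have [r2 r20 Hr2] := close s1 _ c10.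
pose h := Num.min (Num.min h0 r1) r2 / 2.
have m0 : 0 < Num.min (Num.min h0 r1) r2 by rewrite !lt_min h00 r10.
have hp : 0 < h by rewrite divr_gt0.
have : h < Num.min (Num.min h0 r1) r2 by rewrite ltr_pdivrMr// ltr_pMr// ltr1n.
clearbody h; rewrite !lt_min => /andP[/andP[hh0 hr1] hr2].
have dv s : `|s| <= dd -> is_derive s (1 : R) (fun s => G (gam h s, y)) ('D_((v s, 0) : plane R * plane R) G (gam h s, y)).
  move=> sd; have [Fs _] := Hh s sd h hp hh0.
  exact: (is_derive_curve (f := fun w => G (w, y)) (c := gam h) (sdiff_slice1 (kernel_sdiff_F2 oO cG Fs))
    (graph_point_derive e p h (df s I))).
have d1 : (s1 - s0) *: (1 : R) = s1 - s0 by exact: mulr1.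
have sb t : 0 <= t <= 1 -> `|t *: ((s1 - s0) *: (1 : R)) + s0| <= dd.
  move=> /andP[t1 t2]; have h1 : `|s0| <= dd by rewrite le_max lexx.
  have h2 : `|s1| <= dd by rewrite le_max lexx orbT.
  rewrite d1 (_ : _ + _ = (1 - t) * s0 + t * s1); last by rewrite /GRing.scale /=; ring.
  rewrite (le_trans (ler_normD _ _))// !normrM (ger0_norm t1) ger0_norm ?subr_ge0//.
  by have := normr_ge0 s0; have := normr_ge0 s1; clear -t1 t2 h1 h2; nra.
have [t t01 Et] := @MVT_line R R (fun s => G (gam h s, y)) s0 ((s1 - s0) *: (1 : R))
  (fun s => (s1 - s0) * 'D_((v s, 0) : plane R * plane R) G (gam h s, y))
  (fun t ht => is_deriveZv (s1 - s0) (dv _ (sb t ht))).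
have [_ bd'] := Hh _ (sb t t01) h hp hh0.
have Dle : `|G (gam h s1, y) - G (gam h s0, y)| <= eps / 3.
  move: Et; rewrite [in LHS]d1 subrK => ->.
  rewrite normrM (@le_trans _ _ (`|s0 - s1| * eta))//; first by rewrite distrC ler_wpM2l.
  by rewrite /eta mulrA ler_pdivrMr// mulrC ler_wpM2l ?(ltW e30)// lerDr.
have cF s : `|s| <= dd -> F2 (closure Om) (gam h s, y).
  by move=> sdd; have [[/= ? ? ?] _] := Hh s sdd h hp hh0; split => //=; exact: subset_closure.
have s0dd : `|s0| <= dd by rewrite le_max lexx.
have s1dd : `|s1| <= dd by rewrite le_max lexx orbT.
have nq s c : `|gam h s - gam 0 s| < c -> `|(gam h s, y) - (gam 0 s, y)| < c.
  by move=> hc; apply: pair_norm_lt => //=; rewrite subrr normr0 (le_lt_trans _ hc).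
have hh : `|h| < r1 /\ `|h| < r2 by rewrite gtr0_norm.
have G0 := Hc0 _ (cF _ s0dd) (nq _ _ (Hr1 s0 h _ hh.1)).
have G1 := Hc1 _ (cF _ s1dd) (nq _ _ (Hr2 s1 h _ hh.2)).
move: (G0) (G1); rewrite !subrr !normr0 => /(_ r10) {}G0 /(_ r20) {}G1.
by rewrite -!gam0; move: G0 G1 Dle; rewrite !ltr_norml !ler_norml; clear; lra.
Qed.

(** * Reflection in the boundary *)

(** [kap] is a defining function of Om near p whose gradient at p is the inner unit normal n. Since
    the derivative at p is strict, the same n serves at all nearby points with a small relative
    error, so the normal never has to vary. *)
Definition chart (R : realType) (Om : set (plane R)) (p n : plane R) (kap : plane R -> R) : Prop :=
  [/\ dot n n = 1, kap p = 0, continuous kap, sdiff kap p (fun v => dot v n) &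
      exists2 r : R, 0 < r & forall x, `|x - p| < r -> (Om x <-> 0 < kap x)].

Lemma graph_chart_chart (R : realType) (Om : set (plane R)) (p e : plane R) (f : R -> R) (r : R) :
  graph_chart Om p e f r -> exists n kap, chart Om p n kap.
Proof.
move=> [ee r0 cf f0 H].
(* The height above the graph has gradient perp e - m e at p; c normalises it. *)
pose m := 'D_1 f 0; pose c := (Num.sqrt (1 + m ^+ 2))^-1.
have m0 : 0 < 1 + m ^+ 2 by rewrite ltr_wpDr ?sqr_ge0.
have c0 : 0 < c by rewrite invr_gt0 sqrtr_gt0.
have c2 : c ^+ 2 * (1 + m ^+ 2) = 1.
  by rewrite /c exprVn sqr_sqrtr ?mulVf ?gt_eqF// ltW.
pose k0 (v : plane R) := c * (dot v (perp e) + (-1) * f (dot v e)).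
have fc : continuous f by exact: C1_continuous.
exists (c *: (perp e + (- m) *: e)), (fun x => k0 (x - p)); split.
- rewrite (_ : dot _ _ = c ^+ 2 * (1 + m ^+ 2) * dot e e); last first.
    by rewrite /dot /= /GRing.scale /=; ring.
  by rewrite c2 ee mulr1.
- by rewrite /k0 subrr {1 2}/dot /= !mul0r !addr0 f0; ring.
- move=> x; apply: cvgMr; apply: cvgD; first exact: dotl_continuous.
  apply: cvgMr; apply: (@continuous_comp _ _ _ (fun z : plane R => dot (z - p) e) f).
    exact: dotl_continuous.
  exact: fc.
- apply: sdiff_translate; rewrite subrr.
  have dl (u : plane R) (a : R) v w : dot (a *: v + w) u = a * dot v u + dot w u.
    by rewrite dot_add dot_scale.
  have db (u v : plane R) : `|dot v u| <= (2 * `|u|) * `|v|.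
    by rewrite (le_trans (dot_le _ _))// mulrA mulrAC.
  have s1 (u : plane R) : sdiff (fun v => dot v u) 0 (fun v => dot v u).
    split; first exact: dl.
      by exists (2 * `|u|) => v; exact: db.
    move=> ep ep0; exists 1 => // x1 x2 _ _.
    by rewrite dot_add dot_opp subrr normr0 mulr_ge0// ltW.
  have s2 : sdiff (fun v : plane R => f (dot v e)) 0 (fun v => dot v e * m).
    apply: (sdiff_comp_linear (f := f) (A := fun v : plane R => dot v e) (x := 0) (L := fun v => v * m) (dl e) (db e)).
    rewrite (_ : dot 0 e = 0); last by rewrite /dot /= !mul0r addr0.
    exact: sdiff_C1.
  have := sdiff_scale c (sdiff_add (s1 (perp e)) (sdiff_scale (-1) s2)).
  congr sdiff; apply/funext => v; rewrite dot_scaler.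
  by rewrite /dot /= /GRing.scale /=; ring.
- exists r => // x /H ->; rewrite /k0 pmulr_rgt0// mulN1r subr_gt0; done.
Qed.

Lemma chart_eps (R : realType) (Om : set (plane R)) (p n : plane R) (kap : plane R -> R) (e : R) :
  chart Om p n kap -> 0 < e -> exists2 r : R, 0 < r &
  (forall x, `|x - p| < r -> (Om x <-> 0 < kap x)) /\
  (forall x y, `|x - p| < r -> `|y - p| < r -> `|kap x - kap y - dot (x - y) n| <= e * `|x - y|).
Proof.
move=> [nn k0 ck [_ _ sk] [r r0 H]] /sk[s s0 Hs].
exists (Num.min r s); first by rewrite lt_min r0.
split=> [x|x y]; rewrite !lt_min => /andP[h1 h2]; first exact: H.
by move=> /andP[h3 h4]; exact: Hs.
Qed.

Lemma chart_bd (R : realType) (Om : set (plane R)) (p x : plane R) (kap : plane R -> R) (r : R) :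
  open Om -> continuous kap -> (forall x, `|x - p| < r -> (Om x <-> 0 < kap x)) ->
  bd Om x -> `|x - p| < r -> kap x = 0.
Proof.
move=> oO ck H bx xp; have [cx nx] := bdE oO bx.
apply/eqP; rewrite eq_le leNgt; apply/andP; split; first by apply/negP => /(H x xp).2.
rewrite leNgt; apply/negP => h0; rewrite -oppr_gt0 in h0.
have /continuousP_eps/(_ _ h0)[d d0 Hd] := ck x.
have m0 : 0 < Num.min d (r - `|x - p|) by rewrite lt_min d0 subr_gt0.
have [y Oy] := closure_eps cx m0; rewrite lt_min => /andP[yd yr].
have yp : `|y - p| < r.
  by rewrite -(subrKA x) (le_lt_trans (ler_normD _ _))// -ltrBrDr.
have /(H _ yp).1 := Oy.
by have := Hd y yd; rewrite ltr_norml => /andP[h2 h3]; lra.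
Qed.

Definition image (R : realType) (n : plane R) (kap : plane R -> R) (y : plane R) : plane R :=
  y - (2 * kap y) *: n.

Lemma image_sqdist (R : realType) (n : plane R) (kap : plane R -> R) (x y : plane R) : dot n n = 1 ->
  dot (x - image n kap y) (x - image n kap y) =
  dot (x - y) (x - y) + 4 * kap y * (dot (x - y) n + kap y).
Proof.
move=> nn; rewrite (_ : dot _ _ = dot (x - y) (x - y) + 4 * kap y * (dot (x - y) n + kap y * dot n n)).
  by rewrite nn mulr1.
by rewrite /image /dot /= /GRing.scale /=; ring.
Qed.

(** The right-hand side is 130 times the squared distance from x to the image of y. For k <= 8 M the
    product 4 k (a + k) costs at most M^2/2 of d, and M^2 + k^2 <= 65 M^2; for k > 8 M one has |a|
    <= k/4, which makes that product at least 3 k^2. *)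
Lemma image_lower (R : realType) (M d a k : R) : 0 <= M -> M ^+ 2 <= d -> `|a| <= 2 * M ->
  - (64^-1 * M) <= a + k -> 0 <= k -> M ^+ 2 + k ^+ 2 <= 130 * (d + 4 * k * (a + k)).
Proof.
move=> M0 Md aM ak k0; have kM : 0 <= k * M by rewrite mulr_ge0.
have [kM8|kM8] := leP k (8 * M).
  have k2 : k * k <= 8 * M * (8 * M) by rewrite ler_pM.
  have h : - (64^-1 * M) * k <= (a + k) * k by rewrite ler_wpM2r.
  have km : k * M <= 8 * M * M by rewrite ler_wpM2r.
  by move: Md k2 h km; rewrite !expr2; lra.
have h : (3 / 4 * k) * k <= (a + k) * k.
  by rewrite ler_wpM2r//; move: aM; rewrite ler_norml => /andP[? _]; lra.
have k2 : 0 <= k * k by rewrite mulr_ge0.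
have d0 : 0 <= M * M by rewrite mulr_ge0.
by move: Md h; rewrite !expr2; lra.
Qed.

(** * Elementary estimates for logarithms of distances to image points *)

Lemma ln_sub_le (R : realType) (u v : R) : 0 < u -> 0 < v -> ln u - ln v <= (u - v) / v.
Proof.
move=> u0 v0; have E : (u - v) / v = u / v - 1 by field; rewrite gt_eqF.
have uv : 0 < u / v by rewrite divr_gt0.
rewrite -ln_div ?posrE// E -[u / v in X in X <= _](subrK 1) addrC.
by apply: le_ln1Dx; lra.
Qed.

Lemma ln_lip (R : realType) (u v : R) : 2^-1 <= u -> 2^-1 <= v -> `|ln u - ln v| <= 2 * `|u - v|.
Proof.
have A (s t : R) : 2^-1 <= s -> 2^-1 <= t -> ln s - ln t <= 2 * `|s - t|.
  move=> s2 t2; have s0 : 0 < s by rewrite (lt_le_trans _ s2).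
  have t0 : 0 < t by rewrite (lt_le_trans _ t2).
  rewrite (le_trans (ln_sub_le s0 t0))// ler_pdivrMr//.
  have := ler_norm (s - t); have := normr_ge0 (s - t); nra.
move=> u2 v2; rewrite ler_norml A// andbT.
by have := A v u v2 u2; rewrite distrC; lra.
Qed.

(* On the boundary the two distances to a point and to its image agree up to a factor close to 1,
   and their ratio varies slowly with the point. *)
Lemma image_log_small (R : realType) (e M d a k : R) : 0 < M -> M ^+ 2 <= d -> `|a + k| <= e * M -> 0 <= k -> k <= 3 * M ->
  e <= 24^-1 -> `|ln (d + 4 * k * (a + k)) - ln d| <= 24 * e.
Proof.
move=> M0 Md ak k0 kM e24; have M2 : 0 < M ^+ 2 by rewrite exprn_gt0.
have d0 : 0 < d := lt_le_trans M2 Md.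
have e0 : 0 <= e by rewrite -(pmulr_lge0 _ M0) (le_trans (normr_ge0 _) ak).
pose A := 4 * k * (a + k) / d.
have A12 : `|A| <= 12 * e.
  rewrite /A normrM normfV (gtr0_norm d0) ler_pdivrMr// !normrM (ger0_norm k0) (ger0_norm (ler0n _ 4)).
  have h1 : k * `|a + k| <= 3 * M * (e * M) by rewrite ler_pM.
  have h2 : e * M ^+ 2 <= e * d by rewrite ler_wpM2l.
  by move: h1 h2; rewrite expr2; clear; lra.
have -> : d + 4 * k * (a + k) = d * (1 + A) by rewrite /A; field; rewrite gt_eqF.
have h : 2^-1 <= 1 + A by move: A12; rewrite ler_norml => /andP[? _]; lra.
rewrite lnM ?posrE//; last by rewrite (lt_le_trans _ h).
rewrite addrAC subrr add0r -[ln _]subr0 -(@ln1 R).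
have h1 : 2^-1 <= 1 :> R by lra.
rewrite (le_trans (ln_lip h h1))// addrAC subrr add0r; lra.
Qed.

Lemma image_log_diff (R : realType) (e M d a k M' d' a' k' D : R) : 0 < M -> M ^+ 2 <= d -> `|a + k| <= e * M ->
  0 <= k -> k <= 3 * M -> e <= 24^-1 ->
  M' ^+ 2 <= d' -> `|a' + k'| <= e * M' -> 0 <= k' -> k' <= 3 * M' ->
  D <= M / 2 -> `|M - M'| <= D -> `|k - k'| <= 3 * D -> `|(a + k) - (a' + k')| <= e * D ->
  `|d - d'| <= 2 * (D * (M + M')) ->
  M * `|(ln (d + 4 * k * (a + k)) - ln d) - (ln (d' + 4 * k' * (a' + k')) - ln d')| <= 400 * e * D.
Proof.
move=> M0 Md ak k0 kM e24 Md' ak' k0' kM' DM MD kD bD dD.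
have D0 : 0 <= D := le_trans (normr_ge0 _) MD.
have [M1 M2] : M / 2 <= M' /\ M' <= 3 / 2 * M.
  by move: MD; rewrite ler_norml => /andP[? ?]; split; lra.
have M0' : 0 < M' by rewrite (lt_le_trans _ M1)// divr_gt0.
have e0 : 0 <= e by rewrite -(pmulr_lge0 _ M0) (le_trans (normr_ge0 _) ak).
have d0 : 0 < d by rewrite (lt_le_trans _ Md)// exprn_gt0.
have d0' : 0 < d' by rewrite (lt_le_trans _ Md')// exprn_gt0.
move: (a + k) (a' + k') ak ak' bD => b b' bM bM' bD.
pose A := 4 * k * b / d; pose A' := 4 * k' * b' / d'.
have AA (K m dd bb : R) : 0 < m -> m ^+ 2 <= dd -> `|bb| <= e * m -> 0 <= K -> K <= 3 * m ->
    `|4 * K * bb / dd| <= 12 * e.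
  move=> m0 md bm K0 Km; have dd0 : 0 < dd by rewrite (lt_le_trans _ md)// exprn_gt0.
  rewrite normrM normfV (gtr0_norm dd0) ler_pdivrMr// !normrM (ger0_norm K0) (ger0_norm (ler0n _ 4)).
  have h1 : K * `|bb| <= 3 * m * (e * m) by rewrite ler_pM.
  have h2 : e * m ^+ 2 <= e * dd by rewrite ler_wpM2l.
  by move: h1 h2; rewrite expr2; clear; lra.
have hA : 2^-1 <= 1 + A.
  by have := AA _ _ _ _ M0 Md bM k0 kM; rewrite ler_norml => /andP[? _]; rewrite /A; lra.
have hA' : 2^-1 <= 1 + A'.
  by have := AA _ _ _ _ M0' Md' bM' k0' kM'; rewrite ler_norml => /andP[? _]; rewrite /A'; lra.
have -> : d + 4 * k * b = d * (1 + A) by rewrite /A; field; rewrite gt_eqF.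
have -> : d' + 4 * k' * b' = d' * (1 + A') by rewrite /A'; field; rewrite gt_eqF.
have p1 : 0 < 1 + A by rewrite (lt_le_trans _ hA).
have p1' : 0 < 1 + A' by rewrite (lt_le_trans _ hA').
rewrite !lnM ?posrE// (addrAC (ln d)) subrr add0r (addrAC (ln d')) subrr add0r.
apply: (@le_trans _ _ (M * (2 * `|(1 + A) - (1 + A')|))).
  by rewrite ler_wpM2l ?(ltW M0)// ln_lip.
have -> : 1 + A - (1 + A') = 4 * ((k - k') * b / d + k' * (b - b') / d + k' * b' * (d' - d) / (d * d')).
  by rewrite /A /A'; field; rewrite !gt_eqF.
have t1 : M * `|(k - k') * b / d| <= 3 * (e * D).
  rewrite normrM normfV (gtr0_norm d0) [leLHS]mulrA ler_pdivrMr// normrM.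
  have h : `|k - k'| * `|b| <= 3 * D * (e * M) by rewrite ler_pM.
  have h2 : M * (`|k - k'| * `|b|) <= M * (3 * D * (e * M)) by rewrite ler_wpM2l// ltW.
  have h3 : e * D * M ^+ 2 <= e * D * d by rewrite ler_wpM2l// mulr_ge0.
  by move: h2 h3; rewrite expr2; clear; lra.
have t2 : M * `|k' * (b - b') / d| <= 9 / 2 * (e * D).
  rewrite normrM normfV (gtr0_norm d0) [leLHS]mulrA ler_pdivrMr// normrM (ger0_norm k0').
  have km : k' <= 9 / 2 * M by lra.
  have h : k' * `|b - b'| <= 9 / 2 * M * (e * D) by rewrite ler_pM.
  have h2 : M * (k' * `|b - b'|) <= M * (9 / 2 * M * (e * D)) by rewrite ler_wpM2l// ltW.
  have h3 : e * D * M ^+ 2 <= e * D * d by rewrite ler_wpM2l// mulr_ge0.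
  by move: h2 h3; rewrite expr2; clear; lra.
have t3 : M * `|k' * b' * (d' - d) / (d * d')| <= 15 * (e * D).
  have dd0 : 0 < d * d' by rewrite mulr_gt0.
  rewrite normrM normfV (gtr0_norm dd0) [leLHS]mulrA ler_pdivrMr// normrM normrM (ger0_norm k0') (distrC d').
  have h : k' * `|b'| <= 3 * M' * (e * M') by rewrite ler_pM.
  have g : `|d - d'| <= 5 * (D * M) by rewrite (le_trans dD)//; have := ler_wpM2l D0 M2; lra.
  have h2 : k' * `|b'| * `|d - d'| <= 3 * M' * (e * M') * (5 * (D * M)).
    by rewrite ler_pM// mulr_ge0.
  have h3 : M * (k' * `|b'| * `|d - d'|) <= M * (3 * M' * (e * M') * (5 * (D * M))).
    by rewrite ler_wpM2l// ltW.
  have h4 : M ^+ 2 * M' ^+ 2 <= d * d' by rewrite ler_pM// exprn_ge0// ltW.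
  have h5 : e * D * (M ^+ 2 * M' ^+ 2) <= e * D * (d * d') by rewrite ler_wpM2l// mulr_ge0.
  by move: h3 h5; rewrite !expr2; clear; lra.
have T (x y z : R) : `|x + y + z| <= `|x| + `|y| + `|z|.
  by rewrite (le_trans (ler_normD _ _))// lerD2r ler_normD.
rewrite (normrM 4) (ger0_norm (ler0n _ 4)).
have h := T ((k - k') * b / d) (k' * (b - b') / d) (k' * b' * (d' - d) / (d * d')).
have {}h := ler_wpM2l (ltW M0) h.
have eD : 0 <= e * D by rewrite mulr_ge0.
by clear -h t1 t2 t3 eD; lra.
Qed.

(** * The regular part compared with its boundary reflection *)

Notation sqn v := (dot v v).

Definition green_setting (R : realType) (Om : set (plane R)) (G : plane R * plane R -> R) : Prop :=
  [/\ bounded_set Om, C3_boundary Om, Ck_up_to 2 (F2 Om) (F2 (closure Om)) G, green_kernel Om G &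
      tangential_Green Om G].

Lemma compact_closure (R : realType) (Om : set (plane R)) : bounded_set Om -> compact (closure Om).
Proof.
move=> bO; have [M M0 HM] : exists2 M : R, 0 < M & forall x, Om x -> `|x| <= M.
  have [M [_ HM]] := bO; exists (Num.max (M + 1) 1); first by rewrite lt_max ltr01 orbT.
  by move=> x Ox; apply: HM => //; rewrite lt_max ltrDl ltr01.
apply: (@subclosed_compact _ _ (square 0 M)); first exact: closed_closure.
  exact: compact_square.
move=> x cx; apply/squareP; rewrite subr0; apply/ler_addgt0Pr => e e0.
have [y Oy yx] := closure_eps cx e0.
rewrite -(subKr y x) (le_trans (ler_normB _ _))//.
by rewrite lerD ?HM// ltW.
Qed.

(* psi is 4 pi g minus the logarithm of the squared distance to the image point, written so that it
   also makes sense for x on the boundary. *)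
Definition psi (R : realType) (Om : set (plane R)) (G : plane R * plane R -> R) (n : plane R)
    (kap : plane R -> R) (x y : plane R) : R :=
  (if x == y then 4 * pi * regular_part Om G (x, y) else 4 * pi * G (x, y) + ln (sqn (x - y)))
  - ln (sqn (x - image n kap y)).

Lemma psi_regular (R : realType) (Om : set (plane R)) (G : plane R * plane R -> R) (n : plane R)
    (kap : plane R -> R) (x y : plane R) :
  green_kernel Om G -> Om x -> Om y ->
  psi Om G n kap x y = 4 * pi * regular_part Om G (x, y) - ln (sqn (x - image n kap y)).
Proof.
move=> [oO cG _] Ox Oy; rewrite /psi; case: eqVneq => // xy; congr (_ - _).
rewrite regular_part_off//=; last by split => //=; exact/eqP.
by move: (4 * pi : R) (pi4_gt0 R) => P P0; field; rewrite gt_eqF.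
Qed.

Lemma lnsqn_continuous (R : realType) (a x : plane R) : x != a ->
  {for x, continuous (fun z : plane R => ln (sqn (z - a)))}.
Proof.
move=> xa; have [L sL] : exists L, sdiff (fun w : plane R => ln (sqn w)) (x - a) L.
  by apply: sdiff_lndot; rewrite subr_eq0.
exact: (sdiff_continuous (sdiff_translate sL)).
Qed.

Lemma psi_continuous (R : realType) (Om : set (plane R)) (G : plane R * plane R -> R) (n : plane R)
    (kap : plane R -> R) (x y : plane R) :
  green_setting Om G -> closure Om x -> Om y -> x != image n kap y ->
  (fun x => psi Om G n kap x y) @ within (closure Om) (nbhs x) --> psi Om G n kap x y.
Proof.
move=> [_ _ cG gk _] cx Oy xi; have oO : open Om by case: gk.
have [xy|xy] := eqVneq x y.
  have [L sL] := regular_sdiff gk (Oy : Om (y, y).1) (Oy : Om (y, y).2).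
  have Ox : Om x by rewrite xy.
  apply: cvg_within_filter; rewrite psi_regular//.
  have c1 : (fun x => 4 * pi * regular_part Om G (x, y) - ln (sqn (x - image n kap y))) @ x -->
      4 * pi * regular_part Om G (x, y) - ln (sqn (x - image n kap y)).
    apply: cvgB; last exact: lnsqn_continuous.
    by apply: cvgMr; rewrite xy; exact: (sdiff_continuous (sdiff_slice1 sL)).
  apply: cvg_trans c1; apply: near_eq_cvg.
  have : \forall z \near x, Om z by exact: open_nbhs_nbhs.
  by apply: filterS => z Oz; rewrite psi_regular.
apply: cvgB; last by apply: cvg_within_filter; exact: lnsqn_continuous.
rewrite (negbTE xy).
have c1 : (fun x => 4 * pi * G (x, y) + ln (sqn (x - y))) @ within (closure Om) (nbhs x) -->
    4 * pi * G (x, y) + ln (sqn (x - y)).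
  apply: cvgD; last by apply: cvg_within_filter; exact: lnsqn_continuous.
  apply: cvgMr; apply/within_cvgP => e e0.
  have cy : closure Om y by exact: subset_closure.
  have Fq : F2 (closure Om) (x, y) by split => //=; exact/eqP.
  have [r r0 Hr] := kernel_closure_cont cG Fq e0.
  have xy0 : 0 < `|x - y| by rewrite normr_gt0 subr_eq0.
  exists (Num.min r `|x - y|); first by rewrite lt_min r0.
  move=> z cz; rewrite lt_min => /andP[zr zxy]; apply: Hr.
    by split => //= E; move: zxy; rewrite E distrC ltxx.
  by apply: pair_norm_lt => //=; rewrite subrr normr0.
apply: cvg_trans c1; apply: near_eq_cvg; rewrite near_withinE.
have : \forall z \near x, z != y.
  apply/nbhs_ballP; exists `|x - y|; first by rewrite /= normr_gt0 subr_eq0.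
  by move=> z; rewrite -ball_normE /= => h; apply/eqP => E; move: h; rewrite E ltxx.
by apply: filterS => z zy _; rewrite (negbTE zy).
Qed.

Lemma psi_harmonic (R : realType) (Om : set (plane R)) (G : plane R * plane R -> R) (n : plane R)
    (kap : plane R -> R) (x y : plane R) :
  green_kernel Om G -> Om x -> Om y -> x != image n kap y -> sdharmonic (fun x => psi Om G n kap x y) x.
Proof.
move=> gk Ox Oy xi; have oO : open Om by case: gk.
have H := sdharmonic_add (sdharmonic_scale (4 * pi) (regular_sdharmonic gk Ox Oy))
  (sdharmonic_scale (-1) (sdharmonic_lndot xi)).
apply: sdharmonic_near_eq H.
have : \forall z \near x, Om z by exact: open_nbhs_nbhs.
by apply: filterS => z Oz; rewrite psi_regular// mulN1r.
Qed.

(** As functions of x, both terms are harmonic on Om: the pole of G at y is removed by the regular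
    part, and the image points lie off the closure. So the maximum principle applies to their
    difference and to its negative. *)
Lemma psi_compare (R : realType) (Om : set (plane R)) (G : plane R * plane R -> R) (n : plane R)
    (kap : plane R -> R) (y y' : plane R) (M : R) :
  green_setting Om G -> Om y -> Om y' ->
  (forall x, closure Om x -> x != image n kap y /\ x != image n kap y') ->
  (forall x, bd Om x -> `|psi Om G n kap x y - psi Om G n kap x y'| <= M) ->
  forall x, Om x -> `|psi Om G n kap x y - psi Om G n kap x y'| <= M.
Proof.
move=> gs Oy Oy' ni HM x Ox; have [bO _ _ gk _] := gs; have oO : open Om by case: gk.
have A y1 y2 : Om y1 -> Om y2 -> (forall x, closure Om x -> x != image n kap y1 /\ x != image n kap y2) ->
    (forall x, bd Om x -> psi Om G n kap x y1 + (-1) * psi Om G n kap x y2 <= M) ->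
    psi Om G n kap x y1 + (-1) * psi Om G n kap x y2 <= M.
  move=> O1' O2' ni' H.
  apply: (@max_principle _ (closure Om) (fun x => psi Om G n kap x y1 + (-1) * psi Om G n kap x y2)).
  - exact: compact_closure.
  - move=> z cz; have [z1 z2] := ni' z cz.
    by apply: cvgD; [exact: psi_continuous | apply: cvgMr; exact: psi_continuous].
  - move=> z cz; have [Oz|nOz] := pselect (Om z); last by left; apply: H; exact: bd_intro.
    right; split; first by apply: filterS (@subset_closure _ Om) _; exact: open_nbhs_nbhs.
    have [z1 z2] := ni' z cz.
    by apply: sdharmonic_add; [exact: psi_harmonic | apply: sdharmonic_scale; exact: psi_harmonic].
  - exact: subset_closure.
have h1 : psi Om G n kap x y + (-1) * psi Om G n kap x y' <= M.
  by apply: A => // z bz; rewrite mulN1r (le_trans (ler_norm _))// HM.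
have h2 : psi Om G n kap x y' + (-1) * psi Om G n kap x y <= M.
  apply: A => //; first by move=> z /ni[].
  by move=> z bz; rewrite mulN1r (le_trans (ler_norm _))// distrC HM.
by rewrite ler_norml; move: h1 h2; rewrite !mulN1r => *; lra.
Qed.

(** Smallness at the scale of the distance to the boundary: an increment t belonging to y, y' is at
    most e in general, and at most e |y - y'| / kap y once y' is relatively close to y. The second
    half bounds kap y times the derivative in y. The constant 8 keeps the segment from y to y'
    inside Om, as [kap] is 3-Lipschitz. *)
Definition slow (R : realType) (kap : plane R -> R) (e : R) (y y' : plane R) (t : R) : Prop :=
  `|t| <= e /\ (`|y - y'| <= kap y / 8 -> kap y * `|t| <= e * `|y - y'|).

Lemma slow_add (R : realType) (kap : plane R -> R) (e1 e2 : R) (y y' : plane R) (s t : R) : 0 <= kap y ->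
  slow kap e1 y y' s -> slow kap e2 y y' t -> slow kap (e1 + e2) y y' (s + t).
Proof.
move=> k0 [s1 s2] [t1 t2]; split; first by rewrite (le_trans (ler_normD _ _))// lerD.
move=> h; rewrite mulrDl (@le_trans _ _ (kap y * `|s| + kap y * `|t|))//.
  by rewrite -mulrDr ler_wpM2l// ler_normD.
by rewrite lerD// ?s2 ?t2.
Qed.

Lemma slow_lipschitz (R : realType) (kap : plane R -> R) (e C : R) (y y' : plane R) (t : R) : 0 <= kap y ->
  `|t| <= e -> (`|y - y'| <= kap y / 8 -> `|t| <= C * `|y - y'|) -> kap y * C <= e ->
  slow kap e y y' t.
Proof.
move=> k0 te tC kC; split => // /tC h; rewrite (@le_trans _ _ (kap y * (C * `|y - y'|)))//.
  by rewrite ler_wpM2l.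
by rewrite mulrA ler_wpM2r.
Qed.

(** In the max norm, |dot v n| <= 2 |v| for a unit vector n, and 2 + 1/64 is rounded up to the
    Lipschitz constant 3. *)
Lemma chart_near (R : realType) (Om : set (plane R)) (p n : plane R) (kap : plane R -> R) (e : R) :
  chart Om p n kap -> 0 < e -> e <= 64^-1 -> exists2 r : R, 0 < r &
  [/\ forall x, `|x - p| < r -> (Om x <-> 0 < kap x),
      forall x y, `|x - p| < r -> `|y - p| < r -> `|kap x - kap y - dot (x - y) n| <= e * `|x - y|,
      forall x y, `|x - p| < r -> `|y - p| < r -> `|kap x - kap y| <= 3 * `|x - y|,
      forall x, `|x - p| < r -> `|kap x| <= 3 * `|x - p| &
      forall x y, `|x - p| < r -> `|y - p| < r -> `|dot (x - y) n| <= 2 * `|x - y|].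
Proof.
move=> ch e0 e64; have [r r0 [H1 H2]] := chart_eps ch e0; have [nn k0 _ _ _] := ch.
have D (v : plane R) : `|dot v n| <= 2 * `|v|.
  rewrite (le_trans (dot_le _ _))// ler_wpM2l//.
  by have := unit_norm_le nn; have := normr_ge0 v; nra.
have H3 x y : `|x - p| < r -> `|y - p| < r -> `|kap x - kap y| <= 3 * `|x - y|.
  move=> xp yp; have := H2 x y xp yp; have := D (x - y); have := normr_ge0 (x - y).
  have : e * `|x - y| <= 64^-1 * `|x - y| by rewrite ler_wpM2r.
  by rewrite !ler_norml; move=> ? ? /andP[? ?] /andP[? ?]; lra.
exists r => //; split => // x xp.
by have := H3 x p xp; rewrite subrr normr0 k0 subr0; exact.
Qed.

Lemma segment_ball (R : realType) (y y' p : plane R) (r t : R) :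
  `|y - p| < r -> `|y' - p| < r -> 0 <= t <= 1 -> `|t *: (y' - y) + y - p| < r.
Proof.
move=> yp yp' /andP[t0 t1].
rewrite (_ : _ - p = (1 - t) *: (y - p) + t *: (y' - p)); last first.
  by apply: pair_ext; rewrite /= /GRing.scale /=; ring.
rewrite (le_lt_trans (ler_normD _ _))// !normrZ (ger0_norm t0) ger0_norm ?subr_ge0//.
have mr : Num.max `|y - p| `|y' - p| < r by rewrite gt_max yp.
have h1 : (1 - t) * `|y - p| <= (1 - t) * Num.max `|y - p| `|y' - p|.
  by rewrite ler_wpM2l ?subr_ge0// le_max lexx.
have h2 : t * `|y' - p| <= t * Num.max `|y - p| `|y' - p|.
  by rewrite ler_wpM2l// le_max lexx orbT.
by apply: le_lt_trans mr; lra.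
Qed.

Lemma chart_segment (R : realType) (Om : set (plane R)) (p : plane R) (kap : plane R -> R) (r : R) (y y' : plane R) (t : R) :
  (forall x, `|x - p| < r -> (Om x <-> 0 < kap x)) ->
  (forall x y, `|x - p| < r -> `|y - p| < r -> `|kap x - kap y| <= 3 * `|x - y|) ->
  Om y -> `|y - p| < r -> `|y' - p| < r -> `|y - y'| <= kap y / 8 -> 0 <= t <= 1 ->
  `|t *: (y' - y) + y - p| < r /\ Om (t *: (y' - y) + y).
Proof.
move=> H1 H3 Oy yp yp' yy /andP[t0 t1].
have zp : `|t *: (y' - y) + y - p| < r by apply: segment_ball => //; rewrite t0.
split => //; apply/H1 => //; have k0 := (H1 y yp).1 Oy.
have := H3 _ _ zp yp; rewrite addrK normrZ (ger0_norm t0) distrC.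
rewrite distrC in yy; have : t * `|y' - y| <= 1 * `|y' - y| by rewrite ler_wpM2r.
rewrite ler_norml => h /andP[h1 h2]; lra.
Qed.

(** Since x1 differs from p, G is C^1 up to the boundary around (x1, p), so G (x, .) has a Lipschitz
    bound C. The factor [kap y], at most 3 |y - p|, makes C as small as needed near p. *)
Lemma green_slow_far (R : realType) (Om : set (plane R)) (G : plane R * plane R -> R) (p n x1 : plane R)
    (kap : plane R -> R) (e : R) :
  green_setting Om G -> chart Om p n kap -> bd Om p -> closure Om x1 -> x1 != p -> 0 < e ->
  exists2 r : R, 0 < r & forall x y y', closure Om x -> `|x - x1| < r ->
    Om y -> Om y' -> `|y - p| < r -> `|y' - p| < r -> slow kap e y y' (G (x, y) - G (x, y')).
Proof.
move=> [_ _ cG gk _] ch bp cx1 x1p e0; have oO : open Om by case: gk.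
have [cp np] := bdE oO bp.
have Fq : F2 (closure Om) (x1, p) by split => //=; exact/eqP.
have e20 : 0 < e / 2 by rewrite divr_gt0.
have [r1 r10 Hr1] := kernel_closure_cont cG Fq e20.
have [C C0 [r2 r20 Hr2]] := kernel_derive_bounded oO cG Fq.
have [r3 r30 [H1 _ H3 H4 _]] := chart_near ch (ltac:(by rewrite invr_gt0) : 0 < 64^-1 :> R) (lexx _).
have d0 : 0 < `|x1 - p| / 2 by rewrite divr_gt0// normr_gt0 subr_eq0.
have c0 : 0 < e / (3 * C) by rewrite divr_gt0// mulr_gt0.
pose r := Num.min (Num.min r1 r2) (Num.min (Num.min r3 (`|x1 - p| / 2)) (e / (3 * C))).
have r0 : 0 < r by rewrite !lt_min r10 r20 r30 d0 c0.
have rP (s : R) : s < r -> [/\ s < r1, s < r2, s < r3, s < `|x1 - p| / 2 & s < e / (3 * C)].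
  by rewrite !lt_min => /andP[/andP[-> ->] /andP[/andP[-> ->] ->]].
have FF (A : set (plane R)) x y : A x -> A y -> `|x - x1| < r -> `|y - p| < r -> F2 A (x, y).
  move=> Ax Ay /rP[_ _ _ h1 _] /rP[_ _ _ h2 _]; split => //= E; subst y.
  have := ler_distD x x1 p; rewrite (distrC x1 x); lra.
have nq x y (c : R) : `|x - x1| < c -> `|y - p| < c -> `|(x, y) - (x1, p)| < c.
  by move=> ? ?; exact: pair_norm_lt.
exists r => // x y y' cx xx Oy Oy' yp yp'.
have cy := subset_closure Oy; have cy' := subset_closure Oy'.
have [y1 y2 y3 y4 y5] := rP _ yp; have [z1 z2 z3 z4 z5] := rP _ yp'; have [x1' x2' x3' x4' x5'] := rP _ xx.
have k0 : 0 < kap y by apply/(H1 y y3).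
apply: (slow_lipschitz (ltW k0) (C := C)).
- have := Hr1 _ (FF _ _ _ cx cy xx yp) (nq _ _ _ x1' y1).
  have := Hr1 _ (FF _ _ _ cx cy' xx yp') (nq _ _ _ x1' z1).
  rewrite !ltr_norml ler_norml => /andP[? ?] /andP[? ?]; lra.
(* x may lie on the boundary, where derivatives are only limits; the mean value theorem is used at a
   nearby point z of Om and the difference absorbed in eps. *)
- move=> yy; apply/ler_addgt0Pr => eps eps0.
  have eps20 : 0 < eps / 2 by rewrite divr_gt0.
  have [s1 s10 Hs1] := kernel_closure_cont cG (FF _ _ _ cx cy xx yp) eps20.
  have [s2 s20 Hs2] := kernel_closure_cont cG (FF _ _ _ cx cy' xx yp') eps20.
  have m0 : 0 < Num.min (Num.min s1 s2) (r - `|x - x1|) by rewrite !lt_min s10 s20 subr_gt0.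
  have [z Oz] := closure_eps cx m0; rewrite !lt_min => /andP[/andP[zs1 zs2] zr].
  have zx1 : `|z - x1| < r by rewrite -(subrKA x) (le_lt_trans (ler_normD _ _))// -ltrBrDr.
  have cz := subset_closure Oz.
  have nz (w : plane R) : `|(z, w) - (x, w)| = `|z - x|.
    by rewrite (_ : _ - _ = (z - x, w - w))// subrr (_ : `|_| = Num.max `|z - x| `|0 : plane R|)// normr0; apply/max_idPl.
  have G1 := Hs1 (z, y) (FF _ _ _ cz cy zx1 yp) ; rewrite nz in G1; have {}G1 := G1 zs1.
  have G2 := Hs2 (z, y') (FF _ _ _ cz cy' zx1 yp') ; rewrite nz in G2; have {}G2 := G2 zs2.
  have seg t : 0 <= t <= 1 -> `|t *: (y' - y) + y - p| < r2 /\ F2 Om (z, t *: (y' - y) + y).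
    move=> t01; have [h1 h2] := chart_segment H1 H3 Oy y3 z3 yy t01.
    have h3 : `|t *: (y' - y) + y - p| < r by exact: segment_ball.
    by split; [by have [] := rP _ h3 | exact: FF].
  have dG t : 0 <= t <= 1 -> is_derive (t *: (y' - y) + y) (y' - y) (fun w => G (z, w))
      ('D_((0, y' - y) : plane R * plane R) G (z, t *: (y' - y) + y)).
    by move=> /seg[_ Fz]; exact: (sdiff_is_derive _ (sdiff_slice (kernel_sdiff_F2 oO cG Fz))).
  have [t t01 Et] := @MVT_line R _ (fun w => G (z, w)) y (y' - y)
    (fun w => 'D_((0, y' - y) : plane R * plane R) G (z, w)) dG.
  rewrite subrK in Et; have [h1 Fz] := seg t t01.
  have [_ zr2 _ _ _] := rP _ zx1.
  have := Hr2 _ ((0, y' - y) : plane R * plane R) Fz (nq _ _ _ zr2 h1); rewrite -Et.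
  have -> : `|((0, y' - y) : plane R * plane R)| = `|y - y'|.
    rewrite (_ : `|_| = Num.max `|0 : plane R| `|y' - y|)// normr0 distrC; apply/max_idPr.
    exact: normr_ge0.
  by move: G1 G2; rewrite !ltr_norml !ler_norml; clear; lra.
have := H4 y y3; rewrite ger0_norm ?(ltW k0)// => h.
have : kap y <= 3 * (e / (3 * C)) by lra.
move=> /(ler_wpM2r (ltW C0))/le_trans; apply.
by rewrite le_eqVlt; apply/orP; left; apply/eqP; field; rewrite gt_eqF.
Qed.

Definition logratio (R : realType) (n : plane R) (kap : plane R -> R) (x y : plane R) : R :=
  ln (sqn (x - y)) - ln (sqn (x - image n kap y)).

Lemma image_dist (R : realType) (n : plane R) (kap : plane R -> R) (y y' : plane R) : `|n| <= 1 ->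
  `|y - image n kap y| <= 2 * `|kap y| /\
  `|image n kap y - image n kap y'| <= `|y - y'| + 2 * `|kap y - kap y'|.
Proof.
move=> n1; split.
  rewrite /image opprB addrC subrK normrZ normrM (ger0_norm (ler0n _ 2)).
  by rewrite -[leRHS]mulr1 ler_wpM2l// mulr_ge0.
rewrite (_ : _ - _ = (y - y') - (2 * (kap y - kap y')) *: n); last first.
  by rewrite /image; apply: pair_ext; rewrite /= /GRing.scale /=; ring.
rewrite (le_trans (ler_normB _ _))// lerD2l normrZ normrM (ger0_norm (ler0n _ 2)).
by rewrite -[leRHS]mulr1 ler_wpM2l// mulr_ge0.
Qed.

Lemma log_slow_far (R : realType) (Om : set (plane R)) (p n x1 : plane R) (kap : plane R -> R) (e : R) :
  chart Om p n kap -> x1 != p -> 0 < e ->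
  exists2 r : R, 0 < r & forall x y y', `|x - x1| < r ->
    Om y -> Om y' -> `|y - p| < r -> `|y' - p| < r ->
    slow kap e y y' (logratio n kap x y - logratio n kap x y').
Proof.
move=> ch x1p e0; have [nn _ _ _ _] := ch; have n1 := unit_norm_le nn.
have [r3 r30 [H1 _ H3 H4 _]] := chart_near ch (ltac:(by rewrite invr_gt0) : 0 < 64^-1 :> R) (lexx _).
have [L sL] : exists L, sdiff (fun w : plane R => ln (sqn w)) (x1 - p) L.
  by apply: sdiff_lndot; rewrite subr_eq0.
have [C C0 [s s0 Hs]] := sdiff_lipschitz sL.
have q0 : 0 < e / (24 * C) by rewrite divr_gt0// mulr_gt0.
have s80 : 0 < s / 8 by rewrite divr_gt0.
exists (Num.min (Num.min r3 (s / 8)) (e / (24 * C))); first by rewrite !lt_min r30 s80.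
move=> x y y'; rewrite !lt_min => /andP[/andP[x3 xs] xe] Oy Oy' /andP[/andP[y3 ys] ye] /andP[/andP[z3 zs] ze].
have k0 : 0 < kap y by apply/(H1 y y3).
have k0' : 0 < kap y' by apply/(H1 y' z3).
have ky := H4 y y3; have ky' := H4 y' z3; rewrite (gtr0_norm k0) in ky; rewrite (gtr0_norm k0') in ky'.
have [i1 i3] := image_dist kap y y' n1; have [i2 _] := image_dist kap y' y n1.
rewrite (gtr0_norm k0) in i1; rewrite (gtr0_norm k0') in i2.
have B w : `|w - p| < 7 * (s / 8) -> `|(x - w) - (x1 - p)| < s.
  move=> wp; rewrite (_ : _ - _ = (x - x1) - (w - p)); last first.
    by apply: pair_ext; rewrite /=; ring.
  by rewrite (le_lt_trans (ler_normB _ _))//; clear -xs wp; lra.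
have By : `|y - p| < 7 * (s / 8) by clear -ys s0; lra.
have By' : `|y' - p| < 7 * (s / 8) by clear -zs s0; lra.
have Bi w : `|w - p| < s / 8 -> `|w - image n kap w| <= 2 * kap w -> kap w <= 3 * `|w - p| ->
    `|image n kap w - p| < 7 * (s / 8).
  move=> h1 h2 h3; rewrite -(subrKA w) (le_lt_trans (ler_normD _ _))// (distrC _ w).
  by clear -h1 h2 h3; lra.
have Bi1 := Bi y ys i1 ky; have Bi2 := Bi y' zs i2 ky'.
have S (a b : plane R) : (x - a) - (x - b) = b - a by apply: pair_ext; rewrite /=; ring.
have h1 := Hs _ _ (B _ By) (B _ Bi1); have h2 := Hs _ _ (B _ By') (B _ Bi2).
have h3 := Hs _ _ (B _ By) (B _ By'); have h4 := Hs _ _ (B _ Bi1) (B _ Bi2).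
rewrite !S in h1 h2 h3 h4; rewrite distrC in i1; rewrite distrC in i2.
rewrite distrC in i3.
have Ce : e / (24 * C) * (24 * C) = e by rewrite divfK// gt_eqF// mulr_gt0.
have Cd w : `|w - p| < e / (24 * C) -> kap w <= 3 * `|w - p| -> 8 * (C * kap w) <= e.
  move=> h5 h6; rewrite -Ce.
  have : C * kap w <= C * (3 * (e / (24 * C))) by rewrite ler_wpM2l ?(ltW C0)//; clear -h5 h6; lra.
  by move: (e / (24 * C)) => q; clear; lra.
have Cy := Cd _ ye ky; have Cy' := Cd _ ze ky'.
(* 8 = 1 + 7: the image map is 7-Lipschitz, by 1 + 2 * 3 with the Lipschitz constant 3 of [kap]. *)
apply: (slow_lipschitz (ltW k0) (C := 8 * C)).
- rewrite (le_trans (ler_normB _ _))// /logratio.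
  have := ler_wpM2l (ltW C0) i1; have := ler_wpM2l (ltW C0) i2.
  have : 0 <= C * kap y by rewrite mulr_ge0// ltW.
  have : 0 <= C * kap y' by rewrite mulr_ge0// ltW.
  by clear -h1 h2 Cy Cy'; lra.
- move=> _; rewrite /logratio.
  rewrite (_ : _ - _ - _ = (ln (sqn (x - y)) - ln (sqn (x - y'))) -
      (ln (sqn (x - image n kap y)) - ln (sqn (x - image n kap y')))); last by ring.
  rewrite (le_trans (ler_normB _ _))//; have h5 := H3 y y' y3 z3.
  rewrite distrC in h3.
  have h6 : `|image n kap y' - image n kap y| <= 7 * `|y - y'| by clear -i3 h5; lra.
  by have := ler_wpM2l (ltW C0) h6; move: h3 h4; rewrite (distrC y') (distrC (ln (sqn (x - y')))); clear; lra.
- by clear -Cy; lra.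
Qed.

(** For x on the boundary [kap x = 0], so dot (x - y) n + kap y is only the linearisation error of
    [kap], at most f |x - y|. This is the small quantity in the logarithm estimates. *)
Lemma log_slow_near (R : realType) (Om : set (plane R)) (p n : plane R) (kap : plane R -> R) (e : R) :
  open Om -> chart Om p n kap -> 0 < e ->
  exists2 r : R, 0 < r & forall x y y', bd Om x -> `|x - p| < r ->
    Om y -> Om y' -> `|y - p| < r -> `|y' - p| < r ->
    slow kap e y y' (logratio n kap x y - logratio n kap x y').
Proof.
move=> oO ch e0; have [nn _ ck _ _] := ch; have n1 := unit_norm_le nn.
(* 1200 = 3 * 400: the bound kap y <= 3 |x - y| meets the constant of [image_log_diff]. The minimum
   with 1/64 is for [chart_near]. *)
pose f := Num.min 64^-1 (e / 40 / 30).
have f0 : 0 < f by rewrite lt_min invr_gt0 ltr0n !divr_gt0.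
have [f64 fe] : f <= 64^-1 /\ f <= e / 40 / 30 by split; rewrite /f ge_min lexx ?orbT.
have f24 : f <= 24^-1 by rewrite (le_trans f64)// lef_pV2 ?posrE// ler_nat.
clearbody f.
have [r r0 [H1 H2 H3 _ H5]] := chart_near ch f0 f64.
exists r => // x y y' bx xp Oy Oy' yp yp'.
have [cx nx] := bdE oO bx; have kx := chart_bd oO ck H1 bx xp.
have k0 : 0 < kap y by apply/(H1 y yp).
have k0' : 0 < kap y' by apply/(H1 y' yp').
have M0 w : Om w -> 0 < `|x - w|.
  by move=> Ow; rewrite normr_gt0 subr_eq0; apply/eqP => E; apply: nx; rewrite E.
have ak w : `|w - p| < r -> `|dot (x - w) n + kap w| <= f * `|x - w|.
  move=> wp; have := H2 x w xp wp; rewrite kx sub0r -opprD normrN addrC; done.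
have kM w : `|w - p| < r -> 0 < kap w -> kap w <= 3 * `|x - w|.
  by move=> wp kw; have := H3 x w xp wp; rewrite kx sub0r normrN gtr0_norm.
pose A w := ln (sqn (x - w) + 4 * kap w * (dot (x - w) n + kap w)) - ln (sqn (x - w)).
have E : logratio n kap x y - logratio n kap x y' = A y' - A y.
  by rewrite /logratio /A !(image_sqdist kap x _ nn); ring.
have md w := norm_sq_le (x - w).
have s1 := image_log_small (M0 _ Oy) (md y) (ak y yp) (ltW k0) (kM y yp k0) f24.
have s2 := image_log_small (M0 _ Oy') (md y') (ak y' yp') (ltW k0') (kM y' yp' k0') f24.
rewrite -/(A y) in s1; rewrite -/(A y') in s2; rewrite E; split.
  by rewrite (le_trans (ler_normB _ _))//; lra.
move=> yy; have kMy := kM y yp k0.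
have D1 : `|y - y'| <= `|x - y| / 2 by have := normr_ge0 (x - y); lra.
have S : (x - y) - (x - y') = y' - y by apply: pair_ext; rewrite /=; ring.
have D2 : `| `|x - y| - `|x - y'| | <= `|y - y'|.
  by rewrite (le_trans (ler_dist_dist _ _))// S distrC.
have D3 := H3 y y' yp yp'.
have D4 : `|(dot (x - y) n + kap y) - (dot (x - y') n + kap y')| <= f * `|y - y'|.
  rewrite (_ : _ - _ = kap y - kap y' - dot (y - y') n); first exact: H2.
  by rewrite /dot /=; ring.
have D5 : `|sqn (x - y) - sqn (x - y')| <= 2 * (`|y - y'| * (`|x - y| + `|x - y'|)).
  rewrite (_ : _ - _ = dot ((x - y) - (x - y')) ((x - y) + (x - y'))); last by rewrite /dot /=; ring.
  rewrite S (le_trans (dot_le _ _))// (distrC y') ler_wpM2l// ler_wpM2l//.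
  exact: ler_normD.
have h : `|x - y| * `|A y - A y'| <= 400 * f * `|y - y'|.
  exact: image_log_diff (M0 _ Oy) (md y) (ak y yp) (ltW k0) kMy f24
    (md y') (ak y' yp') (ltW k0') (kM y' yp' k0') D1 D2 D3 D4 D5.
rewrite (distrC (A y)) in h.
have h1 : kap y * `|A y' - A y| <= 3 * `|x - y| * `|A y' - A y| by rewrite ler_wpM2r.
have h2 : f * `|y - y'| <= e / 40 / 30 * `|y - y'| by rewrite ler_wpM2r.
lra.
Qed.

(** The second boundary point is the device for avoiding the pole: for y near p, the boundary values
    of G (., y) near p can all be read off there. *)
Lemma boundary_const (R : realType) (Om : set (plane R)) (G : plane R * plane R -> R) (p : plane R) :
  green_setting Om G -> bd Om p -> exists2 r : R, 0 < r &
  (forall x x' y, Om y -> bd Om x -> bd Om x' -> `|x - p| < r -> `|x' - p| < r -> G (x, y) = G (x', y)) /\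
  exists2 x, bd Om x & x != p /\ `|x - p| < r.
Proof.
move=> [_ C3 cG gk tG] bp; have oO : open Om by case: gk.
have [e [f [r gc]]] := C3_graph_chart oO C3 bp; have [ee r0 cf f0 _] := gc.
have [d d0 Hd] := graph_boundary_const oO cG tG gc.
have [d' d0' [_ Hb]] := graph_boundary oO gc.
have s0 : 0 < Num.min r (d / 2) by rewrite lt_min r0 divr_gt0.
exists (Num.min r (d / 2)) => //; split.
  have E x : bd Om x -> `|x - p| < Num.min r (d / 2) ->
      `|dot (x - p) e| < d /\ x = graph_point e p (dot (x - p) e) (f (dot (x - p) e)).
    move=> bx; rewrite lt_min => /andP[xr xd]; split.
      rewrite (le_lt_trans (dot_le _ _))//; have := unit_norm_le ee.
      by have := normr_ge0 (x - p); nra.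
    by rewrite (graph_boundary_conv oO gc bx xr); exact: graph_pointE.
  move=> x x' y Oy bx bx' /(E _ bx)[h1 ->] /(E _ bx')[h2 ->].
  exact: Hd.
have fc : continuous f by exact: C1_continuous.
have m20 : 0 < Num.min r (d / 2) / 2 by rewrite divr_gt0.
have /continuousP_eps/(_ _ m20)[c c0 Hc] := fc 0.
pose s := Num.min (Num.min c d') (Num.min r (d / 2) / 2) / 2.
have mm0 : 0 < Num.min (Num.min c d') (Num.min r (d / 2) / 2) by rewrite lt_min m20 lt_min c0 d0'.
have sp : 0 < s by rewrite divr_gt0.
have : s < Num.min (Num.min c d') (Num.min r (d / 2) / 2) by rewrite ltr_pdivrMr// ltr_pMr// ltr1n.
clearbody s; rewrite (lt_min _ (Num.min c d')) lt_min => /andP[/andP[sc sd] sm].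
have ns : `|s| = s by rewrite gtr0_norm.
exists (graph_point e p s (f s)); first by apply: Hb; rewrite ns.
split.
  apply/eqP => E; have [] := graph_point_coord p s (f s) ee; rewrite E subrr.
  by rewrite {1}/dot /= !mul0r addr0 => h; move: sp; rewrite -h ltxx.
have := Hc s; rewrite subr0 f0 subr0 ns => /(_ sc) fs.
rewrite /graph_point addrC addKr (le_lt_trans (ler_normD _ _))// !normrZ perp_norm ns.
have := unit_norm_le ee; have := normr_ge0 e; have := normr_ge0 (f s); nra.
Qed.

Lemma chart_closure (R : realType) (Om : set (plane R)) (p x : plane R) (kap : plane R -> R) (r : R) :
  open Om -> continuous kap -> (forall x, `|x - p| < r -> (Om x <-> 0 < kap x)) ->
  closure Om x -> `|x - p| < r -> 0 <= kap x.
Proof.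
move=> oO ck H cx xp; have [Ox|nOx] := pselect (Om x); first by rewrite ltW//; apply/H.
by rewrite (chart_bd oO ck H (bd_intro cx nOx) xp).
Qed.

(** At the image point [kap] is close to kap y - 2 kap y < 0, whereas it is nonnegative on the
    closure near p. The image is within 7 |y - p| of p, hence the radius r/7. *)
Lemma image_outside (R : realType) (Om : set (plane R)) (p n : plane R) (kap : plane R -> R) :
  open Om -> chart Om p n kap -> exists2 r : R, 0 < r &
  forall x y, closure Om x -> Om y -> `|y - p| < r -> x != image n kap y.
Proof.
move=> oO ch; have [nn _ ck _ _] := ch; have n1 := unit_norm_le nn.
have [r r0 [H1 H2 H3 H4 _]] := chart_near ch (ltac:(by rewrite invr_gt0) : 0 < 64^-1 :> R) (lexx _).
exists (r / 7); first by rewrite divr_gt0.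
move=> x y cx Oy yp; apply/eqP => E.
have yr : `|y - p| < r by lra.
have k0 : 0 < kap y by apply/(H1 y yr).
have ky := H4 y yr; rewrite (gtr0_norm k0) in ky.
have [i1 _] := image_dist kap y y n1; rewrite (gtr0_norm k0) in i1.
have ip : `|image n kap y - p| < r.
  rewrite -(subrKA y) (le_lt_trans (ler_normD _ _))// (distrC _ y); lra.
rewrite E in cx; have kc := chart_closure oO ck H1 cx ip.
have := H2 _ _ ip yr; rewrite distrC in i1.
have -> : dot (image n kap y - y) n = - (2 * kap y).
  have -> : dot (image n kap y - y) n = - (2 * kap y) * dot n n.
    by rewrite /image /dot /= /GRing.scale /=; ring.
  by rewrite nn mulr1.
move=> h; have : `|kap (image n kap y) - kap y - - (2 * kap y)| <= 64^-1 * (2 * kap y).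
  by rewrite (le_trans h)// ler_wpM2l.
rewrite ler_norml => /andP[h1 h2]; lra.
Qed.

Lemma slow_scale (R : realType) (kap : plane R -> R) (e c : R) (y y' : plane R) (t : R) : 0 <= c ->
  slow kap e y y' t -> slow kap (c * e) y y' (c * t).
Proof.
move=> c0 [h1 h2]; rewrite /slow normrM (ger0_norm c0); split; first by rewrite ler_wpM2l.
by move=> /h2 h; rewrite mulrCA -mulrA ler_wpM2l.
Qed.

(** For x on the boundary away from p, both G and the logarithms are regular at y = p, uniformly by
    compactness; near p the boundary value of G moves to x1 and only the logarithmic ratio is left.
    The maximum principle in x then carries each half of [slow] into Om. *)
Lemma psi_slow (R : realType) (Om : set (plane R)) (G : plane R * plane R -> R) (p n : plane R)
    (kap : plane R -> R) (e : R) :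
  green_setting Om G -> chart Om p n kap -> bd Om p -> 0 < e ->
  exists2 r : R, 0 < r & forall x y y', Om x -> Om y -> Om y' -> `|y - p| < r -> `|y' - p| < r ->
    slow kap e y y' (psi Om G n kap x y - psi Om G n kap x y').
Proof.
move=> gs ch bp e0; have [bO C3 cG gk tG] := gs; have oO : open Om by case: gk.
have P0 := pi4_gt0 R.
pose f := e / 2; have f0 : 0 < f by rewrite divr_gt0.
pose f' := f / (4 * pi); have f0' : 0 < f' by rewrite divr_gt0.
have ff : 4 * pi * f' = f by rewrite /f' mulrC divfK// gt_eqF.
have psiB x y : bd Om x -> Om y -> psi Om G n kap x y = 4 * pi * G (x, y) + logratio n kap x y.
  move=> bx Oy; have [_ nx] := bdE oO bx; rewrite /psi /logratio.
  by case: eqVneq => [E|_]; [case: nx; rewrite E | rewrite addrA].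
have fee : f + f = e by rewrite /f; lra.
have [rc rc0 [Hc [x1 bx1 [x1p x1r]]]] := boundary_const gs bp.
have [cx1 _] := bdE oO bx1.
have [r1 r10 Hr1] := green_slow_far gs ch bp cx1 x1p f0'.
have [r2 r20 Hr2] := log_slow_near oO ch f0.
have [r3 r30 H3] := image_outside oO ch.
have [_ _ _ _ [r4 r40 H4]] := ch.
have kpos y : Om y -> `|y - p| < r4 -> 0 <= kap y by move=> Oy /H4 [h _]; rewrite ltW// h.
pose K := closure Om `&` [set x | Num.min rc r2 <= `|x - p|].
have cK : compact K.
  apply: (@subclosed_compact _ _ (closure Om)); [|exact: compact_closure | by move=> x []].
  apply: closedI; first exact: closed_closure.
  rewrite (_ : [set x | _] = (fun x : plane R => `|x - p|) @^-1` [set t | Num.min rc r2 <= t])//.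
  apply: preimage_closed; last exact: closed_ge.
  have cn : continuous (fun x : plane R => `|x - p|).
    by move=> x; apply: cvg_norm; apply: cvgB; [exact: cvg_id | exact: cvg_cst].
  by move=> x _; exact: cn.
have [|r5 r50 H5] := @compact_small R _ K (fun d x => forall y y', closure Om x -> Om y -> Om y' ->
    `|y - p| < d -> `|y' - p| < d -> `|y - p| < r4 ->
    slow kap e y y' ((4 * pi * G (x, y) + logratio n kap x y) - (4 * pi * G (x, y') + logratio n kap x y'))) cK.
  move=> x [cx xf]; have xp : x != p.
    apply/eqP => E; move: xf; rewrite E /= subrr normr0 leNgt lt_min rc0 r20//.
  have [s1 s10 Hs1] := green_slow_far gs ch bp cx xp f0'.
  have [s2 s20 Hs2] := log_slow_far ch xp f0.
  exists (Num.min s1 s2); first by rewrite lt_min s10.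
  move=> z; rewrite lt_min => /andP[zs1 zs2] d d0; rewrite lt_min => /andP[ds1 ds2] y y' cz Oy Oy' yd yd' y4.
  have A := Hs1 z y y' cz zs1 Oy Oy' (lt_trans yd ds1) (lt_trans yd' ds1).
  have B := Hs2 z y y' zs2 Oy Oy' (lt_trans yd ds2) (lt_trans yd' ds2).
  have := slow_add (kpos y Oy y4) (slow_scale (ltW P0) A) B; rewrite ff fee.
  by congr slow; ring.
pose r := Num.min (Num.min r1 r2) (Num.min (Num.min r3 r4) r5) / 2.
have m0 : 0 < Num.min (Num.min r1 r2) (Num.min (Num.min r3 r4) r5) by rewrite !lt_min r10 r20 r30 r40.
have r0 : 0 < r by rewrite divr_gt0.
have : r < Num.min (Num.min r1 r2) (Num.min (Num.min r3 r4) r5) by rewrite ltr_pdivrMr// ltr_pMr// ltr1n.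
clearbody r; rewrite !lt_min => /andP[/andP[rr1 rr2] /andP[/andP[rr3 rr4] rr5]].
exists r => // x y y' Ox Oy Oy' yr yr'.
have kp := kpos y Oy (lt_trans yr rr4).
have B z : bd Om z -> slow kap e y y' (psi Om G n kap z y - psi Om G n kap z y').
  move=> bz; rewrite !psiB//; have [cz _] := bdE oO bz.
  have [zn|zf] := ltP `|z - p| (Num.min rc r2); last by apply: (H5 z _ r) => //; exact: lt_trans rr4.
  move: zn; rewrite lt_min => /andP[zc z2].
  (* z and y may both be close to p; the value at x1 is the same and is regular in y. *)
  rewrite (Hc z x1 y)// (Hc z x1 y')//.
  have A := Hr1 x1 y y' cx1 _ Oy Oy' (lt_trans yr rr1) (lt_trans yr' rr1).
  rewrite subrr normr0 in A; have {}A := A r10.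
  have B := Hr2 z y y' bz z2 Oy Oy' (lt_trans yr rr2) (lt_trans yr' rr2).
  have := slow_add kp (slow_scale (ltW P0) A) B; rewrite ff fee.
  by congr slow; ring.
have ni z : closure Om z -> z != image n kap y /\ z != image n kap y'.
  by move=> cz; split; apply: H3 => //; exact: lt_trans rr3.
split; first by apply: (psi_compare gs Oy Oy' ni _ Ox) => z /B[].
move=> yy; have [k00|k0] := eqVneq (kap y) 0; first by rewrite k00 mul0r mulr_ge0// ltW.
have k1 : 0 < kap y by rewrite lt0r k0.
rewrite -ler_pdivlMl//; apply: (psi_compare gs Oy Oy' ni _ Ox) => z /B[_ /(_ yy)].
by rewrite ler_pdivlMl.
Qed.

(** * Derivatives near the boundary *)

Lemma dot_cauchy (R : realType) (u v : plane R) : dot u v ^+ 2 <= sqn u * sqn v.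
Proof.
rewrite -subr_ge0 (_ : _ - _ = (u.1 * v.2 - u.2 * v.1) ^+ 2) ?sqr_ge0//.
by rewrite /dot; ring.
Qed.

Lemma sdiff_lnsqn (R : realType) (w : plane R) : w != 0 ->
  sdiff (fun w : plane R => ln (sqn w)) w (fun v => 2 * dot w v / sqn w).
Proof.
move=> w0; have [L sL] := sdiff_lndot w0.
rewrite (_ : (fun v => _) = L)//; apply/funext => v.
have [_ <-] := sdiff_is_derive v sL.
have H := is_derive_comp1 (is_derive_dot w v) (is_derive1_ln (dot_gt0 w0)).
by have [_ ->] := H; rewrite mulrC.
Qed.

Lemma green_derive (R : realType) (Om : set (plane R)) (G : plane R * plane R -> R) (x y : plane R)
    (v : plane R * plane R) :
  green_kernel Om G -> Ck_up_to 2 (F2 Om) (F2 (closure Om)) G -> F2 Om (x, y) ->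
  4 * pi * 'D_v G (x, y) =
  4 * pi * 'D_v (regular_part Om G) (x, y) - 2 * dot (x - y) (v.1 - v.2) / sqn (x - y).
Proof.
move=> gk cG Fxy; have [oO cG1 _] := gk; have [/= Ox Oy xy] := Fxy.
have sg := sdiff_derive (regular_sdiff gk (Ox : Om (x, y).1) (Oy : Om (x, y).2)).
have xy0 : x - y != 0 by rewrite subr_eq0; exact/eqP.
have sl : sdiff (fun p : plane R * plane R => ln (sqn (p.1 - p.2))) (x, y)
    (fun v => 2 * dot (x - y) (v.1 - v.2) / sqn (x - y)).
  apply: (sdiff_comp_linear (f := fun w : plane R => ln (sqn w)) (A := fun p : plane R * plane R => p.1 - p.2)
    (x := (x, y)) (L := fun w => 2 * dot (x - y) w / sqn (x - y)) (C := 2)).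
  - by move=> a u w; apply: pair_ext; rewrite /= /GRing.scale /=; ring.
  - move=> u; rewrite (le_trans (ler_normB _ _))//.
    by have := fst_le u; have := snd_le u; lra.
  - exact: sdiff_lnsqn.
have P0 := pi4_gt0 R.
have s2 : sdiff G (x, y) (fun v => 'D_v (regular_part Om G) (x, y) +
    (- (4 * pi)^-1) * (2 * dot (x - y) (v.1 - v.2) / sqn (x - y))).
  apply: sdiff_near_eq (sdiff_add sg (sdiff_scale (- (4 * pi)^-1) sl)).
  have : \forall p \near (x, y), F2 Om p by apply: open_nbhs_nbhs; split => //; exact: open_F2.
  apply: filterS => p Fp; rewrite (regular_part_off oO cG1 Fp).
  by move: (4 * pi : R) P0 => P P0; field; rewrite gt_eqF.
have [_ ->] := sdiff_is_derive v s2.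
have d0 := dot_gt0 xy0.
by move: (4 * pi : R) P0 => P P0; field; rewrite !gt_eqF.
Qed.

Lemma sdiff_central (R : realType) (V : normedModType R) (u : V -> R) (x v : V) (L : V -> R) (C d : R) :
  sdiff u x L -> `|v| <= 1 -> 0 < d ->
  (forall t, 0 < t -> t <= d -> `|u (t *: v + x) - u ((- t) *: v + x)| <= 2 * C * t) -> `|L v| <= C.
Proof.
move=> sL v1 d0 H; apply/ler_addgt0Pr => e e0; have [_ _ /(_ e e0)[r r0 Hr]] := sL.
pose t := Num.min r d / 2; have m0 : 0 < Num.min r d by rewrite lt_min r0.
have t0 : 0 < t by rewrite divr_gt0.
have : t < Num.min r d by rewrite ltr_pdivrMr// ltr_pMr// ltr1n.
clearbody t; rewrite lt_min => /andP[tr td].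
have B (s : R) : `|s| = t -> `|s *: v + x - x| < r.
  move=> st; rewrite addrK normrZ st (le_lt_trans _ tr)// -[leRHS]mulr1 ler_wpM2l// ltW//.
have n1 : `|t| = t by rewrite gtr0_norm.
have n2 : `|- t| = t by rewrite normrN gtr0_norm.
have := Hr _ _ (B _ n1) (B _ n2).
have -> : t *: v + x - (- t *: v + x) = (2 * t) *: v.
  by rewrite opprD addrACA subrr addr0 scaleNr opprK -scalerDl; congr (_ *: _); ring.
rewrite (sdiffLZ _ _ sL) normrZ normrM (ger0_norm (ler0n _ 2)) n1 => h1.
have h2 := H t t0 (ltW td).
have : `|2 * t * L v| <= 2 * C * t + e * (2 * t).
  rewrite -[2 * t * L v](subKr (u (t *: v + x) - u (- t *: v + x))) (le_trans (ler_normB _ _))//.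
  rewrite lerD// (le_trans h1)// ler_wpM2l ?(ltW e0)// -[leRHS]mulr1 ler_wpM2l// mulr_ge0// ltW//.
rewrite !normrM (ger0_norm (ler0n _ 2)) n1 => h3.
have : (2 * t) * `|L v| <= (2 * t) * (C + e) by lra.
by rewrite ler_pM2l// mulr_gt0.
Qed.

(** Near p, psi is almost a constant: replace y by a fixed y0 using [psi_slow], then use continuity
    in x at p. The gradient bound on a square of half side comparable to [kap x] divides this small
    oscillation by [kap x]. *)
Lemma psi_gradient (R : realType) (Om : set (plane R)) (G : plane R * plane R -> R) (p n : plane R)
    (kap : plane R -> R) (e : R) :
  green_setting Om G -> chart Om p n kap -> bd Om p -> 0 < e ->
  exists2 r : R, 0 < r & forall x y L v, Om x -> Om y -> `|x - p| < r -> `|y - p| < r ->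
    sdiff (fun x => psi Om G n kap x y) x L -> kap x * `|L v| <= e * `|v|.
Proof.
move=> gs ch bp e0; have [bO C3 cG gk tG] := gs; have oO : open Om by case: gk.
have [cp np] := bdE oO bp.
(* An oscillation 2 f at radius kap x / 4 gives 16 f / kap x in each of the two coordinate
   directions. *)
pose f := e / 32; have f0 : 0 < f by rewrite divr_gt0.
have [r1 r10 H1] := psi_slow gs ch bp f0.
have [r4 r40 H4] := image_outside oO ch.
have m14 : 0 < Num.min r1 r4 by rewrite lt_min r10.
have [y0 Oy0] := closure_eps cp m14; rewrite lt_min => /andP[y01 y04].
have [r2 r20 H2] := (within_cvgP _ _ _ _).1 (psi_continuous gs cp Oy0 (H4 _ _ cp Oy0 y04)) f f0.
have [r3 r30 [C1 _ C3' C4 _]] := chart_near ch (ltac:(by rewrite invr_gt0) : 0 < 64^-1 :> R) (lexx _).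
pose r := Num.min (Num.min r1 r4) (Num.min (r2 / 2) (r3 / 2)).
exists r; first by rewrite !lt_min r10 r40 !divr_gt0.
move=> x y L v Ox Oy; rewrite !lt_min => /andP[/andP[x1 x4] /andP[x2 x3]] /andP[/andP[y1 y4] _] sL.
have x3' : `|x - p| < r3 by have := normr_ge0 (x - p); lra.
have k0 : 0 < kap x by apply/C1.
have kx := C4 x x3'; rewrite (gtr0_norm k0) in kx.
pose d := kap x / 4; have d0 : 0 < d by rewrite divr_gt0.
pose c := psi Om G n kap p y0.
have near z : `|z - x| <= d -> [/\ {for z, continuous (fun x => psi Om G n kap x y)},
    sdharmonic (fun x => psi Om G n kap x y) z & `|psi Om G n kap z y - c| <= 2 * f].
  move=> zx.
  have zp : `|z - p| < 2 * `|x - p|.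
    rewrite -(subrKA x) (le_lt_trans (ler_normD _ _))// -[ltRHS]/(2 * _).
    rewrite /d in zx; have := normr_ge0 (x - p); lra.
  have z3 : `|z - p| < r3 by lra.
  have z2 : `|z - p| < r2 by lra.
  have Oz : Om z.
    apply/(C1 _ z3); have := C3' z x z3 x3'; rewrite ler_norml => /andP[h _].
    by rewrite /d in zx; lra.
  have cz := subset_closure Oz; have zi := H4 z y cz Oy y4.
  split; last 1 first.
  - have [h1 _] := H1 z y y0 Oz Oy Oy0 y1 y01.
    have h2 := H2 z cz z2; rewrite -(subrKA (psi Om G n kap z y0)) (le_trans (ler_normD _ _))//.
    by rewrite mulrDl mul1r lerD// ltW.
  - have [L' sL'] := regular_sdiff gk (Oz : Om (z, y).1) (Oy : Om (z, y).2).
    have s1 := sdiff_scale (4 * pi) (sdiff_slice1 sL').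
    have zi0 : z - image n kap y != 0 by rewrite subr_eq0.
    have s2 := sdiff_scale (-1) (sdiff_translate (sdiff_lnsqn zi0)).
    apply: (@sdiff_continuous _ _ _ _ _ (sdiff_near_eq _ (sdiff_add s1 s2))).
    have : \forall w \near z, Om w by exact: open_nbhs_nbhs.
    by apply: filterS => w Ow; rewrite psi_regular// mulN1r.
  - exact: psi_harmonic.
have cc t : 4 * (2 * f) * t / d = 2 * (16 * f / kap x) * t by rewrite /d; field; rewrite gt_eqF.
have L1 : `|L e1| <= 16 * f / kap x.
  apply: (sdiff_central sL (e1_norm R) d0) => t t0 td; rewrite -cc.
  exact: gradient_estimate t0 td near.
have L2 : `|L e2| <= 16 * f / kap x.
  apply: (sdiff_central sL (e2_norm R) d0) => t t0 td; rewrite -cc.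
  exact: gradient_estimate2 t0 td near.
have vE : v = v.1 *: e1 + v.2 *: e2.
  by apply: pair_ext; rewrite /= /GRing.scale /=; ring.
have h : `|L v| <= `|v| * (16 * f / kap x) + `|v| * (16 * f / kap x).
  rewrite [in L v]vE (sdiffLD _ _ sL) !(sdiffLZ _ _ sL) (le_trans (ler_normD _ _))// !normrM.
  by rewrite lerD// ler_pM// ?fst_le ?snd_le.
apply: (le_trans (ler_wpM2l (ltW k0) h)); rewrite /f le_eqVlt; apply/orP; left; apply/eqP.
by field; rewrite gt_eqF.
Qed.

Lemma derivative_bound (R : realType) (V : normedModType R) (u : V -> R) (y v : V) (L : V -> R) (c C r : R) :
  sdiff u y L -> 0 < r ->
  (forall t, 0 < t -> t < r -> `|u (t *: v + y) - u y - t * c| <= C * t) -> `|L v - c| <= C.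
Proof.
move=> sL r0 H; apply/ler_addgt0Pr => e e0; have [_ _ Hd] := sL.
have v0 : 0 < `|v| + 1 by rewrite ltr_wpDl.
have [s s0 Hs] := Hd (e / (`|v| + 1)) (divr_gt0 e0 v0).
pose t := Num.min r (s / (`|v| + 1)) / 2.
have m0 : 0 < Num.min r (s / (`|v| + 1)) by rewrite lt_min r0 divr_gt0.
have t0 : 0 < t by rewrite divr_gt0.
have : t < Num.min r (s / (`|v| + 1)) by rewrite ltr_pdivrMr// ltr_pMr// ltr1n.
clearbody t; rewrite lt_min => /andP[tr]; rewrite ltr_pdivlMr// => ts.
have tv : t * `|v| < s by rewrite (le_lt_trans _ ts)// ler_wpM2l ?(ltW t0)// lerDl.
have h1 := H t t0 tr.
have := Hs (t *: v + y) y; rewrite addrK subrr normr0 normrZ (gtr0_norm t0) => /(_ tv s0).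
rewrite (sdiffLZ _ _ sL) => h2.
have h3 : e / (`|v| + 1) * (t * `|v|) <= e * t.
  have ke : e / (`|v| + 1) * (`|v| + 1) = e by rewrite divfK// gt_eqF.
  move: ke (mulr_ge0 (ltW (divr_gt0 e0 v0)) (ltW t0)); move: (e / _) => k ke; rewrite -ke.
  lra.
have : `|t * (L v - c)| <= C * t + e * t.
  rewrite (_ : t * _ = (u (t *: v + y) - u y - t * c) - (u (t *: v + y) - u y - t * L v)); last by ring.
  by rewrite (le_trans (ler_normB _ _))// lerD// (le_trans h2).
rewrite normrM (gtr0_norm t0) -mulrDl mulrC ler_pM2r//.
Qed.

(** k1 and k2 are the speeds of the two points along the normal. Their sum is nearly b, so 2 (k1 +
    k2) b / q becomes 2 b^2 / q at the cost of the third error. *)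
Lemma square_field (R : realType) (l1 l2 k1 k2 b q e1 e2 e3 e : R) : 0 < q ->
  `|k1 * l1 - 2 * k1 * b / q| <= e1 -> `|k2 * l2 - 2 * k2 * b / q| <= e2 ->
  `|2 * (k1 + k2 - b) * b / q| <= e3 -> e1 + e2 + e3 <= e ->
  `|k1 * l1 + k2 * l2 - 2 * b ^+ 2 / q| <= e.
Proof.
move=> q0 h1 h2 h3; apply: le_trans.
rewrite (_ : _ - _ = (k1 * l1 - 2 * k1 * b / q) + (k2 * l2 - 2 * k2 * b / q) +
  2 * (k1 + k2 - b) * b / q); last by field; rewrite gt_eqF.
by rewrite (le_trans (ler_normD _ _))// lerD// (le_trans (ler_normD _ _))// lerD.
Qed.

(* With b and q the components used below, the gradient of 4 pi g along the field kap n is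
   2 b^2 / q up to a small error: psi varies slowly at the scale of the distance to the boundary. *)
Lemma regular_boundary (R : realType) (Om : set (plane R)) (G : plane R * plane R -> R) (p n : plane R)
    (kap : plane R -> R) (e : R) :
  green_setting Om G -> chart Om p n kap -> bd Om p -> 0 < e ->
  exists2 r : R, 0 < r & forall x y, Om x -> Om y -> `|x - p| < r -> `|y - p| < r ->
    0 < sqn (x - image n kap y) /\
    `|4 * pi * 'D_((kap x *: n, kap y *: n) : plane R * plane R) (regular_part Om G) (x, y)
      - 2 * dot (x - image n kap y) n ^+ 2 / sqn (x - image n kap y)| <= e.
Proof.
move=> gs ch bp e0; have [bO C3 cG gk tG] := gs; have oO : open Om by case: gk.
have [nn _ _ _ _] := ch; have n1 := unit_norm_le nn.
(* The errors below are f, 4 f + 264 eps and 132 eps; with eps <= e/1200 their sum stays below e. *)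
pose f := e / 10; have f0 : 0 < f by rewrite divr_gt0.
pose eps := Num.min 64^-1 (e / 40 / 30).
have eps0 : 0 < eps by rewrite lt_min invr_gt0 ltr0n !divr_gt0.
have [eps64 epse] : eps <= 64^-1 /\ eps <= e / 40 / 30 by split; rewrite /eps ge_min lexx ?orbT.
clearbody eps.
have [r1 r10 H1] := psi_gradient gs ch bp f0.
have [r2 r20 H2] := psi_slow gs ch bp f0.
have [r3 r30 [C1 C2 C3' C4 C5]] := chart_near ch eps0 eps64.
have [r4 r40 H4] := image_outside oO ch.
have t30 : 0 < 3^-1 :> R by rewrite invr_gt0.
pose r := Num.min (Num.min r1 (r2 / 2)) (Num.min (r3 / 2) (Num.min r4 3^-1)).
exists r; first by rewrite !lt_min r10 r40 t30 !divr_gt0.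
move=> x y Ox Oy; rewrite !lt_min => /and3P[/andP[x1 x2] x3 /andP[x4 x5]] /and3P[/andP[y1 y2] y3 /andP[y4 y5]].
have x3' : `|x - p| < r3 by have := normr_ge0 (x - p); lra.
have y3' : `|y - p| < r3 by have := normr_ge0 (y - p); lra.
have kx0 : 0 < kap x by apply/C1.
have ky0 : 0 < kap y by apply/C1.
have ky1 : kap y <= 1 by have := C4 y y3'; rewrite (gtr0_norm ky0); lra.
have xi : x != image n kap y by apply: H4 => //; exact: subset_closure.
have w0 : x - image n kap y != 0 by rewrite subr_eq0.
have q0 := dot_gt0 w0.
pose w := x - image n kap y; rewrite -/w in w0 q0 *.
pose q := sqn w; rewrite -/q in q0 *; pose b := dot w n; rewrite -/b.
pose M := `|x - y|; pose a := dot (x - y) n.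
have bE : b = a + 2 * kap y.
  rewrite /b /w /image /a (_ : dot _ n = dot (x - y) n + 2 * kap y * dot n n); first by rewrite nn mulr1.
  by rewrite /dot /= /GRing.scale /=; ring.
have kab : `|kap x - kap y - a| <= eps * M by exact: C2.
have M0 : 0 <= M by exact: normr_ge0.
have bq : b ^+ 2 <= q by have := dot_cauchy w n; rewrite nn mulr1.
have Mkq : M ^+ 2 + kap y ^+ 2 <= 130 * q.
  rewrite /q /w (image_sqdist kap x y nn); apply: image_lower => //.
  - exact: norm_sq_le.
  - exact: C5.
  - rewrite -/a; have : eps * M <= 64^-1 * M by rewrite ler_wpM2r.
    by move: kab; rewrite ler_norml => /andP[_ h]; lra.
  - exact: ltW.
have amgm (s t : R) : `|s| * `|t| <= (s ^+ 2 + t ^+ 2) / 2.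
  have : 0 <= (`|s| - `|t|) ^+ 2 by rewrite sqr_ge0.
  by rewrite sqrrB !real_normK ?num_real// mulr2n; clear; lra.
have kbq : kap y * `|b| <= 66 * q.
  have := amgm (kap y) b; rewrite (gtr0_norm ky0); have := sqr_ge0 M; lra.
have Mbq : M * `|b| <= 66 * q.
  have := amgm M b; rewrite (ger0_norm M0); have := sqr_ge0 (kap y); lra.
have divle (s c : R) : s <= c * q -> s / q <= c by rewrite ler_pdivrMr.
split => //.
have sg := sdiff_scale (4 * pi) (sdiff_derive (regular_sdiff gk (Ox : Om (x, y).1) (Oy : Om (x, y).2))).
pose Lg (v : plane R * plane R) := 4 * pi * 'D_v (regular_part Om G) (x, y).
rewrite -/(Lg _).
have sx := sdiff_slice1 sg; have sy := sdiff_slice sg; rewrite -/(Lg _) in sx sy.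
have slog := sdiff_lnsqn w0.
have e1x : `|kap x * Lg (n, 0) - 2 * kap x * b / q| <= f.
  have s2 := sdiff_scale (-1) (sdiff_translate slog).
  have s3 : sdiff (fun x => psi Om G n kap x y) x (fun v => Lg (v, 0) + -1 * (2 * dot w v / q)).
    apply: sdiff_near_eq (sdiff_add sx s2).
    have : \forall w \near x, Om w by exact: open_nbhs_nbhs.
    by apply: filterS => z Oz; rewrite psi_regular// mulN1r.
  have := H1 x y _ n Ox Oy x1 y1 s3; rewrite -/b => h.
  have := le_trans h (ler_wpM2l (ltW f0) n1); rewrite mulr1.
  rewrite -[X in X * `|_|](gtr0_norm kx0) -normrM; congr (`|_| <= _); ring.
have e1y : `|kap y * Lg (0, n) - 2 * kap y * b / q| <= 4 * f + 264 * eps.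
  have [_ _ /(_ f f0)[s s0 Hs]] := slog.
  have s40 : 0 < s / 4 by rewrite divr_gt0.
  have r220 : 0 < r2 / 2 by rewrite divr_gt0.
  have r320 : 0 < r3 / 2 by rewrite divr_gt0.
  pose ro := Num.min (Num.min 8^-1 (s / 4)) (Num.min (r2 / 2) (r3 / 2)).
  have ro0 : 0 < ro by rewrite !lt_min invr_gt0 ltr0n s40 r220.
  have -> : kap y * Lg (0, n) = Lg (0, kap y *: n).
    rewrite /Lg mulrCA; congr (_ * _); rewrite -(sdiffLZ _ _ (sdiff_derive (regular_sdiff gk (Ox : Om (x, y).1) (Oy : Om (x, y).2)))).
    by congr ('D_ _ _ _); apply: pair_ext => //=; rewrite scaler0.
  (* In y there is no gradient bound, only [slow]; a bound on all small difference quotients along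
     kap y n passes to the derivative. *)
  apply: (derivative_bound sy ro0) => t t0; rewrite !lt_min => /andP[/andP[t8 ts] /andP[t2 t3]].
  pose y' := t *: (kap y *: n) + y.
  have yy : `|y' - y| <= t * kap y.
    rewrite /y' addrK !normrZ (gtr0_norm t0) (gtr0_norm ky0) ler_wpM2l ?(ltW t0)//.
    by rewrite -[leRHS]mulr1 ler_wpM2l// ltW.
  have tk : t * kap y <= t by rewrite -[leRHS]mulr1 ler_wpM2l// ltW.
  have yp c : `|y - p| < c / 2 -> t < c / 2 -> `|y' - p| < c.
    by move=> h1 h2; rewrite -(subrKA y) (le_lt_trans (ler_normD _ _))// -[c](divfK (lt0r_neq0 (ltr0n R 2)))
      mulr_natr mulr2n ltrD// (le_lt_trans _ h2)// (le_trans yy).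
  have y'3 := yp r3 y3 t3; have y'2 := yp r2 y2 t2.
  have Oy' : Om y'.
    apply/(C1 _ y'3); have := C3' _ _ y'3 y3'; rewrite ler_norml => /andP[h _].
    have t8' : t * kap y < 8^-1 * kap y by rewrite ltr_pM2r.
    by clear -h yy t8' ky0; lra.
  rewrite -/y'.
  have y2' : `|y - p| < r2 by move: (normr_ge0 (y - p)) => h; clear -h y2; lra.
  have [_ psl] := H2 x y y' Ox Oy Oy' y2' y'2.
  have psl' : `|psi Om G n kap x y' - psi Om G n kap x y| <= f * t.
    rewrite distrC -(ler_pM2l ky0) (le_trans (psl _))//.
      rewrite distrC (le_trans yy)// [leRHS]mulrC ler_wpM2r ?(ltW ky0)// ltW//.
    by rewrite mulrCA ler_wpM2l ?(ltW f0)// distrC mulrC (le_trans yy)// mulrC.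
  pose th := kap y' - kap y - t * kap y.
  have thle : `|th| <= eps * (t * kap y).
    have := C2 _ _ y'3 y3'; rewrite (_ : dot (y' - y) n = t * kap y); last first.
      by rewrite /y' addrK !dot_scale nn mulr1.
    by move=> h; rewrite (le_trans h)// ler_wpM2l// ltW.
  (* Moving y by t kap y along n moves its image by the opposite amount, up to twice the
     linearisation error th. *)
  pose sg' := t * kap y + 2 * th.
  have wE : x - image n kap y' = sg' *: n + w.
    rewrite /w /image /sg' /th /y'; apply: pair_ext; rewrite /= /GRing.scale /=; ring.
  have tk0 : 0 <= t * kap y by rewrite mulr_ge0// ltW.
  have sgle : `|sg'| <= 2 * (t * kap y).
    rewrite (le_trans (ler_normD _ _))// (normrM 2 th) (ger0_norm (ler0n _ 2)) (ger0_norm tk0).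
    have h : eps * (t * kap y) <= 64^-1 * (t * kap y) by rewrite ler_wpM2r.
    by clear -h thle tk0; lra.
  have sgn : `|sg' *: n| <= 2 * t.
    rewrite normrZ (@le_trans _ _ `|sg'|)//; first by rewrite -[leRHS]mulr1 ler_wpM2l.
    by clear -sgle tk; lra.
  have ws : `|sg' *: n + w - w| < s by rewrite addrK; clear -sgn ts t0; lra.
  have := Hs _ w ws; rewrite subrr normr0 => /(_ s0); rewrite addrK dot_scaler -/b -/q => hl.
  have hl' : `|ln (sqn (x - image n kap y')) - ln q - sg' * (2 * b / q)| <= 2 * f * t.
    rewrite wE (_ : sg' * (2 * b / q) = 2 * (sg' * b) / q); last by rewrite !mulrA; congr (_ / _); ring.
    by rewrite (le_trans hl)//; have h := ler_wpM2l (ltW f0) sgn; clear -h; lra.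
  have hs : `|(sg' - t * kap y) * (2 * b / q)| <= 264 * eps * t.
    rewrite /sg' addrAC subrr add0r (_ : 2 * th * (2 * b / q) = 4 * (th * b / q)); last by field; rewrite gt_eqF.
    rewrite normrM (ger0_norm (ler0n _ 4)) normrM normfV (gtr0_norm q0) normrM.
    have : `|th| * `|b| <= (66 * (eps * t)) * q.
      rewrite (le_trans (ler_wpM2r (normr_ge0 b) thle))//.
      by have h := ler_wpM2l (mulr_ge0 (ltW eps0) (ltW t0)) kbq; clear -h; lra.
    by move=> /divle h; clear -h; lra.
  rewrite (_ : _ - _ - _ = (psi Om G n kap x y' - psi Om G n kap x y) +
     (ln (sqn (x - image n kap y')) - ln q - sg' * (2 * b / q)) + (sg' - t * kap y) * (2 * b / q)); last first.
    by rewrite (psi_regular n kap gk Ox Oy) (psi_regular n kap gk Ox Oy') -/w -/q; field; rewrite gt_eqF.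
  rewrite (le_trans (ler_normD _ _))// (le_trans (lerD (ler_normD _ _) hs))//.
  by have h := mulr_ge0 (ltW f0) (ltW t0); clear -psl' hl' h; lra.
have LgE : Lg (kap x *: n, kap y *: n) = kap x * Lg (n, 0) + kap y * Lg (0, n).
  have sr := sdiff_derive (regular_sdiff gk (Ox : Om (x, y).1) (Oy : Om (x, y).2)).
  rewrite /Lg !(mulrCA _ (4 * pi)) -mulrDr; congr (_ * _).
  rewrite -!(sdiffLZ _ _ sr) -(sdiffLD _ _ sr); congr ('D_ _ _ _).
  by apply: pair_ext => /=; rewrite scaler0 ?addr0 ?add0r.
rewrite LgE.
have e2' : `|2 * (kap x + kap y - b) * b / q| <= 132 * eps.
  rewrite normrM normfV (gtr0_norm q0) ; apply: divle.
  rewrite !normrM (ger0_norm (ler0n _ 2)).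
  have -> : kap x + kap y - b = kap x - kap y - a by rewrite bE; ring.
  have h1 := ler_wpM2r (normr_ge0 b) kab; have h2 := ler_wpM2l (ltW eps0) Mbq; clear -h1 h2; lra.
apply: (square_field q0 e1x e1y e2').
by clear -epse e0; rewrite /f; lra.
Qed.

(** The derivative of 4 pi G is that of 4 pi g, close to 2 b^2 / q, minus its analogue for x - y. By
    Cauchy-Schwarz both lie in [0, 2] up to small errors, so their difference is at most about 2 in
    absolute value. On the diagonal b = 2 kap x and q = b^2, which gives exactly 2. *)
Lemma boundary_pair (R : realType) (Om : set (plane R)) (G : plane R * plane R -> R) (p n : plane R)
    (kap : plane R -> R) (e : R) :
  green_setting Om G -> chart Om p n kap -> bd Om p -> 0 < e ->
  exists2 r : R, 0 < r &
  (forall x y, Om x -> Om y -> x <> y -> `|x - p| < r -> `|y - p| < r ->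
    `|4 * pi * 'D_((kap x *: n, kap y *: n) : plane R * plane R) G (x, y)| <= 2 + e) /\
  (forall x, Om x -> `|x - p| < r ->
    `|4 * pi * 'D_((kap x *: n, kap x *: n) : plane R * plane R) (regular_part Om G) (x, x) - 2| <= e).
Proof.
move=> gs ch bp e0; have [bO C3 cG gk tG] := gs; have oO : open Om by case: gk.
have [nn _ _ _ _] := ch.
have f0 : 0 < e / 2 by rewrite divr_gt0.
pose eps := Num.min 64^-1 (e / 4).
have eps0 : 0 < eps by rewrite lt_min invr_gt0 ltr0n divr_gt0.
have [eps64 epse] : eps <= 64^-1 /\ eps <= e / 4 by split; rewrite /eps ge_min lexx ?orbT.
clearbody eps.
have [r1 r10 H1] := regular_boundary gs ch bp f0.
have [r3 r30 [C1 C2 _ _ _]] := chart_near ch eps0 eps64.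
exists (Num.min r1 r3); first by rewrite lt_min r10.
split.
  move=> x y Ox Oy xy; rewrite !lt_min => /andP[x1 x3] /andP[y1 y3].
  have [q0 Hq] := H1 x y Ox Oy x1 y1.
  rewrite (green_derive _ gk cG)//=.
  have d0 : 0 < sqn (x - y) by apply: dot_gt0; rewrite subr_eq0; exact/eqP.
  have kab := C2 x y x3 y3.
  have ad := dot_cauchy (x - y) n; have bq := dot_cauchy (x - image n kap y) n.
  rewrite nn mulr1 in ad; rewrite nn mulr1 in bq.
  rewrite (_ : dot (x - y) (kap x *: n - kap y *: n) = (kap x - kap y) * dot (x - y) n); last first.
    by rewrite /dot /= /GRing.scale /=; ring.
  have b1 : 0 <= 2 * dot (x - image n kap y) n ^+ 2 / sqn (x - image n kap y) <= 2.
    move: (dot _ n) (sqn _) q0 bq => b q q0 bq.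
    apply/andP; split; last by rewrite ler_pdivrMr//; clear -bq; lra.
    by apply: divr_ge0; [apply: mulr_ge0 => //; exact: sqr_ge0 | exact: ltW].
  have md := norm_sq_le (x - y).
  move: (dot (x - y) n) ad kab => a ad kab; move: (sqn (x - y)) d0 ad md => d d0 ad md.
  have a1 : - (2 * eps) <= 2 * ((kap x - kap y) * a) / d <= 2 + 2 * eps.
    have h : `|(kap x - kap y) * a - a ^+ 2| <= eps * d.
      rewrite (_ : _ - _ = (kap x - kap y - a) * a); last by ring.
      rewrite normrM (le_trans (ler_wpM2r (normr_ge0 a) kab))// -mulrA ler_wpM2l// ?(ltW eps0)//.
      have : 0 <= (`|x - y| - `|a|) ^+ 2 by rewrite sqr_ge0.
      by rewrite sqrrB real_normK ?num_real// mulr2n; clear -md ad; lra.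
    have a2 := sqr_ge0 a; rewrite ler_pdivlMr// ler_pdivrMr//; move: h; rewrite ler_norml => /andP[h1 h2].
    by apply/andP; split; clear -h1 h2 a2 ad; lra.
  move: Hq; rewrite !ler_norml => /andP[h1 h2]; move: b1 a1 => /andP[b1 b2] /andP[a1 a2].
  move: (_ / d) a1 a2 => A a1 a2; move: (_ / sqn _) b1 b2 h1 h2 => B b1 b2 h1 h2.
  by apply/andP; split; clear -h1 h2 a1 a2 b1 b2 epse; lra.
move=> x Ox; rewrite lt_min => /andP[x1 x3].
have [q0 Hq] := H1 x x Ox Ox x1 x1.
have k0 : 0 < kap x by apply/C1.
move: Hq; rewrite (image_sqdist kap x x nn).
have -> : dot (x - image n kap x) n = 2 * kap x.
  rewrite (_ : dot _ _ = 2 * kap x * dot n n); first by rewrite nn mulr1.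
  by rewrite /image /dot /= /GRing.scale /=; ring.
rewrite subrr dot0 (_ : dot 0 n = 0); last by rewrite /dot /= !mul0r addr0.
rewrite !add0r (_ : 2 * (2 * kap x) ^+ 2 / _ = 2); last by field; rewrite gt_eqF.
by move=> h; rewrite (le_trans h)//; clear -e0; lra.
Qed.

(** * An upper bound on aligned configurations *)

Lemma compact_bounded_above (R : realType) (V : normedModType R) (K A : set V) (f : V -> R) :
  compact K -> A `<=` K ->
  (forall p, K p -> exists C : R, exists2 r : R, 0 < r & forall q, A q -> `|q - p| < r -> f q <= C) ->
  exists C : R, forall q, A q -> f q <= C.
Proof.
move=> cK AK H.
have [|r r0 Hr] := @compact_small R V K (fun d q => A q -> f q <= d^-1) cK; last first.
  by exists (r / 2)^-1 => q Aq; apply: Hr => //; [exact: AK | rewrite divr_gt0 | rewrite ltr_pdivrMr// ltr_pMr// ltr1n].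
move=> p Kp; have [C [r r0 Hr]] := H p Kp.
have C0 : 0 < `|C| + 1 by rewrite ltr_wpDl.
exists (Num.min r (`|C| + 1)^-1); first by rewrite lt_min r0 invr_gt0.
move=> q qp d d0; rewrite lt_min => /andP[dr dC] Aq; apply: (@le_trans _ _ C).
  by apply: Hr => //; move: qp; rewrite lt_min => /andP[].
rewrite (le_trans (ler_norm C))// (@le_trans _ _ (`|C| + 1)) ?lerDl//.
by rewrite -[leLHS]invrK lef_pV2 ?posrE ?invr_gt0// ltW.
Qed.

(** * Distance to the complement *)

Definition bdist (R : realType) (Om : set (plane R)) (y : plane R) : R :=
  inf [set `|y - w| | w in ~` Om].

Lemma bdist_le (R : realType) (Om : set (plane R)) (y w : plane R) : ~ Om w -> bdist Om y <= `|y - w|.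
Proof.
move=> nw; apply: ge_inf; last by exists w.
by exists 0 => _ [v _ <-].
Qed.

Lemma outside_bounded (R : realType) (Om : set (plane R)) : bounded_set Om -> exists w, ~ Om w.
Proof.
move=> [M [_ HM]]; exists (`|M| + 2, 0) => /(HM (`|M| + 1)).
have : M < `|M| + 1 by rewrite (le_lt_trans (ler_norm M))// ltrDl.
move=> h /(_ h) /= h2; have := fst_le ((`|M| + 2, 0) : plane R).
by rewrite /= ger0_norm ?addr_ge0// => h3; have := le_trans h3 h2; clear; lra.
Qed.

Lemma bdist_ge (R : realType) (Om : set (plane R)) (y : plane R) (c : R) : bounded_set Om ->
  (forall w, ~ Om w -> c <= `|y - w|) -> c <= bdist Om y.
Proof.
move=> /outside_bounded[w nw] H; apply: lb_le_inf; first by exists `|y - w|, w.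
by move=> _ [v nv <-]; exact: H.
Qed.

Lemma bdist_lip (R : realType) (Om : set (plane R)) (x y : plane R) : bounded_set Om ->
  bdist Om y <= bdist Om x + `|x - y|.
Proof.
move=> bO; rewrite -lerBlDr; apply: bdist_ge => // w nw; rewrite lerBlDr.
rewrite (le_trans (bdist_le y nw))// -(subrKA x) addrC (le_trans (ler_normD _ _))//.
by rewrite (distrC y x).
Qed.

Lemma bdist_chart (R : realType) (Om : set (plane R)) (p n : plane R) (kap : plane R -> R) :
  open Om -> bounded_set Om -> chart Om p n kap -> exists2 r : R, 0 < r &
  forall y, Om y -> `|y - p| < r -> [/\ 0 < kap y, kap y <= 2^-1, bdist Om y <= 2 * kap y & kap y / 3 <= bdist Om y].
Proof.
move=> oO bO ch; have [nn _ _ _ _] := ch; have n1 := unit_norm_le nn.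
have [r r0 [H1 H2 H3 H4 _]] := chart_near ch (ltac:(by rewrite invr_gt0) : 0 < 64^-1 :> R) (lexx _).
have [r4 r40 Hi] := image_outside oO ch.
exists (Num.min (Num.min (r / 2) r4) 6^-1); first by rewrite !lt_min r40 divr_gt0// invr_gt0 ltr0n.
move=> y Oy; rewrite !lt_min => /andP[/andP[yr y4] y6].
have yr' : `|y - p| < r by move: (normr_ge0 (y - p)) => h; clear -h yr; lra.
have k0 : 0 < kap y by apply/(H1 y yr').
have ky := H4 y yr'; rewrite (gtr0_norm k0) in ky.
have [i1 _] := image_dist kap y y n1; rewrite (gtr0_norm k0) in i1.
split => //.
- by clear -ky y6; lra.
- rewrite (le_trans _ i1)//; apply: bdist_le => Oi.
  by have := Hi _ y (subset_closure Oi) Oy y4; rewrite eqxx.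
- apply: bdist_ge => // w nw; rewrite ler_pdivrMr//.
  have [wr|wr] := ltP `|w - p| r.
    have kw : kap w <= 0 by rewrite leNgt; apply/negP => /(H1 w wr).
    by have := H3 y w yr' wr; rewrite ler_norml => /andP[_ h]; clear -h kw; lra.
  have h : `|w - p| <= `|y - w| + `|y - p|.
    by rewrite (distrC y w) (le_trans _ (ler_normD _ _))// subrKA.
  by clear -ky h wr yr; lra.
Qed.

Lemma ln_bounded (R : realType) (u K : R) : 0 < u -> u <= K -> u^-1 <= K -> `|ln u| <= K.
Proof.
have A (v : R) : 0 < v -> ln v <= v.
  by move=> v0; have := @ln_sub_le R v 1 v0 ltr01; rewrite ln1 subr0 divr1; lra.
move=> u0 uK uK'; rewrite ler_norml (le_trans (A u u0))// andbT lerNl -lnV ?posrE//.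
by rewrite (le_trans (A _ _))// invr_gt0.
Qed.

Lemma psi_bounded (R : realType) (Om : set (plane R)) (G : plane R * plane R -> R) (p n : plane R)
    (kap : plane R -> R) :
  green_setting Om G -> chart Om p n kap -> bd Om p ->
  exists C : R, exists2 r : R, 0 < r & forall x y, Om x -> Om y -> `|x - p| < r -> `|y - p| < r ->
    `|psi Om G n kap x y| <= C.
Proof.
move=> gs ch bp; have [bO C3 cG gk tG] := gs; have oO : open Om by case: gk.
have [cp np] := bdE oO bp.
have [r1 r10 H1] := psi_slow gs ch bp (@ltr01 R).
have [r4 r40 H4] := image_outside oO ch.
have m14 : 0 < Num.min r1 r4 by rewrite lt_min r10.
have [y0 Oy0] := closure_eps cp m14; rewrite lt_min => /andP[y01 y04].
have [r2 r20 H2] := (within_cvgP _ _ _ _).1 (psi_continuous gs cp Oy0 (H4 _ _ cp Oy0 y04)) 1 ltr01.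
exists (`|psi Om G n kap p y0| + 2), (Num.min r1 r2); first by rewrite lt_min r10.
move=> x y Ox Oy; rewrite !lt_min => /andP[x1 x2] /andP[y1 y2].
have [h1 _] := H1 x y y0 Ox Oy Oy0 y1 y01.
have h2 := H2 x (subset_closure Ox) x2.
rewrite -[psi Om G n kap x y](subrK (psi Om G n kap x y0)) -[X in _ + X](subrK (psi Om G n kap p y0)).
rewrite (le_trans (ler_normD _ _))// (le_trans (lerD h1 (ler_normD _ _)))//.
by clear -h2; lra.
Qed.

Lemma regular_bounded (R : realType) (Om : set (plane R)) (G : plane R * plane R -> R) (q : plane R * plane R) :
  green_kernel Om G -> Om q.1 -> Om q.2 ->
  exists C : R, exists2 r : R, 0 < r & forall p, `|p - q| < r -> `|regular_part Om G p| <= C.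
Proof.
move=> gk O1' O2'; have [L sL] := regular_sdiff gk O1' O2'.
have [r r0 Hr] := (continuousP_eps _ _).1 (sdiff_continuous sL) 1 ltr01.
exists (`|regular_part Om G q| + 1), r => // p /Hr h.
by rewrite -[regular_part Om G p](subrK (regular_part Om G q)) (le_trans (ler_normD _ _))// addrC lerD2l ltW.
Qed.

(** Near the boundary 4 pi h is the bounded psi plus ln (4 kap^2), which is nonpositive for kap <=
    1/2. *)
Lemma robin_bounded_above (R : realType) (Om : set (plane R)) (G : plane R * plane R -> R) :
  green_setting Om G -> exists C : R, forall x, Om x -> 4 * pi * robin Om G x <= C.
Proof.
move=> gs; have [bO C3 cG gk tG] := gs; have oO : open Om by case: gk.
apply: (compact_bounded_above (compact_closure bO)); first exact: subset_closure.
move=> q cq; have [Oq|nOq] := pselect (Om q).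
  have [C [r r0 Hr]] := regular_bounded gk (Oq : Om (q, q).1) (Oq : Om (q, q).2).
  exists (4 * pi * C), r => // x Ox xq; rewrite ler_pM2l ?pi4_gt0// (le_trans (ler_norm _))//.
  by apply: Hr; exact: pair_norm_lt.
have bq := bd_intro cq nOq; have [e [f [r gc]]] := C3_graph_chart oO C3 bq.
have [n [kap ch]] := graph_chart_chart gc; have [nn _ _ _ _] := ch.
have [C [r1 r10 H1]] := psi_bounded gs ch bq.
have [r2 r20 H2] := bdist_chart oO bO ch.
exists C, (Num.min r1 r2); first by rewrite lt_min r10.
move=> x Ox; rewrite lt_min => /andP[x1 x2].
have [k0 k2 _ _] := H2 x Ox x2.
have := H1 x x Ox Ox x1 x1; rewrite (psi_regular n kap gk Ox Ox) (image_sqdist kap x x nn).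
rewrite subrr dot0 (_ : dot 0 n = 0); last by rewrite /dot /= !mul0r addr0.
rewrite !add0r ler_norml => /andP[_]; rewrite /robin.
have : ln (4 * kap x * kap x) <= 0.
  by apply: ln_le0; have : kap x * kap x <= 2^-1 * 2^-1; [rewrite ler_pM// ltW | move=> h; clear -h; lra].
by move: (ln _) => l h1 h2; clear -h1 h2; lra.
Qed.

(** Both the squared distance to the image point and d (1 + delta / M)^2 are comparable to (M +
    k)^2, since delta lies between k/3 and 2 k. The constant covers the quotient in both
    directions. *)
Lemma green_image_ratio (R : realType) (M d a k delta : R) : 0 < M -> M ^+ 2 <= d -> d <= 2 * M ^+ 2 ->
  `|a| <= 2 * M -> - (64^-1 * M) <= a + k -> 0 < k -> delta <= 2 * k -> k / 3 <= delta ->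
  `|ln (d + 4 * k * (a + k)) - ln d - 2 * ln (1 + delta / M)| <= 40 * 52.
Proof.
move=> M0 Md dM aM ak k0 dk kd; have d0 : 0 < d by rewrite (lt_le_trans _ Md)// exprn_gt0.
have de0 : 0 < delta by rewrite (lt_le_trans _ kd)// divr_gt0.
have := image_lower (ltW M0) Md aM ak (ltW k0); set q := d + _ => Mkq.
have q0 : 0 < q.
  have : 0 < M ^+ 2 + k ^+ 2 by rewrite addr_gt0// exprn_gt0.
  by clear -Mkq; lra.
pose s := 1 + delta / M; have s0 : 0 < s by rewrite addr_gt0// divr_gt0.
have sM : s * M = M + delta by rewrite /s mulrDl mul1r divfK// gt_eqF.
have ds0 : 0 < d * s ^+ 2 by rewrite mulr_gt0// exprn_gt0.
have dsl : (M + delta) ^+ 2 <= d * s ^+ 2.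
  by rewrite -sM exprMn mulrC ler_wpM2r// exprn_ge0// ltW.
have dsu : d * s ^+ 2 <= 2 * (M + delta) ^+ 2.
  by rewrite -sM exprMn [leRHS]mulrCA [leRHS]mulrC ler_wpM2r// exprn_ge0// ltW.
have Mk : 0 <= (M - k) ^+ 2 by exact: sqr_ge0.
have Mk2 : 0 <= (M - 2 * k) ^+ 2 by exact: sqr_ge0.
have M2 := sqr_ge0 M; have k2 := sqr_ge0 k; have Mkp : 0 <= M * k by rewrite mulr_ge0// ltW.
have dl : (k / 3) ^+ 2 <= delta ^+ 2 by rewrite lerXn2r// nnegrE ?divr_ge0// ltW.
have du : delta ^+ 2 <= (2 * k) ^+ 2 by rewrite lerXn2r// nnegrE ?mulr_ge0// ltW.
have Md0 : 0 <= M * delta by rewrite mulr_ge0// ltW.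
have Mdu : M * delta <= M * (2 * k) by rewrite ler_wpM2l// ltW.
have ka : k * (a + k) <= k * (2 * M + k).
  by rewrite ler_wpM2l ?(ltW k0)// lerD2r; move: aM; rewrite ler_norml => /andP[].
have -> : ln q - ln d - 2 * ln s = ln (q / (d * s ^+ 2)).
  have l2 : ln (s ^+ 2) = 2 * ln s by rewrite lnXn// mulr_natl.
  by rewrite ln_div ?posrE// lnM ?posrE ?exprn_gt0// l2 opprD addrA.
rewrite !expr2 in Mkq dM dsl dsu Mk Mk2 M2 k2 dl du.
apply: ln_bounded; first by rewrite divr_gt0.
  rewrite ler_pdivrMr// expr2; clear -dM dsl Mk Mk2 M2 k2 Mkp dl Md0 ka; rewrite /q; lra.
rewrite invf_div ler_pdivrMr// expr2; clear -Mkq dsu Mk Mk2 M2 k2 Mkp du Mdu; lra.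
Qed.

(** Up to a bounded error G becomes an explicit nonnegative function that, for fixed y, decreases in
    |x - y|; such monotonicity is what an alternating sum can use. By compactness the bound is local
    at a limit pair: two distinct points, a point of Om taken twice, or a boundary point taken
    twice. *)
Lemma green_two_sided (R : realType) (Om : set (plane R)) (G : plane R * plane R -> R) :
  green_setting Om G -> exists C : R, forall p, F2 Om p ->
  `|4 * pi * G p - 2 * ln (1 + bdist Om p.2 / `|p.1 - p.2|)| <= C.
Proof.
move=> gs; have [bO C3 cG gk tG] := gs; have [oO cG1 _] := gk.
have [w0 nw0] := outside_bounded bO.
have cK : compact (closure Om `*` closure Om) by apply: compact_setX; exact: compact_closure.
have D0 y : 0 <= bdist Om y by exact: bdist_ge.
have DD q y : `|y - q| < 1 -> bdist Om y <= `|q - w0| + 1.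
  move=> yq; rewrite (le_trans (bdist_le y nw0))// -(subrKA q) (le_trans (ler_normD _ _))//.
  by rewrite addrC lerD2l ltW.
apply: (compact_bounded_above cK).
  by move=> [x y] [/= Ox Oy _]; split => /=; exact: subset_closure.
move=> [p1 p2] [/= c1 c2]; have [E|/eqP ne] := eqVneq p1 p2; last first.
  have [r1 r10 H1] := kernel_closure_cont cG (And3 c1 c2 ne : F2 (closure Om) (p1, p2)) ltr01.
  pose m := `|p1 - p2|; have m0 : 0 < m by rewrite normr_gt0 subr_eq0; exact/eqP.
  have m40 : 0 < m / 4 by rewrite divr_gt0.
  pose D := `|p2 - w0| + 1; have DD0 : 0 < D by rewrite ltr_wpDl.
  exists (4 * pi * (`|G (p1, p2)| + 1) + 2 * (D / (m / 2))), (Num.min (Num.min r1 (m / 4)) 1).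
    by rewrite !lt_min r10 m40 ltr01.
  move=> [x y] [/= Ox Oy xy]; rewrite !lt_min => /andP[/andP[q1 q2] q3].
  have cx := subset_closure Ox; have cy := subset_closure Oy.
  have h1 := H1 (x, y) (And3 cx cy xy : F2 (closure Om) (x, y)) q1.
  have xp : `|x - p1| < m / 4 by exact: le_lt_trans (fst_le ((x, y) - (p1, p2))) q2.
  have yp : `|y - p2| < m / 4 by exact: le_lt_trans (snd_le ((x, y) - (p1, p2))) q2.
  have y1 : `|y - p2| < 1 by exact: le_lt_trans (snd_le ((x, y) - (p1, p2))) q3.
  have M2 : m / 2 <= `|x - y|.
    have := ler_normD (p1 - x) ((x - y) + (y - p2)); have := ler_normD (x - y) (y - p2).
    rewrite !subrKA -/m (distrC p1) => h3 h4; clear -h3 h4 xp yp; lra.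
  have M0 : 0 < `|x - y| by rewrite (lt_le_trans _ M2)// divr_gt0.
  rewrite (le_trans (ler_normB _ _))// lerD//.
    rewrite normrM (gtr0_norm (pi4_gt0 R)) ler_pM2l ?pi4_gt0//.
    by rewrite -[G (x, y)](subrK (G (p1, p2))) (le_trans (ler_normD _ _))// addrC lerD2l ltW.
  have s1 : 1 <= 1 + bdist Om y / `|x - y| by rewrite lerDl divr_ge0.
  rewrite normrM (ger0_norm (ler0n _ 2)) ger0_norm ?ln_ge0// ler_wpM2l//.
  rewrite (@le_trans _ _ (bdist Om y / `|x - y|))//.
    by apply: le_ln1Dx; rewrite (lt_le_trans (ltrN10 R))// divr_ge0.
  by rewrite ler_pM ?invr_ge0 ?DD// lef_pV2 ?posrE// divr_gt0.
subst p2; have [Op|nOp] := pselect (Om p1).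
  have [C [r r0 Hr]] := regular_bounded gk (Op : Om (p1, p1).1) (Op : Om (p1, p1).2).
  have [a a0 aO] := near_square oO Op.
  pose D := `|p1 - w0| + 1; have DD0 : 0 < D by rewrite ltr_wpDl.
  pose K := 2 * (2 + D) ^+ 2 + ((a / 2) ^+ 2)^-1.
  exists (4 * pi * C + K), (Num.min (Num.min r (a / 2)) 1).
    by rewrite !lt_min r0 divr_gt0// ltr01.
  move=> [x y] Fxy; have [/= Ox Oy xy] := Fxy; rewrite !lt_min => /andP[/andP[q1 q2] q3].
  have ya : `|y - p1| < a / 2 by exact: le_lt_trans (snd_le ((x, y) - (p1, p1))) q2.
  have x1 : `|x - p1| < 1 by exact: le_lt_trans (fst_le ((x, y) - (p1, p1))) q3.
  have y1 : `|y - p1| < 1 by exact: le_lt_trans (snd_le ((x, y) - (p1, p1))) q3.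
  have xy0 : x - y != 0 by rewrite subr_eq0; exact/eqP.
  have M0 : 0 < `|x - y| by rewrite normr_gt0.
  have M2 : `|x - y| <= 2.
    by rewrite -(subrKA p1) (le_trans (ler_normD _ _))// (distrC p1); clear -x1 y1; lra.
  have dD := DD _ _ y1.
  have da : a / 2 <= bdist Om y.
    apply: bdist_ge => // w nw; rewrite leNgt; apply/negP => yw; apply: nw; apply: aO; apply/squareP.
    rewrite -(subrKA y) (le_trans (ler_normD _ _))// (distrC w); clear -yw ya; lra.
  have := regular_part_off oO cG1 Fxy => /= gE.
  have h1 := Hr (x, y) q1.
  have -> : 4 * pi * G (x, y) = 4 * pi * regular_part Om G (x, y) - ln (sqn (x - y)).
    by rewrite gE; move: (4 * pi : R) (pi4_gt0 R) => P P0; field; rewrite gt_eqF.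
  have d0 := dot_gt0 xy0; have md := norm_sq_le (x - y); have dm := dot_sq_le (x - y).
  pose s := 1 + bdist Om y / `|x - y|; rewrite -/s.
  have s0 : 0 < s by rewrite ltr_wpDr// divr_ge0// ltW.
  have sM : s * `|x - y| = `|x - y| + bdist Om y by rewrite /s mulrDl mul1r divfK// gt_eqF.
  rewrite -addrA -opprD (le_trans (ler_normB _ _))// lerD//.
    by rewrite normrM (gtr0_norm (pi4_gt0 R)) ler_pM2l ?pi4_gt0.
  have ds0 : 0 < sqn (x - y) * s ^+ 2 by rewrite mulr_gt0// exprn_gt0.
  have -> : ln (sqn (x - y)) + 2 * ln s = ln (sqn (x - y) * s ^+ 2).
    by rewrite lnM ?posrE ?exprn_gt0// lnXn// mulr_natl.
  have dsl : (`|x - y| + bdist Om y) ^+ 2 <= sqn (x - y) * s ^+ 2.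
    by rewrite -sM exprMn mulrC ler_wpM2r// exprn_ge0// ltW.
  have dsu : sqn (x - y) * s ^+ 2 <= 2 * (`|x - y| + bdist Om y) ^+ 2.
    by rewrite -sM exprMn [leRHS]mulrCA [leRHS]mulrC ler_wpM2r// exprn_ge0// ltW.
  have a20 : 0 < a / 2 by rewrite divr_gt0.
  apply: ln_bounded => //.
    rewrite (le_trans dsu)// /K ler_wpDr ?invr_ge0 ?sqr_ge0// ler_wpM2l// lerXn2r//.
    - by rewrite nnegrE addr_ge0.
    - by rewrite nnegrE addr_ge0// ltW.
    - by rewrite lerD.
  apply: (@le_trans _ _ ((a / 2) ^+ 2)^-1); last first.
    by rewrite /K lerDr; apply: mulr_ge0 => //; exact: sqr_ge0.
  rewrite lef_pV2 ?posrE ?exprn_gt0// (le_trans _ dsl)// lerXn2r//.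
  - by rewrite nnegrE ltW.
  - by rewrite nnegrE addr_ge0.
  - by rewrite (le_trans da)// lerDr.
have bq := bd_intro c1 nOp; have [e [f [r gc]]] := C3_graph_chart oO C3 bq.
have [n [kap ch]] := graph_chart_chart gc; have [nn _ _ _ _] := ch.
have [C [r1 r10 H1]] := psi_bounded gs ch bq.
have [r2 r20 H2] := bdist_chart oO bO ch.
have [r3 r30 [C1 C2 _ _ C5]] := chart_near ch (ltac:(by rewrite invr_gt0) : 0 < 64^-1 :> R) (lexx _).
exists (C + 40 * 52), (Num.min (Num.min r1 r2) r3); first by rewrite !lt_min r10 r20.
move=> [x y] [/= Ox Oy xy]; rewrite !lt_min => /andP[/andP[q1 q2] q3].
have xr c : `|(x, y) - (p1, p1)| < c -> `|x - p1| < c by exact: le_lt_trans (fst_le ((x, y) - (p1, p1))).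
have yr c : `|(x, y) - (p1, p1)| < c -> `|y - p1| < c by exact: le_lt_trans (snd_le ((x, y) - (p1, p1))).
have [k0 k2 dk kd] := H2 y Oy (yr _ q2).
have kx0 : 0 < kap x by apply/(C1 _ (xr _ q3)).
have xyb : (x == y) = false by apply/eqP.
have M0 : 0 < `|x - y| by rewrite normr_gt0 subr_eq0 xyb.
have := H1 x y Ox Oy (xr _ q1) (yr _ q1); rewrite /psi xyb => h1.
have h2 := C2 x y (xr _ q3) (yr _ q3).
have ak : - (64^-1 * `|x - y|) <= dot (x - y) n + kap y.
  by move: h2; rewrite ler_norml => /andP[_ h2]; clear -h2 kx0; lra.
have := green_image_ratio M0 (norm_sq_le (x - y)) (dot_sq_le (x - y)) (C5 x y (xr _ q3) (yr _ q3)) ak k0 dk kd.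
rewrite -(image_sqdist kap x y nn) => h3.
rewrite (_ : _ - _ = (4 * pi * G (x, y) + ln (sqn (x - y)) - ln (sqn (x - image n kap y))) +
  (ln (sqn (x - image n kap y)) - ln (sqn (x - y)) - 2 * ln (1 + bdist Om y / `|x - y|))); last by ring.
by rewrite (le_trans (ler_normD _ _))// lerD.
Qed.

(** The sign is fixed by counting from the last term, which is negative, so the largest term
    decides. The lower bound is carried along for the induction. *)
Lemma alternating_sum (R : realType) (b : nat -> R) (m : nat) :
  (forall k, (k < m)%N -> 0 <= b k) -> (forall k, (k.+1 < m)%N -> b k <= b k.+1) ->
  - (if m is k.+1 then b k else 0) <= \sum_(i < m) (-1) ^+ (m + i) * b i <= 0.
Proof.
elim: m => [|m IH] b0 bm; first by rewrite big_ord0 oppr0 lexx.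
have /andP[h1 h2] : - (if m is k.+1 then b k else 0) <= \sum_(i < m) (-1) ^+ (m + i) * b i <= 0.
  by apply: IH => k km; [apply: b0; exact: ltnW | apply: bm; exact: ltnW].
rewrite big_ord_recr /= (eq_bigr (fun i : 'I_m => - ((-1) ^+ (m + i) * b i))); last first.
  by move=> i _; rewrite addSn exprS mulN1r mulNr.
rewrite sumrN addSn exprS addnn -mul2n exprM sqrrN expr1n expr1n mulr1 mulN1r.
have bm0 := b0 m (ltnSn m).
have : (if m is k.+1 then b k else 0) <= b m by case: m {IH b0 h1 h2} bm bm0 => [|k] bm bm0 //; exact: bm.
move: (\sum_(i < m) _) h1 h2; move: (if m is k.+1 then b k else 0) => c S h1 h2 h3.
by apply/andP; split; clear -h1 h2 h3; lra.
Qed.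

Definition aligned (R : realType) (N : nat) (z : 'M[R]_(N, 2)) : Prop :=
  forall i j : 'I_N, (i < j)%N ->
  (Defs.point z i).1 < (Defs.point z j).1 /\ (Defs.point z i).2 = (Defs.point z j).2.

(** As i increases towards j, both |Gam i| and the logarithm grow, the latter because the points
    approach point j. The signs of Gam i * Gam j alternate and the one next to j is nonpositive. *)
Lemma aligned_row (R : realType) (N : nat) (Gam : 'I_N -> R) (z : 'M[R]_(N, 2)) (d : R) (j : 'I_N) :
  (forall i : 'I_N, Gam i = (-1) ^+ i.+1 * `|Gam i|) ->
  (forall i j : 'I_N, j = i.+1 :> nat -> `|Gam i| <= `|Gam j|) ->
  aligned z -> 0 <= d ->
  \sum_(i < N | (i < j)%N) Gam i * Gam j * ln (1 + d / `|Defs.point z i - Defs.point z j|) <= 0.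
Proof.
move=> sgn mono al d0.
pose T (i : 'I_N) := ln (1 + d / `|Defs.point z i - Defs.point z j|).
have dist (i : 'I_N) : (i < j)%N -> `|Defs.point z i - Defs.point z j| = (Defs.point z j).1 - (Defs.point z i).1.
  move=> /al[h1 h2]; rewrite (_ : `|_| = Num.max `|(Defs.point z i).1 - (Defs.point z j).1| `|(Defs.point z i).2 - (Defs.point z j).2|)//.
  by rewrite h2 subrr normr0 distrC gtr0_norm ?subr_gt0//; apply/max_idPl; rewrite subr_ge0 ltW.
(* [alternating_sum] is indexed by natural numbers; the default 0 lies beyond the range that is
   summed. *)
pose b k := oapp (fun i : 'I_N => `|Gam i| * T i) 0 (insub k).
have bE (i : 'I_N) : b i = `|Gam i| * T i by rewrite /b valK.
have T0 i : 0 <= T i by rewrite ln_ge0// lerDl divr_ge0.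
have b0 k : 0 <= b k.
  by rewrite /b; case: insubP => [i _ _|_] //=; rewrite mulr_ge0.
have jN : (j <= N)%N by exact: ltnW.
rewrite (big_ord_narrow jN).
have := @alternating_sum R b j (fun k _ => b0 k).
have bm k : (k.+1 < j)%N -> b k <= b k.+1.
  move=> kj; have k1 : (k.+1 < N)%N := ltn_trans kj (ltn_ord j).
  rewrite -[X in b X]/(nat_of_ord (Ordinal (ltnW k1))) -[X in _ <= b X]/(nat_of_ord (Ordinal k1)) !bE.
  rewrite ler_pM//; first exact: mono.
  have kj' : (Ordinal (ltnW k1) < j)%N by exact: ltnW.
  have kk : (Ordinal (ltnW k1) < Ordinal k1)%N by [].
  have [h1 _] := al _ _ kk; have [h2 _] := al _ _ (kj : (Ordinal k1 < j)%N).
  rewrite /T (dist _ kj') (dist _ (kj : (Ordinal k1 < j)%N)).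
  have p1 : 0 < (Defs.point z j).1 - (Defs.point z (Ordinal k1)).1 by rewrite subr_gt0.
  have p2 : 0 < (Defs.point z j).1 - (Defs.point z (Ordinal (ltnW k1))).1 by rewrite subr_gt0 (lt_trans h1).
  rewrite ler_ln ?posrE ?ltr_wpDr ?divr_ge0 ?(ltW p1) ?(ltW p2)// lerD2l ler_wpM2l// lef_pV2 ?posrE//.
  by rewrite lerD2l lerN2 ltW.
move=> /(_ bm)/andP[_] h.
rewrite (eq_bigr (fun i : 'I_j => `|Gam j| * ((-1) ^+ (j + i) * b i))); last first.
  move=> i _; have -> : b i = `|Gam (widen_ord jN i)| * T (widen_ord jN i) by rewrite -bE.
  have E (k l : nat) (u v : R) : (-1) ^+ k.+1 * u * ((-1) ^+ l.+1 * v) = (-1) ^+ (l + k) * (u * v).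
    by rewrite exprD !exprS; ring.
  by rewrite [X in X * _](congr2 *%R (sgn (widen_ord jN i)) (sgn j)) E /= -/(T _); ring.
by rewrite -mulr_sumr mulr_ge0_le0.
Qed.

Lemma sum_offdiag (R : realType) (N : nat) (F : 'I_N -> 'I_N -> R) :
  \sum_i \sum_(j | j != i) F i j =
  \sum_(j < N) \sum_(i < N | (i < j)%N) F i j + \sum_(j < N) \sum_(i < N | (i < j)%N) F j i.
Proof.
have -> : \sum_(j < N) \sum_(i < N | (i < j)%N) F i j = \sum_(i < N) \sum_(j < N | (i < j)%N) F i j.
  by rewrite (exchange_big_dep xpredT).
rewrite -big_split /=; apply: eq_bigr => i _.
rewrite (bigID (fun j : 'I_N => (i < j)%N)) /=; congr (_ + _); apply: eq_bigl => j.
  by rewrite -(inj_eq val_inj) /=; case: ltngtP.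
by rewrite -(inj_eq val_inj) /= -leqNgt; case: ltngtP.
Qed.

Lemma Kirchhoff_Routh_aligned (R : realType) (Om : set (plane R)) (G : plane R * plane R -> R) (N : nat)
    (Gam : 'I_N -> R) :
  green_setting Om G ->
  (forall i : 'I_N, Gam i = (-1) ^+ i.+1 * `|Gam i|) ->
  (forall i j : 'I_N, j = i.+1 :> nat -> `|Gam i| <= `|Gam j|) ->
  exists C : R, forall z, config_space Om z -> aligned z -> Kirchhoff_Routh Om G Gam z <= C.
Proof.
move=> gs sgn mono; have [bO _ _ _ _] := gs.
have D0 y : 0 <= bdist Om y by exact: bdist_ge.
have [C1 H1] := robin_bounded_above gs; have [C2 H2] := green_two_sided gs.
pose B := \sum_(j < N) Gam j ^+ 2 * C1 + \sum_i \sum_(j | j != i) `|Gam i * Gam j| * (C2 + 4).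
exists (B / (4 * pi)) => z [zO zne] al.
rewrite ler_pdivlMr ?pi4_gt0// mulrC mulrDr !mulr_sumr.
pose T (i j : 'I_N) := 2 * ln (1 + bdist Om (Defs.point z j) / `|Defs.point z i - Defs.point z j|).
(* T is not symmetric, so both orders of a pair use the boundary distance of the point with the
   larger index. The change costs at most 4: [bdist] is 1-Lipschitz, so (M + a) / (M + b) lies in
   [1/2, 2]. *)
pose T' (i j : 'I_N) := if (i < j)%N then T i j else T j i.
have TT i j : j != i -> `|4 * pi * G (Defs.point z i, Defs.point z j) - T' i j| <= C2 + 4.
  move=> ji; have Fij : F2 Om (Defs.point z i, Defs.point z j) by split => //=; apply: zne; rewrite eq_sym.
  have h := H2 _ Fij; rewrite /= -/(T i j) in h.
  have [ij|ij] := boolP (i < j)%N; first by rewrite /T' ij (le_trans h)// lerDl.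
  rewrite /T' (negbTE ij) -(subrKA (T i j)) (le_trans (ler_normD _ _))// lerD//.
  have M0 : 0 < `|Defs.point z i - Defs.point z j|.
    by rewrite normr_gt0 subr_eq0; apply/eqP; case: Fij.
  rewrite /T (distrC (Defs.point z j)) -mulrBr normrM (ger0_norm (ler0n _ 2)).
  have l1 := bdist_lip (Defs.point z i) (Defs.point z j) bO; have l2 := bdist_lip (Defs.point z j) (Defs.point z i) bO.
  rewrite (distrC (Defs.point z j)) in l2.
  move: `|_ - _| M0 l1 l2 (D0 (Defs.point z i)) (D0 (Defs.point z j)) => M M0.
  move: (bdist _ _) (bdist _ _) => a b l1 l2 a0 b0.
  have E c : 1 + c / M = (M + c) / M by field; rewrite gt_eqF.
  have p1 : 0 < M + a by rewrite ltr_wpDr.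
  have p2 : 0 < M + b by rewrite ltr_wpDr.
  rewrite !E -ln_div ?posrE ?divr_gt0//.
  have -> : (4 : R) = 2 * 2 by ring.
  rewrite ler_wpM2l//; apply: ln_bounded; first by rewrite !divr_gt0.
    by rewrite invf_div mulrA divfK ?gt_eqF// ler_pdivrMr//; clear -l1 l2 a0 b0 M0; lra.
  by rewrite invf_div invf_div mulrA divfK ?gt_eqF// ler_pdivrMr//; clear -l1 l2 a0 b0 M0; lra.
have S0 : \sum_i \sum_(j | j != i) Gam i * Gam j * T' i j <= 0.
  have row : \sum_(j < N) \sum_(i < N | (i < j)%N) Gam i * Gam j * T i j <= 0.
    apply: sumr_le0 => j _; have h := @aligned_row R N Gam z _ j sgn mono al (D0 (Defs.point z j)).
    rewrite (eq_bigr (fun i : 'I_N => 2 * (Gam i * Gam j * ln (1 + bdist Om (Defs.point z j) / `|Defs.point z i - Defs.point z j|)))).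
      by rewrite -mulr_sumr mulr_ge0_le0.
    by move=> i _; rewrite /T mulrCA.
  rewrite sum_offdiag -[leRHS]addr0 lerD//; rewrite (le_trans _ row)// le_eqVlt; apply/orP; left; apply/eqP;
    apply: eq_bigr => j _; apply: eq_bigr => i ij; rewrite /T'; first by rewrite ij.
  by rewrite ltnNge (ltnW ij) /= (mulrC (Gam j)).
rewrite /B lerD//.
  by apply: ler_sum => j _; rewrite mulrCA ler_wpM2l ?sqr_ge0// H1.
rewrite -[leRHS]add0r; apply: le_trans (lerD S0 (lexx _)).
rewrite -big_split /=; apply: ler_sum => i _; rewrite mulr_sumr -big_split /=; apply: ler_sum => j ji.
rewrite [leLHS](_ : _ = Gam i * Gam j * T' i j + Gam i * Gam j *
  (4 * pi * G (Defs.point z i, Defs.point z j) - T' i j)); last by ring.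
rewrite lerD2l.
by rewrite (le_trans (ler_norm _))// normrM ler_wpM2l// TT.
Qed.

(** * Local ascending fields *)

Lemma finite_radius (R : realType) (I : finType) (P : I -> R -> Prop) :
  (forall i d d', d' <= d -> P i d -> P i d') -> (forall i, exists2 r : R, 0 < r & P i r) ->
  exists2 r : R, 0 < r & forall i, P i r.
Proof.
move=> mP H; have /(_ _)/cid2-/all_sig2[r r0 Hr] := H.
exists (\big[Order.min/1]_i r i); first by apply: lt_bigmin => // i _; exact: r0.
by move=> i; apply: mP (Hr i); exact: bigmin_le_cond.
Qed.

Definition cfg (R : realType) (N : nat) (f : 'I_N -> plane R) : 'M[R]_(N, 2) :=
  \matrix_(i, j) if j == ord0 then (f i).1 else (f i).2.

Lemma point_cfg (R : realType) (N : nat) (f : 'I_N -> plane R) (i : 'I_N) : Defs.point (cfg f) i = f i.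
Proof. by rewrite /Defs.point !mxE /=; case: (f i). Qed.

Lemma cfg_point (R : realType) (N : nat) (z : 'M[R]_(N, 2)) : cfg (Defs.point z) = z.
Proof.
apply/matrixP => i j; rewrite !mxE /=; case: j => [[|[|//]]] Hj /=; congr (z i _); exact: val_inj.
Qed.

Lemma point_linear (R : realType) (N : nat) (a : R) (u v : 'M[R]_(N, 2)) (i : 'I_N) :
  Defs.point (a *: u + v) i = a *: Defs.point u i + Defs.point v i.
Proof. by apply: pair_ext; rewrite /Defs.point /= !mxE. Qed.

Lemma pointB (R : realType) (N : nat) (u v : 'M[R]_(N, 2)) (i : 'I_N) :
  Defs.point (u - v) i = Defs.point u i - Defs.point v i.
Proof. by apply: pair_ext; rewrite /Defs.point /= !mxE. Qed.

Lemma point_le (R : realType) (N : nat) (v : 'M[R]_(N, 2)) (i : 'I_N) : `|Defs.point v i| <= `|v|.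
Proof. by apply: pair_norm_le; exact: mx_norm_ge. Qed.

Lemma point_norm_le (R : realType) (N : nat) (v : 'M[R]_(N, 2)) (c : R) : 0 <= c -> (forall i, `|Defs.point v i| <= c) -> `|v| <= c.
Proof.
move=> c0 H; apply: mx_norm_le => // i j; case: j => [[|[|//]]] Hj.
  by rewrite (le_trans _ (H i))// (le_trans _ (fst_le _))//= le_eqVlt; apply/orP; left; apply/eqP; congr (`|v i _|); exact: val_inj.
by rewrite (le_trans _ (H i))// (le_trans _ (snd_le _))//= le_eqVlt; apply/orP; left; apply/eqP; congr (`|v i _|); exact: val_inj.
Qed.

Definition DKR (R : realType) (N : nat) (Om : set (plane R)) (G : plane R * plane R -> R) (Gam : 'I_N -> R)
    (z v : 'M[R]_(N, 2)) : R :=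
  \sum_j Gam j ^+ 2 * 'D_((Defs.point v j, Defs.point v j) : plane R * plane R) (regular_part Om G)
                        (Defs.point z j, Defs.point z j) +
  \sum_i \sum_(j | j != i) Gam i * Gam j *
    'D_((Defs.point v i, Defs.point v j) : plane R * plane R) G (Defs.point z i, Defs.point z j).

Lemma Kirchhoff_Routh_sdiff (R : realType) (N : nat) (Om : set (plane R)) (G : plane R * plane R -> R)
    (Gam : 'I_N -> R) (z : 'M[R]_(N, 2)) :
  green_setting Om G -> config_space Om z -> sdiff (Kirchhoff_Routh Om G Gam) z (DKR Om G Gam z).
Proof.
move=> [_ _ cG gk _] [zO zne]; have oO : open Om by case: gk.
have pl (i j : 'I_N) (a : R) (u v : 'M[R]_(N, 2)) :
    (Defs.point (a *: u + v) i, Defs.point (a *: u + v) j) =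
    a *: (Defs.point u i, Defs.point u j) + (Defs.point v i, Defs.point v j).
  by apply: pair_ext; rewrite /= point_linear.
have pb (i j : 'I_N) (v : 'M[R]_(N, 2)) : `|(Defs.point v i, Defs.point v j)| <= 1 * `|v|.
  by rewrite mul1r; apply: pair_norm_le; exact: point_le.
apply: sdiff_add.
  apply: sdiff_sum => j _; apply: sdiff_scale; rewrite /robin.
  apply: (sdiff_comp_linear (f := regular_part Om G) (A := fun z => (Defs.point z j, Defs.point z j))
    (x := z) (L := fun v => 'D_v (regular_part Om G) (Defs.point z j, Defs.point z j)) (pl j j) (pb j j)).
  exact: (sdiff_derive (regular_sdiff gk (zO j : Om (Defs.point z j, Defs.point z j).1) (zO j : Om (Defs.point z j, Defs.point z j).2))).
apply: sdiff_sum => i _; apply: sdiff_sum => j ji; apply: sdiff_scale.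
apply: (sdiff_comp_linear (f := G) (A := fun z => (Defs.point z i, Defs.point z j))
  (x := z) (L := fun v => 'D_v G (Defs.point z i, Defs.point z j)) (pl i j) (pb i j)).
have Fij : F2 Om (Defs.point z i, Defs.point z j) by split => //=; apply: zne; rewrite eq_sym.
exact: kernel_sdiff_F2 oO cG Fij.
Qed.

(* A family of vector fields along which the path function increases near the configuration q,
   vanishing at least linearly at the boundary of the configuration space. *)
Definition local_field (R : realType) (N : nat) (Om : set (plane R)) (G : plane R * plane R -> R)
    (Gam : 'I_N -> R) (q : 'I_N -> plane R) : Prop :=
  exists (f : 'I_N -> plane R -> plane R) (r c C : R),
  [/\ 0 < r, 0 < c, forall j, continuous (f j),
      forall z, config_space Om z -> (forall j, `|Defs.point z j - q j| < r) ->
        c <= DKR Om G Gam z (cfg (fun j => f j (Defs.point z j))) &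
      (forall j x y, Om x -> `|x - q j| < r -> ~ Om y -> `|f j x| <= C * `|x - y|) /\
      (forall i j x y, `|x - q i| < r -> `|y - q j| < r -> `|f i x - f j y| <= C * `|x - y|)].

(** The Lipschitz constant near x bounds every strict derivative taken at nearby points. *)
Lemma derive_bounded (R : realType) (V : normedModType R) (f : V -> R) (x : V) (L : V -> R) :
  sdiff f x L -> exists2 C : R, 0 < C & exists2 r : R, 0 < r &
  forall y L' v, `|y - x| < r -> sdiff f y L' -> `|L' v| <= C * `|v|.
Proof.
move=> /sdiff_lipschitz[C C0 [r r0 Hr]]; exists C => //; exists (r / 2); first by rewrite divr_gt0.
move=> y L' v yr sy.
have B z : `|z - y| < r / 2 -> `|z - x| < r.
  move=> zy; rewrite -(subrKA y) (le_lt_trans (ler_normD _ _))//; clear -zy yr; lra.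
have := @sdiff_dist R V f y L' (fun=> 0) C (r / 2) sy _ _ _ v; rewrite subr0; apply.
- by move=> c w; rewrite mulr0.
- by rewrite divr_gt0.
- by move=> x1 x2 h1 h2; rewrite subr0; apply: Hr; exact: B.
Qed.

(* If q_i = q_j forces f_i = f_j then near q the fields i and j are Lipschitz, or act on
   points that stay apart. *)
Lemma fields_lipschitz (R : realType) (N : nat) (q : 'I_N -> plane R) (f : 'I_N -> plane R -> plane R) :
  (forall j, exists C : R, exists2 r : R, 0 < r &
     forall x y, `|x - q j| < r -> `|y - q j| < r -> `|f j x - f j y| <= C * `|x - y|) ->
  (forall i j, q i = q j -> f i = f j) ->
  exists C : R, exists2 r : R, 0 < r &
    forall i j x y, `|x - q i| < r -> `|y - q j| < r -> `|f i x - f j y| <= C * `|x - y|.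
Proof.
move=> Hl Hf.
have [||r r0 Hr] := @finite_radius R ('I_N * 'I_N)%type (fun ij r => forall x y, `|x - q ij.1| < r ->
    `|y - q ij.2| < r -> `|f ij.1 x - f ij.2 y| <= r^-1 * `|x - y|).
- move=> [i j] d d' dd H x y xd yd /=.
  have d0 : 0 < d' by exact: le_lt_trans (normr_ge0 _) xd.
  rewrite (le_trans (H x y (lt_le_trans xd dd) (lt_le_trans yd dd)))// ler_wpM2r//.
  by rewrite lef_pV2// posrE// (lt_le_trans d0).
- move=> [i j] /=.
  suff [C [r r0 Hr]] : exists C : R, exists2 r : R, 0 < r &
      forall x y, `|x - q i| < r -> `|y - q j| < r -> `|f i x - f j y| <= C * `|x - y|.
    have C0 : 0 < `|C| + 1 by rewrite ltr_wpDl.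
    exists (Num.min r (`|C| + 1)^-1); first by rewrite lt_min r0 invr_gt0.
    move=> x y; rewrite lt_min => /andP[xr _]; rewrite lt_min => /andP[yr _].
    rewrite (le_trans (Hr x y xr yr))// ler_wpM2r//.
    rewrite (@le_trans _ _ (`|C| + 1))//; first by rewrite (le_trans (ler_norm C))// lerDl.
    by rewrite -[leLHS]invrK lef_pV2 ?posrE ?invr_gt0// ?lt_min ?r0 ?invr_gt0// ge_min lexx orbT.
  have [qij|qij] := eqVneq (q i) (q j).
    by have [C [r r0 Hr]] := Hl j; exists C, r => // x y; rewrite qij (Hf _ _ qij); exact: Hr.
  have [C1 [r1 r10 H1]] := Hl i; have [C2 [r2 r20 H2]] := Hl j.
  pose m := `|q i - q j|; have m0 : 0 < m by rewrite normr_gt0 subr_eq0.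
  pose B := `|f i (q i)| + `|f j (q j)| + `|C1| + `|C2|.
  have B0 : 0 <= B by rewrite !addr_ge0.
  exists (B / (m / 2)), (Num.min (Num.min (Num.min r1 r2) (m / 4)) 1).
    by rewrite !lt_min r10 r20 ltr01 divr_gt0.
  move=> x y; rewrite !lt_min => /andP[/andP[/andP[x1 _] x3] x4] /andP[/andP[/andP[_ y2] y3] y4].
  have bnd (k : 'I_N) (w : plane R) (c : R) : `|f k w - f k (q k)| <= c * `|w - q k| -> `|w - q k| < 1 ->
      `|f k w| <= `|f k (q k)| + `|c|.
    move=> h w1; rewrite -[f k w](subrK (f k (q k))) (le_trans (ler_normD _ _))// addrC lerD2l.
    rewrite (le_trans h)// (le_trans (ler_wpM2r (normr_ge0 _) (ler_norm c)))//.
    by rewrite -[leRHS]mulr1 ler_wpM2l// ltW.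
  have hx : `|f i x| <= `|f i (q i)| + `|C1| by apply: bnd => //; apply: H1 => //; rewrite subrr normr0.
  have hy : `|f j y| <= `|f j (q j)| + `|C2| by apply: bnd => //; apply: H2 => //; rewrite subrr normr0.
  have M2 : m / 2 <= `|x - y|.
    have h3 := ler_normD (q i - x) ((x - y) + (y - q j)); have h4 := ler_normD (x - y) (y - q j).
    rewrite !subrKA -/m (distrC (q i)) in h3 h4; clear -h3 h4 x3 y3; lra.
  rewrite (@le_trans _ _ B)//.
    by rewrite (le_trans (ler_normB _ _))// /B; clear -hx hy; lra.
  rewrite -[leLHS](divfK (lt0r_neq0 (divr_gt0 m0 (ltr0n R 2)))) ler_wpM2l// divr_ge0// divr_ge0// ltW//.
- by exists r^-1, r => // i j x y; exact: (Hr (i, j)).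
Qed.

(** [alpha] and [beta] are lower limits at q of the summands of the derivative of H; half of their
    positive total survives in a neighbourhood. Each summand may lose e, and m counts the
    summands. *)
Lemma DKR_lower (R : realType) (N : nat) (Om : set (plane R)) (G : plane R * plane R -> R) (Gam : 'I_N -> R)
    (q : 'I_N -> plane R) (f : 'I_N -> plane R -> plane R) (alpha : 'I_N -> R) (beta : 'I_N -> 'I_N -> R) :
  (forall j e, 0 < e -> exists2 r : R, 0 < r & forall x, Om x -> `|x - q j| < r ->
     alpha j - e <= Gam j ^+ 2 * 'D_((f j x, f j x) : plane R * plane R) (regular_part Om G) (x, x)) ->
  (forall i j e, 0 < e -> j != i -> exists2 r : R, 0 < r &
     forall x y, Om x -> Om y -> x <> y -> `|x - q i| < r -> `|y - q j| < r ->
     beta i j - e <= Gam i * Gam j * 'D_((f i x, f j y) : plane R * plane R) G (x, y)) ->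
  0 < \sum_j alpha j + \sum_i \sum_(j | j != i) beta i j ->
  exists2 c : R, 0 < c & exists2 r : R, 0 < r &
    forall z, config_space Om z -> (forall j, `|Defs.point z j - q j| < r) ->
        c <= DKR Om G Gam z (cfg (fun j => f j (Defs.point z j))).
Proof.
move=> Ha Hb; set S := _ + _ => S0.
pose m := \sum_(j < N) (1 : R) + \sum_(i < N) \sum_(j < N | j != i) (1 : R).
have m0 : 0 <= m by rewrite addr_ge0// sumr_ge0// => i _; rewrite ?sumr_ge0.
pose e := S / (2 * (m + 1)); have e0 : 0 < e by rewrite divr_gt0// mulr_gt0// ltr_wpDl.
have em : e * m <= S / 2.
  have m1 : 0 < m + 1 by rewrite ltr_wpDl.
  have E : e * (m + 1) = S / 2 by rewrite /e; field; rewrite gt_eqF.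
  by rewrite -E ler_wpM2l ?(ltW e0)// lerDl.
have [||r1 r10 H1] := @finite_radius R 'I_N (fun j r => forall x, Om x -> `|x - q j| < r ->
     alpha j - e <= Gam j ^+ 2 * 'D_((f j x, f j x) : plane R * plane R) (regular_part Om G) (x, x)).
- by move=> i d d' dd H x Ox xd; apply: H => //; exact: lt_le_trans dd.
- by move=> j; exact: Ha.
have [||r2 r20 H2] := @finite_radius R ('I_N * 'I_N)%type (fun ij r => ij.2 != ij.1 ->
     forall x y, Om x -> Om y -> x <> y -> `|x - q ij.1| < r -> `|y - q ij.2| < r ->
     beta ij.1 ij.2 - e <= Gam ij.1 * Gam ij.2 * 'D_((f ij.1 x, f ij.2 y) : plane R * plane R) G (x, y)).
- by move=> ij d d' dd H ji x y Ox Oy xy xd yd; apply: H => //; exact: lt_le_trans dd.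
- move=> [i j] /=; have [->|ji] := eqVneq j i; first by exists 1.
  by have [r r0 Hr] := Hb i j e e0 ji; exists r.
exists (S / 2); first by rewrite divr_gt0.
exists (Num.min r1 r2); first by rewrite lt_min r10.
move=> z [zO zne] zq.
have z1 j : `|Defs.point z j - q j| < r1 by have := zq j; rewrite lt_min => /andP[].
have z2 j : `|Defs.point z j - q j| < r2 by have := zq j; rewrite lt_min => /andP[].
have -> : S / 2 = S - S / 2 by lra.
apply: (@le_trans _ _ (S - e * m)); first by rewrite lerD2l lerN2.
rewrite /DKR /S /m mulrDr opprD addrACA; apply: lerD.
  rewrite mulr_sumr -sumrB; apply: ler_sum => j _; rewrite mulr1 !point_cfg; exact: H1.
rewrite mulr_sumr -sumrB; apply: ler_sum => i _.
rewrite mulr_sumr -sumrB; apply: ler_sum => j ji; rewrite mulr1 !point_cfg.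
by apply: (H2 (i, j)) => //=; apply: zne; rewrite eq_sym.
Qed.

(* Two clusters at different points: the fields tend to 0 while G is C^1 up to the boundary. *)
Lemma cross_term_small (R : realType) (Om : set (plane R)) (G : plane R * plane R -> R) (p1 p2 : plane R)
    (f1 f2 : plane R -> plane R) (e : R) :
  green_setting Om G -> closure Om p1 -> closure Om p2 -> p1 <> p2 ->
  {for p1, continuous f1} -> {for p2, continuous f2} -> f1 p1 = 0 -> f2 p2 = 0 -> 0 < e ->
  exists2 r : R, 0 < r & forall x y, Om x -> Om y -> x <> y -> `|x - p1| < r -> `|y - p2| < r ->
    `|'D_((f1 x, f2 y) : plane R * plane R) G (x, y)| <= e.
Proof.
move=> [_ _ cG gk _] c1 c2 p12 cf1 cf2 f10 f20 e0; have oO : open Om by case: gk.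
have [C C0 [r r0 Hr]] := kernel_derive_bounded oO cG (And3 c1 c2 p12 : F2 (closure Om) (p1, p2)).
have eC : 0 < e / C by rewrite divr_gt0.
have S (g : plane R -> plane R) p : {for p, continuous g} -> g p = 0 ->
    exists2 s : R, 0 < s & forall x, `|x - p| < s -> `|g x| < e / C.
  move=> cg g0; have /cvgrPdist_lt/(_ _ eC)/nbhs_ballP[s /= s0 Hs] := cg.
  exists s => // x xp; have := Hs x; rewrite -ball_normE /= distrC => /(_ xp).
  by rewrite g0 sub0r normrN.
have [s1 s10 H1] := S _ _ cf1 f10; have [s2 s20 H2] := S _ _ cf2 f20.
exists (Num.min r (Num.min s1 s2)); first by rewrite !lt_min r0 s10.
move=> x y Ox Oy xy; rewrite !lt_min => /and3P[x1 x2 _] /and3P[y1 _ y2].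
have := Hr (x, y) ((f1 x, f2 y) : plane R * plane R) (And3 Ox Oy xy : F2 Om (x, y)).
move=> /(_ (pair_norm_lt (v := (x, y) - (p1, p2)) x1 y1)) h; rewrite (le_trans h)//.
rewrite mulrC -ler_pdivlMr//; apply: pair_norm_le => /=; rewrite ltW//; [exact: H1 | exact: H2].
Qed.

Lemma scaled_bound (R : realType) (a b e : R) : 0 < e -> `|b| <= e / (`|a| + 1) -> `|a * b| <= e.
Proof.
move=> e0 h; have a0 : 0 < `|a| + 1 by rewrite ltr_wpDl.
rewrite normrM (@le_trans _ _ ((`|a| + 1) * `|b|))//; first by rewrite ler_wpM2r// lerDl.
by rewrite mulrC -ler_pdivlMr.
Qed.

Lemma sum_pairs_in (R : realType) (N : nat) (J : {set 'I_N}) (F : 'I_N -> 'I_N -> R) :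
  \sum_i \sum_(j | j != i) (if (i \in J) && (j \in J) then F i j else 0) =
  \sum_(i in J) \sum_(j in J | j != i) F i j.
Proof.
rewrite [RHS]big_mkcond; apply: eq_bigr => i _; case: (i \in J) => /=; last by rewrite big1.
rewrite -big_mkcondr; apply: eq_bigl => j; exact: andbC.
Qed.

Lemma cluster_fields (R : realType) (N : nat) (q : 'I_N -> plane R) (p : plane R) (F : plane R -> plane R)
    (C r : R) : 0 < r ->
  (forall x y, `|x - p| < r -> `|y - p| < r -> `|F x - F y| <= C * `|x - y|) ->
  exists C' : R, exists2 r' : R, 0 < r' & forall i j x y, `|x - q i| < r' -> `|y - q j| < r' ->
    `|(if q i == p then F x else 0) - (if q j == p then F y else 0)| <= C' * `|x - y|.
Proof.
move=> r0 HF.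
apply: (@fields_lipschitz R N q (fun j x => if q j == p then F x else 0)) => [j|i j ->//].
have [->|_] := eqVneq (q j) p; first by exists C, r.
by exists 0, 1 => // x y _ _; rewrite subrr normr0 mul0r.
Qed.

(** Only the points near p move, by one field F vanishing at p. Pairs of distinct limit points
    contribute nothing in the limit, as G is C^1 up to the boundary there, and pairs outside the
    cluster at rest contribute nothing at all; so the sign depends on the cluster J alone. *)
Lemma cluster_local_field (R : realType) (N : nat) (Om : set (plane R)) (G : plane R * plane R -> R)
    (Gam : 'I_N -> R) (q : 'I_N -> plane R) (p : plane R) (F : plane R -> plane R) (a C : R)
    (beta : 'I_N -> 'I_N -> R) :
  green_setting Om G -> (forall j, closure Om (q j)) -> continuous F -> F p = 0 ->
  (exists2 r : R, 0 < r & forall x y, `|x - p| < r -> `|y - p| < r -> `|F x - F y| <= C * `|x - y|) ->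
  (exists2 r : R, 0 < r & forall x y, Om x -> `|x - p| < r -> ~ Om y -> `|F x| <= C * `|x - y|) ->
  (forall e, 0 < e -> exists2 r : R, 0 < r & forall x, Om x -> `|x - p| < r ->
     `|'D_((F x, F x) : plane R * plane R) (regular_part Om G) (x, x) - a| <= e) ->
  (forall i j e, 0 < e -> exists2 r : R, 0 < r & forall x y, Om x -> Om y -> x <> y ->
     `|x - p| < r -> `|y - p| < r ->
     beta i j - e <= Gam i * Gam j * 'D_((F x, F y) : plane R * plane R) G (x, y)) ->
  (forall J : {set 'I_N}, J = [set j | q j == p]%SET ->
     0 < \sum_(j in J) Gam j ^+ 2 * a + \sum_(i in J) \sum_(j in J | j != i) beta i j) ->
  local_field Om G Gam q.
Proof.
move=> gs cq cF Fp [r1 r10 H1] [r2 r20 H2] H3 H4 HJ; have [bO C3 cG gk tG] := gs; have [oO cG1 _] := gk.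
pose f j x := if q j == p then F x else 0.
have cf j : continuous (f j) by rewrite /f; case: eqP => _ //; exact: cst_continuous.
have fq j : f j (q j) = 0 by rewrite /f; case: eqP => // ->.
pose J := [set j | q j == p]%SET.
have sr (x : plane R) : Om x -> sdiff (regular_part Om G) (x, x) (fun v => 'D_v (regular_part Om G) (x, x)).
  by move=> Ox; exact: (sdiff_derive (regular_sdiff gk (Ox : Om (x, x).1) (Ox : Om (x, x).2))).
have [|||c c0 [r3 r30 H5]] := @DKR_lower R N Om G Gam q f (fun j => if j \in J then Gam j ^+ 2 * a else 0)
    (fun i j => if (i \in J) && (j \in J) then beta i j else 0).
- move=> j e e0; rewrite inE /f; have [qj|_] := eqVneq (q j) p; last first.
    by exists 1 => // x Ox _; rewrite (sdiffL0 (sr x Ox)) mulr0 sub0r oppr_le0 ltW.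
  have h0 : 0 < e / (`|Gam j ^+ 2| + 1) by rewrite divr_gt0// ltr_wpDl.
  have [r r0 Hr] := H3 _ h0; exists r => // x Ox; rewrite qj => xp.
  have := scaled_bound e0 (Hr x Ox xp).
  by rewrite ler_norml mulrBr => /andP[h _]; clear -h; lra.
- move=> i j e e0 ji; rewrite !inE.
  have h0 : 0 < e / (`|Gam i * Gam j| + 1) by rewrite divr_gt0// ltr_wpDl.
  have [/andP[/eqP qi /eqP qj]|nij] := boolP ((q i == p) && (q j == p)).
    rewrite /f qi qj eqxx; exact: H4.
  suff [r r0 Hr] : exists2 r : R, 0 < r & forall x y, Om x -> Om y -> x <> y -> `|x - q i| < r -> `|y - q j| < r ->
      `|'D_((f i x, f j y) : plane R * plane R) G (x, y)| <= e / (`|Gam i * Gam j| + 1).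
    exists r => // x y Ox Oy xy xi yj; have := scaled_bound e0 (Hr x y Ox Oy xy xi yj).
    by rewrite ler_norml sub0r => /andP[].
  have [qij|/eqP qij] := eqVneq (q i) (q j); last first.
    exact: (cross_term_small gs (cq i) (cq j) qij (cf i (q i)) (cf j (q j)) (fq i) (fq j) h0).
  exists 1 => // x y Ox Oy xy _ _; rewrite qij andbb in nij.
  rewrite /f qij (negbTE nij) (sdiffL0 (kernel_sdiff_F2 oO cG (And3 Ox Oy xy : F2 Om (x, y)))) normr0.
  exact: ltW.
- rewrite -big_mkcond /= sum_pairs_in; exact: HJ.
have [C' [r4 r40 H6]] := cluster_fields q r10 H1.
exists f, (Num.min r2 (Num.min r3 r4)), c, (`|C| + `|C'|); split => //.
- by rewrite !lt_min r20 r30.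
- move=> z zc zq; apply: H5 => // j; have := zq j; rewrite !lt_min => /and3P[_ h _]; exact: h.
split.
  move=> j x y Ox; rewrite !lt_min => /and3P[x2 _ _] nOy; rewrite /f; case: eqP => [qj|_]; last first.
    by rewrite normr0 mulr_ge0 ?addr_ge0.
  rewrite qj in x2; rewrite (le_trans (H2 x y Ox x2 nOy))// ler_wpM2r// (le_trans (ler_norm C))//.
  by rewrite lerDl.
move=> i j x y; rewrite !lt_min => /and3P[_ _ x4] /and3P[_ _ y4].
by rewrite (le_trans (H6 i j x y x4 y4))// ler_wpM2r// (le_trans (ler_norm C'))// lerDr.
Qed.

Lemma boundary_local_field (R : realType) (N : nat) (Om : set (plane R)) (G : plane R * plane R -> R)
    (Gam : 'I_N -> R) (q : 'I_N -> plane R) (p : plane R) :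
  green_setting Om G -> (forall j, closure Om (q j)) -> bd Om p ->
  (forall J : {set 'I_N}, J = [set j | q j == p]%SET ->
     \sum_(i in J) \sum_(j in J | j != i) `|Gam i * Gam j| < \sum_(j in J) Gam j ^+ 2) ->
  local_field Om G Gam q.
Proof.
move=> gs cq bp HJ; have [bO C3 cG gk tG] := gs; have [oO cG1 _] := gk.
have [e [phi [r0 gc]]] := C3_graph_chart oO C3 bp.
have [n [kap ch]] := graph_chart_chart gc; have [nn k0 ck _ _] := ch.
have n1 := unit_norm_le nn; have P0 := pi4_gt0 R.
have [r1 r10 [C1 _ C3' _ _]] := chart_near ch (ltac:(by rewrite invr_gt0) : 0 < 64^-1 :> R) (lexx _).
have [r2 r20 H2] := bdist_chart oO bO ch.
apply: (@cluster_local_field R N Om G Gam q p (fun x => kap x *: n) (2 / (4 * pi)) 3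
  (fun i j => - (`|Gam i * Gam j| * (2 / (4 * pi))))) => //.
- by move=> x; apply: cvgZr_tmp; exact: ck.
- by rewrite k0 scale0r.
- exists r1 => // x y x1 y1; rewrite -scalerBl normrZ.
  by rewrite (le_trans _ (C3' x y x1 y1))// -[leRHS]mulr1 ler_wpM2l.
- exists r2 => // x y Ox x2 nOy; have [k1 _ _ k3] := H2 x Ox x2.
  rewrite normrZ gtr0_norm// (@le_trans _ _ (kap x))//; first by rewrite -[leRHS]mulr1 ler_wpM2l// ltW.
  by have := bdist_le x nOy; clear -k3; lra.
- move=> e' e0; have h0 : 0 < 4 * pi * e' by rewrite mulr_gt0.
  have [r rp [_ Hr]] := boundary_pair gs ch bp h0; exists r => // x Ox xp; have := Hr x Ox xp.
  move: ('D_(_ : plane R * plane R) _ _) (4 * pi : R) P0 => D P P0 h.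
  rewrite -(ler_pM2l P0) (le_trans _ h)// -[X in X * _](gtr0_norm P0) -normrM.
  by rewrite le_eqVlt; apply/orP; left; apply/eqP; congr (`|_|); field; rewrite gt_eqF.
- move=> i j e' e0; have h0 : 0 < 4 * pi * (e' / (`|Gam i * Gam j| + 1)).
    by rewrite mulr_gt0// divr_gt0// ltr_wpDl.
  have [r rp [Hr _]] := boundary_pair gs ch bp h0; exists r => // x y Ox Oy xy xp yp.
  have := Hr x y Ox Oy xy xp yp.
  move: ('D_(_ : plane R * plane R) _ _) (4 * pi : R) P0 => D P P0; move: (Gam i * Gam j) => g h.
  have g0 : 0 < `|g| + 1 by rewrite ltr_wpDl.
  have hD : `|D| <= 2 / P + e' / (`|g| + 1).
    rewrite -(ler_pM2l P0) (le_trans (_ : P * `|D| <= `|P * D|))//; first by rewrite normrM (gtr0_norm P0).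
    rewrite (le_trans h)// le_eqVlt; apply/orP; left; apply/eqP; field; rewrite !gt_eqF//.
  have : `|g * D| <= `|g| * (2 / P) + e'.
    rewrite normrM (le_trans (ler_wpM2l (normr_ge0 g) hD))// mulrDr lerD2l.
    by rewrite mulrCA ler_piMr ?(ltW e0)// ler_pdivrMr// mul1r lerDl.
  by rewrite ler_norml => /andP[h1 _]; clear -h1; lra.
- move=> J JE; have := HJ J JE; rewrite -subr_gt0 => h.
  have -> : \sum_(i in J) \sum_(j in J | j != i) - (`|Gam i * Gam j| * (2 / (4 * pi))) =
      - (\sum_(i in J) \sum_(j in J | j != i) `|Gam i * Gam j|) * (2 / (4 * pi)).
    rewrite mulNr mulr_suml -sumrN; apply: eq_bigr => i _; rewrite mulr_suml -sumrN; done.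
  by rewrite -mulr_suml -mulrDl mulr_gt0// divr_gt0.
Qed.

(** The field vanishes at p, where g is regular, so g contributes nothing in the limit. By
    homogeneity the logarithm contributes the exact constant -2 s / (4 pi) for each ordered pair of
    the cluster. *)
Lemma interior_local_field (R : realType) (N : nat) (Om : set (plane R)) (G : plane R * plane R -> R)
    (Gam : 'I_N -> R) (q : 'I_N -> plane R) (p : plane R) :
  green_setting Om G -> (forall j, closure Om (q j)) -> Om p ->
  (forall J : {set 'I_N}, J = [set j | q j == p]%SET ->
     \sum_(i in J) \sum_(j in J | j != i) Gam i * Gam j != 0) ->
  local_field Om G Gam q.
Proof.
move=> gs cq Op HJ; have [bO C3 cG gk tG] := gs; have [oO cG1 _] := gk.
have P0 := pi4_gt0 R.
have [a a0 aO] := near_square oO Op.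
pose S := \sum_(i in [set j | q j == p]%SET) \sum_(j in [set j | q j == p]%SET | j != i) Gam i * Gam j.
have S0 : S != 0 by exact: HJ.
(* Expanding or contracting according to the sign of S makes the total equal to 2 |S| / (4 pi) >
   0. *)
pose s := - Num.sg S; have s1 : `|s| = 1 by rewrite normrN normr_sg S0.
have [Cg Cg0 [rg rg0 Hg]] := derive_bounded (sdiff_derive (regular_sdiff gk (Op : Om (p, p).1) (Op : Om (p, p).2))).
have nF x : `|s *: (x - p)| = `|x - p| by rewrite normrZ s1 mul1r.
have small e : 0 < e -> exists2 r : R, 0 < r & forall x y, Om x -> Om y -> `|x - p| < r -> `|y - p| < r ->
    `|'D_((s *: (x - p), s *: (y - p)) : plane R * plane R) (regular_part Om G) (x, y)| <= e.
  move=> e0; exists (Num.min rg (e / Cg)); first by rewrite lt_min rg0 divr_gt0.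
  move=> x y Ox Oy; rewrite !lt_min => /andP[x1 x2] /andP[y1 y2].
  have sxy := sdiff_derive (regular_sdiff gk (Ox : Om (x, y).1) (Oy : Om (x, y).2)).
  have := Hg (x, y) _ ((s *: (x - p), s *: (y - p)) : plane R * plane R)
    (pair_norm_lt (v := (x, y) - (p, p)) x1 y1) sxy => h.
  rewrite (le_trans h)// mulrC -ler_pdivlMr//.
  by apply: pair_norm_le => /=; rewrite nF ltW.
apply: (@cluster_local_field R N Om G Gam q p (fun x => s *: (x - p)) 0 1
  (fun i j => Gam i * Gam j * (- (2 * s) / (4 * pi)))) => //.
- move=> x; apply: cvgZl_tmp; apply: cvgB; [exact: cvg_id | exact: cvg_cst].
- by rewrite subrr scaler0.
- exists 1 => // x y _ _; rewrite mul1r -scalerBr normrZ s1 mul1r opprB addrA subrK; done.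
- exists (a / 2); first by rewrite divr_gt0.
  move=> x y Ox xp nOy; rewrite mul1r nF leNgt; apply/negP => h; apply: nOy; apply: aO; apply/squareP.
  rewrite -(subrKA x) (le_trans (ler_normD _ _))// (distrC y); clear -h xp; lra.
- move=> e e0; have [r r0 Hr] := small e e0; exists r => // x Ox xp; rewrite subr0; exact: Hr.
- move=> i j e e0; have h0 : 0 < e / (`|Gam i * Gam j| + 1) by rewrite divr_gt0// ltr_wpDl.
  have [r r0 Hr] := small _ h0; exists r => // x y Ox Oy xy xp yp.
  have := scaled_bound e0 (Hr x y Ox Oy xp yp).
  have := green_derive ((s *: (x - p), s *: (y - p)) : plane R * plane R) gk cG (And3 Ox Oy xy : F2 Om (x, y)).
  rewrite /= -scalerBr (_ : x - p - (y - p) = x - y); last by rewrite opprB addrA subrK.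
  rewrite dot_scaler.
  have d0 : sqn (x - y) != 0 by rewrite gt_eqF// dot_gt0// subr_eq0; exact/eqP.
  rewrite (_ : 2 * (s * sqn (x - y)) / sqn (x - y) = 2 * s); last by field.
  move: ('D_(_ : plane R * plane R) G _) ('D_(_ : plane R * plane R) (regular_part Om G) _) => D1 D2 E h.
  have -> : D1 = D2 - 2 * s / (4 * pi).
    by apply: (mulfI (lt0r_neq0 P0)); rewrite E; move: (4 * pi : R) P0 => P P0; field; rewrite gt_eqF.
  by move: h; rewrite ler_norml => /andP[h _]; rewrite mulrBr mulNr mulrN; clear -h; lra.
- move=> J JE; rewrite big1 ?add0r; last by move=> j _; rewrite mulr0.
  have -> : \sum_(i in J) \sum_(j in J | j != i) Gam i * Gam j * (- (2 * s) / (4 * pi)) =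
      S * (- (2 * s) / (4 * pi)).
    by rewrite /S -JE mulr_suml; apply: eq_bigr => i _; rewrite mulr_suml.
  have -> : S * (- (2 * s) / (4 * pi)) = 2 * `|S| / (4 * pi).
    by rewrite [`|S|]normrEsg /s; ring.
  by rewrite divr_gt0// mulr_gt0// normr_gt0.
Qed.

(** A constant direction of ascent at q still gives half the growth nearby. The linear bounds hold
    because, near q, the points keep a positive distance from each other and from the complement of
    Om. *)
Lemma regular_local_field (R : realType) (N : nat) (Om : set (plane R)) (G : plane R * plane R -> R)
    (Gam : 'I_N -> R) (q : 'I_N -> plane R) (v : 'M[R]_(N, 2)) :
  green_setting Om G -> (forall j, Om (q j)) -> injective q -> 0 < DKR Om G Gam (cfg q) v ->
  local_field Om G Gam q.
Proof.
move=> gs qO qi Dv; have [bO C3 cG gk tG] := gs; have [oO cG1 _] := gk.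
have cq : config_space Om (cfg q).
  by split=> [i|i j ij]; rewrite !point_cfg// => /qi E; rewrite E eqxx in ij.
pose c := DKR Om G Gam (cfg q) v / 2; have c0 : 0 < c by rewrite divr_gt0.
have sq := Kirchhoff_Routh_sdiff Gam gs cq; have [_ _ Hs] := sq.
have v0 : 0 < `|v| + 1 by rewrite ltr_wpDl.
have [s s0 Hss] := Hs (c / (`|v| + 1)) (divr_gt0 c0 v0).
have [||ra ra0 Ha] := @finite_radius R 'I_N (fun j r => square (q j) r `<=` Om).
- by move=> j d d' dd H x /squareP xq; apply: H; apply/squareP; exact: le_trans dd.
- by move=> j; have [a a0 aO] := near_square oO (qO j); exists a.
pose f (j : 'I_N) (x : plane R) := Defs.point v j.
have [||C [r r0 Hr]] := @fields_lipschitz R N q f.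
- by move=> j; exists 0, 1 => // x y _ _; rewrite subrr normr0 mul0r.
- by move=> i j /qi ->.
have B0 : 0 <= `|v| / (ra / 2) by rewrite divr_ge0// divr_ge0// ltW.
exists f, (Num.min (Num.min (s / 2) (ra / 2)) r), c, (`|v| / (ra / 2) + `|C|); split => //.
- by rewrite !lt_min r0 !divr_gt0.
- by move=> j; exact: cst_continuous.
- move=> z zc zq; have sz := Kirchhoff_Routh_sdiff Gam gs zc.
  have -> : cfg (fun j => f j (Defs.point z j)) = v by exact: cfg_point.
  have s20 : 0 < s / 2 by rewrite divr_gt0.
  have zs : `|z - cfg q| < s / 2.
    have : `|z - cfg q| <= \big[Order.max/0]_j `|Defs.point z j - q j|.
      apply: point_norm_le; first by apply: bigmax_ge_id.
      by move=> i; rewrite pointB point_cfg; exact: le_bigmax.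
    move=> h; apply: (le_lt_trans h); apply: bigmax_lt => // j _.
    by have := zq j; rewrite !lt_min => /andP[/andP[]].
  have B w : `|w - z| < s / 2 -> `|w - cfg q| < s.
    by move=> wz; rewrite -(subrKA z) (le_lt_trans (ler_normD _ _))//; clear -wz zs; lra.
  have := @sdiff_dist R _ _ z _ (DKR Om G Gam (cfg q)) (c / (`|v| + 1)) (s / 2) sz _ s20 _ v.
  move=> /(_ (fun c v => sdiffLZ c v sq) (fun x1 x2 h1 h2 => Hss x1 x2 (B x1 h1) (B x2 h2))) h.
  have : c / (`|v| + 1) * `|v| <= c.
    by rewrite mulrAC ler_pdivrMr// ler_wpM2l ?(ltW c0)// lerDl.
  move: h; rewrite ler_norml => /andP[h _] h'.
  have E : DKR Om G Gam (cfg q) v = c + c by rewrite /c; clear; lra.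
  by clearbody c; clear -h h' E; lra.
split.
  move=> j x y Ox; rewrite !lt_min => /andP[/andP[_ xa] _] nOy.
  have xy : ra / 2 <= `|x - y|.
    rewrite leNgt; apply/negP => h; apply: nOy; apply: (Ha j); apply/squareP.
    rewrite -(subrKA x) (le_trans (ler_normD _ _))// (distrC y); clear -h xa; lra.
  rewrite /f (le_trans (point_le v j))// (@le_trans _ _ (`|v| / (ra / 2) * `|x - y|))//.
    by rewrite -[leLHS](divfK (lt0r_neq0 (divr_gt0 ra0 (ltr0n R 2)))) ler_wpM2l.
  by rewrite ler_wpM2r// lerDl.
move=> i j x y; rewrite !lt_min => /andP[_ xr] /andP[_ yr].
by rewrite (le_trans (Hr i j x y xr yr))// ler_wpM2r// (le_trans (ler_norm C))// lerDr.
Qed.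

(** * A global ascending field *)

Local Opaque DKR.

Lemma point_continuous (R : realType) (N : nat) (j : 'I_N) :
  continuous (fun z : 'M[R]_(N, 2) => Defs.point z j).
Proof. by move=> z; apply: continuous_pair; exact: coord_continuous. Qed.

(** Matrices are transported to row vectors, where closed bounded sets are compact. *)
Lemma compact_configurations (R : realType) (N : nat) (A : set (plane R)) : compact A ->
  compact [set z : 'M[R]_(N, 2) | forall j, A (Defs.point z j)].
Proof.
move=> cA; have [M [_ HM]] := compact_bounded cA.
pose B := `|M| + 1; have MB : M < B by rewrite (le_lt_trans (ler_norm M))// ltrDl.
pose h (v : 'rV[R]_(N * 2)) : 'M[R]_(N, 2) := vec_mx v.
pose P := [set v | forall j, A (Defs.point (h v) j)].
have ch : continuous h.
  move=> v; apply: continuous_coords => i j.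
  rewrite (_ : (fun t => h t i j) = fun t => t ord0 (mxvec_index i j)); first exact: coord_continuous.
  by apply/funext => t; rewrite /h mxE.
have -> : [set z : 'M[R]_(N, 2) | forall j, A (Defs.point z j)] = h @` P.
  by apply/seteqP; split=> [z zA|_ [v vA <-] //]; exists (mxvec z) => [j|]; rewrite /h mxvecK.
apply: continuous_compact; first exact: continuous_subspaceT.
apply: bounded_closed_compact.
  exists B; split; first exact: num_real.
  move=> b Bb v vP; apply: mx_norm_le => [|i k]; first by rewrite (le_trans _ (ltW Bb))// addr_ge0.
  rewrite (ord1 i); case/mxvec_indexP: k => k j.
  have := HM B MB _ (vP k) => h1; rewrite (le_trans _ (le_trans h1 (ltW Bb)))//.
  have -> : v ord0 (mxvec_index k j) = h v k j by rewrite /h mxE.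
  case: j => [[|[|//]]] Hj.
    by rewrite (le_trans _ (fst_le _))//= le_eqVlt; apply/orP; left; apply/eqP; congr (`|h v k _|); exact: val_inj.
  by rewrite (le_trans _ (snd_le _))//= le_eqVlt; apply/orP; left; apply/eqP; congr (`|h v k _|); exact: val_inj.
rewrite (_ : P = \bigcap_(j in [set: 'I_N]) ((fun v => Defs.point (h v) j) @^-1` A)); last first.
  by apply/seteqP; split=> [v vA j _|v vA j]; [exact: vA | exact: (vA j I)].
apply: closed_bigI => j _; apply: preimage_closed; last by apply: compact_closed.
move=> v _; apply: (@continuous_comp _ _ _ h (fun z : 'M[R]_(N, 2) => Defs.point z j)); first exact: ch.
exact: point_continuous.
Qed.

(** The growth is quantified on S and merely nonnegative elsewhere. This form, like the two linear
    bounds, is stable under addition of fields, so finitely many local fields can simply be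
    summed. *)
Definition good_field (R : realType) (N : nat) (Om : set (plane R)) (G : plane R * plane R -> R)
    (Gam : 'I_N -> R) (S : set 'M[R]_(N, 2)) : Prop :=
  exists (W : 'M[R]_(N, 2) -> 'M[R]_(N, 2)) (c C : R), [/\ 0 < c, 0 < C,
    forall z, config_space Om z -> {for z, continuous W} /\ 0 <= DKR Om G Gam z (W z),
    forall z, config_space Om z -> S z -> c <= DKR Om G Gam z (W z) &
    (forall z j y, config_space Om z -> ~ Om y -> `|Defs.point (W z) j| <= C * `|Defs.point z j - y|) /\
    (forall z i j, config_space Om z ->
       `|Defs.point (W z) i - Defs.point (W z) j| <= C * `|Defs.point z i - Defs.point z j|)].

Lemma good_field_union (R : realType) (N : nat) (Om : set (plane R)) (G : plane R * plane R -> R)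
    (Gam : 'I_N -> R) (S T : set 'M[R]_(N, 2)) :
  green_setting Om G -> good_field Om G Gam S -> good_field Om G Gam T -> good_field Om G Gam (S `|` T).
Proof.
move=> gs [W1 [c1 [C1 [c10 C10 H1 S1 [B1 D1]]]]] [W2 [c2 [C2 [c20 C20 H2 S2 [B2 D2]]]]].
exists (fun z => W1 z + W2 z), (Num.min c1 c2), (C1 + C2).
have dk z : config_space Om z -> DKR Om G Gam z (W1 z + W2 z) = DKR Om G Gam z (W1 z) + DKR Om G Gam z (W2 z).
  by move=> zc; exact: (sdiffLD _ _ (Kirchhoff_Routh_sdiff Gam gs zc)).
have m1 : Num.min c1 c2 <= c1 by rewrite ge_min lexx.
have m2 : Num.min c1 c2 <= c2 by rewrite ge_min lexx orbT.
have addl (x y : R) : 0 <= y -> x <= x + y by rewrite lerDl.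
have addr (x y : R) : 0 <= x -> y <= x + y by rewrite lerDr.
have pD (u v : 'M[R]_(N, 2)) i : Defs.point (u + v) i = Defs.point u i + Defs.point v i.
  by apply: pair_ext; rewrite /Defs.point /= !mxE.
split.
- by rewrite lt_min c10.
- by rewrite addr_gt0.
- move=> z zc; have [cW1 d1] := H1 z zc; have [cW2 d2] := H2 z zc; split; first exact: continuousD.
  by have E := dk z zc; have P := addr_ge0 d1 d2; rewrite E.
- move=> z zc [Sz|Tz]; have [_ d1] := H1 z zc; have [_ d2] := H2 z zc; rewrite (dk z zc).
    exact: le_trans m1 (le_trans (S1 z zc Sz) (addl _ _ d2)).
  exact: le_trans m2 (le_trans (S2 z zc Tz) (addr _ _ d1)).
split=> [z j y zc ny|z i j zc]; rewrite !pD mulrDl.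
  by rewrite (le_trans (ler_normD _ _))// lerD ?B1 ?B2.
by rewrite opprD addrACA (le_trans (ler_normD _ _))// lerD ?D1 ?D2.
Qed.

Lemma good_field_local (R : realType) (N : nat) (Om : set (plane R)) (G : plane R * plane R -> R)
    (Gam : 'I_N -> R) (q : 'M[R]_(N, 2)) :
  green_setting Om G -> local_field Om G Gam (Defs.point q) ->
  exists2 r : R, 0 < r & good_field Om G Gam [set z | `|z - q| < r].
Proof.
move=> gs [f [r [c [C [r0 c0 cf Hc [HB HD]]]]]].
exists (r / 2); first by rewrite divr_gt0.
(* A tent function, at least r/2 on the ball of radius r/2 and zero where the local field is not
   controlled. *)
pose phi (z : 'M[R]_(N, 2)) : R := Num.max 0 (r - `|z - q|).
have phi0 z : 0 <= phi z by rewrite le_max lexx.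
have phir z : phi z <= r by rewrite ge_max ltW//= gerBl.
have cphi : continuous phi.
  have L (a b : R) : `|Num.max 0 a - Num.max 0 b| <= `|a - b|.
    case: (leP 0 a) => ha; case: (leP 0 b) => hb; rewrite ?subrr ?normr0//.
    - rewrite subr0 (ger0_norm ha); have := ler_norm (a - b); clear -hb; lra.
    - rewrite sub0r normrN (ger0_norm hb) distrC; have := ler_norm (b - a); clear -ha; lra.
  move=> z; apply/continuousP_eps => e e0; exists e => // y yz.
  rewrite (le_lt_trans (L _ _))//.
  have -> : r - `|y - q| - (r - `|z - q|) = `|z - q| - `|y - q| by ring.
  rewrite (le_lt_trans (ler_dist_dist _ _))//.
  by rewrite opprB addrA subrK distrC.
pose v z := cfg (fun j => f j (Defs.point z j)).
have near z : phi z != 0 -> forall j, `|Defs.point z j - Defs.point q j| < r.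
  move=> pz j; have zr : `|z - q| < r.
    by rewrite ltNge; apply: contra pz => h; apply/eqP; apply/max_idPl; rewrite subr_le0.
  by rewrite -pointB (le_lt_trans (point_le _ _)).
have C0 : 0 < r * (`|C| + 1) by rewrite mulr_gt0// ltr_wpDl.
have CC (s : R) : 0 <= s -> r * (C * s) <= r * (`|C| + 1) * s.
  move=> s0; rewrite -mulrA ler_wpM2l ?(ltW r0)// ler_wpM2r//.
  by rewrite (le_trans (ler_norm C))// lerDl.
have pZ (a : R) (u : 'M[R]_(N, 2)) i : Defs.point (a *: u) i = a *: Defs.point u i.
  by rewrite -[a *: u]addr0 point_linear (_ : Defs.point 0 i = 0) ?addr0// /Defs.point !mxE.
have dk z : config_space Om z -> DKR Om G Gam z (phi z *: v z) = phi z * DKR Om G Gam z (v z).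
  by move=> zc; exact: (sdiffLZ _ _ (Kirchhoff_Routh_sdiff Gam gs zc)).
exists (fun z => phi z *: v z), (r / 2 * c), (r * (`|C| + 1)); split; last 1 first.
- split=> [z j y zc ny|z i j zc]; rewrite !pZ ?point_cfg.
    rewrite normrZ (ger0_norm (phi0 z)); have [->|pz] := eqVneq (phi z) 0.
      by rewrite mul0r mulr_ge0// ltW.
    rewrite (le_trans _ (CC _ (normr_ge0 _)))// ler_pM//.
    by apply: HB => //; [case: zc => + _; exact | exact: near].
  rewrite -scalerBr normrZ (ger0_norm (phi0 z)); have [->|pz] := eqVneq (phi z) 0.
    by rewrite mul0r mulr_ge0// ltW.
  rewrite (le_trans _ (CC _ (normr_ge0 _)))// ler_pM//.
  by apply: HD; exact: near.
- by rewrite mulr_gt0// divr_gt0.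
- exact: C0.
- move=> z zc; split.
    have cp (i : 'I_N) : {for z, continuous (fun z : 'M[R]_(N, 2) => f i (Defs.point z i))}.
      apply: (@continuous_comp _ _ _ (fun z : 'M[R]_(N, 2) => Defs.point z i) (f i)); last exact: cf.
      by apply: continuous_pair; exact: coord_continuous.
    apply: continuous_coords => i j.
    rewrite (_ : (fun t => (phi t *: v t) i j) = fun t => phi t * v t i j); last by apply/funext => t; rewrite mxE.
    apply: continuousM; first exact: cphi.
    rewrite (_ : (fun t => v t i j) = fun t => if j == ord0 then (f i (Defs.point t i)).1 else (f i (Defs.point t i)).2); last first.
      by apply/funext => t; rewrite mxE.
    case: (j == ord0).
      by apply: (@continuous_comp _ _ _ (fun t : 'M[R]_(N, 2) => f i (Defs.point t i)) fst); [exact: cp | exact: cvg_fst].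
    by apply: (@continuous_comp _ _ _ (fun t : 'M[R]_(N, 2) => f i (Defs.point t i)) snd); [exact: cp | exact: cvg_snd].
  have E := dk z zc; rewrite E; have [->|pz] := eqVneq (phi z) 0; first by rewrite mul0r.
  exact: mulr_ge0 (phi0 z) (le_trans (ltW c0) (Hc z zc (near z pz))).
- move=> z zc /= zr; have E := dk z zc; rewrite E.
  have pz : r / 2 <= phi z by rewrite le_max; apply/orP; right; clear -zr; lra.
  have r20 : 0 < r / 2 by rewrite divr_gt0.
  have pz0 : phi z != 0 by rewrite gt_eqF// (lt_le_trans _ pz).
  exact: ler_pM (ltW r20) (ltW c0) pz (Hc z zc (near z pz0)).
Qed.

Lemma good_field_global (R : realType) (N : nat) (Om : set (plane R)) (G : plane R * plane R -> R)
    (Gam : 'I_N -> R) :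
  green_setting Om G -> (forall q, (forall j : 'I_N, closure Om (q j)) -> local_field Om G Gam q) ->
  good_field Om G Gam (config_space Om).
Proof.
move=> gs Hl; have [bO _ _ _ _] := gs.
pose K := [set z : 'M[R]_(N, 2) | forall j, closure Om (Defs.point z j)].
have cK : compact K by apply: compact_configurations; exact: compact_closure.
have /(_ _)/cid2-/all_sig2[r r0 Hr] : forall q : 'M[R]_(N, 2), exists2 r : R, 0 < r & K q ->
    good_field Om G Gam [set z | `|z - q| < r].
  move=> q; have [Kq|nKq] := pselect (K q); last by exists 1.
  by have [r r0 Hr] := good_field_local gs (Hl _ Kq); exists r.
rewrite compact_cover in cK.
have [|z Kz|D DK KD] := cK 'M[R]_(N, 2) K (fun q => ball q (r q)).
- by move=> q _; exact: ball_open.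
- by exists z => //; exact: ballxx.
have base : good_field Om G Gam set0.
  exists (fun=> 0), 1, 1; split => //.
  - by move=> z zc; split; [exact: cst_continuous | rewrite (sdiffL0 (Kirchhoff_Routh_sdiff Gam gs zc))].
  - have p0 i : Defs.point (0 : 'M[R]_(N, 2)) i = 0 by rewrite /Defs.point !mxE.
    by split=> [z j y _ _|z i j _]; rewrite !p0 ?subrr normr0 mul1r.
have all (s : seq 'M[R]_(N, 2)) : {subset s <= K} -> good_field Om G Gam [set z | exists2 q, q \in s & `|z - q| < r q].
  elim: s => [|q s IH] sK.
    by rewrite (_ : [set z | _] = set0)//; apply/seteqP; split => z // -[].
  rewrite (_ : [set z | _] = [set z | `|z - q| < r q] `|` [set z | exists2 q, q \in s & `|z - q| < r q]).
    apply: good_field_union => //; last by apply: IH => x xs; apply: sK; rewrite in_cons xs orbT.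
    by apply: Hr; apply/set_mem; apply: sK; rewrite mem_head.
  apply/seteqP; split => z /=.
    by move=> [x]; rewrite in_cons => /orP[/eqP ->|xs] h; [left | right; exists x].
  by move=> [h|[x xs h]]; [exists q => //; exact: mem_head | exists x => //; rewrite in_cons xs orbT].
have [W [c [C [c0 C0 H1 H2 H3]]]] := all (finmap.enum_fset D) (fun x xD => DK x xD).
exists W, c, C; split => // z zc _; apply: H2 => //.
have /KD[q qD] : K z by move=> j; apply: subset_closure; case: zc => + _; exact.
by rewrite -ball_normE /= distrC => h; exists q.
Qed.

(** * A discrete proof of the Poincare-Miranda theorem *)

(* The sums below are modulo 2: [pathsum A ls S x] is the value on the cube with lowest vertex x
   and directions S of the cup product of the coboundaries of the 0-cochains [A l], l in ls. *)
Definition gshift (I : finType) (x : {ffun I -> nat}) (i : I) : {ffun I -> nat} :=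
  [ffun j => (x j + (j == i))%N].

Definition gset (I : finType) (x : {ffun I -> nat}) (i : I) (t : nat) : {ffun I -> nat} :=
  [ffun j => if j == i then t else x j].

Fixpoint pathsum (I : finType) (A : I -> {ffun I -> nat} -> bool) (ls : seq I)
    (S : {set I}) (x : {ffun I -> nat}) : bool :=
  if ls is l :: ls' then
    \big[addb/false]_(i in S)
      ((A l x (+) A l (gshift x i)) && pathsum A ls' (S :\ i) (gshift x i))
  else true.

Lemma big_addb_andl (I : finType) (P : pred I) (b : bool) (F : I -> bool) :
  \big[addb/false]_(i | P i) (b && F i) = b && \big[addb/false]_(i | P i) F i.
Proof. by rewrite big_distrr. Qed.

Lemma gshiftC (I : finType) (x : {ffun I -> nat}) i j :
  gshift (gshift x i) j = gshift (gshift x j) i.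
Proof. by apply/ffunP => k; rewrite !ffunE addnAC. Qed.

Lemma big_addb_sym (I : finType) (S : {set I}) (f : I -> I -> bool) :
  (forall i j, f i j = f j i) ->
  \big[addb/false]_(i in S) \big[addb/false]_(j in S :\ i) f i j = false.
Proof.
move=> fC.
pose r (i j : I) := (enum_rank i < enum_rank j)%N.
have E i : i \in S -> \big[addb/false]_(j in S :\ i) f i j =
  \big[addb/false]_(j in S | r i j) f i j (+) \big[addb/false]_(j in S | r j i) f i j.
  move=> iS; rewrite (bigID (r i)) /=; congr (_ (+) _); apply: eq_bigl => j.
    rewrite !inE /r; case: (eqVneq j i) => [->|] //=; rewrite ?ltnn ?andbF //.
  rewrite !inE /r -leqNgt; case: (eqVneq j i) => [->|ji] /=; first by rewrite ltnn andbF.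
  by rewrite leq_eqVlt (inj_eq val_inj) (inj_eq enum_rank_inj) (negbTE ji).
rewrite (eq_bigr _ E) big_split /=.
rewrite [X in _ (+) X](exchange_big_dep (mem S)) /=; last by move=> ? ? ? /andP[].
have -> : \big[addb/false]_(j in S) \big[addb/false]_(i in S | (j \in S) && r j i) f i j =
  \big[addb/false]_(i in S) \big[addb/false]_(j in S | r i j) f i j.
  by apply: eq_bigr => j jS; apply: eq_big => [i|i _]; rewrite ?jS // fC.
exact: addbb.
Qed.

Lemma exchange_setD1 (I : finType) (S : {set I}) (f : I -> I -> bool) :
  \big[addb/false]_(i in S) \big[addb/false]_(j in S :\ i) f i j =
  \big[addb/false]_(i in S) \big[addb/false]_(j in S :\ i) f j i.
Proof.
rewrite (exchange_big_dep (mem S)) /=; last by move=> i j _; rewrite !inE => /andP[].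
apply: eq_bigr => i iS; apply: eq_bigl => j.
by rewrite !inE iS andbT eq_sym andbC.
Qed.

(** The cochain is closed, being a cup product of coboundaries: its values on the facets of a cube
    sum to 0. In the induction, terms symmetric in two directions cancel modulo 2 and the others
    reduce to the shorter product. *)
Lemma pathsum_closed (I : finType) (A : I -> {ffun I -> nat} -> bool) (ls : seq I)
    (S : {set I}) (x : {ffun I -> nat}) :
  \big[addb/false]_(i in S)
    (pathsum A ls (S :\ i) x (+) pathsum A ls (S :\ i) (gshift x i)) = false.
Proof.
elim: ls S x => [|l ls IH] S x /=; first by rewrite big1.
set P := pathsum A ls in IH *.
have setC i j : S :\ i :\ j = S :\ j :\ i by apply/setP => k; rewrite !inE andbCA.
transitivity (\big[addb/false]_(i in S) \big[addb/false]_(j in S :\ i)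
  ((A l x && P (S :\ i :\ j) (gshift x j)) (+) (A l (gshift x j) && P (S :\ i :\ j) (gshift x j))
   (+) ((A l (gshift x i) && P (S :\ i :\ j) (gshift (gshift x i) j)) (+)
   (A l (gshift (gshift x i) j) && P (S :\ i :\ j) (gshift (gshift x i) j))))).
  apply: eq_bigr => i iS; rewrite -big_split; apply: eq_bigr => j jS /=.
  by rewrite !andb_addl.
under eq_bigr => i _ do rewrite big_split /= big_split /= [X in _ (+) X]big_split /=.
rewrite big_split /= big_split /= [X in _ (+) X]big_split /=.
rewrite [X in _ (+) (_ (+) X)]big_addb_sym; last first.
  by move=> i j; rewrite setC gshiftC.
rewrite addbF -addbA [X in _ (+) (X (+) _)]exchange_setD1 -[X in _ (+) X]big_split /=.
rewrite [X in _ (+) X]big1 ?addbF; last first.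
  move=> i iS; rewrite -big_split /=.
  under eq_bigr => j _ do rewrite [S :\ j :\ i]setC -andb_addr.
  by rewrite big_addb_andl IH andbF.
rewrite exchange_setD1.
under eq_bigr => i _ do rewrite big_addb_andl.
rewrite big_addb_andl.
have -> : \big[addb/false]_(i in S) \big[addb/false]_(j in S :\ i) P (S :\ j :\ i) (gshift x i) =
  \big[addb/false]_(i in S) \big[addb/false]_(j in S :\ i) P (S :\ i :\ j) (gshift (gshift x i) j).
  apply: eq_bigr => i iS.
  under eq_bigr => j _ do rewrite [S :\ j :\ i]setC.
  have := IH (S :\ i) (gshift x i); rewrite big_split /=.
  by do 2 case: (\big[_/_]_(_ in _) _).
by rewrite big_addb_sym ?andbF // => i j; rewrite setC gshiftC.
Qed.

(** Leibniz rule: the product is the coboundary of [A l] times the remaining product, because the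
    latter is closed. In this form it can be summed over the grid by telescoping. *)
Lemma pathsum_cons (I : finType) (A : I -> {ffun I -> nat} -> bool) l (ls : seq I)
    (S : {set I}) (x : {ffun I -> nat}) :
  pathsum A (l :: ls) S x = \big[addb/false]_(i in S)
    ((A l (gshift x i) && pathsum A ls (S :\ i) (gshift x i)) (+)
     (A l x && pathsum A ls (S :\ i) x)).
Proof.
have := congr1 (fun b => A l x && b) (pathsum_closed A ls S x).
rewrite andbF -big_addb_andl => E.
rewrite -[LHS]addbF -[X in _ (+) X]E /= -big_split /=; apply: eq_bigr => i _.
by case: (A l x); case: (A l _); case: (pathsum A ls _ x); case: (pathsum A ls _ _).
Qed.

(** * Summation over the grid *)

Fixpoint gridsum (I : finType) (m : nat) (ds : seq I) (F : {ffun I -> nat} -> bool)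
    (x : {ffun I -> nat}) : bool :=
  if ds is i :: ds' then \big[addb/false]_(t < m) gridsum m ds' F (gset x i t) else F x.

Lemma eq_gridsum (I : finType) m (ds : seq I) F1 F2 x :
  F1 =1 F2 -> gridsum m ds F1 x = gridsum m ds F2 x.
Proof. by move=> E; elim: ds x => [|i ds IH] x /=; [|under eq_bigr do rewrite IH]. Qed.

Lemma gridsum_sum (I J : finType) (P : pred J) m (ds : seq I) (F : J -> {ffun I -> nat} -> bool) x :
  gridsum m ds (fun z => \big[addb/false]_(j | P j) F j z) x =
  \big[addb/false]_(j | P j) gridsum m ds (F j) x.
Proof.
elim: ds x => [|i ds IH] x //=.
by under eq_bigr do rewrite IH; rewrite exchange_big.
Qed.

Lemma gridsumD (I : finType) m (ds : seq I) F1 F2 x :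
  gridsum m ds (fun z => F1 z (+) F2 z) x = gridsum m ds F1 x (+) gridsum m ds F2 x.
Proof.
elim: ds x => [|i ds IH] x //=.
by under eq_bigr do rewrite IH; rewrite big_split.
Qed.

Lemma gsetC (I : finType) (x : {ffun I -> nat}) i j s t : i != j ->
  gset (gset x i s) j t = gset (gset x j t) i s.
Proof.
move=> ij; apply/ffunP => k; rewrite !ffunE.
by case: (eqVneq k j) => [->|//]; rewrite eq_sym (negbTE ij).
Qed.

Lemma gridsum_gset (I : finType) m (ds : seq I) F x i t : i \notin ds ->
  gridsum m ds F (gset x i t) = gridsum m ds (fun z => F (gset z i t)) x.
Proof.
elim: ds x => [|j ds IH] x //=; rewrite inE negb_or => /andP[ij ids].
by apply: eq_bigr => s _; rewrite gsetC // IH.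
Qed.

(** Stokes' formula in one direction: facets between neighbouring cubes cancel modulo 2. *)
Lemma gridsum_telescope (I : finType) m (ds : seq I) F x i : uniq ds -> i \in ds ->
  gridsum m ds (fun z => F (gshift z i) (+) F z) x =
  gridsum m (rem i ds) (fun z => F (gset z i m) (+) F (gset z i 0)) x.
Proof.
elim: ds x => [//|j ds IH] x /= /andP[jds uds]; rewrite inE.
case: (eqVneq j i) => [ji _|ji]; last first.
  by move=> /= ids; apply: eq_bigr => t _; rewrite IH.
rewrite ji in jds *.
under eq_bigr => t _ do rewrite gridsum_gset //.
have tele n : \big[addb/false]_(t < n) (gridsum m ds (fun z => F (gset z i t.+1)) x (+)
  gridsum m ds (fun z => F (gset z i t)) x) =
  gridsum m ds (fun z => F (gset z i n)) x (+) gridsum m ds (fun z => F (gset z i 0)) x.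
  elim: n => [|n IHn]; first by rewrite big_ord0 addbb.
  rewrite big_ord_recr /= IHn.
  by case: (gridsum _ _ _ _); case: (gridsum _ _ _ _); case: (gridsum _ _ _ _).
rewrite gridsumD -tele; apply: eq_bigr => t _; rewrite -gridsumD; apply: eq_gridsum => z.
congr (F _ (+) _).
by apply/ffunP => k; rewrite !ffunE; case: eqP => _; rewrite ?addn1 ?addn0.
Qed.

(** Without direction i, every path stays in the hyperplane where coordinate i is c; [A i] is
    constant there, so its coboundary vanishes. *)
Lemma pathsum_const (I : finType) (A : I -> {ffun I -> nat} -> bool) (ls : seq I) (S : {set I})
    (x : {ffun I -> nat}) (i : I) (c : nat) :
  (forall z z' : {ffun I -> nat}, z i = c -> z' i = c -> A i z = A i z') ->
  i \in ls -> i \notin S -> x i = c -> pathsum A ls S x = false.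
Proof.
move=> Ac; elim: ls S x => [//|l ls IH] S x /=; rewrite inE => ils iS xi.
apply: big1 => j jS.
have ji : gshift x j i = c.
  rewrite ffunE xi; case: (eqVneq i j) => [ij|_]; first by rewrite ij jS in iS.
  by rewrite addn0.
case/orP: ils => [/eqP <-|ils]; first by rewrite (Ac x (gshift x j)) // addbb.
by rewrite IH ?andbF // !inE (negbTE iS) andbF.
Qed.

(** Induction on the dimension. After telescoping, the faces in directions other than l vanish by
    [pathsum_const], the face z l = 0 vanishes since [A l] is false there, and the face z l = m is
    the same problem in one dimension less. *)
Lemma gridsum_pathsum (I : finType) (A : I -> {ffun I -> nat} -> bool) (m : nat) (r : seq I) x :
  uniq r ->
  (forall i (z : {ffun I -> nat}), z i = 0%N -> A i z = false) ->
  (forall i (z : {ffun I -> nat}), z i = m -> A i z = true) ->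
  gridsum m r (pathsum A r [set i in r]) x = true.
Proof.
move=> + A0 Am; elim: r x => [//|l r IH] x /= /andP[lr ur].
rewrite -[LHS]/(gridsum m (l :: r) (pathsum A (l :: r) [set i in l :: r]) x).
rewrite (eq_gridsum _ _ _ (pathsum_cons A l r _)) gridsum_sum.
have ulr : uniq (l :: r) by rewrite /= lr.
rewrite (eq_bigr (fun i => gridsum m (rem i (l :: r)) (fun z =>
   (A l (gset z i m) && pathsum A r ([set i in l :: r] :\ i) (gset z i m)) (+)
   (A l (gset z i 0) && pathsum A r ([set i in l :: r] :\ i) (gset z i 0))) x)); last first.
  move=> i; rewrite inE => ilr.
  exact: (gridsum_telescope m (fun z => A l z && pathsum A r ([set i in l :: r] :\ i) z)).
rewrite (bigD1 l) /=; last by rewrite !inE eqxx.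
rewrite [X in _ (+) X]big1 ?addbF; last first.
  move=> i /andP[]; rewrite !inE => /orP[-> //|ir] il.
  rewrite (@eq_gridsum _ _ _ _ (fun=> false)) => [|z].
    elim: (if _ then _ else _) x => [//|j s IHs] y /=.
    by apply: big1 => t _.
  have zi c : gset z i c i = c by rewrite ffunE eqxx.
  have iN : i \notin [set i0 in l :: r] :\ i by rewrite !inE eqxx.
  rewrite (pathsum_const (c := m) _ ir iN) // => [|? ? ? ?]; last by rewrite !Am.
  by rewrite (pathsum_const (c := 0%N) _ ir iN) ?andbF // => ? ? ? ?; rewrite !A0.
rewrite eqxx (@eq_gridsum _ _ _ _ (fun z => pathsum A r [set i in r] (gset z l m))).
  by rewrite -gridsum_gset // IH.
move=> z; rewrite Am ?ffunE ?eqxx //= A0 ?ffunE ?eqxx //= addbF; congr (pathsum _ _ _ _).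
by apply/setP => j; rewrite !inE; case: eqP => [->|//]; rewrite (negbTE lr).
Qed.

Lemma gridsum_true (I : finType) m (ds : seq I) F (x : {ffun I -> nat}) :
  (forall i, (x i <= m)%N) -> gridsum m ds F x ->
  exists2 z : {ffun I -> nat}, F z & forall i, (z i <= m)%N.
Proof.
elim: ds x => [|i ds IH] x xm /=; first by exists x.
move=> H; have [t /IH] : exists t : 'I_m, gridsum m ds F (gset x i t).
  apply: contrapT => nex; move: H; rewrite big1 // => t _.
  by apply/negbTE/negP => Ht; apply: nex; exists t.
by apply=> j; rewrite ffunE; case: eqP => // _; apply: ltnW.
Qed.

Lemma pathsum_true (I : finType) (A : I -> {ffun I -> nat} -> bool) ls (S : {set I}) x :
  pathsum A ls S x -> forall l, l \in ls -> exists w w' : {ffun I -> nat},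
    [/\ A l w != A l w', forall i, (x i <= w i <= x i + (i \in S))%N &
        forall i, (x i <= w' i <= x i + (i \in S))%N].
Proof.
elim: ls S x => [//|l ls IH] S x /= H k.
have [j jS /andP[dA Hp]] : exists2 j, j \in S &
   (A l x (+) A l (gshift x j)) && pathsum A ls (S :\ j) (gshift x j).
  apply: contrapT => nex; move: H; rewrite big1 // => t tS.
  by apply/negbTE/negP => Ht; apply: nex; exists t.
rewrite inE => /orP[/eqP ->|kls].
  exists x, (gshift x j); split.
  - by move: dA; case: (A l x); case: (A l _).
  - by move=> i; rewrite leqnn leq_addr.
  - move=> i; rewrite ffunE leq_addr leq_add2l /=.
    by case: eqP => [->|]; rewrite ?jS.
have [w [w' [H1 H2 H3]]] := IH _ _ Hp _ kls.
have B (v : {ffun I -> nat}) :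
  (forall i, (gshift x j i <= v i <= gshift x j i + (i \in S :\ j))%N) ->
  forall i, (x i <= v i <= x i + (i \in S))%N.
  move=> Hv i; have := Hv i; rewrite !ffunE !inE => /andP[a b].
  rewrite (leq_trans (leq_addr _ _) a) (leq_trans b) // -addnA leq_add2l.
  by case: eqP => [->|] //=; rewrite jS.
by exists w, w'; split; [| exact: B | exact: B].
Qed.

(** The total over the grid is 1 modulo 2, so some cube has a nonzero value; a path contributing to
    it has, for every l, an edge across which [A l] changes. *)
Lemma cubical_sperner (I : finType) (A : I -> {ffun I -> nat} -> bool) (m : nat) :
  (forall i (z : {ffun I -> nat}), z i = 0%N -> A i z = false) ->
  (forall i (z : {ffun I -> nat}), z i = m -> A i z = true) ->
  exists2 z : {ffun I -> nat}, (forall i, (z i <= m)%N) &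
    forall l, exists w w' : {ffun I -> nat},
      [/\ A l w != A l w', forall i, (z i <= w i <= (z i).+1)%N &
          forall i, (z i <= w' i <= (z i).+1)%N].
Proof.
move=> A0 Am.
have [||z Hz zm] := gridsum_true (m := m) (ds := enum I) (x := [ffun=> 0%N])
    (F := pathsum A (enum I) [set i in enum I]).
- by move=> i; rewrite ffunE.
- by rewrite gridsum_pathsum // enum_uniq.
exists z => // l; have [|w [w' [H1 H2 H3]]] := pathsum_true Hz (l := l).
  by rewrite mem_enum.
exists w, w'; split => // i.
- by have := H2 i; rewrite inE mem_enum addn1.
- by have := H3 i; rewrite inE mem_enum addn1.
Qed.

Lemma zero_of_bounded_perturbation (R : realType) (k : nat) (b : 'rV[R]_k -> 'rV[R]_k) (B : R) :
  continuous b -> (forall x, `|b x| <= B) -> exists x, x + b x = 0.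
Proof.
move=> cb bB.
have B0 : 0 <= B by rewrite (le_trans _ (bB 0)).
pose M := B + 1; have M0 : 0 < M by rewrite /M ltr_wpDl.
pose f (x : 'rV[R]_k) : 'rV[R]_k := x + b x.
have cf : continuous f by move=> x; apply: (@continuousD _ _ _ id b x); [exact: cvg_id | exact: cb].
pose K := [set x : 'rV[R]_k | `|x| <= 3 * M].
have cK : compact K.
  apply: bounded_closed_compact.
    exists (3 * M); split; first by rewrite num_real.
    by move=> y My x /= /le_trans; apply; exact: ltW.
  rewrite (_ : K = (fun x : 'rV[R]_k => `|x|) @^-1` [set t | t <= 3 * M]) //.
  by apply: preimage_closed; [move=> x _; exact: norm_continuous | exact: closed_le].
have step e : 0 < e -> exists2 x, K x & `|f x| <= e.
  move=> e0; have [d d0 Hd] := compact_uniform cK (fun x _ => cf x) (divr_gt0 e0 (ltr0n R 3)).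
  pose m := (Num.truncn (2 * M / Num.min d M)).+1.
  have dM0 : 0 < Num.min d M by rewrite lt_min d0.
  have mR0 : 0 < m%:R :> R by rewrite ltr0n.
  have hm : 2 * M / m%:R < Num.min d M.
    rewrite ltr_pdivrMr// [ltRHS]mulrC -ltr_pdivrMr//.
    by have /andP[_] := truncn_itv (ltW (divr_gt0 (mulr_gt0 (ltr0n R 2) M0) dM0)).
  pose pt (z : {ffun 'I_k -> nat}) : 'rV[R]_k := \row_i (- M + 2 * M * (z i)%:R / m%:R).
  have [| |z zm Hz] := @cubical_sperner 'I_k (fun i z => 0 < f (pt z) 0 i) m.
  (* The labels are the signs of the coordinates of f = id + b. On opposite faces of the cube of
     half side M = B + 1 coordinate i of f has opposite signs, since |b| <= B < M. *)
  - move=> i z z0; apply/negbTE; rewrite -leNgt /f !mxE z0 mulr0 mul0r addr0.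
    have := le_trans (mx_norm_ge (b (pt z)) 0 i) (bB _); rewrite ler_norml => /andP[_ h].
    by rewrite addrC subr_le0 (le_trans h)// /M lerDl.
  - move=> i z zm; rewrite /f !mxE zm mulfK ?gt_eqF//.
    have := le_trans (mx_norm_ge (b (pt z)) 0 i) (bB _); rewrite ler_norml => /andP[h _].
    by rewrite /M; lra.
  have near_pt (w : {ffun 'I_k -> nat}) : (forall i, (z i <= w i <= (z i).+1)%N) ->
      `|pt w - pt z| < Num.min d M.
    move=> H; apply: le_lt_trans hm; apply: mx_norm_le; first by rewrite divr_ge0 ?mulr_ge0 ?ltW.
    move=> i j.
    have -> : (pt w - pt z) i j = 2 * M * ((w j)%:R - (z j)%:R) / m%:R.
      by rewrite !mxE; move: (m%:R^-1) => c; ring.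
    have /andP[h1 h2] := H j.
    have s0 : 0 <= (w j)%:R - (z j)%:R :> R by rewrite subr_ge0 ler_nat.
    rewrite normrM normrM !ger0_norm ?invr_ge0 ?mulr_ge0 ?(ltW M0)//.
    rewrite ler_pM2r ?invr_gt0// -[leRHS]mulr1 ler_pM2l ?mulr_gt0//.
    by rewrite -natrB// (ler_nat _ _ 1) leq_subLR addn1.
  have Kpt : K (pt z).
    apply: mx_norm_le; first by rewrite mulr_ge0 // ltW.
    move=> i j; rewrite mxE.
    have h0 : 0 <= (z j)%:R / m%:R :> R by rewrite divr_ge0.
    have h1 : (z j)%:R / m%:R <= 1 :> R by rewrite ler_pdivrMr// mul1r ler_nat.
    rewrite -mulrA; have := mulr_ge0 (ltW M0) h0.
    have := ler_wpM2l (ltW M0) h1; rewrite mulr1.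
    by rewrite ler_norml => ? ?; apply/andP; split; lra.
  exists (pt z) => //; apply: mx_norm_le; first exact: ltW.
  move=> i l; rewrite ord1 {i}.
  (* Coordinate l of f changes sign between two vertices within d of [pt z], and f varies by less
     than e/3 from [pt z] to each of them. *)
  have [w [w' [A12 /near_pt w1 /near_pt w2]]] := Hz l.
  rewrite !lt_min in w1 w2.
  have /(le_lt_trans (mx_norm_ge _ 0 l)) := Hd _ _ Kpt (proj1 (andP w1)).
  have /(le_lt_trans (mx_norm_ge _ 0 l)) := Hd _ _ Kpt (proj1 (andP w2)).
  move: A12; rewrite ![(f _ - f _) _ _]mxE ![(- f _) _ _]mxE.
  move: (f (pt w) 0 l) (f (pt w') 0 l) (f (pt z) 0 l) => a a' c.
  by case: (ltP 0 a); case: (ltP 0 a') => // ? ? _; rewrite !ltr_norml ler_norml => /andP[? ?] /andP[? ?];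
    apply/andP; split; lra.
have K0 : K !=set0 by exists 0; rewrite /K /= normr0 mulr_ge0 // ltW.
have [|c /set_mem Kc Hc] := compact_EVT_min (f := fun x => `|f x|) K0 cK.
  apply: continuous_subspaceT => x; apply: continuous_comp; [exact: cf|exact: norm_continuous].
exists c; apply/eqP; rewrite -normr_le0 -[_ + _]/(f c).
have [//|pos] := leP `|f c| 0.
have [x Kx] := step _ (divr_gt0 pos (ltr0n R 2)).
have := Hc x (mem_set Kx); lra.
Qed.

(** * Flow of a torus of configurations *)

Definition circ (R : realType) (a : R) : plane R := (cos a, sin a).

Lemma circ_sq (R : realType) (a : R) : sqn (circ a) = 1.
Proof. by rewrite /dot /= -!expr2 cos2Dsin2. Qed.

Lemma circ_le (R : realType) (a : R) : `|circ a| <= 1.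
Proof. exact: unit_norm_le (circ_sq a). Qed.

Lemma circ_ge (R : realType) (a : R) : 2^-1 <= `|circ a|.
Proof.
have := dot_sq_le (circ a); rewrite circ_sq => h; rewrite leNgt; apply/negP => h2.
have : `|circ a| * `|circ a| <= 2^-1 * 2^-1 by rewrite ler_pM// ltW.
by rewrite -expr2 => h3; clear -h h3; lra.
Qed.

Definition cross (R : realType) (u v : plane R) : R := u.1 * v.2 - u.2 * v.1.

(** The signed angle from u to v, valid when [dot u v] is positive; in that range it is continuous,
    so no branch of the argument has to be lifted. *)
Definition turn (R : realType) (u v : plane R) : R := atan (cross u v / dot u v).

Lemma turn_le (R : realType) (u v : plane R) : `|turn u v| <= pi.
Proof.
have p0 := pi_gt0 R; have := atan_gtNpi2 (cross u v / dot u v); have := atan_ltpi2 (cross u v / dot u v).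
by rewrite -/(turn u v) ler_norml => h1 h2; apply/andP; split; clear -h1 h2 p0; lra.
Qed.

Lemma dot_perturbed (R : realType) (w w' : plane R) : w != 0 -> `|w' - w| <= `|w| / 4 -> 0 < dot w w'.
Proof.
move=> w0 h; have n0 : 0 < `|w| by rewrite normr_gt0.
have := dot_le w (w' - w); have -> : dot w (w' - w) = dot w w' - sqn w by rewrite /dot /=; ring.
have h1 := norm_sq_le w; rewrite ler_norml => /andP[h2 _].
have h3 : `|w| * `|w' - w| <= `|w| * (`|w| / 4) by rewrite ler_wpM2l.
have h4 : 0 < `|w| * `|w| by rewrite mulr_gt0.
by rewrite expr2 in h1; clear -h1 h2 h3 h4; lra.
Qed.

(** In the frame [circ a], [perp (circ a)] the coordinates of w' are dot w w' / r and cross w w' /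
    r, whose quotient is the tangent of [turn w w']. *)
Lemma turn_step (R : realType) (a r : R) (w w' : plane R) : 0 < r -> w = r *: circ a ->
  0 < dot w w' -> exists2 r' : R, 0 < r' & w' = r' *: circ (a + turn w w').
Proof.
move=> r0 wE d0; pose d := dot w w'; rewrite -/d in d0; pose x := cross w w' / d.
have k0 : 0 < cos (atan x) by rewrite cos_atan invr_gt0 sqrtr_gt0 ltr_wpDr ?sqr_ge0.
have sE : sin (atan x) = x * cos (atan x).
  by rewrite -[X in X * _](atanK x) /tan divfK// gt_eqF.
exists (d / (r * cos (atan x))); first by rewrite divr_gt0// mulr_gt0.
have := circ_sq a; rewrite /dot /= => cs.
have w'E : w' = r^-1 *: (d *: circ a + cross w w' *: perp (circ a)).
  rewrite /d /cross wE; apply: pair_ext; rewrite /dot /= /GRing.scale /=.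
    rewrite [RHS](_ : _ = w'.1 * (cos a * cos a + sin a * sin a)); first by rewrite cs mulr1.
    by field; rewrite gt_eqF.
  rewrite [RHS](_ : _ = w'.2 * (cos a * cos a + sin a * sin a)); first by rewrite cs mulr1.
  by field; rewrite gt_eqF.
rewrite [LHS]w'E /turn -/d -/x.
have -> : cross w w' = x * d by rewrite /x divfK// gt_eqF.
rewrite /circ cosD sinD sE; move: (cos (atan x)) k0 => k k0.
by apply: pair_ext; rewrite /= /GRing.scale /=; field; rewrite !gt_eqF.
Qed.

Lemma turn_continuous (R : realType) (T : topologicalType) (u v : T -> plane R) (t : T) :
  {for t, continuous u} -> {for t, continuous v} -> 0 < dot (u t) (v t) ->
  {for t, continuous (fun t => turn (u t) (v t))}.
Proof.
move=> cu cv d0.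
have c1 (w : T -> plane R) : {for t, continuous w} -> {for t, continuous (fun t => (w t).1)}.
  by move=> cw; apply: (@continuous_comp _ _ _ w fst); [exact: cw | exact: cvg_fst].
have c2 (w : T -> plane R) : {for t, continuous w} -> {for t, continuous (fun t => (w t).2)}.
  by move=> cw; apply: (@continuous_comp _ _ _ w snd); [exact: cw | exact: cvg_snd].
apply: (@continuous_comp _ _ _ (fun t => cross (u t) (v t) / dot (u t) (v t)) (@atan R)); last exact: continuous_atan.
apply: continuousM.
  by apply: continuousB; apply: continuousM; [exact: c1 | exact: c2 | exact: c2 | exact: c1].
apply: continuousV; first by rewrite gt_eqF.
by apply: continuousD; apply: continuousM; [exact: c1 | exact: c1 | exact: c2 | exact: c2].
Qed.

(** In the max norm a Euclidean unit vector has length in [1/2, 1]. Gap j therefore has length at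
    least r 5^j / 2, while the earlier gaps add up to at most r 5^j / 4, so the points stay r/4
    apart for all angles. The default angle 0 occurs only for indices from k on, which k + 1 points
    never use. *)
Fixpoint spiral (R : realType) (k : nat) (x0 : plane R) (r : R) (th : 'rV[R]_k) (i : nat) : plane R :=
  if i is i'.+1 then spiral x0 r th i' + (r * 5 ^+ i') *: circ (oapp (th ord0) 0 (insub i')) else x0.

Lemma spiral_le (R : realType) (k : nat) (x0 : plane R) (r : R) (th : 'rV[R]_k) (i m : nat) : 0 < r ->
  `|spiral x0 r th (i + m) - spiral x0 r th i| <= r * (5 ^+ (i + m) - 5 ^+ i) / 4.
Proof.
move=> r0; elim: m => [|m IH]; first by rewrite addn0 !subrr normr0 mulr0 mul0r.
rewrite addnS /= addrAC (le_trans (ler_normD _ _))// (le_trans (lerD IH (lexx _)))//.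
rewrite normrZ ger0_norm; last by rewrite mulr_ge0 ?(ltW r0)// exprn_ge0.
have p0 : 0 <= r * 5 ^+ (i + m) by rewrite mulr_ge0 ?(ltW r0)// exprn_ge0.
have := ler_wpM2l p0 (circ_le (oapp (th ord0) 0 (insub (i + m)))); rewrite exprS; clear; lra.
Qed.

Lemma spiral_ge (R : realType) (k : nat) (x0 : plane R) (r : R) (th : 'rV[R]_k) (i j : nat) : 0 < r -> (i < j)%N ->
  r / 4 <= `|spiral x0 r th i - spiral x0 r th j|.
Proof.
move=> r0; case: j => // j; rewrite ltnS => ij; rewrite distrC.
have := spiral_le x0 th i (j - i) r0; rewrite subnKC// => h.
have p1 : 1 <= 5 ^+ j :> R by rewrite exprn_ege1// ler1n.
have p2 : 0 <= 5 ^+ i :> R by rewrite exprn_ge0.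
have p0 : 0 <= r * 5 ^+ j by rewrite mulr_ge0 ?(ltW r0)// exprn_ge0.
have q := ler_wpM2l p0 (circ_ge (oapp (th ord0) 0 (insub j))).
have n : `|(r * 5 ^+ j) *: circ (oapp (th ord0) 0 (insub j))| = r * 5 ^+ j * `|circ (oapp (th ord0) 0 (insub j))|.
  by rewrite normrZ ger0_norm.
rewrite /= addrAC addrC -n in q *.
have := ler_normB ((r * 5 ^+ j) *: circ (oapp (th ord0) 0 (insub j)) + (spiral x0 r th j - spiral x0 r th i))
  (spiral x0 r th j - spiral x0 r th i).
rewrite addrK => h2; have := ler_wpM2l (ltW r0) p1; have := mulr_ge0 (ltW r0) p2.
by clear -h h2 q; lra.
Qed.

Lemma spiral_continuous (R : realType) (k : nat) (x0 : plane R) (r : R) (i : nat) :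
  continuous (fun th : 'rV[R]_k => spiral x0 r th i).
Proof.
elim: i => [|i IH] th /=; first exact: cst_continuous.
have c1 : {for th, continuous (fun th : 'rV[R]_k => spiral x0 r th i)} := IH th.
have c2 : {for th, continuous (fun th : 'rV[R]_k => (r * 5 ^+ i) *: circ (oapp (th ord0) 0 (insub i)))}.
  have cg : continuous (fun a : R => (r * 5 ^+ i) *: circ a).
    have -> : (fun a : R => (r * 5 ^+ i) *: circ a) = (fun a => (r * 5 ^+ i * cos a, r * 5 ^+ i * sin a)) by [].
    move=> a; apply: (@continuous_pair _ _ _ (fun a : R => r * 5 ^+ i * cos a) (fun a : R => r * 5 ^+ i * sin a)).
      by apply: cvgM; [exact: cvg_cst | exact: continuous_cos].
    by apply: cvgM; [exact: cvg_cst | exact: continuous_sin].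
  case: (insub i) => [j|] /=; last exact: cst_continuous.
  apply: (@continuous_comp _ _ _ (fun th : 'rV[R]_k => th ord0 j) (fun a : R => (r * 5 ^+ i) *: circ a)).
    exact: coord_continuous.
  exact: cg.
exact: (continuousD c1 c2).
Qed.

(** * Compact sets of configurations and Euler steps *)

Definition Kset (R : realType) (N : nat) (Om : set (plane R)) (rho : R) : set 'M[R]_(N, 2) :=
  [set z | (forall j y, ~ Om y -> rho <= `|Defs.point z j - y|) /\
           (forall i j, i != j -> rho <= `|Defs.point z i - Defs.point z j|)].

Lemma Kset_config (R : realType) (N : nat) (Om : set (plane R)) (rho : R) : 0 < rho ->
  @Kset R N Om rho `<=` config_space Om.
Proof.
move=> r0 z [H1 H2]; split=> [j|i j /H2 h E].
  apply: contrapT => nO; have := H1 j _ nO; rewrite subrr normr0 leNgt r0//.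
by move: h; rewrite E subrr normr0 leNgt r0.
Qed.

Lemma Kset_anti (R : realType) (N : nat) (Om : set (plane R)) (rho rho' : R) : rho' <= rho ->
  @Kset R N Om rho `<=` @Kset R N Om rho'.
Proof. by move=> h z [H1 H2]; split=> [j y ny|i j ij]; [exact: le_trans h (H1 _ _ ny) | exact: le_trans h (H2 _ _ ij)]. Qed.

Lemma compact_Kset (R : realType) (N : nat) (Om : set (plane R)) (rho : R) : bounded_set Om -> 0 < rho ->
  compact (@Kset R N Om rho).
Proof.
move=> bO r0; apply: (subclosed_compact _ (compact_configurations (compact_closure bO))); last first.
  by move=> z /(Kset_config r0)[zO _] j; apply: subset_closure; exact: zO.
have C z e : closure (@Kset R N Om rho) z -> 0 < e -> exists2 z', Kset Om rho z' & `|z' - z| < e.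
  move=> cz e0; have [z' [Kz']] := cz _ (nbhsx_ballx z e e0).
  by rewrite -ball_normE /= distrC => h; exists z'.
move=> z cz; split=> [j y ny|i j ij]; apply/ler_addgt0Pr => e e0.
  have [z' [H1 _] h] := C z e cz e0; have := H1 j y ny.
  have := le_lt_trans (point_le (z' - z) j) h; rewrite pointB => h1.
  by rewrite -(subrKA (Defs.point z j)) => h2; have := ler_normD (Defs.point z' j - Defs.point z j) (Defs.point z j - y);
    clear -h1 h2; lra.
have e20 : 0 < e / 2 by rewrite divr_gt0.
have [z' [_ H2] h] := C z _ cz e20; have := H2 i j ij.
have := le_lt_trans (point_le (z' - z) j) h; have := le_lt_trans (point_le (z' - z) i) h; rewrite !pointB => h1 h2.
have -> : Defs.point z' i - Defs.point z' j = (Defs.point z i - Defs.point z j) +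
    ((Defs.point z' i - Defs.point z i) - (Defs.point z' j - Defs.point z j)).
  by apply: pair_ext; rewrite /=; ring.
move=> h3; have h4 := ler_normD (Defs.point z i - Defs.point z j)
    ((Defs.point z' i - Defs.point z i) - (Defs.point z' j - Defs.point z j)).
have h5 := ler_normB (Defs.point z' i - Defs.point z i) (Defs.point z' j - Defs.point z j).
by clear -h1 h2 h3 h4 h5; lra.
Qed.

Lemma Kset_step (R : realType) (N : nat) (Om : set (plane R)) (rho tau C : R) (z v : 'M[R]_(N, 2)) :
  0 <= tau ->
  (forall j y, ~ Om y -> `|Defs.point v j| <= C * `|Defs.point z j - y|) ->
  (forall i j, `|Defs.point v i - Defs.point v j| <= C * `|Defs.point z i - Defs.point z j|) ->
  0 <= 1 - C * tau -> Kset Om rho z -> Kset Om (rho * (1 - C * tau)) (z + tau *: v).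
Proof.
move=> t0 H1 H2 Ct [K1 K2].
have pE i : Defs.point (z + tau *: v) i = Defs.point z i + tau *: Defs.point v i.
  by apply: pair_ext; rewrite /Defs.point /= !mxE.
split=> [j y ny|i j ij]; rewrite !pE.
  have h1 := ler_wpM2l t0 (H1 j y ny); have h2 := ler_wpM2r Ct (K1 j y ny).
  have := ler_normB (Defs.point z j + tau *: Defs.point v j - y) (tau *: Defs.point v j).
  rewrite normrZ (ger0_norm t0) (_ : Defs.point z j + tau *: Defs.point v j - y - tau *: Defs.point v j = Defs.point z j - y); last first.
    by apply: pair_ext; rewrite /=; ring.
  by clear -h1 h2; lra.
have h1 := ler_wpM2l t0 (H2 i j); have h2 := ler_wpM2r Ct (K2 i j ij).
have := ler_normB (Defs.point z i + tau *: Defs.point v i - (Defs.point z j + tau *: Defs.point v j))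
  (tau *: (Defs.point v i - Defs.point v j)).
rewrite normrZ (ger0_norm t0) (_ : Defs.point z i + tau *: Defs.point v i - (Defs.point z j + tau *: Defs.point v j) -
   tau *: (Defs.point v i - Defs.point v j) = Defs.point z i - Defs.point z j); last first.
  by apply: pair_ext; rewrite /= /GRing.scale /=; ring.
by clear -h1 h2; lra.
Qed.

(** Of the rate c one quarter is lost to the variation of W and one quarter to the strict remainder,
    which is valid between y and y + tau W y for all y near a given configuration; hence a uniform
    step length by compactness. *)
Lemma uniform_gain (R : realType) (N : nat) (Om : set (plane R)) (G : plane R * plane R -> R) (Gam : 'I_N -> R)
    (W : 'M[R]_(N, 2) -> 'M[R]_(N, 2)) (c rho : R) :
  green_setting Om G -> 0 < c -> 0 < rho ->
  (forall z, config_space Om z -> {for z, continuous W}) ->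
  (forall z, config_space Om z -> c <= DKR Om G Gam z (W z)) ->
  exists2 t0 : R, 0 < t0 & forall z tau, Kset Om rho z -> 0 < tau -> tau < t0 ->
    Kirchhoff_Routh Om G Gam z + tau * (c / 2) <= Kirchhoff_Routh Om G Gam (z + tau *: W z).
Proof.
move=> gs c0 r0 cW dW; have [bO _ _ _ _] := gs.
have [|t0 t00 Ht] := @compact_small R _ (Kset Om rho) (fun tau z =>
   Kirchhoff_Routh Om G Gam z + tau * (c / 2) <= Kirchhoff_Routh Om G Gam (z + tau *: W z)) (compact_Kset bO r0); last first.
  by exists t0 => // z tau Kz; exact: Ht.
move=> x /(Kset_config r0) xc; have sH := Kirchhoff_Routh_sdiff Gam gs xc; have dx := dW x xc.
move: (DKR Om G Gam x) sH dx => L sH dx; have [_ [C0 HC] HL] := sH.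
move: (Kirchhoff_Routh Om G Gam) sH HL => H sH HL.
pose B := `|W x| + 1; have B0 : 0 < B by rewrite ltr_wpDl.
have C1 : 0 < `|C0| + 1 by rewrite ltr_wpDl.
have e0 : 0 < c / 4 / B by rewrite !divr_gt0.
have [s s0 Hs] := HL _ e0.
pose eta := Num.min 1 (c / 4 / (`|C0| + 1)).
have eta0 : 0 < eta by rewrite lt_min ltr01 !divr_gt0.
have /cvgrPdist_lt/(_ _ eta0)/nbhs_ballP[u /= u0 Hu] := cW x xc.
have q0 : 0 < s / 2 / B by rewrite !divr_gt0.
have s20 : 0 < s / 2 by rewrite divr_gt0.
exists (Num.min (Num.min u (s / 2)) (s / 2 / B)); first by rewrite !lt_min u0 s20.
move=> y; rewrite !lt_min => /andP[/andP[yu ys] _] d d0; rewrite !lt_min => /andP[_ dB].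
have Wy : `|W y - W x| < eta.
  by rewrite distrC; apply: Hu; rewrite -ball_normE /= distrC.
have [Wy1 Wy2] : `|W y - W x| <= 1 /\ `|W y - W x| <= c / 4 / (`|C0| + 1).
  by move: Wy; rewrite lt_min => /andP[h1 h2]; split; exact: ltW.
have WB : `|W y| <= B by rewrite -[W y](subrK (W x)) (le_trans (ler_normD _ _))// addrC lerD2l.
have dW' : `|d *: W y| <= d * B by rewrite normrZ gtr0_norm// ler_wpM2l// ltW.
have dBs : d * B < s / 2 by rewrite -ltr_pdivlMr.
have y1 : `|y + d *: W y - x| < s.
  by rewrite addrAC (le_lt_trans (ler_normD _ _))//; clear -ys dW' dBs; lra.
have y2 : `|y - x| < s by clear -ys s0; lra.
have := Hs _ _ y1 y2; rewrite [y + _ - y]addrAC subrr add0r (sdiffLZ _ _ sH) => h.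
have LW : c - c / 4 <= L (W y).
  have -> : L (W y) = L (W x) + L (W y - W x) by rewrite -(sdiffLD _ _ sH) addrC subrK.
  have h1 : `|L (W y - W x)| <= c / 4.
    rewrite (le_trans (HC _))// (@le_trans _ _ ((`|C0| + 1) * `|W y - W x|))//.
      by rewrite ler_wpM2r// (le_trans (ler_norm C0))// lerDl.
    by rewrite mulrC -ler_pdivlMr.
  by move: h1; rewrite ler_norml => /andP[h1 _]; clear -h1 dx; lra.
have h2 : c / 4 / B * `|d *: W y| <= d * (c / 4).
  rewrite (le_trans (ler_wpM2l (ltW e0) dW'))// le_eqVlt; apply/orP; left; apply/eqP.
  by field; rewrite gt_eqF.
have h3 := ler_wpM2l (ltW d0) LW.
move: h; rewrite ler_norml => /andP[h _]; clear -h h2 h3; lra.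
Qed.

Lemma compact_lower (R : realType) (V : normedModType R) (K : set V) (f : V -> R) :
  compact K -> (forall z, K z -> {for z, continuous f}) -> exists M : R, forall z, K z -> - M <= f z.
Proof.
move=> cK cf; have [|M HM] := @compact_bounded_above R V K K (fun z => - f z) cK (@subset_refl _ K).
  move=> p Kp; have [r r0 Hr] := (continuousP_eps f p).1 (cf p Kp) 1 ltr01.
  exists (- f p + 1), r => // z _ /Hr; rewrite ltr_norml => /andP[h _]; clear -h; lra.
by exists M => z /HM h; rewrite lerNl.
Qed.

Definition gap (R : realType) (k : nat) (z : 'M[R]_(k.+1, 2)) (j : 'I_k) : plane R :=
  Defs.point z (lift ord0 j) - Defs.point z (widen_ord (leqnSn k) j).

Lemma aligned_gaps (R : realType) (k : nat) (z : 'M[R]_(k.+1, 2)) :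
  (forall j, exists2 r : R, 0 < r & gap z j = r *: circ 0) -> aligned z.
Proof.
move=> H i j ij.
have S m (jm : (i + m < k)%N) (a b : 'I_k.+1) : nat_of_ord a = (i + m)%N -> nat_of_ord b = (i + m).+1 ->
    (Defs.point z a).1 < (Defs.point z b).1 /\ (Defs.point z a).2 = (Defs.point z b).2.
  move=> Ea Eb; have [r r0] := H (Ordinal jm); rewrite /gap.
  have -> : widen_ord (leqnSn k) (Ordinal jm) = a by apply: val_inj.
  have -> : lift ord0 (Ordinal jm) = b by apply: val_inj; rewrite /= /bump /= add1n.
  rewrite /circ cos0 sin0 => E; have E1 := congr1 fst E; have E2 := congr1 snd E.
  rewrite /= /GRing.scale /= mulr1 in E1; rewrite /= /GRing.scale /= mulr0 in E2.
  by split; [rewrite -subr_gt0 E1 | apply/eqP; rewrite eq_sym -subr_eq0 E2].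
have [m jE] : exists m, nat_of_ord j = (i + m).+1.
  by exists (j - i.+1)%N; rewrite -addSn subnKC.
elim: m j jE ij => [|m IH] j jE ij.
  by apply: (S 0%N) => //; rewrite ?addn0//; have := ltn_ord j; rewrite jE addn0 ltnS.
have jk : (i + m.+1 < k)%N by have := ltn_ord j; rewrite jE ltnS.
have mk : ((i + m).+1 < k.+1)%N by rewrite -addnS ltnW.
have [h1 h2] := IH (Ordinal mk) erefl (leq_addr m i).
have [h3 h4] := S m.+1 jk (Ordinal mk) j (esym (addnS i m)) jE.
by rewrite h2 h4; split => //; exact: lt_trans h3.
Qed.

(* Euler steps along the field starting from all configurations of the torus: the angles of the
   gaps change by a bounded continuous amount, so some starting angles end up aligned. *)
Lemma no_good_field (R : realType) (k : nat) (Om : set (plane R)) (G : plane R * plane R -> R)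
    (Gam : 'I_k.+1 -> R) (Cup : R) :
  green_setting Om G -> Om !=set0 -> good_field Om G Gam (config_space Om) ->
  (forall z, config_space Om z -> aligned z -> Kirchhoff_Routh Om G Gam z <= Cup) -> False.
Proof.
move=> gs [x0 Ox0] [W [c [C [c0 C0 H1 H2 [H3 H4]]]]] Hup.
have [bO _ _ gk _] := gs; have [oO _ _] := gk.
have [a a0 aO] := near_square oO Ox0.
(* The whole spiral stays within a/4 of x0, hence at distance at least a/2 from the complement. *)
pose r := a / 5 ^+ k; have p5 : 0 < 5 ^+ k :> R by rewrite exprn_gt0.
have r0 : 0 < r by rewrite divr_gt0.
have rk : r * 5 ^+ k = a by rewrite divfK// gt_eqF.
pose init (th : 'rV[R]_k) : 'M[R]_(k.+1, 2) := cfg (fun i => spiral x0 r th i).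
have cinit : continuous init.
  move=> th; apply: continuous_coords => i j.
  rewrite (_ : (fun t => init t i j) = fun t => if j == ord0 then (spiral x0 r t i).1 else (spiral x0 r t i).2); last first.
    by apply/funext => t; rewrite mxE.
  have cs : {for th, continuous (fun t : 'rV[R]_k => spiral x0 r t i)} by exact: spiral_continuous.
  case: (j == ord0).
    by apply: (@continuous_comp _ _ _ (fun t : 'rV[R]_k => spiral x0 r t i) fst); [exact: cs | exact: cvg_fst].
  by apply: (@continuous_comp _ _ _ (fun t : 'rV[R]_k => spiral x0 r t i) snd); [exact: cs | exact: cvg_snd].
pose rho := Num.min (a / 2) (r / 4); have rho0 : 0 < rho by rewrite lt_min !divr_gt0.
have Kinit th : Kset Om rho (init th).
  split=> [j y ny|i j ij]; rewrite !point_cfg.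
    have h := spiral_le x0 th 0 j r0; rewrite add0n /= expr0 in h.
    have j5 : 5 ^+ j <= 5 ^+ k :> R by rewrite ler_eXn2l ?ltr1n// -ltnS.
    have ya : a < `|x0 - y|.
      by rewrite ltNge; apply/negP => ya; apply: ny; apply: aO; apply/squareP; rewrite distrC.
    rewrite (@le_trans _ _ (a / 2))// ?ge_min ?lexx//.
    have h2 := ler_normB (spiral x0 r th j - y) (spiral x0 r th j - x0).
    rewrite (_ : spiral x0 r th j - y - _ = x0 - y) in h2; last by apply: pair_ext; rewrite /=; ring.
    have h3 := ler_wpM2l (ltW r0) j5; rewrite rk in h3.
    by clear -h h2 h3 ya r0 a0; lra.
  rewrite (@le_trans _ _ (r / 4))// ?ge_min ?lexx ?orbT//.
  case: (ltngtP i j) => [lij|lji|/val_inj E]; first exact: spiral_ge.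
    by rewrite distrC; exact: spiral_ge.
  by rewrite E eqxx in ij.
have cH z : config_space Om z -> {for z, continuous (Kirchhoff_Routh Om G Gam)}.
  by move=> zc; exact: (sdiff_continuous (Kirchhoff_Routh_sdiff Gam gs zc)).
have [M HM] := compact_lower (compact_Kset bO rho0) (fun z Kz => cH z (Kset_config rho0 Kz)).
(* H starts above -M and grows at rate c/2, so by time T it exceeds Cup. *)
pose T := 2 * (`|Cup| + `|M| + 1) / c.
have T0 : 0 < T by rewrite divr_gt0// mulr_gt0// ltr_wpDl// addr_ge0.
have TE : T * (c / 2) = `|Cup| + `|M| + 1 by rewrite /T; field; rewrite gt_eqF.
(* A lower bound for rho (1 - C tau)^n with n tau = T that does not depend on n: the admissible step
   length t0 depends on rho', which must be fixed before n. *)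
pose rho' := rho * expR (- (2 * C * T)).
have rho'0 : 0 < rho' by rewrite mulr_gt0// expR_gt0.
have [t0 t00 Ht] := uniform_gain gs c0 rho'0 (fun z zc => (H1 z zc).1) (fun z zc => H2 z zc zc).
(* C tau <= 1/8 serves twice: for the exponential bound below, and to keep successive gaps within an
   acute angle. *)
have eps0 : 0 < Num.min t0 (8 * C)^-1 / T.
  by rewrite divr_gt0// lt_min t00 invr_gt0 mulr_gt0.
have [n' _ /(_ n' (leqnn _))] := near_infty_natSinv_lt (PosNum eps0).
rewrite /= ltr_pdivlMr// => nlt; pose n := n'.+1; pose tau := T / n%:R.
have n0 : 0 < n%:R :> R by rewrite ltr0n.
have tau0 : 0 < tau by rewrite divr_gt0.
have tn : tau * n%:R = T by rewrite divfK// gt_eqF.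
have [tt0 tC] : tau < t0 /\ C * tau <= 8^-1.
  move: nlt; rewrite mulrC -/tau lt_min => /andP[h1 h2]; split => //.
  have := ltW h2; rewrite -(ler_pM2l C0) => h3; rewrite (le_trans h3)// le_eqVlt.
  by apply/orP; left; apply/eqP; field; rewrite gt_eqF.
have Ct : 0 <= 1 - C * tau by clear -tC; lra.
have Ct1 : 1 - C * tau <= 1 by rewrite gerBl mulr_ge0// ltW.
(* exp (2 s) >= 1 + 2 s, and (1 + 2 s) (1 - s) >= 1 for 0 <= s <= 1/2. *)
have xexp : expR (- (2 * C * tau)) <= 1 - C * tau.
  have Ct0 : 0 <= C * tau by rewrite mulr_ge0// ltW.
  have := expR_ge1Dx (2 * C * tau); rewrite expRN -[X in _ -> _ <= X]invrK lef_pV2 ?posrE ?expR_gt0 ?invr_gt0//; last first.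
    by clear -tC; lra.
  apply: le_trans; rewrite -[X in X <= _]mul1r ler_pdivrMr; last by clear -tC; lra.
  by have := mulr_ge0 Ct0 Ct0; have := ler_wpM2l Ct0 tC; clear; lra.
pose step z := z + tau *: W z.
pose Z m th := iter m step (init th).
have Kpow m : (m <= n)%N -> rho' <= rho * (1 - C * tau) ^+ m.
  move=> mn; rewrite ler_wpM2l ?(ltW rho0)//.
  rewrite (@le_trans _ _ ((1 - C * tau) ^+ n))//; last by rewrite ler_wiXn2l.
  have -> : - (2 * C * T) = - (2 * C * tau) * n%:R by rewrite -tn; ring.
  by rewrite expRM_natr lerXn2r// nnegrE ?expR_ge0.
have Kstep z rh : 0 < rh -> Kset Om rh z -> Kset Om (rh * (1 - C * tau)) (step z).
  move=> rh0 Kz; have zc := Kset_config rh0 Kz.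
  by apply: Kset_step => //; [exact: ltW | move=> j y ny; exact: H3 | move=> i j; exact: H4].
have KZ m th : (m <= n)%N -> Kset Om (rho * (1 - C * tau) ^+ m) (Z m th).
  elim: m => [|m IH] mn; first by rewrite expr0 mulr1; exact: Kinit.
  rewrite exprSr mulrA; apply: Kstep; last by apply: IH; exact: ltnW.
  by rewrite mulr_gt0// exprn_gt0//; clear -tC; lra.
have KZ' m th : (m <= n)%N -> Kset Om rho' (Z m th).
  by move=> mn; apply: (Kset_anti (Kpow m mn)); exact: KZ.
have Zc m th : (m <= n)%N -> config_space Om (Z m th) by move=> mn; exact: Kset_config (KZ' m th mn).
have gain m th : (m <= n)%N -> - M + m%:R * (tau * (c / 2)) <= Kirchhoff_Routh Om G Gam (Z m th).
  elim: m => [|m IH] mn; first by rewrite mul0r addr0; exact: HM (Kinit th).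
  have h := Ht _ tau (KZ' m th (ltnW mn)) tau0 tt0.
  apply: le_trans h; rewrite -natr1 mulrDl mul1r addrA lerD2r; exact: IH (ltnW mn).
have cZ m : (m <= n)%N -> continuous (Z m).
  elim: m => [|m IH] mn th; first exact: cinit.
  have c1 : {for th, continuous (Z m)} := IH (ltnW mn) th.
  have cW : {for th, continuous (fun th => W (Z m th))}.
    by apply: (@continuous_comp _ _ _ (Z m) W) => //; exact: (H1 _ (Zc m th (ltnW mn))).1.
  apply: continuous_coords => i j.
  rewrite (_ : (fun t => Z m.+1 t i j) = fun t => Z m t i j + tau * W (Z m t) i j); last first.
    by apply/funext => t; rewrite /Z /= /step !mxE.
  have ce (f : 'rV[R]_k -> 'M[R]_(k.+1, 2)) : {for th, continuous f} -> {for th, continuous (fun t => f t i j)}.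
    move=> cf; apply: (@continuous_comp _ _ _ f (fun z : 'M[R]_(k.+1, 2) => z i j)); first exact: cf.
    exact: coord_continuous.
  apply: continuousD; first exact: ce.
  by apply: continuousM; [exact: cst_continuous | exact: ce].
have cgap m (j : 'I_k) : (m <= n)%N -> continuous (fun th => gap (Z m th) j).
  move=> mn th; have cp (i : 'I_k.+1) : {for th, continuous (fun th => Defs.point (Z m th) i)}.
    apply: (@continuous_comp _ _ _ (Z m) (fun z => Defs.point z i)); first exact: cZ.
    exact: point_continuous.
  exact: continuousB.
have dotpos m th (j : 'I_k) : (m < n)%N -> 0 < dot (gap (Z m th) j) (gap (Z m.+1 th) j).
  move=> mn; have zc := Zc m th (ltnW mn); have [_ zne] := zc.
  have ne : lift ord0 j != widen_ord (leqnSn k) j.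
    by rewrite -(inj_eq val_inj) /= /bump /= add1n gtn_eqF.
  apply: dot_perturbed; first by rewrite subr_eq0; apply/eqP; exact: zne.
  have -> : gap (Z m.+1 th) j - gap (Z m th) j =
      tau *: (Defs.point (W (Z m th)) (lift ord0 j) - Defs.point (W (Z m th)) (widen_ord (leqnSn k) j)).
    rewrite /gap /Z /= /step -/(Z m th); apply: pair_ext; rewrite /Defs.point /= !mxE /GRing.scale /=; ring.
  rewrite normrZ gtr0_norm//.
  have h := ler_wpM2l (ltW tau0) (H4 _ (lift ord0 j) (widen_ord (leqnSn k) j) zc).
  rewrite (le_trans h)// -/(gap (Z m th) j).
  have := ler_wpM2r (normr_ge0 (gap (Z m th) j)) tC; have := normr_ge0 (gap (Z m th) j).
  by clear; lra.
(* The accumulated turning of each gap, a sum of m single-valued angles; it is therefore continuous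
   in th and bounded by m pi. *)
pose B := fix B m (th : 'rV[R]_k) : 'rV[R]_k :=
  if m is m'.+1 then B m' th + \row_j turn (gap (Z m' th) j) (gap (Z m th) j) else 0.
have angle m th (j : 'I_k) : (m <= n)%N ->
    exists2 s : R, 0 < s & gap (Z m th) j = s *: circ (th ord0 j + B m th ord0 j).
  elim: m => [|m IH] mn.
    exists (r * 5 ^+ j); first by rewrite mulr_gt0// exprn_gt0.
    rewrite /gap /Z /= !point_cfg /= addrC addKr mxE addr0.
    by rewrite (_ : insub (nat_of_ord j) = Some j)//; exact: valK.
  have [s s0 E] := IH (ltnW mn); have [s' s'0 E'] := turn_step s0 E (dotpos m th j mn).
  by exists s' => //; rewrite E' /= !mxE addrA.
have cB m : (m <= n)%N -> continuous (B m).
  elim: m => [|m IH] mn th /=; first exact: cst_continuous.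
  have cr : {for th, continuous (fun th => \row_j turn (gap (Z m th) j) (gap (Z m.+1 th) j))}.
    apply: continuous_coords => i j.
    rewrite (_ : (fun t => _) = fun t => turn (gap (Z m t) j) (gap (Z m.+1 t) j)); last first.
      by apply/funext => t; rewrite mxE.
    by apply: turn_continuous; [exact: cgap (ltnW mn) th | exact: cgap mn th | exact: dotpos].
  exact: (continuousD (IH (ltnW mn) th) cr).
have Bb m th : `|B m th| <= m%:R * pi.
  elim: m => [|m IH] /=; first by rewrite normr0 mul0r.
  rewrite (le_trans (ler_normD _ _))// -natr1 mulrDl mul1r lerD//.
  apply: mx_norm_le => [|i j]; first exact: pi_ge0.
  by rewrite mxE turn_le.
have [th thE] := zero_of_bounded_perturbation (cB n (leqnn n)) (Bb n).
have al : aligned (Z n th).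
  apply: aligned_gaps => j; have [s s0 E] := angle n th j (leqnn n); exists s => //.
  by rewrite E; congr (_ *: circ _); have := congr1 (fun v : 'rV[R]_k => v ord0 j) thE; rewrite !mxE.
have h1 := Hup _ (Zc n th (leqnn n)) al; have h2 := gain n th (leqnn n).
move: (le_trans h2 h1); rewrite mulrA (mulrC n%:R) tn TE.
by have := ler_norm M; have := ler_norm Cup; clear; lra.
Qed.

(** * Critical points *)

Lemma hydrodynamic_green_setting (R : realType) (Om : set (plane R)) (G : plane R * plane R -> R) :
  domain Om -> bounded_set Om -> C3_boundary Om -> hydrodynamic_Green Om G -> green_setting Om G.
Proof.
move=> [_ oO _] bO b3 [k0 [Omj [gamma [_ _ [cG [fG tG _ _]]]]]]; split=> //; split=> //.
by have [cG2 _ _] := cG; exact: Ck_S cG2.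
Qed.

Lemma vanishing_critical (R : realType) (N : nat) (Om : set (plane R)) (G : plane R * plane R -> R)
    (Gam : 'I_N -> R) (z : 'M[R]_(N, 2)) :
  (forall j, Gam j = 0) -> critical_point (Kirchhoff_Routh Om G Gam) z.
Proof.
move=> G0; have -> : Kirchhoff_Routh Om G Gam = cst 0.
  apply/funext => x; rewrite /Kirchhoff_Routh !big1 ?addr0// => i _; last by rewrite G0 expr0n mul0r.
  by rewrite big1// => j _; rewrite G0 !mul0r.
by split=> [|v]; [exact: differentiable_cst | rewrite diff_cst].
Qed.

Lemma noncritical_ascent (R : realType) (V : normedModType R) (f : V -> R) (z : V) (L : V -> R) :
  sdiff f z L -> ~ critical_point f z -> exists v, 0 < L v.
Proof.
move=> sf nc; have [v vP] : exists v, L v <> 0.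
  apply: contrapT => nv; apply: nc; have [df E] := sdiff_diff sf.
  by split=> // v; rewrite E; apply: contrapT => h; apply: nv; exists v.
have [h|h|//] := ltgtP (L v) 0; last by exists v.
by exists (-1 *: v); rewrite (sdiffLZ (-1) v sf) mulN1r oppr_gt0.
Qed.

Lemma local_field_everywhere (R : realType) (N : nat) (Om : set (plane R)) (G : plane R * plane R -> R)
    (Gam : 'I_N -> R) (q : 'I_N -> plane R) :
  green_setting Om G -> (forall j, Gam j != 0) ->
  (forall J : {set 'I_N}, (2 <= #|J|)%N ->
     \sum_(i in J) \sum_(j in J | j != i) Gam i * Gam j != 0 /\
     \sum_(i in J) \sum_(j in J | j != i) `|Gam i * Gam j| < \sum_(j in J) Gam j ^+ 2) ->
  (forall z, config_space Om z -> ~ critical_point (Kirchhoff_Routh Om G Gam) z) ->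
  (forall j, closure Om (q j)) -> local_field Om G Gam q.
Proof.
move=> gs Gn0 hJ nc cq.
have [[i nOi]|/forallNP qO] := pselect (exists i, ~ Om (q i)).
  have bp : bd Om (q i) := bd_intro (cq i) nOi.
  refine (boundary_local_field gs cq bp _) => J JE.
  have iJ : i \in J by rewrite JE inE eqxx.
  have [c2|] := leqP 2 #|J|; first by have [_] := hJ J c2.
  (* With a single point at p the condition on subsets says nothing, but the double sum is empty and
     [Gam i] is nonzero. *)
  rewrite ltnS => c1; have -> : J = [set i]%SET.
    by apply/esym/eqP; rewrite eqEcard finset.sub1set iJ cards1.
  rewrite !big_set1 big1 => [|j]; first by rewrite exprn_even_gt0// Gn0.
  by rewrite inE => /andP[->].
have {}qO j : Om (q j) by apply: contrapT => h; exact: (qO j).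
have [qi|] := pselect (injective q).
  have zc : config_space Om (cfg q).
    split=> [j|i j ij]; rewrite !point_cfg; first exact: qO.
    by move/qi => E; rewrite E eqxx in ij.
  have [v v0] := noncritical_ascent (Kirchhoff_Routh_sdiff Gam gs zc) (nc _ zc).
  exact: (regular_local_field gs qO qi v0).
move=> ni.
have [i [j [ij qij]]] : exists i j, i != j /\ q i = q j.
  apply: contrapT => h; apply: ni => i j qij; apply/eqP; apply: contrapT => /negP ij.
  by apply: h; exists i, j.
refine (interior_local_field gs cq (qO i) _) => J JE.
suff c2 : (2 <= #|J|)%N by have [] := hJ J c2.
have <- : #|[set i; j]%SET| = 2%N by rewrite cards2 ij.
by apply/subset_leq_card/fintype.subsetP => x; rewrite JE !inE => /orP[/eqP->|/eqP->]; rewrite ?qij.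
Qed.

(* Vortex j of {1, ..., N} is the element j - 1 of 'I_N, whence the sign
   (-1) ^+ i.+1. *)
Theorem theorem1p1 (R : realType) (Om : set (plane R))
    (G : plane R * plane R -> R) (N : nat) (Gam : 'I_N -> R) :
  domain Om -> bounded_set Om -> C3_boundary Om ->
  hydrodynamic_Green Om G ->
  (forall J : {set 'I_N}, (2 <= #|J|)%N ->
     \sum_(i in J) \sum_(j in J | j != i) Gam i * Gam j != 0 /\
     \sum_(i in J) \sum_(j in J | j != i) `|Gam i * Gam j|
       < \sum_(j in J) Gam j ^+ 2) ->
  (forall i : 'I_N, Gam i = (-1) ^+ i.+1 * `|Gam i|) ->
  (forall i j : 'I_N, j = i.+1 :> nat -> `|Gam i| <= `|Gam j|) ->
  exists z : 'M[R]_(N, 2),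
    config_space Om z /\ critical_point (Kirchhoff_Routh Om G Gam) z.
Proof.
move=> dO bO b3 hG hJ sgn mono; have gs := hydrodynamic_green_setting dO bO b3 hG.
have [[x0 Ox0] _ _] := dO; apply: contrapT => nex.
have nc z : config_space Om z -> ~ critical_point (Kirchhoff_Routh Om G Gam) z.
  by move=> zc cz; apply: nex; exists z.
have [C0 HC] := Kirchhoff_Routh_aligned gs sgn mono.
(* A zero strength next to any other index i would make the sum over {i, j} vanish; if j is the only
   index, H is identically 0 and every configuration is critical. *)
have Gn0 j : Gam j != 0.
  apply/eqP => Gj0; have [sub|/existsNP[i /eqP ij]] := pselect (forall i, i = j).
    apply: (nc (cfg (fun=> x0))); last by apply: vanishing_critical => i; rewrite (sub i).
    by split=> [i|i i' ii']; rewrite !point_cfg; [exact: Ox0 | rewrite (sub i) (sub i') eqxx in ii'].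
  have c2 : #|[set i; j]%SET| = 2%N by rewrite cards2 ij.
  have [/eqP h _] := hJ [set i; j]%SET (eq_leq (esym c2)); apply: h.
  rewrite big1// => a aJ; rewrite big1// => b /andP[].
  move: aJ; rewrite !inE => /orP[/eqP->|/eqP->]; last by rewrite Gj0 mul0r.
  by move=> /orP[/eqP->|/eqP->]; [rewrite eqxx | rewrite Gj0 mulr0].
have lf q : (forall j, closure Om (q j)) -> local_field Om G Gam q.
  by move=> cq; exact: (local_field_everywhere gs Gn0 hJ nc cq).
(* Without vortices the empty configuration is critical; otherwise N = k + 1 and the torus has one
   angle for each of the k gaps. *)
case: N Gam hJ sgn mono nex nc C0 HC Gn0 lf => [|k] Gam hJ sgn mono nex nc C0 HC Gn0 lf.
  by apply: (nc 0); [split=> -[] | apply: vanishing_critical => -[]].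
exact: (no_good_field gs (ex_intro _ x0 Ox0) (good_field_global gs lf) HC).
Qed.
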